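(* Let $K$ be the quotient field of $A$. The $K$-algebra ${}_K\mathcal H=K\otimes_A\mathcal H$ is split semisimple and $\{{}_KV^\lambda\mid\lambda\text{ a }b\text{-partition of }n\}$, where ${}_KV^\lambda=K\otimes_AV^\lambda$, is a complete set of inequivalent, irreducible ${}_K\mathcal H$-modules.
   Context: **Algebra.** Let $n,b$ be positive integers, let $\mathbf q,\mathbf a$ be indeterminates, and write $[l]=\{1,\dots,l\}$ and $\Sigma_l$ for the symmetric group on $[l]$. Let $\mathcal H_{b,n}$ be the unital associative $\mathbb Z[\mathbf q,\mathbf a]$-algebra with generators $T_1,\dots,T_n,R_1,\dots,R_{n-1}$ and relations: $T_j^b=1$ ($j\in[n]$); $T_jT_{j'}=T_{j'}T_j$ ($j,j'\in[n]$); $T_jR_i=R_iT_{s_i(j)}$ ($j\in[n]$, $i\in[n-1]$); $R_iR_{i'}=R_{i'}R_i$ ($|i-i'|>1$); $R_iR_{i+1}R_i=R_{i+1}R_iR_{i+1}$ ($i\in[n-2]$); $R_i^2=\mathbf q+\mathbf a\,T_i^{(b^2-b)/2}E_iR_i$ ($i\in[n-1]$), where $s_i=(i\ i{+}1)$ and $E_i=\sum_{k=0}^{b-1}T_i^kT_{i+1}^{-k}$. Let $\zeta\in\mathbb C$ be a primitive $b$th root of unity. $A$ is the smallest subring of an algebraic closure of $\mathbb C(\mathbf q,\mathbf a)$ that contains $1,\mathbf q,\mathbf a,\zeta$ and a fixed square root $\sqrt{b^2\mathbf a^2+4\mathbf q}$, in which $2$, $b$, $\mathbf q$ are units, and in which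 $1+x+\dots+x^k$ is a unit for every $k\in[n-2]$, where $x=\dfrac{b^2\mathbf a^2+b\mathbf a\sqrt{b^2\mathbf a^2+4\mathbf q}+2\mathbf q}{2\mathbf q}$. Also $y=\dfrac{b\mathbf a+\sqrt{b^2\mathbf a^2+4\mathbf q}}{2\mathbf q}$, a unit of $A$ with $x=\mathbf qy^2$. Put $\mathcal H=A\otimes_{\mathbb Z[\mathbf q,\mathbf a]}\mathcal H_{b,n}$ and $\epsilon=\zeta^{(b^2-b)/2}$. $D$ is the group of diagonal matrices in $\mathrm{GL}_n(\mathbb C)$ with diagonal entries in $\langle\zeta\rangle$; for $d=\mathrm{diag}(\zeta^{p_1},\dots,\zeta^{p_n})\in D$ put $t_d=T_1^{p_1}\cdots T_n^{p_n}$. For $i\in[n-1]$ put $t_{s_i}=R_i$. **Characters.** $X(D)$ is the group of homomorphisms $D\to A^\times$. For $\chi\in X(D)$, $e_\chi=b^{-n}\sum_{d\in D}\chi(d^{-1})t_d$. For $(i_1,\dots,i_n)\in[b]^n$, $\chi_{(i_1,\dots,i_n)}(\mathrm{diag}(\zeta^{p_1},\dots,\zeta^{p_n}))=\zeta^{i_1p_1+\dots+i_np_n}$. For a $b$-tuple $\alpha=(m_1,\dots,m_b)$ of non-negative integers with sum $n$, $\chi_\alpha=\chi_{(1,\dots,1,\dots,b,\dots,b)}$ with $j$ repeated $m_j$ times, $\mathcal H_\alpha=e_{\chi_\alpha}\mathcal He_{\chi_\alpha}$, and $\bar m_j=m_1+\dots+m_j$, $\bar m_0=0$. **Tableaux.**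 A $b$-partition of $n$ is a $b$-tuple $\lambda=(\lambda^1,\dots,\lambda^b)$ of (possibly empty) partitions with $|\lambda^1|+\dots+|\lambda^b|=n$; $|\lambda|=(|\lambda^1|,\dots,|\lambda^b|)$. For a Young tableau $\hat\tau$ with entries $i,j$ in (row, column) positions $(r_i,c_i)$ and $(r_j,c_j)$, the axial distance is $\delta_{\hat\tau}(i,j)=(c_j-r_j)-(c_i-r_i)$. **Hoefsmit modules.** For $m>1$, $\mathcal I^m$ is the unital $A$-algebra with generators $S_1,\dots,S_{m-1}$ and relations $S_iS_j=S_jS_i$ ($|i-j|>1$), $S_iS_{i+1}S_i=S_{i+1}S_iS_{i+1}$, $S_i^2=\mathbf q+b\mathbf a S_i$; $\mathcal I^0=\mathcal I^1=A$. For a partition $\hat\lambda$ of $m$, $P^{\hat\lambda}$ is the free $A$-module with basis $\{p_{\hat\tau}\}$ indexed by the standard Young tableaux $\hat\tau$ of shape $\hat\lambda$ (entries $1,\dots,m$), which is an $\mathcal I^m$-module via $S_l\cdot p_{\hat\tau}=\frac{x-1}{y(1-x^k)}p_{\hat\tau}+\frac{x-x^k}{y(1-x^k)}p_{s_l\cdot\hat\tau}$, where $k=\delta_{\hat\tau}(l+1,l)$, $s_l\cdot\hat\tau$ is obtained by switching the entries $l$ and $l+1$, and $p_{s_l\cdot\hat\tau}=0$ if $s_l\cdot\hat\tau$ is not standard (these coefficients, computed in $K$, lie in $A$). **The module $V^\lambda$.** Let $\alpha=|\lambda|=(m_1,\dots,m_b)$. There is an $A$-algebra isomorphism $\eta\colon\mathcal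 I^{m_1}\otimes_A\dots\otimes_A\mathcal I^{m_b}\to\mathcal H_\alpha$ sending the generator $S_l$ of the $j$th factor $\mathcal I^{m_j}$ to $\epsilon^jt_{s_{\bar m_{j-1}+l}}e_{\chi_\alpha}$. Put $P^\lambda_0=P^{\lambda^1}\otimes_A\dots\otimes_AP^{\lambda^b}$, regarded as an $\mathcal H_\alpha$-module via $\eta$, and $V^\lambda=\mathcal He_{\chi_\alpha}\otimes_{\mathcal H_\alpha}P^\lambda_0$. *)

(* Defs.v *)
From HB Require Import structures.
From mathcomp Require Import all_boot all_order all_fingroup all_algebra.
From mathcomp Require Import generic_quotient boolp classical_sets reals complex.

Set Implicit Arguments.
Unset Strict Implicit.
Unset Printing Implicit Defensive.

Import GRing.Theory.

Local Open Scope ring_scope.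
Local Open Scope quotient_scope.

(* Unital associative algebras over a commutative ring, as rings with a
   central structure morphism.  The library's [algType] requires 1 != 0, which
   is not available a priori for an algebra given by generators and
   relations. *)
HB.mixin Record PzRing_isAlgebraOver (R : comPzRingType) B
    of GRing.PzRing B := {
  alg_const : R -> B;
  alg_const_nmod : nmod_morphism alg_const;
  alg_const_monoid : monoid_morphism alg_const;
  alg_const_central : forall (c : R) (x : B),
    alg_const c * x = x * alg_const c }.

#[short(type="pzAlgType")]
HB.structure Definition AlgebraOver (R : comPzRingType) :=
  { B of GRing.PzRing B & PzRing_isAlgebraOver R B }.

HB.instance Definition _ (R : comPzRingType) (B : pzAlgType R) :=
  GRing.isNmodMorphism.Build R B (@alg_const R B) (@alg_const_nmod R B).
HB.instance Definition _ (R : comPzRingType) (B : pzAlgType R) :=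
  GRing.isMonoidMorphism.Build R B (@alg_const R B) (@alg_const_monoid R B).

Notation "c %:AC" := (alg_const c) (at level 2, left associativity,
  format "c %:AC") : ring_scope.

Section FreeAlgebra.
Variables (R : comPzRingType) (X : Type).

Inductive aterm : Type :=
| AGen of X
| ACst of R
| AAdd of aterm & aterm
| AMul of aterm & aterm.

Inductive aeq : aterm -> aterm -> Prop :=
| aeq_refl t : aeq t t
| aeq_sym t u : aeq t u -> aeq u t
| aeq_trans t u v : aeq t u -> aeq u v -> aeq t v
| aeq_add t t' u u' : aeq t t' -> aeq u u' -> aeq (AAdd t u) (AAdd t' u')
| aeq_mul t t' u u' : aeq t t' -> aeq u u' -> aeq (AMul t u) (AMul t' u')
| aeq_addA t u v : aeq (AAdd t (AAdd u v)) (AAdd (AAdd t u) v)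
| aeq_addC t u : aeq (AAdd t u) (AAdd u t)
| aeq_add0 t : aeq (AAdd (ACst 0) t) t
| aeq_addN t : aeq (AAdd (AMul (ACst (-1)) t) t) (ACst 0)
| aeq_mulA t u v : aeq (AMul t (AMul u v)) (AMul (AMul t u) v)
| aeq_mul1l t : aeq (AMul (ACst 1) t) t
| aeq_mul1r t : aeq (AMul t (ACst 1)) t
| aeq_mulDl t u v : aeq (AMul (AAdd t u) v) (AAdd (AMul t v) (AMul u v))
| aeq_mulDr t u v : aeq (AMul t (AAdd u v)) (AAdd (AMul t u) (AMul t v))
| aeq_cstD c d : aeq (ACst (c + d)) (AAdd (ACst c) (ACst d))
| aeq_cstM c d : aeq (ACst (c * d)) (AMul (ACst c) (ACst d))
| aeq_cstC c t : aeq (AMul (ACst c) t) (AMul t (ACst c)).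

HB.instance Definition _ := gen_eqMixin aterm.
HB.instance Definition _ := gen_choiceMixin aterm.

Definition aeqb (t u : aterm) := `[< aeq t u >].

Lemma aeqb_refl : reflexive aeqb.
Proof. by move=> t; apply/asboolP/aeq_refl. Qed.
Lemma aeqb_sym : symmetric aeqb.
Proof. by move=> t u; apply/asboolP/asboolP; apply: aeq_sym. Qed.
Lemma aeqb_trans : transitive aeqb.
Proof.
by move=> t u v /asboolP h1 /asboolP h2; apply/asboolP; apply: aeq_trans h1 h2.
Qed.

Canonical aeqb_equiv := EquivRel aeqb aeqb_refl aeqb_sym aeqb_trans.

Definition freealg : Type := {eq_quot aeqb}.
HB.instance Definition _ := Choice.on freealg.
HB.instance Definition _ := EqQuotient.on freealg.

Definition fpi (t : aterm) : freealg := \pi_freealg t.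

Lemma fpiP (t u : aterm) : fpi t = fpi u <-> aeq t u.
Proof.
by split=> [/(@eqquotP _ _ freealg)/asboolP|h] //;
  apply/(@eqquotP _ _ freealg)/asboolP.
Qed.

Lemma fpi_ind (P : freealg -> Prop) : (forall t, P (fpi t)) -> forall x, P x.
Proof. by move=> h; elim/quotW. Qed.

Lemma free_repr (t : aterm) : aeq (repr (fpi t)) t.
Proof. by apply/fpiP; rewrite /fpi reprK. Qed.

Definition fgen (x : X) : freealg := fpi (AGen x).
Definition fcst (c : R) : freealg := fpi (ACst c).
Definition fadd (x y : freealg) : freealg := fpi (AAdd (repr x) (repr y)).
Definition fmul (x y : freealg) : freealg := fpi (AMul (repr x) (repr y)).
Definition fopp (x : freealg) : freealg := fmul (fcst (-1)) x.

Lemma faddE t u : fadd (fpi t) (fpi u) = fpi (AAdd t u).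
Proof. by apply/fpiP/aeq_add; apply: free_repr. Qed.
Lemma fmulE t u : fmul (fpi t) (fpi u) = fpi (AMul t u).
Proof. by apply/fpiP/aeq_mul; apply: free_repr. Qed.

Ltac free_axiom lem :=
  repeat (elim/fpi_ind => ?); rewrite /fopp /fcst ?(faddE, fmulE);
  apply/fpiP; exact: lem.

Lemma faddA : associative fadd. Proof. free_axiom aeq_addA. Qed.
Lemma faddC : commutative fadd. Proof. free_axiom aeq_addC. Qed.
Lemma fadd0 : left_id (fcst 0) fadd. Proof. free_axiom aeq_add0. Qed.
Lemma faddN : left_inverse (fcst 0) fopp fadd. Proof. free_axiom aeq_addN. Qed.
HB.instance Definition _ :=
  GRing.isZmodule.Build freealg faddA faddC fadd0 faddN.

Lemma fmulA : associative fmul. Proof. free_axiom aeq_mulA. Qed.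
Lemma fmul1l : left_id (fcst 1) fmul. Proof. free_axiom aeq_mul1l. Qed.
Lemma fmul1r : right_id (fcst 1) fmul. Proof. free_axiom aeq_mul1r. Qed.
Lemma fmulDl : left_distributive fmul fadd. Proof. free_axiom aeq_mulDl. Qed.
Lemma fmulDr : right_distributive fmul fadd. Proof. free_axiom aeq_mulDr. Qed.
HB.instance Definition _ :=
  GRing.Zmodule_isPzRing.Build freealg fmulA fmul1l fmul1r fmulDl fmulDr.

Lemma fcst_nmod : nmod_morphism fcst.
Proof.
split=> // c d; rewrite [RHS]faddE; exact/fpiP/aeq_cstD.
Qed.
Lemma fcst_monoid : monoid_morphism fcst.
Proof.
split=> // c d; rewrite [RHS]fmulE; exact/fpiP/aeq_cstM.
Qed.
Lemma fcst_central (c : R) (x : freealg) : fcst c * x = x * fcst c.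
Proof.
by elim/fpi_ind: x => t; rewrite [LHS]fmulE [RHS]fmulE; apply/fpiP/aeq_cstC.
Qed.
HB.instance Definition _ :=
  PzRing_isAlgebraOver.Build R freealg fcst_nmod fcst_monoid fcst_central.

End FreeAlgebra.

Arguments freealg : clear implicits.

(* The quotient of an algebra by the two-sided ideal generated by the
   differences x - y with [rel x y]. *)
Section QuotientAlgebra.
Variables (R : comPzRingType) (B : pzAlgType R) (rel : B -> B -> Prop).

Inductive acong : B -> B -> Prop :=
| acong_rel x y : rel x y -> acong x y
| acong_refl x : acong x x
| acong_sym x y : acong x y -> acong y x
| acong_trans x y z : acong x y -> acong y z -> acong x z
| acong_add x x' y y' : acong x x' -> acong y y' -> acong (x + y) (x' + y')
| acong_mul x x' y y' : acong x x' -> acong y y' -> acong (x * y) (x' * y').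

Definition acongb (x y : B) := `[< acong x y >].

Lemma acongb_refl : reflexive acongb.
Proof. by move=> t; apply/asboolP/acong_refl. Qed.
Lemma acongb_sym : symmetric acongb.
Proof. by move=> t u; apply/asboolP/asboolP; apply: acong_sym. Qed.
Lemma acongb_trans : transitive acongb.
Proof.
by move=> t u v /asboolP h1 /asboolP h2; apply/asboolP; exact: acong_trans h1 h2.
Qed.

Canonical acongb_equiv := EquivRel acongb acongb_refl acongb_sym acongb_trans.

Definition quotalg : Type := {eq_quot acongb}.
HB.instance Definition _ := Choice.on quotalg.
HB.instance Definition _ := EqQuotient.on quotalg.

Definition qproj (x : B) : quotalg := \pi_quotalg x.

Lemma qprojP (x y : B) : qproj x = qproj y <-> acong x y.
Proof.
by split=> [/(@eqquotP _ _ quotalg)/asboolP|h] //;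
  apply/(@eqquotP _ _ quotalg)/asboolP.
Qed.

Lemma qproj_ind (P : quotalg -> Prop) :
  (forall x, P (qproj x)) -> forall x, P x.
Proof. by move=> h; elim/quotW. Qed.

Lemma q_repr (x : B) : acong (repr (qproj x)) x.
Proof. by apply/qprojP; rewrite /qproj reprK. Qed.

Definition qcst (c : R) : quotalg := qproj c%:AC.
Definition qadd (x y : quotalg) : quotalg := qproj (repr x + repr y).
Definition qmul (x y : quotalg) : quotalg := qproj (repr x * repr y).
Definition qopp (x : quotalg) : quotalg := qproj (- repr x).

Lemma qaddE t u : qadd (qproj t) (qproj u) = qproj (t + u).
Proof. by apply/qprojP/acong_add; apply: q_repr. Qed.
Lemma qmulE t u : qmul (qproj t) (qproj u) = qproj (t * u).
Proof. by apply/qprojP/acong_mul; apply: q_repr. Qed.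
Lemma qoppE t : qopp (qproj t) = qproj (- t).
Proof.
apply/qprojP; rewrite -mulN1r -[- t]mulN1r.
by apply: acong_mul; [apply: acong_refl | apply: q_repr].
Qed.

Let qE := (qaddE, qmulE, qoppE).
Ltac quot_axiom lem :=
  repeat (elim/qproj_ind => ?); rewrite ?qE; congr qproj; exact: lem.

Lemma qaddA : associative qadd. Proof. quot_axiom addrA. Qed.
Lemma qaddC : commutative qadd. Proof. quot_axiom addrC. Qed.
Lemma qadd0 : left_id (qproj 0) qadd. Proof. quot_axiom add0r. Qed.
Lemma qaddN : left_inverse (qproj 0) qopp qadd. Proof. quot_axiom addNr. Qed.
HB.instance Definition _ :=
  GRing.isZmodule.Build quotalg qaddA qaddC qadd0 qaddN.

Lemma qmulA : associative qmul. Proof. quot_axiom mulrA. Qed.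
Lemma qmul1l : left_id (qproj 1) qmul. Proof. quot_axiom mul1r. Qed.
Lemma qmul1r : right_id (qproj 1) qmul. Proof. quot_axiom mulr1. Qed.
Lemma qmulDl : left_distributive qmul qadd. Proof. quot_axiom mulrDl. Qed.
Lemma qmulDr : right_distributive qmul qadd. Proof. quot_axiom mulrDr. Qed.
HB.instance Definition _ :=
  GRing.Zmodule_isPzRing.Build quotalg qmulA qmul1l qmul1r qmulDl qmulDr.

Lemma qproj_nmod : nmod_morphism qproj.
Proof. by split=> // c d; rewrite [RHS]qaddE. Qed.
Lemma qproj_monoid : monoid_morphism qproj.
Proof. by split=> // c d; rewrite [RHS]qmulE. Qed.
HB.instance Definition _ :=
  GRing.isNmodMorphism.Build B quotalg qproj qproj_nmod.
HB.instance Definition _ :=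
  GRing.isMonoidMorphism.Build B quotalg qproj qproj_monoid.

Lemma qcst_nmod : nmod_morphism qcst.
Proof. by split=> [|c d]; rewrite /qcst ?rmorph0 ?rmorphD. Qed.
Lemma qcst_monoid : monoid_morphism qcst.
Proof. by split=> [|c d]; rewrite /qcst ?rmorph1 ?rmorphM. Qed.
Lemma qcst_central (c : R) (x : quotalg) : qcst c * x = x * qcst c.
Proof. by elim/qproj_ind: x => x; rewrite /qcst -!rmorphM alg_const_central. Qed.
HB.instance Definition _ :=
  PzRing_isAlgebraOver.Build R quotalg qcst_nmod qcst_monoid qcst_central.

End QuotientAlgebra.

(* The R-algebra with generators X and relations rel. *)
Definition presalg (R : comPzRingType) (X : Type)
  (rel : freealg R X -> freealg R X -> Prop) : pzAlgType R := quotalg rel.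

Definition pgen (R : comPzRingType) (X : Type)
  (rel : freealg R X -> freealg R X -> Prop) (x : X) : presalg rel :=
  qproj rel (fgen R x).

Section FreeModule.
Variables (S : pzRingType) (X : Type).

Inductive mterm : Type :=
| MGen of X
| MZero
| MAdd of mterm & mterm
| MScale of S & mterm.

Inductive meq : mterm -> mterm -> Prop :=
| meq_refl t : meq t t
| meq_sym t u : meq t u -> meq u t
| meq_trans t u v : meq t u -> meq u v -> meq t v
| meq_add t t' u u' : meq t t' -> meq u u' -> meq (MAdd t u) (MAdd t' u')
| meq_scale c t t' : meq t t' -> meq (MScale c t) (MScale c t')
| meq_addA t u v : meq (MAdd t (MAdd u v)) (MAdd (MAdd t u) v)
| meq_addC t u : meq (MAdd t u) (MAdd u t)
| meq_add0 t : meq (MAdd MZero t) t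
| meq_addN t : meq (MAdd (MScale (-1) t) t) MZero
| meq_scaleA c d t : meq (MScale c (MScale d t)) (MScale (c * d) t)
| meq_scale1 t : meq (MScale 1 t) t
| meq_scaleDr c t u : meq (MScale c (MAdd t u)) (MAdd (MScale c t) (MScale c u))
| meq_scaleDl t c d : meq (MScale (c + d) t) (MAdd (MScale c t) (MScale d t)).

HB.instance Definition _ := gen_eqMixin mterm.
HB.instance Definition _ := gen_choiceMixin mterm.

Definition meqb (t u : mterm) := `[< meq t u >].

Lemma meqb_refl : reflexive meqb.
Proof. by move=> t; apply/asboolP/meq_refl. Qed.
Lemma meqb_sym : symmetric meqb.
Proof. by move=> t u; apply/asboolP/asboolP; apply: meq_sym. Qed.
Lemma meqb_trans : transitive meqb.
Proof.
by move=> t u v /asboolP h1 /asboolP h2; apply/asboolP; apply: meq_trans h1 h2.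
Qed.

Canonical meqb_equiv := EquivRel meqb meqb_refl meqb_sym meqb_trans.

Definition freemod : Type := {eq_quot meqb}.
HB.instance Definition _ := Choice.on freemod.
HB.instance Definition _ := EqQuotient.on freemod.

Definition mpi (t : mterm) : freemod := \pi_freemod t.

Lemma mpiP (t u : mterm) : mpi t = mpi u <-> meq t u.
Proof.
by split=> [/(@eqquotP _ _ freemod)/asboolP|h] //;
  apply/(@eqquotP _ _ freemod)/asboolP.
Qed.

Lemma mpi_ind (P : freemod -> Prop) : (forall t, P (mpi t)) -> forall x, P x.
Proof. by move=> h; elim/quotW. Qed.

Lemma freem_repr (t : mterm) : meq (repr (mpi t)) t.
Proof. by apply/mpiP; rewrite /mpi reprK. Qed.

Definition fmgen (x : X) : freemod := mpi (MGen x).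
Definition fmadd (x y : freemod) : freemod := mpi (MAdd (repr x) (repr y)).
Definition fmscale (c : S) (x : freemod) : freemod := mpi (MScale c (repr x)).

Lemma fmaddE t u : fmadd (mpi t) (mpi u) = mpi (MAdd t u).
Proof. by apply/mpiP/meq_add; apply: freem_repr. Qed.
Lemma fmscaleE c t : fmscale c (mpi t) = mpi (MScale c t).
Proof. by apply/mpiP/meq_scale; apply: freem_repr. Qed.

Ltac freem_axiom lem :=
  repeat (elim/mpi_ind => ?); rewrite ?(fmaddE, fmscaleE); apply/mpiP; exact: lem.

Lemma fmaddA : associative fmadd. Proof. freem_axiom meq_addA. Qed.
Lemma fmaddC : commutative fmadd. Proof. freem_axiom meq_addC. Qed.
Lemma fmadd0 : left_id (mpi MZero) fmadd. Proof. freem_axiom meq_add0. Qed.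
Lemma fmaddN : left_inverse (mpi MZero) (fmscale (-1)) fmadd.
Proof. freem_axiom meq_addN. Qed.
HB.instance Definition _ :=
  GRing.isZmodule.Build freemod fmaddA fmaddC fmadd0 fmaddN.

Lemma fmscaleA c d x : fmscale c (fmscale d x) = fmscale (c * d) x.
Proof. move: x; freem_axiom meq_scaleA. Qed.
Lemma fmscale1 : left_id 1 fmscale. Proof. freem_axiom meq_scale1. Qed.
Lemma fmscaleDr : right_distributive fmscale fmadd.
Proof. move=> c; freem_axiom meq_scaleDr. Qed.
Lemma fmscaleDl x : {morph fmscale^~ x : c d / c + d >-> fmadd c d}.
Proof.
elim/mpi_ind: x => t c d; rewrite !(fmaddE, fmscaleE).
by apply/mpiP/meq_scaleDl.
Qed.
HB.instance Definition _ :=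
  GRing.Zmodule_isLmodule.Build S freemod fmscaleA fmscale1 fmscaleDr fmscaleDl.

End FreeModule.

Arguments freemod : clear implicits.

(* The quotient of a module by the submodule generated by the differences
   x - y with [rel x y]. *)
Section QuotientModule.
Variables (S : pzRingType) (M : lmodType S) (rel : M -> M -> Prop).

Inductive mcong : M -> M -> Prop :=
| mcong_rel x y : rel x y -> mcong x y
| mcong_refl x : mcong x x
| mcong_sym x y : mcong x y -> mcong y x
| mcong_trans x y z : mcong x y -> mcong y z -> mcong x z
| mcong_add x x' y y' : mcong x x' -> mcong y y' -> mcong (x + y) (x' + y')
| mcong_scale c x x' : mcong x x' -> mcong (c *: x) (c *: x').

Definition mcongb (x y : M) := `[< mcong x y >].

Lemma mcongb_refl : reflexive mcongb.
Proof. by move=> t; apply/asboolP/mcong_refl. Qed.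
Lemma mcongb_sym : symmetric mcongb.
Proof. by move=> t u; apply/asboolP/asboolP; apply: mcong_sym. Qed.
Lemma mcongb_trans : transitive mcongb.
Proof.
by move=> t u v /asboolP h1 /asboolP h2; apply/asboolP; apply: mcong_trans h1 h2.
Qed.

Canonical mcongb_equiv := EquivRel mcongb mcongb_refl mcongb_sym mcongb_trans.

Definition quotmod : Type := {eq_quot mcongb}.
HB.instance Definition _ := Choice.on quotmod.
HB.instance Definition _ := EqQuotient.on quotmod.

Definition mproj (x : M) : quotmod := \pi_quotmod x.

Lemma mprojP (x y : M) : mproj x = mproj y <-> mcong x y.
Proof.
by split=> [/(@eqquotP _ _ quotmod)/asboolP|h] //;
  apply/(@eqquotP _ _ quotmod)/asboolP.
Qed.

Lemma mproj_ind (P : quotmod -> Prop) :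
  (forall x, P (mproj x)) -> forall x, P x.
Proof. by move=> h; elim/quotW. Qed.

Lemma qm_repr (x : M) : mcong (repr (mproj x)) x.
Proof. by apply/mprojP; rewrite /mproj reprK. Qed.

Definition qmadd (x y : quotmod) : quotmod := mproj (repr x + repr y).
Definition qmscale (c : S) (x : quotmod) : quotmod := mproj (c *: repr x).

Lemma qmaddE t u : qmadd (mproj t) (mproj u) = mproj (t + u).
Proof. by apply/mprojP/mcong_add; apply: qm_repr. Qed.
Lemma qmscaleE c t : qmscale c (mproj t) = mproj (c *: t).
Proof. by apply/mprojP/mcong_scale; apply: qm_repr. Qed.

Ltac quotm_axiom lem :=
  repeat (elim/mproj_ind => ?); rewrite ?(qmaddE, qmscaleE); congr mproj;
  exact: lem.

Lemma qmaddA : associative qmadd. Proof. quotm_axiom addrA. Qed.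
Lemma qmaddC : commutative qmadd. Proof. quotm_axiom addrC. Qed.
Lemma qmadd0 : left_id (mproj 0) qmadd. Proof. quotm_axiom add0r. Qed.
Lemma qmaddN : left_inverse (mproj 0) (qmscale (-1)) qmadd.
Proof.
by elim/mproj_ind=> x; rewrite qmscaleE qmaddE scaleN1r addNr.
Qed.
HB.instance Definition _ :=
  GRing.isZmodule.Build quotmod qmaddA qmaddC qmadd0 qmaddN.

Lemma qmscaleA c d x : qmscale c (qmscale d x) = qmscale (c * d) x.
Proof. move: x; quotm_axiom scalerA. Qed.
Lemma qmscale1 : left_id 1 qmscale. Proof. quotm_axiom scale1r. Qed.
Lemma qmscaleDr : right_distributive qmscale qmadd.
Proof. move=> c; quotm_axiom scalerDr. Qed.
Lemma qmscaleDl x : {morph qmscale^~ x : c d / c + d >-> qmadd c d}.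
Proof.
by elim/mproj_ind: x => t c d; rewrite !(qmaddE, qmscaleE) scalerDl.
Qed.
HB.instance Definition _ :=
  GRing.Zmodule_isLmodule.Build S quotmod qmscaleA qmscale1 qmscaleDr qmscaleDl.

End QuotientModule.

(* The left S-module with generators X and relations rel. *)
Definition presmod (S : pzRingType) (X : Type)
  (rel : freemod S X -> freemod S X -> Prop) : lmodType S := quotmod rel.

Definition pmgen (S : pzRingType) (X : Type)
  (rel : freemod S X -> freemod S X -> Prop) (x : X) : presmod rel :=
  mproj rel (fmgen S x).

(* The tensor product of S and B over R as an S-algebra, for phi : R -> S,
   presented by the pure tensors; [bc_gen s x] is the pure tensor of s and x. *)
Section BaseChange.
Variables (R S : comPzRingType) (phi : {rmorphism R -> S}) (B : pzAlgType R).

Inductive bc_rel : freealg S (S * B) -> freealg S (S * B) -> Prop :=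
| bc_addl s s' x : bc_rel (fgen S (s + s', x)) (fgen S (s, x) + fgen S (s', x))
| bc_addr s x x' : bc_rel (fgen S (s, x + x')) (fgen S (s, x) + fgen S (s, x'))
| bc_bal s r x : bc_rel (fgen S (s * phi r, x)) (fgen S (s, r%:AC * x))
| bc_mul s s' x x' :
    bc_rel (fgen S (s, x) * fgen S (s', x')) (fgen S (s * s', x * x'))
| bc_const s : bc_rel s%:AC (fgen S (s, 1)).

Definition base_change : pzAlgType S := presalg bc_rel.
Definition bc_gen (s : S) (x : B) : base_change := pgen bc_rel (s, x).

End BaseChange.

(* The tensor product over R of a finite family of R-algebras, presented by
   the pure tensors. *)
Section TensorAlgebra.
Variables (R : comPzRingType) (I : finType) (B : I -> pzAlgType R).

Inductive ta_rel :
    freealg R (forall i, B i) -> freealg R (forall i, B i) -> Prop :=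
| ta_add f i (x y : B i) :
    ta_rel (fgen R (dfwith f (x + y)))
           (fgen R (dfwith f x) + fgen R (dfwith f y))
| ta_scale f i (c : R) (x : B i) :
    ta_rel (fgen R (dfwith f (c%:AC * x))) (c%:AC * fgen R (dfwith f x))
| ta_mul f g : ta_rel (fgen R f * fgen R g) (fgen R (fun i => f i * g i))
| ta_one : ta_rel (fgen R (fun i => 1)) 1.

Definition tensor_alg : pzAlgType R := presalg ta_rel.
Definition ta_gen (f : forall i, B i) : tensor_alg := pgen ta_rel f.

(* The pure tensor with x in position i and 1 elsewhere. *)
Definition ta_in (i : I) (x : B i) : tensor_alg :=
  ta_gen (dfwith (fun j => 1 : B j) x).

End TensorAlgebra.

Section GroundRing.
Variables (L : fieldType) (n b : nat) (q a zeta s : L).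

Definition xL : L :=
  (b%:R ^+ 2 * a ^+ 2 + b%:R * a * s + 2%:R * q) / (2%:R * q).
Definition yL : L := (b%:R * a + s) / (2%:R * q).

Definition unit_in (B : set L) (u : L) : Prop :=
  B u /\ exists2 v, B v & u * v = 1.

Definition ground_closed (B : set L) : Prop :=
  [/\ [/\ B 1, (forall u v, B u -> B v -> B (u - v))
        & forall u v, B u -> B v -> B (u * v)],
      [/\ B q, B a, B zeta & B s],
      [/\ unit_in B 2%:R, unit_in B b%:R & unit_in B q]
    & forall k : nat, (1 <= k <= n - 2)%N ->
        unit_in B (\sum_(i < k.+1) xL ^+ i)].

(* The smallest subring is the intersection of all of them. *)
Definition in_ground (z : L) : bool :=
  `[< forall B : set L, ground_closed B -> B z >].

Record ground : Type := Ground { gval : L; _ : in_ground gval }.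

HB.instance Definition _ := [isSub for gval].
HB.instance Definition _ := [Choice of ground by <:].

Lemma in_groundP z :
  reflect (forall B : set L, ground_closed B -> B z) (in_ground z).
Proof. exact: asboolP. Qed.

Lemma in_ground_subring : subring_closed (in_ground : {pred L}).
Proof.
split=> [|u v /in_groundP hu /in_groundP hv|u v /in_groundP hu /in_groundP hv];
  apply/in_groundP => B hB; case: (hB) => -[h1 hsub hmul] _ _ _ //.
- by apply: hsub; [apply: hu | apply: hv].
- by apply: hmul; [apply: hu | apply: hv].
Qed.

HB.instance Definition _ :=
  GRing.isSubringClosed.Build L in_ground in_ground_subring.
HB.instance Definition _ := [SubChoice_isSubComNzRing of ground by <:].

Definition ground_unit : {pred ground} :=
  fun u => (gval u != 0) && in_ground (gval u)^-1.
Definition ground_inv (u : ground) : ground := insubd u (gval u)^-1.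

Lemma ground_mulVx : {in ground_unit, left_inverse 1 ground_inv *%R}.
Proof.
move=> u /andP[u0 uV]; apply: val_inj.
by rewrite rmorphM rmorph1 /= insubdK // mulVf.
Qed.
Lemma ground_unitPl (u v : ground) : v * u = 1 -> ground_unit u.
Proof.
move=> /(congr1 gval); rewrite [LHS](rmorphM val) [RHS](rmorph1 val) /= => vu.
have u0 : gval u != 0.
  by apply: contra_eq_neq vu => ->; rewrite mulr0 eq_sym oner_eq0.
have -> : ground_unit u = in_ground (gval u)^-1 by rewrite /ground_unit u0.
have -> : (gval u)^-1 = gval v by apply: (mulIf u0); rewrite mulVf.
exact: valP.
Qed.
Lemma ground_invr_out : {in [predC ground_unit], ground_inv =1 id}.
Proof.
move=> u; rewrite inE negb_and negbK /ground_inv => /orP[/eqP u0|/negbTE h].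
  by apply: val_inj; rewrite /insubd; case: insubP => //= w _ ->;
     rewrite u0 invr0.
by rewrite /insubd insubF.
Qed.
HB.instance Definition _ := GRing.ComNzRing_hasMulInverse.Build ground
  ground_mulVx ground_unitPl ground_invr_out.

Lemma ground_idomain (u v : ground) : u * v = 0 -> (u == 0) || (v == 0).
Proof.
move=> /(congr1 gval); rewrite [LHS](rmorphM val) [RHS](rmorph0 val) /=.
by move/eqP; rewrite mulf_eq0 -!(inj_eq val_inj) !(rmorph0 val).
Qed.
HB.instance Definition _ :=
  GRing.ComUnitRing_isIntegral.Build ground ground_idomain.

Lemma in_ground_q : in_ground q.
Proof. by apply/in_groundP=> B [_ [? ? ? ?]]. Qed.
Lemma in_ground_a : in_ground a.
Proof. by apply/in_groundP=> B [_ [? ? ? ?]]. Qed.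
Lemma in_ground_zeta : in_ground zeta.
Proof. by apply/in_groundP=> B [_ [? ? ? ?]]. Qed.

Definition qA : ground := Ground in_ground_q.
Definition aA : ground := Ground in_ground_a.
Definition zetaA : ground := Ground in_ground_zeta.

(* The element of A with value z, meaningful when z lies in A. *)
Definition toA (z : L) : ground := insubd 0 z.

Definition fracA : fieldType := {fraction ground}.

End GroundRing.

(* The elements i and i+1 of [m] for i in [m-1], all shifted to start at 0. *)
Definition ord_lo (m : nat) (i : 'I_m.-1) : 'I_m := widen_ord (leq_pred m) i.

Lemma ord_hi_subproof (m : nat) (i : 'I_m.-1) : (i.+1 < m)%N.
Proof. by case: m i => [|m] [k]; rewrite ?ltn0. Qed.

Definition ord_hi (m : nat) (i : 'I_m.-1) : 'I_m :=
  Ordinal (ord_hi_subproof i).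

Definition far (i j : nat) : bool := ((i.+1 < j) || (j.+1 < i))%N.

(* Z[q,a], with q the inner and a the outer indeterminate *)
Definition Zqa : comNzRingType := {poly {poly int}}.
Definition qZ : Zqa := 'X%:P.
Definition aZ : Zqa := 'X.

Definition Zqa_eval (S : comNzRingType) (u v : S) : {rmorphism Zqa -> S} :=
  horner_eval v \o map_poly (horner_eval u \o map_poly (intmul 1)).

Section GenericHecke.
Variables (b n : nat).

Inductive ygen : Type := GenT of 'I_n | GenR of 'I_n.-1.

Local Notation F := (freealg Zqa ygen).
Local Notation T j := (fgen Zqa (GenT j) : F).
Local Notation R i := (fgen Zqa (GenR i) : F).

(* T^(-k) is written T^(b-k), as T^b = 1 *)
Definition yE (i : 'I_n.-1) : F :=
  \sum_(k < b) T (ord_lo i) ^+ k * T (ord_hi i) ^+ (b - k).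

Inductive yrel : F -> F -> Prop :=
| yrel_Tb j : yrel (T j ^+ b) 1
| yrel_TT j j' : yrel (T j * T j') (T j' * T j)
| yrel_TR j i : yrel (T j * R i) (R i * T (tperm (ord_lo i) (ord_hi i) j))
| yrel_RR (i i' : 'I_n.-1) : far i i' -> yrel (R i * R i') (R i' * R i)
| yrel_braid (i i' : 'I_n.-1) : i' = i.+1 :> nat ->
    yrel (R i * R i' * R i) (R i' * R i * R i')
| yrel_quad i : yrel (R i ^+ 2)
    (qZ%:AC + aZ%:AC * T (ord_lo i) ^+ ((b ^ 2 - b) %/ 2) * yE i * R i).

Definition yalg : pzAlgType Zqa := presalg yrel.
Definition yT (j : 'I_n) : yalg := pgen yrel (GenT j).
Definition yR (i : 'I_n.-1) : yalg := pgen yrel (GenR i).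

End GenericHecke.

(* The algebra I^m over S, with quadratic relation S_i^2 = u + v S_i. *)
Section TypeAHecke.
Variables (S : comPzRingType) (u v : S) (m : nat).

Local Notation F := (freealg S 'I_m.-1).
Local Notation G i := (fgen S i : F).

Inductive irel : F -> F -> Prop :=
| irel_comm (i j : 'I_m.-1) : far i j -> irel (G i * G j) (G j * G i)
| irel_braid (i j : 'I_m.-1) : j = i.+1 :> nat ->
    irel (G i * G j * G i) (G j * G i * G j)
| irel_quad i : irel (G i ^+ 2) (u%:AC + v%:AC * G i).

Definition ialg : pzAlgType S := presalg irel.
Definition iS (l : 'I_m.-1) : ialg := pgen irel l.

End TypeAHecke.

Definition is_partition (l : seq nat) : bool := sorted geq l && (0%N \notin l).

Definition is_bpartition (b n : nat) (lam : {ffun 'I_b -> seq nat}) : bool :=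
  [forall j, is_partition (lam j)] && (\sum_(j < b) sumn (lam j) == n)%N.

Definition bpartition (b n : nat) : Type :=
  {lam : {ffun 'I_b -> seq nat} | is_bpartition n lam}.

(* A tableau with m boxes maps each entry to its (row, column) position; the
   entry l+1 of the usual numbering is l : 'I_m, and rows and columns are
   numbered from 0. *)
Definition tableau (m : nat) : Type := {ffun 'I_m -> 'I_m * 'I_m}.

(* As there are m = |l| entries, an injective map to the boxes of l is a
   bijection. *)
Definition is_standard (l : seq nat) (t : tableau (sumn l)) : bool :=
  [&& injectiveb t,
      [forall i, ((t i).2 < nth 0%N l (t i).1)%N],
      [forall i, [forall j,
        ((t i).1 == (t j).1) && ((t i).2 < (t j).2)%N ==> (i < j)%N]]
    & [forall i, [forall j,
        ((t i).2 == (t j).2) && ((t i).1 < (t j).1)%N ==> (i < j)%N]]].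

Definition std_tableau (l : seq nat) : Type :=
  {t : tableau (sumn l) | is_standard t}.

Definition axial (m : nat) (t : tableau m) (i j : 'I_m) : int :=
  ((t j).2%:Z - (t j).1%:Z) - ((t i).2%:Z - (t i).1%:Z).

Definition swap_tableau (m : nat) (l : 'I_m.-1) (t : tableau m) : tableau m :=
  [ffun i => t (tperm (ord_lo l) (ord_hi l) i)].

(* Unital action of an R-algebra by R-linear maps. *)
Definition is_alg_action (R : comPzRingType) (B : pzAlgType R) (M : lmodType R)
    (act : B -> M -> M) : Prop :=
  [/\ (forall x p p', act x (p + p') = act x p + act x p'),
      (forall x y p, act (x + y) p = act x p + act y p),
      (forall x y p, act (x * y) p = act x (act y p))
    & (forall c p, act c%:AC p = c *: p)].

(* The field C(q,a), with q the inner and a the outer indeterminate *)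
Section RationalFunctions.
Variable C : fieldType.

Definition Cqa : fieldType := {fraction {poly {poly C}}}.
Definition qF : Cqa := tofrac ('X%:P : {poly {poly C}}).
Definition aF : Cqa := tofrac ('X : {poly {poly C}}).
Definition cF (c : C) : Cqa := tofrac (c%:P%:P : {poly {poly C}}).

End RationalFunctions.

Section Modules.
Variables (L : fieldType) (n b : nat) (q a zeta s : L).

Local Notation A := (ground n b q a zeta s).
Local Notation K := (fracA n b q a zeta s).
Local Notation x := (xL b q a s).
Local Notation y := (yL b q a s).
Local Notation qA := (qA n b q a zeta s).
Local Notation aA := (aA n b q a zeta s).
Local Notation zetaA := (zetaA n b q a zeta s).

Definition halg : pzAlgType A := base_change (Zqa_eval qA aA) (yalg b n).
Definition hT (j : 'I_n) : halg := bc_gen (Zqa_eval qA aA) 1 (yT b j).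
Definition hR (i : 'I_n.-1) : halg := bc_gen (Zqa_eval qA aA) 1 (yR b i).

Definition epsA : A := zetaA ^+ ((b ^ 2 - b) %/ 2).

(* The exponent vector (p_1, ..., p_n) modulo b of an element of D. *)
Definition diag_exp : Type := {ffun 'I_n -> 'I_b}.

Definition t_diag (d : diag_exp) : halg := \prod_(j < n) hT j ^+ d j.

Definition char_of (i : nat -> nat) (d : diag_exp) : A :=
  zetaA ^+ (\sum_(k < n) i k * d k).

(* chi (d^-1) is the inverse of chi d *)
Definition e_char (chi : diag_exp -> A) : halg :=
  ((b%:R ^+ n)^-1)%:AC * \sum_(d : diag_exp) ((chi d)^-1)%:AC * t_diag d.

Definition char_seq (al : 'I_b -> nat) : seq nat :=
  flatten [seq nseq (al j) j.+1 | j <- enum 'I_b].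

Definition e_al (al : 'I_b -> nat) : halg :=
  e_char (char_of (nth 0%N (char_seq al))).

Definition h_al (al : 'I_b -> nat) : set halg :=
  [set h | exists g, h = e_al al * g * e_al al].

Definition he_al (al : 'I_b -> nat) : set halg :=
  [set h | exists g, h = g * e_al al].

Definition mbar (al : 'I_b -> nat) (j : nat) : nat :=
  (\sum_(i < b | i < j) al i)%N.

Definition iA (m : nat) : pzAlgType A := ialg qA (b%:R * aA) m.
Definition iten (al : 'I_b -> nat) : pzAlgType A :=
  tensor_alg (fun j => iA (al j)).

(* f is an isomorphism onto h_al, whose unit is e_al; the exponent is j.+1
   because the factors are numbered from 1 in the formula. *)
Definition is_eta (al : 'I_b -> nat) (f : iten al -> halg) : Prop :=
  [/\ [/\ (forall u v, f (u + v) = f u + f v),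
          (forall u v, f (u * v) = f u * f v),
          (forall c : A, f c%:AC = c%:AC * e_al al) & f 1 = e_al al],
      injective f, range f = h_al al
    & forall (j : 'I_b) (l : 'I_(al j).-1) (i : 'I_n.-1),
        i = (mbar al j + l)%N :> nat ->
        f (ta_in (B := fun j => iA (al j)) (iS _ _ l)) =
        (epsA ^+ j.+1)%:AC * hR i * e_al al].

(* The map specified by [is_eta] is unique, as the generators of the factors
   generate the tensor product. *)
Definition eta (al : 'I_b -> nat) : iten al -> halg :=
  xget (fun=> 0) [set f | is_eta f].

Definition eta_inv (al : 'I_b -> nat) (h : halg) : iten al :=
  xget 0 [set u | eta u = h].

Definition hoef_mod (l : seq nat) : lmodType A := {ffun std_tableau l -> A^o}.

(* The basis vector p_t; it is 0 when t is not standard. *)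
Definition hoef_basis (l : seq nat) (t : tableau (sumn l)) : hoef_mod l :=
  [ffun t' : std_tableau l => (val t' == t)%:R].

Definition is_hoefsmit (l : seq nat)
    (act : iA (sumn l) -> hoef_mod l -> hoef_mod l) : Prop :=
  is_alg_action act /\
  forall (i : 'I_(sumn l).-1) (t : std_tableau l),
    let k := axial (val t) (ord_hi i) (ord_lo i) in
    act (iS _ _ i) (hoef_basis (val t)) =
      toA n b q a zeta s ((x - 1) / (y * (1 - x ^ k))) *: hoef_basis (val t) +
      toA n b q a zeta s ((x - x ^ k) / (y * (1 - x ^ k))) *:
        hoef_basis (swap_tableau i (val t)).

(* As above, the generators determine the action. *)
Definition hoef_act (l : seq nat) : iA (sumn l) -> hoef_mod l -> hoef_mod l :=
  xget (fun _ _ => 0) [set act | is_hoefsmit act].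

Section VLambda.
Variable lam : {ffun 'I_b -> seq nat}.

Definition al_of (j : 'I_b) : nat := sumn (lam j).

(* The tensor product over A of the modules P^(lam j), with the factorwise
   action of the tensor product of the algebras. *)
Inductive p0_rel :
    freemod (iten al_of) (forall j, hoef_mod (lam j)) ->
    freemod (iten al_of) (forall j, hoef_mod (lam j)) -> Prop :=
| p0_add f j (u v : hoef_mod (lam j)) :
    p0_rel (fmgen _ (dfwith f (u + v)))
           (fmgen _ (dfwith f u) + fmgen _ (dfwith f v))
| p0_scale f j (c : A) (u : hoef_mod (lam j)) :
    p0_rel (fmgen _ (dfwith f (c *: u))) (c%:AC *: fmgen _ (dfwith f u))
| p0_act (g : forall j, iA (al_of j)) f :
    p0_rel (ta_gen g *: fmgen _ f) (fmgen _ (fun j => hoef_act (g j) (f j))).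

Definition P0 : lmodType (iten al_of) := presmod p0_rel.

Definition h_al_act (h : halg) (p : P0) : P0 := eta_inv al_of h *: p.

Definition he_sub : Type := {u : halg | he_al al_of u}.

(* The balanced tensor product of H e and P0 over H_alpha, as a left
   H-module. *)
Inductive v_rel :
    freemod halg (he_sub * P0) -> freemod halg (he_sub * P0) -> Prop :=
| v_addl (u u1 u2 : he_sub) p : sval u = sval u1 + sval u2 ->
    v_rel (fmgen _ (u, p)) (fmgen _ (u1, p) + fmgen _ (u2, p))
| v_addr (u : he_sub) p1 p2 :
    v_rel (fmgen _ (u, p1 + p2)) (fmgen _ (u, p1) + fmgen _ (u, p2))
| v_bal (u u' : he_sub) c p : h_al al_of c -> sval u' = sval u * c ->
    v_rel (fmgen _ (u', p)) (fmgen _ (u, h_al_act c p))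
| v_act (h : halg) (u u' : he_sub) p : sval u' = h * sval u ->
    v_rel (h *: fmgen _ (u, p)) (fmgen _ (u', p)).

Definition Vlam : lmodType halg := presmod v_rel.

Definition khalg : pzAlgType K := base_change (@tofrac A) halg.

(* The tensor product of K and V over A, with the action of the tensor product
   of K and H over A: (k, h) sends (k', v) to (k k', h v). *)
Inductive kv_rel :
    freemod khalg (K * Vlam) -> freemod khalg (K * Vlam) -> Prop :=
| kv_addl k k' v :
    kv_rel (fmgen _ (k + k', v)) (fmgen _ (k, v) + fmgen _ (k', v))
| kv_addr k v v' :
    kv_rel (fmgen _ (k, v + v')) (fmgen _ (k, v) + fmgen _ (k, v'))
| kv_bal k (c : A) v :
    kv_rel (fmgen _ (k * tofrac c, v)) (fmgen _ (k, c%:AC *: v))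
| kv_act k h k' v :
    kv_rel (bc_gen (@tofrac A) k h *: fmgen _ (k', v))
           (fmgen _ (k * k', h *: v)).

Definition KVlam : lmodType khalg := presmod kv_rel.

End VLambda.
End Modules.

Definition is_submodule (B : pzRingType) (M : lmodType B) (N : set M) : Prop :=
  [/\ N 0, (forall u v, N u -> N v -> N (u + v))
    & forall c u, N u -> N (c *: u)].

Definition simple_module (B : pzRingType) (M : lmodType B) : Prop :=
  (exists u : M, u != 0) /\
  forall N : set M, is_submodule N ->
    N = [set 0]%classic \/ N = [set: M]%classic.

Definition semisimple_module (B : pzRingType) (M : lmodType B) : Prop :=
  forall N : set M, is_submodule N ->
    exists N' : set M,
      [/\ is_submodule N', (forall u, N u -> N' u -> u = 0)
        & forall w, exists u v, [/\ N u, N' v & w = u + v]].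

Definition isomorphic_modules (B : pzRingType) (M N : lmodType B) : Prop :=
  exists f : {linear M -> N}, bijective f.

(* Semisimple as a left module over itself, and every simple module has only
   the scalars as endomorphisms. *)
Definition split_semisimple (F : fieldType) (B : pzAlgType F) : Prop :=
  semisimple_module (B^o : lmodType B) /\
  forall M : lmodType B, simple_module M -> forall f : {linear M -> M},
    exists c : F, forall u, f u = c%:AC *: u.

Definition complete_irreducibles (B : pzRingType) (I : Type)
    (M : I -> lmodType B) : Prop :=
  [/\ forall i, simple_module (M i),
      forall i j, isomorphic_modules (M i) (M j) -> i = j
    & forall N : lmodType B, simple_module N ->
        exists i, isomorphic_modules N (M i)].

(* Main.v *)
Require Import Defs.
From HB Require Import structures.
From mathcomp Require Import all_boot all_order all_fingroup all_algebra.
From mathcomp Require Import zify ring.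
From mathcomp Require Import generic_quotient boolp classical_sets reals complex.

Set Implicit Arguments.
Unset Strict Implicit.
Unset Printing Implicit Defensive.

Import GRing.Theory.

Local Open Scope ring_scope.

(** * Universal properties of the presented algebras and modules *)

Section FreeAlgebraLift.
Variables (R : comPzRingType) (X : Type) (E : pzAlgType R) (g : X -> E).

Fixpoint aterm_eval (t : aterm R X) : E :=
  match t with
  | AGen x => g x
  | ACst c => c%:AC
  | AAdd t u => aterm_eval t + aterm_eval u
  | AMul t u => aterm_eval t * aterm_eval u
  end.

Lemma aterm_eval_aeq t u : aeq t u -> aterm_eval t = aterm_eval u.
Proof.
elim=> {t u} //=.
- by move=> t u v _ -> _ ->.
- by move=> t t' u u' _ -> _ ->.
- by move=> t t' u u' _ -> _ ->.
- by move=> *; rewrite addrA.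
- by move=> *; rewrite addrC.
- by move=> *; rewrite rmorph0 add0r.
- by move=> *; rewrite rmorphN rmorph1 mulN1r addNr rmorph0.
- by move=> *; rewrite mulrA.
- by move=> *; rewrite rmorph1 mul1r.
- by move=> *; rewrite rmorph1 mulr1.
- by move=> *; rewrite mulrDl.
- by move=> *; rewrite mulrDr.
- by move=> *; rewrite rmorphD.
- by move=> *; rewrite rmorphM.
- by move=> c t; rewrite alg_const_central.
Qed.

Definition free_lift (z : freealg R X) : E := aterm_eval (repr z).

Lemma free_lift_pi t : free_lift (fpi t) = aterm_eval t.
Proof. exact/aterm_eval_aeq/free_repr. Qed.

Lemma free_lift_nmod : nmod_morphism free_lift.
Proof.
split=> [|u v]; first by rewrite [LHS]free_lift_pi /= rmorph0.
elim/fpi_ind: u => t; elim/fpi_ind: v => u.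
by have -> : fpi t + fpi u = fpi (AAdd t u); [exact: faddE | rewrite !free_lift_pi].
Qed.

Lemma free_lift_monoid : monoid_morphism free_lift.
Proof.
split=> [|u v]; first by rewrite [LHS]free_lift_pi /= rmorph1.
elim/fpi_ind: u => t; elim/fpi_ind: v => u.
by have -> : fpi t * fpi u = fpi (AMul t u); [exact: fmulE | rewrite !free_lift_pi].
Qed.

HB.instance Definition _ :=
  GRing.isNmodMorphism.Build (freealg R X) E free_lift free_lift_nmod.
HB.instance Definition _ :=
  GRing.isMonoidMorphism.Build (freealg R X) E free_lift free_lift_monoid.

Lemma free_lift_gen x : free_lift (fgen R x) = g x.
Proof. exact: free_lift_pi. Qed.

Lemma free_lift_cst c : free_lift c%:AC = c%:AC.
Proof. exact: free_lift_pi. Qed.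

End FreeAlgebraLift.

Lemma freealg_ind (R : comPzRingType) (X : Type) (P : freealg R X -> Prop) :
  (forall x, P (fgen R x)) -> (forall c : R, P c%:AC) ->
  (forall u v, P u -> P v -> P (u + v)) ->
  (forall u v, P u -> P v -> P (u * v)) -> forall u, P u.
Proof.
move=> Pg Pc Pa Pm; elim/fpi_ind; elim=> [x|c|t Pt u Pu|t Pt u Pu].
- exact: Pg.
- exact: Pc.
- by rewrite -faddE; apply: Pa.
- by rewrite -fmulE; apply: Pm.
Qed.

Section PresentedAlgebra.
Variables (R : comPzRingType) (X : Type).
Variable rel : freealg R X -> freealg R X -> Prop.

Lemma pres_ind (P : presalg rel -> Prop) :
  (forall x, P (pgen rel x)) -> (forall c : R, P c%:AC) ->
  (forall u v, P u -> P v -> P (u + v)) ->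
  (forall u v, P u -> P v -> P (u * v)) -> forall u, P u.
Proof.
move=> Pg Pc Pa Pm; elim/qproj_ind; elim/freealg_ind => // u v Pu Pv.
- by rewrite rmorphD; apply: Pa.
- by rewrite rmorphM; apply: Pm.
Qed.

Lemma pres_rel u v : rel u v -> qproj rel u = qproj rel v.
Proof. by move=> h; apply/qprojP/acong_rel. Qed.

Variables (E : pzAlgType R) (g : X -> E).
Hypothesis g_rel : forall u v, rel u v -> free_lift g u = free_lift g v.

Lemma free_lift_acong u v : acong rel u v -> free_lift g u = free_lift g v.
Proof.
elim=> {u v} //.
- by move=> x y z _ -> _ ->.
- by move=> x x' y y' _ e1 _ e2; rewrite !rmorphD /= e1 e2.
- by move=> x x' y y' _ e1 _ e2; rewrite !rmorphM /= e1 e2.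
Qed.

Definition pres_lift_fun (z : presalg rel) : E := free_lift g (repr z).

Lemma pres_lift_proj u : pres_lift_fun (qproj rel u) = free_lift g u.
Proof. exact/free_lift_acong/q_repr. Qed.

Lemma pres_lift_nmod : nmod_morphism pres_lift_fun.
Proof.
split=> [|u v]; first by rewrite [LHS]pres_lift_proj rmorph0.
elim/qproj_ind: u => t; elim/qproj_ind: v => u.
by rewrite -rmorphD !pres_lift_proj rmorphD.
Qed.

Lemma pres_lift_monoid : monoid_morphism pres_lift_fun.
Proof.
split=> [|u v]; first by rewrite [LHS]pres_lift_proj rmorph1.
elim/qproj_ind: u => t; elim/qproj_ind: v => u.
by rewrite -rmorphM !pres_lift_proj rmorphM.
Qed.

Lemma pres_lift : exists G : {rmorphism presalg rel -> E},
  (forall c : R, G c%:AC = c%:AC) /\ (forall x, G (pgen rel x) = g x).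
Proof.
pose m1 := GRing.isNmodMorphism.Build _ _ pres_lift_fun pres_lift_nmod.
pose m2 := GRing.isMonoidMorphism.Build _ _ pres_lift_fun pres_lift_monoid.
pose G : {rmorphism presalg rel -> E} := HB.pack pres_lift_fun m1 m2.
exists G; split=> [c|x]; rewrite /= [LHS]pres_lift_proj.
- exact: free_lift_cst.
- exact: free_lift_gen.
Qed.

End PresentedAlgebra.

(** The additive span of a set, used to reduce statements on presented algebras
    to their pure tensors. *)
Inductive sums (V : zmodType) (G : V -> Prop) : V -> Prop :=
| sums_gen u of G u : sums G u
| sums_add u v of sums G u & sums G v : sums G (u + v).

Lemma sums_mul (B : pzRingType) (G : B -> Prop) u v :
  (forall x y, G x -> G y -> sums G (x * y)) ->
  sums G u -> sums G v -> sums G (u * v).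
Proof.
move=> GM su; elim: su v => {u} [u Gu|u u' _ IH _ IH'] v sv; last first.
  by rewrite mulrDl; apply: sums_add; [apply: IH | apply: IH'].
elim: sv => {v} [v Gv|v v' _ IH _ IH']; first exact: GM.
by rewrite mulrDr; apply: sums_add.
Qed.

Section BaseChangeTheory.
Variables (R S : comPzRingType) (phi : {rmorphism R -> S}) (B : pzAlgType R).
Local Notation BS := (base_change phi B).

Lemma bc_genDl s s' x : bc_gen phi (s + s') x = bc_gen phi s x + bc_gen phi s' x :> BS.
Proof. by rewrite /bc_gen/pgen -rmorphD; apply/pres_rel/bc_addl. Qed.

Lemma bc_genDr s x x' : bc_gen phi s (x + x') = bc_gen phi s x + bc_gen phi s x' :> BS.
Proof. by rewrite /bc_gen/pgen -rmorphD; apply/pres_rel/bc_addr. Qed.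

Lemma bc_genM s s' x x' :
  bc_gen phi s x * bc_gen phi s' x' = bc_gen phi (s * s') (x * x') :> BS.
Proof. by rewrite /bc_gen/pgen -rmorphM; apply/pres_rel/bc_mul. Qed.

Lemma bc_gen_cst s : bc_gen phi s 1 = s%:AC :> BS.
Proof. by symmetry; apply/pres_rel/bc_const. Qed.

Lemma bc_gen_bal s r x : bc_gen phi (s * phi r) x = bc_gen phi s (r%:AC * x) :> BS.
Proof. exact/pres_rel/bc_bal. Qed.

Definition bc_in (x : B) : BS := bc_gen phi 1 x.

Lemma bc_in_nmod : nmod_morphism bc_in.
Proof.
split=> [|x y]; last exact: bc_genDr.
by apply: (addrI (bc_in 0)); rewrite addr0 -bc_genDr addr0.
Qed.

Lemma bc_in_monoid : monoid_morphism bc_in.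
Proof.
split=> [|x y]; first by rewrite /bc_in bc_gen_cst rmorph1.
by rewrite /bc_in bc_genM mulr1.
Qed.

HB.instance Definition _ := GRing.isNmodMorphism.Build B BS bc_in bc_in_nmod.
HB.instance Definition _ := GRing.isMonoidMorphism.Build B BS bc_in bc_in_monoid.

Lemma bc_in_cst r : bc_in r%:AC = (phi r)%:AC.
Proof. by rewrite -bc_gen_cst -[phi r]mul1r bc_gen_bal mulr1. Qed.

Lemma bc_genE s x : bc_gen phi s x = s%:AC * bc_in x :> BS.
Proof. by rewrite -bc_gen_cst bc_genM mul1r mulr1. Qed.

Lemma bc_sums (u : BS) : sums (fun v => exists s x, v = bc_gen phi s x) u.
Proof.
elim/pres_ind: u => [[s x]|c|u v su sv|u v su sv].
- by apply: sums_gen; exists s, x.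
- by apply: sums_gen; exists c, 1; rewrite bc_gen_cst.
- exact: sums_add.
- apply: sums_mul su sv => _ _ [s [x ->]] [s' [x' ->]].
  by apply: sums_gen; exists (s * s'), (x * x'); rewrite bc_genM.
Qed.

Lemma bc_span (P : BS -> Prop) :
  (forall s x, P (bc_gen phi s x)) ->
  (forall u v, P u -> P v -> P (u + v)) -> forall u, P u.
Proof.
by move=> Pg Pa u; elim: (bc_sums u) => {u} [_ [s [x ->]]|u v _ Pu _ Pv] //; apply: Pa.
Qed.

Lemma bc_lift (E : pzAlgType S) (g : {rmorphism B -> E}) :
  (forall r, g r%:AC = (phi r)%:AC) ->
  exists G : {rmorphism BS -> E},
    (forall c : S, G c%:AC = c%:AC) /\ (forall x, G (bc_in x) = g x).
Proof.
move=> g_cst; pose h (p : S * B) : E := p.1%:AC * g p.2.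
have h_rel u v : bc_rel phi u v -> free_lift h u = free_lift h v.
  case=> [s s' x|s x x'|s r x|s s' x x'|s];
    rewrite ?(rmorphD (free_lift h)) ?(rmorphM (free_lift h)) /= ?free_lift_cst ?free_lift_gen /h /=.
  - by rewrite rmorphD mulrDl.
  - by rewrite rmorphD mulrDr.
  - by rewrite !rmorphM g_cst mulrA.
  - by rewrite !rmorphM !mulrA; congr (_ * _); rewrite -!mulrA; congr (_ * _); rewrite alg_const_central.
  - by rewrite rmorph1 mulr1.
have [G [G_cst G_gen]] := pres_lift h_rel.
by exists G; split=> // x; rewrite [LHS]G_gen /h rmorph1 mul1r.
Qed.

End BaseChangeTheory.

Section TensorTheory.
Variables (R : comPzRingType) (I : finType) (B : I -> pzAlgType R).
Local Notation TB := (tensor_alg B).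

Lemma ta_genM (f g : forall i, B i) :
  ta_gen f * ta_gen g = ta_gen (fun i => f i * g i).
Proof. by rewrite /ta_gen/pgen -rmorphM; apply/pres_rel/ta_mul. Qed.

Lemma ta_gen1 : ta_gen (fun i => 1 : B i) = 1.
Proof. by rewrite /ta_gen/pgen (pres_rel (ta_one B)) rmorph1. Qed.

Lemma ta_genD (f : forall i, B i) i (x y : B i) :
  ta_gen (dfwith f (x + y)) = ta_gen (dfwith f x) + ta_gen (dfwith f y).
Proof. by rewrite /ta_gen/pgen -rmorphD; apply/pres_rel/ta_add. Qed.

Lemma ta_genZ (f : forall i, B i) i c (x : B i) :
  ta_gen (dfwith f (c%:AC * x)) = c%:AC * ta_gen (dfwith f x).
Proof.
by rewrite /ta_gen/pgen (pres_rel (ta_scale f c x)) rmorphM.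
Qed.

Lemma dfwith_mul (f g : forall i, B i) i (x y : B i) :
  (fun j => dfwith f x j * dfwith g y j) =
  dfwith (fun j => f j * g j) (x * y).
Proof.
apply: functional_extensionality_dep => j.
by case: (eqVneq i j) => [<-|ne]; rewrite ?dfwith_in ?dfwith_out.
Qed.

Lemma dfwith_id (f : forall i, B i) i : dfwith f (f i) = f.
Proof.
apply: functional_extensionality_dep => j.
by case: (eqVneq i j) => [<-|ne]; rewrite ?dfwith_in ?dfwith_out.
Qed.

Lemma ta_in_nmod i : nmod_morphism (@ta_in R I B i).
Proof.
split=> [|x y]; last exact: ta_genD.
apply: (addrI (@ta_in R I B i 0)); rewrite addr0.
by have := ta_genD (fun j => 1 : B j) (0 : B i) 0; rewrite addr0 => /esym.
Qed.

Lemma ta_in_monoid i : monoid_morphism (@ta_in R I B i).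
Proof.
split=> [|x y]; first by rewrite /ta_in (dfwith_id (fun j => 1)) ta_gen1.
rewrite /ta_in ta_genM dfwith_mul; congr ta_gen.
apply: functional_extensionality_dep => j.
by case: (eqVneq i j) => [<-|ne]; rewrite ?dfwith_in ?dfwith_out ?mulr1.
Qed.

HB.instance Definition _ i :=
  GRing.isNmodMorphism.Build (B i) TB (@ta_in R I B i) (ta_in_nmod i).
HB.instance Definition _ i :=
  GRing.isMonoidMorphism.Build (B i) TB (@ta_in R I B i) (ta_in_monoid i).

Lemma ta_in_cst i c : ta_in (c%:AC : B i) = c%:AC.
Proof.
by rewrite /ta_in -[c%:AC in LHS]mulr1 ta_genZ (dfwith_id (fun j => 1)) ta_gen1 mulr1.
Qed.

Lemma ta_in_comm i j (x : B i) (y : B j) :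
  i != j -> ta_in x * ta_in y = ta_in y * ta_in x.
Proof.
move=> ne; rewrite /ta_in !ta_genM; congr ta_gen.
apply: functional_extensionality_dep => k.
case: (eqVneq i k) => [ik|nik]; last first.
  by rewrite (dfwith_out _ x nik) mul1r mulr1.
by subst k; rewrite dfwith_in dfwith_out 1?eq_sym // mul1r mulr1.
Qed.

(** A pure tensor is the product of its factors, so the factors generate. *)
Lemma ta_gen_prod (g : forall i, B i) (s : seq I) : uniq s ->
  \prod_(i <- s) ta_in (g i) =
  ta_gen (fun i => if i \in s then g i else 1).
Proof.
elim: s => [|i s IH] /=; first by rewrite big_nil -ta_gen1.
case/andP=> nis us; rewrite big_cons IH // /ta_in ta_genM; congr ta_gen.
apply: functional_extensionality_dep => j; rewrite in_cons.
case: (eqVneq j i) => [->|ne]; first by rewrite dfwith_in (negbTE nis) mulr1.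
by rewrite dfwith_out 1?eq_sym // mul1r.
Qed.

Lemma ta_gen_prodT (g : forall i, B i) :
  ta_gen g = \prod_(i <- enum I) ta_in (g i).
Proof.
rewrite ta_gen_prod ?enum_uniq //; congr ta_gen.
by apply: functional_extensionality_dep => j; rewrite mem_enum.
Qed.

Lemma ta_ind (P : TB -> Prop) :
  (forall i (x : B i), P (ta_in x)) -> (forall c : R, P c%:AC) ->
  (forall u v, P u -> P v -> P (u + v)) ->
  (forall u v, P u -> P v -> P (u * v)) -> forall u, P u.
Proof.
move=> Pg Pc Pa Pm; elim/pres_ind => // g; rewrite -/(ta_gen g) ta_gen_prodT.
elim/big_ind: _ => //; first by rewrite -(rmorph1 (@alg_const R TB)); apply: Pc.
Qed.

Variables (E : pzAlgType R) (g : forall i, {rmorphism B i -> E}).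
Hypothesis g_cst : forall i c, g i c%:AC = c%:AC.
Hypothesis g_comm : forall i j x y, i != j -> g i x * g j y = g j y * g i x.

Let G (f : forall i, B i) : E := \prod_(i <- enum I) g i (f i).

Let G_split (f : forall i, B i) i : exists a b : E,
  forall x : B i, G (dfwith f x) = a * g i x * b.
Proof.
have : i \in enum I by rewrite mem_enum.
move: (enum_uniq I); rewrite /G; elim: (enum I) => //= j s IH /andP[njs us].
rewrite in_cons; case: (eqVneq i j) => [ij _|ne /= iis].
  subst j; exists 1, (\prod_(k <- s) g k (f k)) => x.
  rewrite big_cons dfwith_in mul1r; congr (_ * _).
  rewrite big_seq [RHS]big_seq; apply: eq_bigr => k ks.
  by rewrite dfwith_out //; apply: contraNneq njs => ->.
have [a [b hab]] := IH us iis; exists (g j (f j) * a), b => x.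
by rewrite big_cons hab dfwith_out // !mulrA.
Qed.

Lemma ta_lift : exists F : {rmorphism TB -> E},
  (forall c : R, F c%:AC = c%:AC) /\ (forall i (x : B i), F (ta_in x) = g i x).
Proof.
have G_rel u v : ta_rel u v -> free_lift G u = free_lift G v.
  case=> [f i x y|f i c x|f f'|];
    rewrite ?(rmorphD (free_lift G)) ?(rmorphM (free_lift G)) /= ?free_lift_cst ?free_lift_gen.
  - by have [a [b e]] := G_split f i; rewrite !e rmorphD mulrDr mulrDl.
  - have [a [b e]] := G_split f i; rewrite !e rmorphM g_cst !mulrA.
    by rewrite alg_const_central.
  - rewrite /G; move: (enum_uniq I); elim: (enum I) => [|i s IH] /=.
      by rewrite !big_nil mulr1.
    case/andP=> nis us; rewrite !big_cons -IH // rmorphM !mulrA.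
    congr (_ * _); rewrite -!mulrA; congr (_ * _).
    elim: s nis {us IH} => [|j s IHs]; first by rewrite !big_nil mul1r mulr1.
    rewrite in_cons negb_or => /andP[nij nis]; rewrite !big_cons.
    by rewrite -mulrA IHs // !mulrA; congr (_ * _); rewrite g_comm // eq_sym.
  - by rewrite rmorph1 /G big1 // => i _; rewrite rmorph1.
have [F [F_cst F_gen]] := pres_lift G_rel.
exists F; split=> // i x; rewrite [LHS]F_gen /G.
move: (enum_uniq I) (mem_enum I i); rewrite inE.
elim: (enum I) => //= j s IH /andP[njs us]; rewrite in_cons big_cons.
case: (eqVneq i j) => [ij _|ne /= iis]; last first.
  by rewrite dfwith_out // rmorph1 mul1r IH.
subst j; rewrite dfwith_in big_seq big1 ?mulr1 // => k ks.
by rewrite dfwith_out ?rmorph1 //; apply: contraNneq njs => ->.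
Qed.

End TensorTheory.

(** Maps out of a presented module are needed into groups on which the ring
    acts through a corner e B e, where 1 acts as the identity only on the
    subgroup [P] of vectors fixed by e. *)
Section PresentedModuleLift.
Variables (S : pzRingType) (X : Type) (Z : zmodType).
Variables (act : S -> Z -> Z) (P : Z -> Prop) (g : X -> Z).
Hypothesis act_addr : forall c u v, act c (u + v) = act c u + act c v.
Hypothesis act_addl : forall c d u, act (c + d) u = act c u + act d u.
Hypothesis act_mul : forall c d u, act (c * d) u = act c (act d u).
Hypothesis act_one : forall u, P u -> act 1 u = u.
Hypothesis P_zero : P 0.
Hypothesis P_add : forall u v, P u -> P v -> P (u + v).
Hypothesis P_act : forall c u, P u -> P (act c u).
Hypothesis P_gen : forall x, P (g x).

Fixpoint mterm_eval (t : mterm S X) : Z :=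
  match t with
  | MGen x => g x
  | MZero => 0
  | MAdd t u => mterm_eval t + mterm_eval u
  | MScale c t => act c (mterm_eval t)
  end.

Lemma mterm_eval_in t : P (mterm_eval t).
Proof. by elim: t => //= *; [apply: P_add | apply: P_act]. Qed.

Let act_zero c : act c 0 = 0.
Proof. by apply: (addrI (act c 0)); rewrite -act_addr !addr0. Qed.

Let act_zerol u : act 0 u = 0.
Proof. by apply: (addrI (act 0 u)); rewrite -act_addl !addr0. Qed.

Lemma mterm_eval_meq t u : meq t u -> mterm_eval t = mterm_eval u.
Proof.
elim=> {t u} //=.
- by move=> t u v _ -> _ ->.
- by move=> t t' u u' _ -> _ ->.
- by move=> c t t' _ ->.
- by move=> *; rewrite addrA.
- by move=> *; rewrite addrC.
- by move=> *; rewrite add0r.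
- move=> t; rewrite -[X in _ + X]act_one; last exact: mterm_eval_in.
  by rewrite -act_addl addNr act_zerol.
- by move=> t; rewrite act_one //; exact: mterm_eval_in.
Qed.

Definition freem_lift (z : freemod S X) : Z := mterm_eval (repr z).

Lemma freem_lift_pi t : freem_lift (Defs.mpi t) = mterm_eval t.
Proof. exact/mterm_eval_meq/freem_repr. Qed.

Lemma freem_liftD u v : freem_lift (u + v) = freem_lift u + freem_lift v.
Proof.
elim/mpi_ind: u => t; elim/mpi_ind: v => u.
by have -> : Defs.mpi t + Defs.mpi u = Defs.mpi (MAdd t u); [exact: fmaddE | rewrite !freem_lift_pi].
Qed.

Lemma freem_liftZ c u : freem_lift (c *: u) = act c (freem_lift u).
Proof.
elim/mpi_ind: u => t.
by have -> : c *: Defs.mpi t = Defs.mpi (MScale c t); [exact: fmscaleE | rewrite !freem_lift_pi].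
Qed.

Lemma freem_lift_gen x : freem_lift (fmgen S x) = g x.
Proof. exact: freem_lift_pi. Qed.

Variable rel : freemod S X -> freemod S X -> Prop.
Hypothesis g_rel : forall u v, rel u v -> freem_lift u = freem_lift v.

Lemma presmod_lift : exists f : presmod rel -> Z,
  [/\ forall u v, f (u + v) = f u + f v,
      forall c u, f (c *: u) = act c (f u),
      forall x, f (pmgen rel x) = g x & forall u, P (f u)].
Proof.
have g_cong u v : mcong rel u v -> freem_lift u = freem_lift v.
  elim=> {u v} //.
  - by move=> x y z _ -> _ ->.
  - by move=> x x' y y' _ e1 _ e2; rewrite !freem_liftD e1 e2.
  - by move=> c x x' _ e; rewrite !freem_liftZ e.
pose f (z : presmod rel) := freem_lift (repr z).
have fE u : f (mproj rel u) = freem_lift u by apply/g_cong/qm_repr.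
exists f; split.
- move=> u v; elim/mproj_ind: u => u; elim/mproj_ind: v => v.
  have -> : mproj rel u + mproj rel v = mproj rel (u + v) by exact: qmaddE.
  by rewrite !fE freem_liftD.
- move=> c u; elim/mproj_ind: u => u.
  have -> : c *: mproj rel u = mproj rel (c *: u) by exact: qmscaleE.
  by rewrite !fE freem_liftZ.
- by move=> x; rewrite fE freem_lift_gen.
- by move=> u; apply: mterm_eval_in.
Qed.

End PresentedModuleLift.

Section PresentedModule.
Variables (S : pzRingType) (X : Type) (rel : freemod S X -> freemod S X -> Prop).

Lemma mprojD u v : mproj rel (u + v) = mproj rel u + mproj rel v.
Proof. by rewrite [RHS]qmaddE. Qed.

Lemma mprojZ c u : mproj rel (c *: u) = c *: mproj rel u.
Proof. by rewrite [RHS]qmscaleE. Qed.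

Lemma presmod_rel u v : rel u v -> mproj rel u = mproj rel v.
Proof. by move=> h; apply/mprojP/mcong_rel. Qed.

Lemma presmod_ind (P : presmod rel -> Prop) :
  (forall x, P (pmgen rel x)) -> P 0 ->
  (forall u v, P u -> P v -> P (u + v)) ->
  (forall c u, P u -> P (c *: u)) -> forall u, P u.
Proof.
move=> Pg P0 Pa Pz; elim/mproj_ind; elim/mpi_ind.
elim=> [x||t Pt u Pu|c t Pt]; [exact: Pg | exact: P0 | |].
- by rewrite -fmaddE; have := Pa _ _ Pt Pu; rewrite -mprojD.
- by rewrite -fmscaleE; have := Pz c _ Pt; rewrite -mprojZ.
Qed.

End PresentedModule.

(** The algebra of endomorphisms of a module, so that an action of an algebra
    is a morphism into it. *)
Section EndomorphismAlgebra.
Variables (R : comPzRingType) (M : lmodType R).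

Record endo : Type :=
  Endo { endo_fun :> M -> M; endo_lin : forall c u v, endo_fun (c *: u + v) = c *: endo_fun u + endo_fun v }.

Lemma endoP (f g : endo) : (forall u, f u = g u) -> f = g.
Proof.
case: f g => f f_lin [g g_lin] /= fg.
have e : f = g by apply: functional_extensionality_dep.
by subst g; congr Endo; apply: Prop_irrelevance.
Qed.

HB.instance Definition _ := gen_eqMixin endo.
HB.instance Definition _ := gen_choiceMixin endo.

Lemma endoD (f : endo) u v : f (u + v) = f u + f v.
Proof. by rewrite -[u]scale1r endo_lin !scale1r. Qed.
Lemma endo0 (f : endo) : f 0 = 0.
Proof. by apply: (addrI (f 0)); rewrite -endoD !addr0. Qed.
Lemma endoZ (f : endo) c u : f (c *: u) = c *: f u.
Proof. by rewrite -[c *: u]addr0 endo_lin endo0 !addr0. Qed.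
Lemma endo_sum (f : endo) I (r : seq I) (Q : pred I) F :
  f (\sum_(i <- r | Q i) F i) = \sum_(i <- r | Q i) f (F i).
Proof. by rewrite (big_morph f (endoD f) (endo0 f)). Qed.

Definition endo_add (f g : endo) : endo.
Proof.
by exists (fun u => f u + g u) => c u v; rewrite !endo_lin scalerDr addrACA.
Defined.
Definition endo_opp (f : endo) : endo.
Proof. by exists (fun u => - f u) => c u v; rewrite endo_lin opprD scalerN. Defined.
Definition endo_zero : endo.
Proof. by exists (fun u => 0) => c u v; rewrite scaler0 addr0. Defined.
Definition endo_one : endo.
Proof. by exists id. Defined.
Definition endo_mul (f g : endo) : endo.
Proof. by exists (fun u => f (g u)) => c u v; rewrite !endo_lin. Defined.
Definition endo_cst (c : R) : endo.
Proof.
by exists (fun u => c *: u) => d u v; rewrite scalerDr !scalerA mulrC.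
Defined.

Let endo_addA : associative endo_add.
Proof. by move=> f g h; apply: endoP => u /=; rewrite addrA. Qed.
Let endo_addC : commutative endo_add.
Proof. by move=> f g; apply: endoP => u /=; rewrite addrC. Qed.
Let endo_add0 : left_id endo_zero endo_add.
Proof. by move=> f; apply: endoP => u /=; rewrite add0r. Qed.
Let endo_addN : left_inverse endo_zero endo_opp endo_add.
Proof. by move=> f; apply: endoP => u /=; rewrite addNr. Qed.
HB.instance Definition _ :=
  GRing.isZmodule.Build endo endo_addA endo_addC endo_add0 endo_addN.

Let endo_mulA : associative endo_mul.
Proof. by move=> f g h; apply: endoP. Qed.
Let endo_mul1l : left_id endo_one endo_mul.
Proof. by move=> f; apply: endoP. Qed.
Let endo_mul1r : right_id endo_one endo_mul.
Proof. by move=> f; apply: endoP. Qed.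
Let endo_mulDl : left_distributive endo_mul endo_add.
Proof. by move=> f g h; apply: endoP. Qed.
Let endo_mulDr : right_distributive endo_mul endo_add.
Proof. by move=> f g h; apply: endoP => u /=; rewrite endoD. Qed.
HB.instance Definition _ := GRing.Zmodule_isPzRing.Build endo
  endo_mulA endo_mul1l endo_mul1r endo_mulDl endo_mulDr.

Let endo_cst_nmod : nmod_morphism endo_cst.
Proof.
by split=> [|c d]; apply: endoP => u /=; rewrite ?scale0r ?scalerDl.
Qed.
Let endo_cst_monoid : monoid_morphism endo_cst.
Proof.
by split=> [|c d]; apply: endoP => u /=; rewrite ?scale1r ?scalerA.
Qed.
Let endo_cst_central (c : R) (f : endo) : endo_cst c * f = f * endo_cst c.
Proof. by apply: endoP => u /=; rewrite endoZ. Qed.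
HB.instance Definition _ :=
  PzRing_isAlgebraOver.Build R endo endo_cst_nmod endo_cst_monoid endo_cst_central.

Lemma endo_addE (f g : endo) u : (f + g) u = f u + g u. Proof. by []. Qed.
Lemma endo_mulE (f g : endo) u : (f * g) u = f (g u). Proof. by []. Qed.
Lemma endo_oneE u : (1 : endo) u = u. Proof. by []. Qed.
Lemma endo_zeroE u : (0 : endo) u = 0. Proof. by []. Qed.
Lemma endo_cstE (c : R) u : (c%:AC : endo) u = c *: u. Proof. by []. Qed.
Lemma endo_sumE I (r : seq I) (Q : pred I) (F : I -> endo) u :
  (\sum_(i <- r | Q i) F i) u = \sum_(i <- r | Q i) F i u.
Proof. by rewrite (big_morph (fun f : endo => f u) (fun _ _ => erefl) erefl). Qed.

End EndomorphismAlgebra.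

(** * Normal forms of words in braid-like generators *)

Section CosetWords.
Variables (B : pzRingType) (R : nat -> B).

(** [cosw k d] is R_(k-1) R_(k-2) ... R_(k-d); for d = 0, ..., k these lift
    the coset representatives of the symmetric group on k points in the one on
    k + 1 points. *)
Fixpoint cosw (k d : nat) : B :=
  if d is d'.+1 then cosw k d' * R (k - d'.+1) else 1.

Definition word_of (p : seq nat) : B :=
  \prod_(0 <= k < size p) cosw k (nth 0%N p k).

Lemma word_of_nil : word_of [::] = 1.
Proof. by rewrite /word_of big_nil. Qed.

Lemma word_of_rcons p d : word_of (rcons p d) = word_of p * cosw (size p) d.
Proof.
rewrite /word_of size_rcons big_nat_recr //= nth_rcons ltnn eqxx.
by congr (_ * _); apply: eq_big_nat => k /= kp; rewrite nth_rcons kp.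
Qed.

End CosetWords.

Fixpoint idx (m : nat) : seq (seq nat) :=
  if m is m'.+1 then [seq rcons p d | p <- idx m', d <- iota 0 m] else [:: [::]].

Lemma mem_idxS m p d :
  (rcons p d \in idx m.+1) = (p \in idx m) && (d <= m)%N.
Proof.
apply/allpairsP/andP => [[[p' d'] [p'm]]|[pm dm]].
  by rewrite mem_iota => /andP[_ d'm] /rcons_inj[-> ->].
by exists (p, d); split=> //; rewrite mem_iota add0n ltnS.
Qed.

Lemma idx_size m p : p \in idx m -> size p = m.
Proof.
elim: m p => [|m IH] p; first by rewrite inE => /eqP ->.
case/lastP: p => [|p d]; last by rewrite mem_idxS size_rcons => /andP[/IH ->].
by case/allpairsP => -[p d] /= [_ _ /(congr1 size)]; rewrite size_rcons.
Qed.

Lemma idx_uniq m : uniq (idx m).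
Proof.
elim: m => // m IH; apply: allpairs_uniq => //; first exact: iota_uniq.
by move=> [p d] [p' d'] _ _ /rcons_inj[-> ->].
Qed.

Lemma size_idx m : size (idx m) = m`!.
Proof. by elim: m => // m IH; rewrite size_allpairs IH size_iota factS mulnC. Qed.

(** A ring generated by a subring [C] and generators R_0, ..., R_(N-1) that
    satisfy the braid relations, normalize [C], and have quadratic relations
    over [C], is spanned over [C] on the left by (N+1)! words. *)
Section NormalForm.
Variables (B : pzRingType) (C : B -> Prop) (N : nat) (R : nat -> B).
Hypothesis C_zero : C 0.
Hypothesis C_add : forall x y, C x -> C y -> C (x + y).
Hypothesis C_mul : forall x y, C x -> C y -> C (x * y).
Hypothesis R_far : forall i j, (j < N)%N -> (i.+1 < j)%N -> R i * R j = R j * R i.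
Hypothesis R_braid : forall i, (i.+1 < N)%N ->
  R i * R i.+1 * R i = R i.+1 * R i * R i.+1.
Hypothesis R_quad : forall i, (i < N)%N ->
  exists c0 c1, [/\ C c0, C c1 & R i * R i = c0 + c1 * R i].
Hypothesis R_norm : forall i c, (i < N)%N -> C c ->
  exists2 c', C c' & R i * c = c' * R i.

Fixpoint left_span (m : nat) (x : B) : Prop :=
  if m is m'.+1 then
    exists2 h : nat -> B, forall d, left_span m' (h d) &
      x = \sum_(0 <= d < m) h d * cosw R m' d
  else C x.

Lemma left_span0 m : left_span m 0.
Proof.
elim: m => //= m IH; exists (fun=> 0) => //.
by rewrite big1 // => d _; rewrite mul0r.
Qed.

Lemma left_spanD m x y : left_span m x -> left_span m y -> left_span m (x + y).
Proof.
elim: m x y => [|m IH] x y /=; first exact: C_add.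
move=> [h hs ->] [h' hs' ->]; exists (fun d => h d + h' d); first by move=> d; apply: IH.
by rewrite -big_split; apply: eq_bigr => d _; rewrite mulrDl.
Qed.

Lemma left_span_sum m (I : Type) (r : seq I) (P : pred I) (F : I -> B) :
  (forall i, P i -> left_span m (F i)) -> left_span m (\sum_(i <- r | P i) F i).
Proof.
by move=> h; elim/big_ind: _ => //; [apply: left_span0 | apply: left_spanD].
Qed.

Lemma left_span_cosw m h d :
  left_span m h -> (d <= m)%N -> left_span m.+1 (h * cosw R m d).
Proof.
move=> hm dm /=; exists (fun e => if e == d then h else 0).
  by move=> e; case: eqP => // _; apply: left_span0.
rewrite (bigD1_seq d) ?iota_uniq ?mem_index_iota //= eqxx.
by rewrite big1 ?addr0 // => e /negbTE ->; rewrite mul0r.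
Qed.

Lemma left_span_ind m (P : B -> Prop) x :
  (forall u v, P u -> P v -> P (u + v)) -> P 0 ->
  (forall h d, left_span m h -> (d <= m)%N -> P (h * cosw R m d)) ->
  left_span m.+1 x -> P x.
Proof.
move=> Pa P0 Pg /= [h hs ->]; rewrite big_nat; elim/big_ind: _ => // d /= dm.
by apply: Pg.
Qed.

Lemma cosw_norm m d c : (m <= N)%N -> (d <= m)%N -> C c ->
  exists2 c', C c' & cosw R m d * c = c' * cosw R m d.
Proof.
move=> mN; elim: d c => [|d IH] c dm Cc /=; first by exists c; rewrite ?mul1r ?mulr1.
have [|c' Cc' e] := R_norm (i := (m - d.+1)%N) _ Cc; first by lia.
have [|c'' Cc'' e'] := IH c' _ Cc'; first by lia.
by exists c'' => //; rewrite -mulrA e mulrA e' mulrA.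
Qed.

Lemma left_span_mulC m x c : (m <= N.+1)%N -> left_span m x -> C c -> left_span m (x * c).
Proof.
elim: m x c => [|m IH] x c mN; first exact: C_mul.
move=> sx Cc; apply: (left_span_ind (P := fun u => left_span m.+1 (u * c))) sx => [u v su sv||h d hm dm].
- by rewrite mulrDl; apply: left_spanD.
- by rewrite mul0r; apply: left_span0.
- have [|c' Cc' e] := cosw_norm _ dm Cc; first by lia.
  by rewrite -mulrA e mulrA; apply: left_span_cosw => //; apply: IH => //; lia.
Qed.

Lemma cosw_far m d i : (m <= N)%N -> (d <= m)%N -> (i.+1 < m - d)%N ->
  cosw R m d * R i = R i * cosw R m d.
Proof.
move=> mN; elim: d => [|d IH] dm im /=; first by rewrite mul1r mulr1.
rewrite -mulrA -R_far; [|lia|lia].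
by rewrite !mulrA IH //; lia.
Qed.

Lemma cosw_shift m d i : (m <= N)%N -> (d <= m)%N -> (m - d < i)%N -> (i < m)%N ->
  cosw R m d * R i = R i.-1 * cosw R m d.
Proof.
move=> mN; elim: d => [|d IH] dm mi im /=; first by lia.
case: (eqVneq i (m - d)%N) => [ei|ne]; last first.
  by rewrite -mulrA R_far ?mulrA ?IH //; lia.
case: d IH dm mi ei => [|d] IH dm mi ei /=; first by lia.
have -> : (m - d.+1)%N = i by lia.
have -> : (m - d.+2)%N = i.-1 by lia.
have iS : i = i.-1.+1 by lia.
have := R_braid (i := i.-1); rewrite -iS => /(_ _) br.
rewrite -!mulrA [R i * (_ * _)]mulrA -br; last by lia.
rewrite !mulrA cosw_far //; lia.
Qed.

Lemma left_span_mulR m i x : (m <= N)%N -> (i < m)%N ->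
  left_span m.+1 x -> left_span m.+1 (x * R i).
Proof.
elim: m i x => // m IH i x mN im.
apply: (left_span_ind (P := fun u => left_span m.+2 (u * R i))) => [u v su sv||h d hm dm].
- by rewrite mulrDl; apply: left_spanD.
- by rewrite mul0r; apply: left_span0.
have [i_lt|i_gt|i_eq] := ltngtP i (m.+1 - d)%N; last first.
- case: d i_eq dm => [|d] i_eq dm; first by lia.
  have [|c0 [c1 [C0 C1 e]]] := R_quad (i := i); first by lia.
  have cS : cosw R m.+1 d.+1 = cosw R m.+1 d * R i by rewrite i_eq.
  have [||c0' C0' e0] := cosw_norm (m := m.+1) (d := d) _ _ C0; [lia|lia|].
  have [||c1' C1' e1] := cosw_norm (m := m.+1) (d := d) _ _ C1; [lia|lia|].
  rewrite cS -!mulrA e mulrDr mulrDr e0 [_ * (c1 * _)]mulrA e1 -mulrA -cS.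
  apply: left_spanD; rewrite mulrA; apply: left_span_cosw => //;
    solve [lia | by apply: left_span_mulC => //; lia].
- rewrite -mulrA cosw_shift // mulrA; apply: left_span_cosw => //.
  by apply: IH => //; lia.
- have [e|ne] := eqVneq i.+1 (m.+1 - d)%N.
    rewrite -mulrA [_ * R i](_ : _ = cosw R m.+1 d.+1); last by rewrite /=; congr (_ * R _); lia.
    by apply: left_span_cosw => //; lia.
  rewrite -mulrA cosw_far //; [|lia].
  rewrite mulrA; apply: left_span_cosw => //; case: m IH mN im h hm dm i_lt ne => [|m] IH *; first by lia.
  by apply: IH => //; lia.
Qed.

Lemma left_span_words m x : left_span m x ->
  exists2 c : seq nat -> B, forall p, C (c p) &
    x = \sum_(p <- idx m) c p * word_of R p.
Proof.
elim: m x => [|m IH] x.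
  by move=> Cx; exists (fun=> x) => //; rewrite big_seq1 word_of_nil mulr1.
move=> [h hs ->].
have /choice[c hc] : forall d, exists c : seq nat -> B, (forall p, C (c p)) /\
    h d = \sum_(p <- idx m) c p * word_of R p.
  by move=> d; have [c] := IH _ (hs d); exists c.
exists (fun q => c (last 0%N q) (take m q)); first by move=> p; apply: (hc _).1.
rewrite [RHS]big_allpairs_dep exchange_big.
apply: eq_bigr => d _; rewrite (hc d).2 mulr_suml big_seq [RHS]big_seq.
apply: eq_bigr => p /idx_size sp.
have -> : take m (rcons p d) = p by rewrite -sp -cats1 take_size_cat.
by rewrite last_rcons word_of_rcons sp mulrA.
Qed.

(** The words span as soon as the ring is generated by [C] and the R_i. *)
Lemma normal_form (gen : forall P : B -> Prop,
    (forall c, C c -> P c) -> (forall i, (i < N)%N -> P (R i)) ->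
    (forall u v, P u -> P v -> P (u + v)) ->
    (forall u v, P u -> P v -> P (u * v)) -> forall u, P u) (C_one : C 1) x :
  exists2 c : seq nat -> B, forall p, C (c p) &
    x = \sum_(p <- idx N.+1) c p * word_of R p.
Proof.
apply: left_span_words.
suff h : forall y, left_span N.+1 y -> left_span N.+1 (y * x).
  rewrite -[x]mul1r; apply: h.
  elim: (N.+1) => //= m IH; rewrite -[1]mulr1 -[X in _ * X]/(cosw R m 0).
  exact: (left_span_cosw IH).
move: x; apply: gen => [c Cc|i iN|u v hu hv|u v hu hv] y sy.
- exact: left_span_mulC.
- exact: left_span_mulR.
- by rewrite mulrDr; apply: left_spanD; [apply: hu|apply: hv].
- by rewrite mulrA; apply/hv/hu.
Qed.

End NormalForm.

(** * Lattice words *)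

(** A letter (j, r) adds a box to row r of the j-th diagram, so that a word
    is a way of building a tuple of diagrams box by box. *)
Notation letter := (nat * nat)%type.

(** The length of row r of the j-th diagram. *)
Definition boxes (s : seq letter) (j r : nat) : nat := count_mem (j, r) s.

Definition shape_ok (s : seq letter) : bool :=
  all (fun x => (x.2 == 0%N) || (boxes s x.1 x.2 <= boxes s x.1 x.2.-1)%N) s.

Definition lattice (w : seq letter) : bool :=
  all (fun k => shape_ok (take k w)) (iota 0 (size w).+1).

Lemma shape_okP s :
  reflect (forall j r, boxes s j r.+1 <= boxes s j r)%N (shape_ok s).
Proof.
apply: (iffP allP) => [h j r|h [j [|r]] _ //=].
have [/h //|/count_memPn e] := boolP ((j, r.+1) \in s).
by rewrite [boxes s j r.+1]e.
Qed.

Lemma shape_ok_le s j r r' : shape_ok s -> (r <= r')%N ->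
  (boxes s j r' <= boxes s j r)%N.
Proof.
move/shape_okP=> h; elim: r' => [|r' IH]; first by rewrite leqn0 => /eqP ->.
by rewrite leq_eqVlt => /orP[/eqP -> //|/IH]; apply: leq_trans.
Qed.

Lemma perm_boxes s t : perm_eq s t -> boxes s = boxes t.
Proof.
move=> /seq.permP e; do 2!apply: functional_extensionality_dep => ?.
exact: e.
Qed.

Lemma boxes_perm s t : boxes s = boxes t -> perm_eq s t.
Proof.
by move=> e; apply/allP => -[j r] _; apply/eqP; rewrite -![count_mem _ _]/(boxes _ j r) e.
Qed.

Lemma perm_shape_ok s t : perm_eq s t -> shape_ok s = shape_ok t.
Proof.
by move=> /perm_boxes e; apply/shape_okP/shape_okP => h j r; [rewrite -!e|rewrite !e].
Qed.

Lemma latticeP w : reflect (forall k, shape_ok (take k w)) (lattice w).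
Proof.
apply: (iffP allP) => [h k|h k _] //.
have [kw|kw] := leqP k (size w); first by apply: h; rewrite mem_iota /= add0n ltnS.
rewrite take_oversize; last exact: ltnW.
by rewrite -[w in shape_ok w]take_size; apply: h; rewrite mem_iota /= add0n.
Qed.

Lemma lattice_shape w : lattice w -> shape_ok w.
Proof. by move=> /latticeP /(_ (size w)); rewrite take_size. Qed.

Lemma lattice_rcons w x : lattice (rcons w x) = lattice w && shape_ok (rcons w x).
Proof.
rewrite /lattice size_rcons -[(size w).+2]addn1 iotaD all_cat; congr (_ && _); last first.
  by rewrite /= andbT add0n take_oversize ?size_rcons.
apply: eq_in_all => k; rewrite mem_iota /= add0n ltnS => kw.
by rewrite -cats1 takel_cat.
Qed.

Lemma lattice_catl u v : lattice (u ++ v) -> lattice u.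
Proof.
move/latticeP => h; apply/latticeP => k.
have [ku|/ltnW ku] := leqP k (size u); first by have := h k; rewrite takel_cat.
by rewrite take_oversize //; have := h (size u); rewrite take_size_cat.
Qed.

Lemma lattice_cat_perm u u' t : lattice u' -> perm_eq u u' ->
  lattice (u ++ t) -> lattice (u' ++ t).
Proof.
move=> /latticeP lu' uu' /latticeP h; apply/latticeP => k.
have [ku|ku] := leqP k (size u); rewrite (perm_size uu') in ku.
  by rewrite takel_cat.
have := h k; rewrite !take_cat (perm_size uu') ltnNge (ltnW ku) /=.
by rewrite (@perm_shape_ok _ (u' ++ take (k - size u') t)) // perm_cat2r.
Qed.

Lemma boxes_cons x s j r :
  boxes (x :: s) j r = (((x.1 == j) && (x.2 == r)) + boxes s j r)%N.
Proof. by case: x. Qed.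

Lemma boxes_rcons s x j r :
  boxes (rcons s x) j r = (((x.1 == j) && (x.2 == r)) + boxes s j r)%N.
Proof. by rewrite -boxes_cons /boxes; apply/seq.permP; rewrite perm_rcons. Qed.

(** The component and the content (column minus row) of the k-th box. *)
Definition weight (w : seq letter) (k : nat) : nat * int :=
  let x := nth (0%N, 0%N) w k in
  (x.1, (boxes (take k w) x.1 x.2)%:Z - x.2%:Z).

Definition adjacent (c d : nat * int) : bool :=
  (c.1 == d.1) && (`|c.2 - d.2| == 1)%N.

Lemma weight_cat u x v :
  weight (u ++ x :: v) (size u) = (x.1, (boxes u x.1 x.2)%:Z - x.2%:Z).
Proof. by rewrite /weight nth_cat ltnn subnn /= take_size_cat. Qed.

Lemma weight_catl u v k : (k < size u)%N -> weight (u ++ v) k = weight u k.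
Proof. by move=> ku; rewrite /weight nth_cat ku takel_cat // ltnW. Qed.

Lemma weight_catr u u' x v : perm_eq u u' ->
  weight (u ++ x :: v) (size u) = weight (u' ++ x :: v) (size u).
Proof.
by move=> e; rewrite weight_cat (perm_size e) weight_cat (perm_boxes e).
Qed.

(** Distinct boxes that can be added to the same diagram have distinct
    contents. *)
Lemma addable_inj s x y : shape_ok s -> shape_ok (rcons s x) -> shape_ok (rcons s y) ->
  x.1 = y.1 -> (boxes s x.1 x.2)%:Z - x.2%:Z = (boxes s y.1 y.2)%:Z - y.2%:Z -> x = y.
Proof.
case: x y => [j r] [j' r'] hs hx hy /= e; subst j' => e.
suff -> : r = r' by [].
have [h|h|//] := ltngtP r r'.
  by have := shape_ok_le j hs (ltnW h); lia.
by have := shape_ok_le j hs (ltnW h); lia.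
Qed.

Lemma split2 (T : Type) (w : seq T) i : (i.+1 < size w)%N ->
  exists u x y v, w = u ++ x :: y :: v /\ size u = i.
Proof.
elim: i w => [|i IH] [|x [|y v]] //= h; first by exists [::], x, y, v.
have [u [x' [y' [v' [-> <-]]]]] := IH (y :: v) h.
by exists (x :: u), x', y', v'.
Qed.

Lemma lattice2 u x y v : lattice (u ++ x :: y :: v) ->
  [/\ shape_ok u, shape_ok (rcons u x) & shape_ok (rcons (rcons u x) y)].
Proof.
move=> l; split; apply: lattice_shape; rewrite -?cats1 -?catA; move: l.
- exact: lattice_catl.
- by rewrite -[x :: _]cat1s catA => /lattice_catl.
- by rewrite -[x :: _]/([:: x; y] ++ v) catA => /lattice_catl.
Qed.

Lemma weight2 u x y v : weight (u ++ x :: y :: v) (size u).+1 =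
  (y.1, (boxes (rcons u x) y.1 y.2)%:Z - y.2%:Z).
Proof.
by rewrite -cat_rcons -(size_rcons u x) weight_cat.
Qed.

Lemma weight_neq1 w i : lattice w -> (i.+1 < size w)%N -> weight w i != weight w i.+1.
Proof.
move=> l /split2[u [x [y [v [ew <-]]]]]; subst w.
have [hu hx hy] := lattice2 l; rewrite weight_cat weight2.
apply/eqP => -[] e1; rewrite boxes_rcons.
case: (eqVneq x y) => [<-|ne] e2; first by move: e2; rewrite !eqxx /=; lia.
case: x y e1 e2 ne hx hy {l} => [j r] [j' r'] /= <- e2 ne hx hy.
have [h|h|h] := ltngtP r r'; last by rewrite h eqxx in ne.
  by have := shape_ok_le j hu (ltnW h); lia.
by have := shape_ok_le j hu (ltnW h); lia.
Qed.

Lemma weight_neq2 w i : lattice w -> (i.+2 < size w)%N -> weight w i != weight w i.+2.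
Proof.
move=> l iw; have [u [x [y [v [ew eu]]]]] := split2 (ltnW iw); subst w i.
case: v l iw => [|z v] l iw; first by move: iw; rewrite size_cat /=; lia.
have [hu hx hy] := lattice2 l.
have [_ _ hz] : [/\ shape_ok (rcons u x), shape_ok (rcons (rcons u x) y)
     & shape_ok (rcons (rcons (rcons u x) y) z)].
  by apply: (@lattice2 _ _ _ v); rewrite cat_rcons.
rewrite weight_cat -cat_rcons -(size_rcons u x) weight2.
apply/eqP => -[] e1; rewrite !boxes_rcons.
case: x y z e1 hx hy hz {l iw} => [j r] [j' r'] [j'' r''] /= <- hx hy hz e2.
have [h|h|h] := ltngtP r r''.
- have := shape_ok_le j hu (ltnW h).
  have /shape_okP/(_ j r) := hz; rewrite !boxes_rcons.
  move: e2; rewrite !eqxx /=.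
  case: (eqVneq r'' r.+1) => [->|ne]; last by move: h; lia.
  by case: (eqVneq r'' r.+1) => [e|ne]; [subst r''|]; move: h; lia.
  have := shape_ok_le j hu (ltnW h).
  by move: e2; rewrite !eqxx /=; lia.
- by subst r''; move: e2; rewrite eqxx; lia.
Qed.

Definition swap_nat (i k : nat) : nat :=
  if k == i then i.+1 else if k == i.+1 then i else k.

Definition swap_word (i : nat) (w : seq letter) : seq letter :=
  mkseq (fun k => nth (0%N, 0%N) w (swap_nat i k)) (size w).

Lemma swap_word_cat u x y v :
  swap_word (size u) (u ++ x :: y :: v) = u ++ y :: x :: v.
Proof.
apply: (@eq_from_nth _ (0%N, 0%N)); first by rewrite size_mkseq !size_cat.
rewrite size_mkseq => k hk; rewrite nth_mkseq // /swap_nat.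
case: eqP => [->|n1]; first by rewrite !nth_cat ltnNge leqnSn subSnn ltnn subnn.
case: eqP => [->|n2]; first by rewrite !nth_cat ltnn subnn ltnNge leqnSn subSnn.
rewrite !nth_cat; case: ltnP => // uk.
by have -> : (k - size u = (k - size u).-2.+2)%N by lia.
Qed.

Lemma size_swap_word i w : size (swap_word i w) = size w.
Proof. exact: size_mkseq. Qed.

Lemma perm_swap_word i w : (i.+1 < size w)%N -> perm_eq (swap_word i w) w.
Proof.
move=> /split2[u [x [y [v [-> <-]]]]]; rewrite swap_word_cat perm_cat2l.
by rewrite (perm_catCA [:: y] [:: x]).
Qed.

Lemma swap_word_lattice i w : lattice w -> (i.+1 < size w)%N ->
  ~~ adjacent (weight w i) (weight w i.+1) -> lattice (swap_word i w).
Proof.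
move=> l /split2[u [x [y [v [ew <-]]]]]; subst w.
rewrite weight_cat weight2 swap_word_cat boxes_rcons => nadj.
have [hu hx hy] := lattice2 l.
have lu : lattice u := lattice_catl l.
have huy : shape_ok (rcons u y).
  apply/shape_okP => j r; have /shape_okP/(_ j r) := hu.
  have /shape_okP/(_ j r) := hx; have /shape_okP/(_ j r) := hy.
  rewrite !boxes_rcons; move: nadj; rewrite /adjacent.
  case: x y {hx hy l} => [j1 r1] [j2 r2] /=.
  case: (eqVneq j2 j) => [->|_] /=; last by move=> _ _ _; lia.
  case: (eqVneq r2 r.+1) => [->|_] /=; last by move=> _ _ _; lia.
  case: (eqVneq j1 j) => [->|_] /=; last by move=> _; lia.
  by case: (eqVneq r1 r) => [->|_] /=; lia.
have luyx : lattice (u ++ [:: y; x]).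
  have p : perm_eq (rcons (rcons u x) y) (rcons (rcons u y) x).
    by rewrite -!cats1 -!catA perm_cat2l (perm_catC [:: x]).
  rewrite -cat_rcons cats1 !lattice_rcons lu huy /=.
  by rewrite -(perm_shape_ok p).
rewrite -[y :: _]/([:: y; x] ++ v) catA.
apply: (@lattice_cat_perm (u ++ [:: x; y])) luyx _ _; last by rewrite -catA; exact: l.
by rewrite perm_cat2l (perm_catC [:: x] [:: y]).
Qed.

Lemma weight_swap i w k : (i.+1 < size w)%N ->
  ~~ adjacent (weight w i) (weight w i.+1) -> (k < size w)%N ->
  weight (swap_word i w) k = weight w (swap_nat i k).
Proof.
move=> /split2[u [x [y [v [ew <-]]]]]; subst w.
rewrite weight_cat weight2 swap_word_cat => nadj kw.
have ne : x <> y.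
  move=> e; subst y; move: nadj; rewrite boxes_rcons /adjacent !eqxx /=.
  by move/eqP; lia.
rewrite /swap_nat; case: eqP => [->|n1].
  rewrite weight_cat weight2 boxes_rcons.
  case: x y ne {nadj kw} => [j r] [j' r'] ne /=; case: andP => // -[/eqP e1 /eqP e2].
  by case: ne; rewrite e1 e2.
case: eqP => [->|n2].
  rewrite weight_cat weight2 boxes_rcons.
  case: x y ne {nadj kw} => [j r] [j' r'] ne /=; case: andP => // -[/eqP e1 /eqP e2].
  by case: ne; rewrite e1 e2.
have [ku|ku] := ltnP k (size u); first by rewrite !weight_catl.
have [v1 [z [v2 [-> ->]]]] : exists v1 z v2, v = v1 ++ z :: v2 /\ k = (size u + (size v1).+2)%N.
  move: kw; rewrite size_cat /= => kw.
  exists (take (k - size u).-2 v), (nth x v (k - size u).-2), (drop (k - size u).-1 v).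
  have -> : ((k - size u).-1 = (k - size u).-2.+1)%N by lia.
  by rewrite -drop_nth ?cat_take_drop ?size_take; [split=> //; case: ifP; lia|lia].
have := @weight_catr (u ++ y :: x :: v1) (u ++ x :: y :: v1) z v2.
rewrite !size_cat /= -!catA /= => -> //.
by rewrite perm_cat2l (perm_catCA [:: y] [:: x]).
Qed.

(** A word can be read off the weights of its boxes. *)
Lemma weight_inj w w' : lattice w -> lattice w' -> size w = size w' ->
  (forall k, (k < size w)%N -> weight w k = weight w' k) -> w = w'.
Proof.
move=> /latticeP l /latticeP l' sw ww.
suff h k : (k <= size w)%N -> take k w = take k w'.
  by have := h (size w) (leqnn _); rewrite take_size sw take_size.
elim: k => [|k IH] kw; first by rewrite !take0.
have e := IH (ltnW kw); rewrite !(take_nth (0%N, 0%N)) -?sw // e; congr rcons.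
have := ww _ kw; rewrite /weight e => -[e1 e2].
apply: addable_inj e1 e2; first exact: l'.
- by rewrite -e -take_nth.
- by rewrite -take_nth -?sw.
Qed.

Lemma boxes_rem z s j r : z \in s ->
  boxes (rem z s) j r = (boxes s j r - ((z.1 == j) && (z.2 == r)))%N.
Proof. by move=> zs; rewrite (perm_boxes (perm_to_rem zs)) boxes_cons addKn. Qed.

Lemma boxes_gt0 s j r : (0 < boxes s j r)%N = ((j, r) \in s).
Proof. by rewrite /boxes -has_count has_pred1. Qed.

Lemma ex_lattice s : shape_ok s -> exists2 w, lattice w & perm_eq w s.
Proof.
elim: {s}(size s) {-2}s (erefl (size s)) => [|m IH] s sm hs.
  by move/size0nil: sm => ->; exists [::].
have ex : exists r, has (fun x => x.2 == r) s.
  by case: s sm {hs} => // x s _; exists x.2; rewrite /= eqxx.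
have bd r : has (fun x : letter => x.2 == r) s -> (r <= \max_(x <- s) x.2)%N.
  by case/hasP => x xs /eqP <-; apply: leq_bigmax_seq.
case: (ex_maxnP ex bd) => r /hasP[[j r'] zs /= /eqP e] rmax; subst r'.
have hz : shape_ok (rem (j, r) s).
  apply/shape_okP => j' r'; have /shape_okP/(_ j' r') := hs.
  rewrite !boxes_rem //=.
  case: (eqVneq j j') => [ej|] /=; last by rewrite !subn0.
  case: (eqVneq r r') => [er|] /=; last by lia.
  subst j' r'; suff -> : boxes s j r.+1 = 0%N by lia.
  apply/eqP; rewrite -leqn0 leqNgt boxes_gt0; apply/negP => h.
  have := rmax r.+1; rewrite ltnn => /(_ _) /negP; apply => //.
  by apply/hasP; exists (j, r.+1).
have [|w lw pw] := IH (rem (j, r) s) _ hz; first by rewrite size_rem // sm.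
have p : perm_eq (rcons w (j, r)) s.
  by rewrite perm_rcons perm_sym (perm_trans (perm_to_rem zs)) // perm_cons perm_sym.
by exists (rcons w (j, r)) => //; rewrite lattice_rcons lw (perm_shape_ok p).
Qed.

(** Two lattice words of the same shape are joined by swaps of neighbours
    through lattice words: if they end in different corners x and y, both can
    be moved to words ending in y x and x y with a common beginning. *)
Section Connectivity.
Variable Z : seq letter -> seq letter -> Prop.
Hypothesis Z_refl : forall w, lattice w -> Z w w.
Hypothesis Z_trans : forall v u w, Z u v -> Z v w -> Z u w.
Hypothesis Z_swap : forall u x y v, x <> y -> lattice (u ++ x :: y :: v) ->
  lattice (u ++ y :: x :: v) -> Z (u ++ x :: y :: v) (u ++ y :: x :: v).

Lemma lattice_connected_cat u u' t : lattice u -> lattice u' -> perm_eq u u' ->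
  lattice (u ++ t) -> Z (u ++ t) (u' ++ t).
Proof.
elim: {u}(size u) {-2}u (erefl (size u)) u' t => [|m IH] u sm u' t lu lu' p lut.
  move/size0nil: sm p lut => ->; rewrite perm_sym => /perm_nilP -> lt; exact: Z_refl.
have sm' : size u' = m.+1 by rewrite -(perm_size p).
case/lastP: u sm p lu lut => // u x; rewrite size_rcons => -[sm].
case/lastP: u' sm' lu' => // u' y; rewrite size_rcons => -[sm'] lu' p lu lut.
move: (lu) (lu'); rewrite !lattice_rcons => /andP[lu0 hx] /andP[lu0' hy].
case: (eqVneq x y) => [exy|ne].
  subst y; move: p; rewrite -!cats1 perm_cat2r => p.
  by rewrite -!catA; apply: IH => //; rewrite cat_rcons in lut.
have yu : y \in u.
  have : y \in rcons u x by rewrite (perm_mem p) mem_rcons mem_head.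
  by rewrite mem_rcons in_cons eq_sym (negbTE ne).
have xu' : x \in u'.
  have : x \in rcons u' y by rewrite -(perm_mem p) mem_rcons mem_head.
  by rewrite mem_rcons in_cons (negbTE ne).
have pb j r := congr1 (fun f => f j r) (perm_boxes p).
have hr : shape_ok (rem y u).
  apply/shape_okP => j r; rewrite !boxes_rem //.
  have /shape_okP/(_ j r) := lattice_shape lu0; have /shape_okP/(_ j r) := lattice_shape lu0'.
  move: (pb j r) (pb j r.+1); rewrite !boxes_rcons.
  have nxy : (x.1 == y.1) && (x.2 == y.2) = false.
    by rewrite -xpair_eqE -!surjective_pairing (negbTE ne).
  case: (boolP ((y.1 == j) && (y.2 == r))) => [/andP[/eqP <- /eqP <-]|_].
    rewrite nxy eqxx /=. have -> : (y.2 == y.2.+1) = false by clear; lia.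
    by move: (_ && _) => bb; clear; case: bb; lia.
  by move: (_ && _) (_ && _) (_ && _) => p1 p2 p3; clear; lia.
have [k lk pk] := ex_lattice hr.
have pu : perm_eq u (rcons k y).
  by rewrite (perm_trans (perm_to_rem yu)) // perm_sym perm_rcons perm_cons.
have pu' : perm_eq u' (rcons k x).
  apply: boxes_perm; apply: functional_extensionality_dep => j.
  apply: functional_extensionality_dep => r.
  have := pb j r; rewrite !boxes_rcons (perm_boxes pk) boxes_rem //.
  have : (0 < boxes u y.1 y.2)%N by rewrite boxes_gt0 -surjective_pairing.
  by case: (boolP ((y.1 == j) && (y.2 == r))) => [/andP[/eqP <- /eqP <-]|_];
    move: (_ && _) => bb; clear; case: bb; lia.
have lky : lattice (rcons k y).
  by rewrite lattice_rcons lk -(perm_shape_ok pu) lattice_shape.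
have lkx : lattice (rcons k x).
  by rewrite lattice_rcons lk -(perm_shape_ok pu') lattice_shape.
have lt' : lattice (rcons u' y ++ t) by apply: lattice_cat_perm lut.
have lkyx : lattice (rcons k y ++ x :: t).
  by apply: (lattice_cat_perm lky pu); rewrite cat_rcons in lut.
have lkxy : lattice (rcons k x ++ y :: t).
  by apply: (lattice_cat_perm lkx pu'); rewrite cat_rcons in lt'.
rewrite !cat_rcons in lut lkyx lkxy lt' *.
apply: (Z_trans (v := k ++ y :: x :: t)).
  by rewrite -[k ++ _]cat_rcons; apply: IH.
apply: (Z_trans (v := k ++ x :: y :: t)); first by apply: Z_swap => // e; rewrite e eqxx in ne.
rewrite -[k ++ _]cat_rcons; apply: IH => //.
- by rewrite -(perm_size pu').
- by rewrite perm_sym.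
- by rewrite cat_rcons.
Qed.

Lemma lattice_connected w w' : lattice w -> lattice w' -> perm_eq w w' -> Z w w'.
Proof.
by move=> l l' p; have := @lattice_connected_cat w w' [::] l l' p; rewrite !cats0; apply.
Qed.

End Connectivity.

(** * Counting pairs of lattice words of the same shape *)

Lemma shape_ok_cons0 j s : shape_ok s -> shape_ok ((j, 0%N) :: s).
Proof.
move=> /shape_okP h; apply/shape_okP => j' r; have := h j' r.
by rewrite !boxes_cons /= andbF; lia.
Qed.

Lemma shape_ok_consS j r s : shape_ok s ->
  shape_ok ((j, r.+1) :: s) = (boxes s j r.+1 < boxes s j r)%N.
Proof.
move=> /shape_okP h; apply/shape_okP/idP => [/(_ j r)|lt j' r'].
  by rewrite !boxes_cons !eqxx /=; lia.
have := h j' r'; rewrite !boxes_cons /=.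
case: (eqVneq j j') => [<-|] //=; case: (eqVneq r.+1 r'.+1) => [[<-]|] //=; last by lia.
have -> : (r.+1 == r) = false by lia.
by lia.
Qed.

Lemma shape_ok_rem j r s : shape_ok s ->
  ((j, r) \in s) && shape_ok (rem (j, r) s) = (boxes s j r.+1 < boxes s j r)%N.
Proof.
move=> /shape_okP h; apply/andP/idP => [[js /shape_okP/(_ j r)]|lt].
  rewrite !boxes_rem // !eqxx /=; have := boxes_gt0 s j r; rewrite js.
  have -> : (r == r.+1) = false by lia.
  by lia.
have js : (j, r) \in s by rewrite -boxes_gt0; lia.
split=> //; apply/shape_okP => j' r'; have := h j' r'; rewrite !boxes_rem //=.
by case: (eqVneq j j') => [<-|] /=; [case: (eqVneq r r') => [<-|] /=|]; lia.
Qed.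

Lemma shape_ok_exchange s x z : shape_ok s -> z \in s -> x != z ->
  shape_ok (x :: rem z s) -> shape_ok (x :: s) /\ shape_ok (rem z s).
Proof.
move=> /shape_okP h zs xz /shape_okP h'.
have nxz : (x.1 == z.1) && (x.2 == z.2) = false.
  by rewrite -xpair_eqE -!surjective_pairing (negbTE xz).
have zs' : (0 < boxes s z.1 z.2)%N by rewrite boxes_gt0 -surjective_pairing.
split; apply/shape_okP => j r; move: (h j r) (h' j r);
  rewrite !boxes_cons !boxes_rem //.
- case: (boolP ((z.1 == j) && (z.2 == r.+1))) => [/andP[/eqP ej /eqP er]|_]; last by lia.
  by move: nxz; rewrite ej er => ->; lia.
- case: (boolP ((z.1 == j) && (z.2 == r))) => [/andP[/eqP ej /eqP er]|_]; last by lia.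
  by move: nxz; rewrite ej er => ->; lia.
Qed.

Lemma shape_ok_row s j r : shape_ok s -> (j, r) \in s -> (r < size s)%N.
Proof.
move=> hs jrs; rewrite -[r.+1](size_iota 0) -(size_map (fun k => (j, k))).
apply: uniq_leq_size; first by rewrite map_inj_uniq ?iota_uniq // => k k' [].
move=> _ /mapP[k + ->]; rewrite mem_iota add0n ltnS /= => kr.
by rewrite -boxes_gt0; apply: leq_trans (shape_ok_le j hs kr); rewrite boxes_gt0.
Qed.

Section Counting.
Variables (b N : nat).

Definition letters : seq letter := [seq (j, r) | j <- iota 0 b, r <- iota 0 N].

Lemma mem_letters x : (x \in letters) = (x.1 < b)%N && (x.2 < N)%N.
Proof.
case: x => j r; apply/allpairsP/andP => [[[j' r'] [+ + [-> ->]]]|[/= jb rN]].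
  by rewrite !mem_iota.
by exists (j, r); rewrite !mem_iota.
Qed.

Lemma letters_uniq : uniq letters.
Proof. by apply: allpairs_uniq; rewrite ?iota_uniq // => -[? ?] [? ?] _ _ [-> ->]. Qed.

Fixpoint lattice_words (m : nat) : seq (seq letter) :=
  if m is m'.+1 then
    [seq w <- [seq rcons w x | w <- lattice_words m', x <- letters] | shape_ok w]
  else [:: [::]].

Lemma mem_lattice_words m w : (w \in lattice_words m) =
  [&& lattice w, size w == m & all (fun x => x \in letters) w].
Proof.
elim: m w => [|m IH] w.
  by rewrite inE; case: w => [|x w] //=; rewrite andbF.
rewrite [lattice_words _]/= mem_filter; case/lastP: w => [|w x].
  rewrite andbF; apply/negP => /andP[_ /allpairsP[[w x] [_ _]]].
  by move/(congr1 size); rewrite size_rcons.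
rewrite lattice_rcons size_rcons eqSS all_rcons.
have -> : (rcons w x \in [seq rcons w x | w <- lattice_words m, x <- letters]) =
    (w \in lattice_words m) && (x \in letters).
  apply/allpairsP/andP => [[[w' x'] [+ + /rcons_inj[-> ->]]] //|[]].
  by exists (w, x).
rewrite IH; case: (lattice w) (shape_ok _) (size w == m) (x \in _) (all _ w) => [] [] [] [] [] //.
Qed.

Lemma lattice_words_uniq m : uniq (lattice_words m).
Proof.
elim: m => // m IH; apply: filter_uniq; apply: allpairs_uniq => //.
  exact: letters_uniq.
by move=> [? ?] [? ?] _ _ /rcons_inj[-> ->].
Qed.

Definition nwords m s := count (perm_eq s) (lattice_words m).

Lemma nwords_perm m s t : perm_eq s t -> nwords m s = nwords m t.
Proof. by move=> /permPl e; apply: eq_count => w; rewrite e. Qed.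

Lemma nwords_ok m s : (0 < nwords m s)%N -> shape_ok s.
Proof.
rewrite -has_count => /hasP[w]; rewrite mem_lattice_words => /and3P[/lattice_shape h _ _] p.
by rewrite (perm_shape_ok p).
Qed.

Lemma nwordsS m s : nwords m.+1 s =
  (shape_ok s * \sum_(x <- letters) (x \in s) * nwords m (rem x s))%N.
Proof.
rewrite /nwords -sum1_count [lattice_words m.+1]/= big_filter_cond big_mkcond.
rewrite big_allpairs_dep exchange_big big_distrr /=; apply: eq_bigr => x _.
rewrite -sum1_count [in RHS]big_mkcond !big_distrr /=; apply: eq_bigr => w _.
have -> : perm_eq s (rcons w x) = (x \in s) && perm_eq (rem x s) w.
  case xs : (x \in s) => /=.
    by rewrite (permPl (perm_to_rem xs)) perm_sym perm_rcons perm_cons perm_sym.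
  by apply/negP => /perm_mem/(_ x); rewrite xs mem_rcons mem_head.
case xs : (x \in s); last by rewrite andbF mul0n muln0.
rewrite mul1n /=; case p : (perm_eq _ w); last by rewrite andbF muln0.
rewrite andbT muln1 (@perm_shape_ok s (rcons w x)); first by case: shape_ok.
by rewrite (permPl (perm_to_rem xs)) perm_sym perm_rcons perm_cons perm_sym.
Qed.

(** A diagram has one more addable than removable box: the row below a
    removable box is addable, and so is the first row. *)
Lemma count_addable s : shape_ok s -> (size s < N)%N ->
  (\sum_(x <- letters) shape_ok (x :: s) =
   b + \sum_(x <- letters) ((x \in s) && shape_ok (rem x s)))%N.
Proof.
move=> hs sN; rewrite /letters !big_allpairs_dep.
transitivity (\sum_(j <- iota 0 b) (1 + \sum_(r <- iota 0 N)
    (((j, r) \in s) && shape_ok (rem (j, r) s))))%N; last first.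
  by rewrite big_split sum1_size size_iota.
apply: eq_bigr => j _; case: N sN => // N' sN.
rewrite -[iota 0 N'.+1]/(index_iota 0 N'.+1) big_nat_recl // big_nat_recr //=.
rewrite shape_ok_cons0 //.
have -> : ((j, N') \in s) = false.
  by apply/negP => /(shape_ok_row hs); lia.
rewrite addn0; congr addn; apply: eq_bigr => r _.
by rewrite shape_ok_consS // shape_ok_rem.
Qed.


Lemma rem_cons_neq (x z : letter) s : z != x -> rem z (x :: s) = x :: rem z s.
Proof. by rewrite /= eq_sym; case: eqP. Qed.

(** The commutation relation of adding and removing boxes: a box can be moved
    from z to x in s exactly when x can be added first, exactly when z can be
    removed first. *)
Lemma sum_nwords_cons m s : size s = m -> (m < N)%N -> shape_ok s ->
  all (fun x => x \in letters) s ->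
  (\sum_(x <- letters) nwords m.+1 (x :: s) = b * m.+1 * nwords m s)%N.
Proof.
elim: m s => [|m IH] s sm mN hs sl.
  move/size0nil: sm hs => -> _.
  transitivity (\sum_(x <- letters) shape_ok (x :: [::]))%N.
    rewrite big_seq [RHS]big_seq; apply: eq_bigr => x xl; rewrite nwordsS.
    rewrite (bigD1_seq x) ?letters_uniq //= mem_head eqxx /= big1 => [|y ne].
      by rewrite addn0 mul1n; case: shape_ok.
    by rewrite in_cons (negbTE ne).
  by rewrite count_addable // big1 // addn0 !muln1.
pose D z := (z \in s) && shape_ok (rem z s).
transitivity (\sum_(x <- letters) (shape_ok (x :: s) * nwords m.+1 s +
   \sum_(z <- letters | z != x) D z * nwords m.+1 (x :: rem z s)))%N.
  rewrite big_seq [RHS]big_seq; apply: eq_bigr => x xl; rewrite nwordsS.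
  rewrite (bigD1_seq x) ?letters_uniq //= mem_head eqxx mul1n mulnDr; congr addn.
  rewrite big_distrr /=; apply: eq_bigr => z zx; rewrite eq_sym (negbTE zx).
  rewrite in_cons (negbTE zx) /= /D.
  case zs : (z \in s); last by rewrite muln0.
  case: (posnP (nwords m.+1 (x :: rem z s))) => [->|/nwords_ok h]; first by rewrite !muln0.
  have xz : x != z by rewrite eq_sym.
  have [-> ->] := shape_ok_exchange hs zs xz h.
  by rewrite !mul1n.
rewrite big_split -big_distrl /= count_addable ?sm //.
rewrite (exchange_big_dep xpredT) //= mulnDl -addnA.
transitivity (b * nwords m.+1 s + b * m.+1 * \sum_(z <- letters) (z \in s) * nwords m (rem z s))%N.
  congr addn; rewrite big_distrl -big_split big_distrr /=.
  rewrite big_seq [RHS]big_seq; apply: eq_bigr => z zl.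
  rewrite -/(D z); have [hD|nD] := boolP (D z); last first.
    rewrite mul0n big1 // add0n; case: (posnP (nwords m (rem z s))) => [->|/nwords_ok h].
      by rewrite !muln0.
    by move: nD; rewrite /D h andbT => /negbTE ->; rewrite muln0.
  have /andP[zs hz] := hD.
  rewrite zs !mul1n -IH //; last first.
  - by apply/allP => x /mem_rem /(allP sl).
  - exact: ltnW.
  - by rewrite size_rem // sm.
  rewrite [RHS](bigD1_seq z) ?letters_uniq //=; congr addn.
    exact/nwords_perm/perm_to_rem.
  by apply: eq_big => [x|x _]; rewrite 1?eq_sym ?mul1n.
have := nwordsS m s; rewrite hs mul1n => <-; ring.
Qed.

Theorem sum_nwords n : (n <= N)%N ->
  (\sum_(w <- lattice_words n) nwords n w = b ^ n * n`!)%N.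
Proof.
elim: n => [|n IH] nN; first by rewrite big_seq1.
rewrite [lattice_words n.+1]/= big_filter big_mkcond big_allpairs_dep /=.
transitivity (\sum_(w <- lattice_words n) \sum_(x <- letters) nwords n.+1 (x :: w))%N.
  apply: eq_bigr => w _; apply: eq_bigr => x _.
  have p : perm_eq (rcons w x) (x :: w) by rewrite perm_rcons.
  rewrite (perm_shape_ok p) (nwords_perm _ p).
  case: ifP => // h; apply/esym/eqP; rewrite -leqn0 leqNgt; apply/negP => /nwords_ok.
  by rewrite h.
transitivity (\sum_(w <- lattice_words n) b * n.+1 * nwords n w)%N.
  rewrite big_seq [RHS]big_seq; apply: eq_bigr => w.
  rewrite mem_lattice_words => /and3P[/lattice_shape hw /eqP sw wl].
  exact: sum_nwords_cons.
by rewrite -big_distrr /= (IH (ltnW nN)) expnS factS mulnACA.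
Qed.

End Counting.

(** * Seminormal representations *)

(** Functions on a finite set of weight vectors on which the l-th generator
    mixes a vector with the one whose entries l and l + 1 are exchanged. *)
Section WeightModule.
Variables (S : comNzRingType) (I : finType) (N : nat) (X : Type).
Variables (wt : I -> nat -> X) (sw : nat -> I -> I) (A B : X -> X -> S).
Hypothesis wt_inj : forall i i', (forall k, (k < N)%N -> wt i k = wt i' k) -> i = i'.
Hypothesis wt_sw : forall l i, (l.+1 < N)%N -> B (wt i l) (wt i l.+1) != 0 ->
  forall k, (k < N)%N -> wt (sw l i) k = wt i (swap_nat l k).

Local Notation V := {ffun I -> S^o}.

Definition diag_op (d : I -> S) : endo V.
Proof.
exists (fun f : V => [ffun i => (d i * f i : S^o)] : V) => c u v; apply/ffunP => i.
rewrite !ffunE /GRing.scale /=; ring.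
Defined.

Definition mix_op (l : nat) : endo V.
Proof.
exists (fun f : V => [ffun i => (A (wt i l) (wt i l.+1) * f i
  + B (wt i l) (wt i l.+1) * f (sw l i) : S^o)] : V) => c u v.
apply/ffunP => i; rewrite !ffunE /GRing.scale /=; ring.
Defined.

Lemma diag_opE d f i : diag_op d f i = d i * f i.
Proof. by rewrite ffunE. Qed.

Lemma mix_opE l f i : mix_op l f i = A (wt i l) (wt i l.+1) * f i
   + B (wt i l) (wt i l.+1) * f (sw l i).
Proof. by rewrite ffunE. Qed.

Let cancel_nz (c x y : S) : (c != 0 -> x = y) -> c * x = c * y.
Proof. by case: (eqVneq c 0) => [->|ne ->] //; rewrite !mul0r. Qed.

Lemma swap_natK l : involutive (swap_nat l).
Proof.
move=> k; rewrite /swap_nat; case: (eqVneq k l) => [->|n1].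
  by rewrite eqxx; case: eqP => //; lia.
case: (eqVneq k l.+1) => [->|n2]; first by rewrite eqxx.
by rewrite (negbTE n1) (negbTE n2).
Qed.

Lemma swap_nat_lt l k n : (l.+1 < n)%N -> (k < n)%N -> (swap_nat l k < n)%N.
Proof. by rewrite /swap_nat; case: eqP => // _; case: eqP => //; lia. Qed.

Lemma sw_twice l i : (l.+1 < N)%N -> B (wt i l) (wt i l.+1) != 0 ->
  B (wt i l.+1) (wt i l) != 0 -> sw l (sw l i) = i.
Proof.
move=> lN n1 n2; apply: wt_inj => k kN.
have w1 : wt (sw l i) l = wt i l.+1.
  by rewrite wt_sw //; [rewrite /swap_nat eqxx|lia].
have w2 : wt (sw l i) l.+1 = wt i l.
  by rewrite wt_sw // /swap_nat eqxx; case: eqP => //; lia.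
rewrite wt_sw ?w1 ?w2 // wt_sw ?swap_natK //; exact: swap_nat_lt.
Qed.

Lemma mix_op_sq (u v : X -> X -> S) l f i : (l.+1 < N)%N ->
  let c := wt i l in let d := wt i l.+1 in
  A c d ^+ 2 + B c d * B d c = u c d + v c d * A c d ->
  B c d * (A c d + A d c) = B c d * v c d ->
  mix_op l (mix_op l f) i = u c d * f i + v c d * mix_op l f i.
Proof.
move=> lN c d e1 e2; rewrite !mix_opE -/c -/d.
have E : B c d * (A (wt (sw l i) l) (wt (sw l i) l.+1) * f (sw l i)
     + B (wt (sw l i) l) (wt (sw l i) l.+1) * f (sw l (sw l i))) =
    B c d * (A d c * f (sw l i) + B d c * f i).
  apply: cancel_nz => nz.
  have -> : wt (sw l i) l = d by rewrite wt_sw //; [rewrite /swap_nat eqxx|lia].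
  have -> : wt (sw l i) l.+1 = c.
    by rewrite wt_sw // /swap_nat eqxx; case: eqP => //; lia.
  by congr (_ + _); apply: cancel_nz => nz'; rewrite sw_twice.
rewrite E; set F := f i; set F' := f _.
transitivity ((A c d ^+ 2 + B c d * B d c) * F + B c d * (A c d + A d c) * F').
  ring.
rewrite e1 e2; ring.
Qed.

Lemma mix_op_far l l' f i : (l.+1 < l')%N -> (l'.+1 < N)%N ->
  mix_op l (mix_op l' f) i = mix_op l' (mix_op l f) i.
Proof.
move=> ll' lN; rewrite !mix_opE.
set c := wt i l; set d := wt i l.+1; set c' := wt i l'; set d' := wt i l'.+1.
have E : B c d * (A (wt (sw l i) l') (wt (sw l i) l'.+1) * f (sw l i)
     + B (wt (sw l i) l') (wt (sw l i) l'.+1) * f (sw l' (sw l i))) =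
    B c d * (A c' d' * f (sw l i) + B c' d' * f (sw l' (sw l i))).
  apply: cancel_nz => nz.
  have -> : wt (sw l i) l' = c'.
    by rewrite wt_sw //; [rewrite /swap_nat; do 2!(case: eqP; first by lia)|lia|lia].
  have -> // : wt (sw l i) l'.+1 = d'.
  by rewrite wt_sw //; [rewrite /swap_nat; do 2!(case: eqP; first by lia)|lia].
have E' : B c' d' * (A (wt (sw l' i) l) (wt (sw l' i) l.+1) * f (sw l' i)
     + B (wt (sw l' i) l) (wt (sw l' i) l.+1) * f (sw l (sw l' i))) =
    B c' d' * (A c d * f (sw l' i) + B c d * f (sw l (sw l' i))).
  apply: cancel_nz => nz.
  have -> : wt (sw l' i) l = c.
    by rewrite wt_sw //; [rewrite /swap_nat; do 2!(case: eqP; first by lia)|lia].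
  have -> // : wt (sw l' i) l.+1 = d.
  by rewrite wt_sw //; [rewrite /swap_nat; do 2!(case: eqP; first by lia)|lia].
rewrite E E'.
have E2 : B c d * (B c' d' * f (sw l' (sw l i))) = B c d * (B c' d' * f (sw l (sw l' i))).
  apply: cancel_nz => nz; apply: cancel_nz => nz'; congr (f _).
  apply: wt_inj => k kN.
  have w1 : wt (sw l i) l' = c'.
    by rewrite wt_sw //; [rewrite /swap_nat; do 2!(case: eqP; first by lia)|lia|lia].
  have w2 : wt (sw l i) l'.+1 = d'.
    by rewrite wt_sw //; [rewrite /swap_nat; do 2!(case: eqP; first by lia)|lia].
  have w3 : wt (sw l' i) l = c.
    by rewrite wt_sw //; [rewrite /swap_nat; do 2!(case: eqP; first by lia)|lia].
  have w4 : wt (sw l' i) l.+1 = d.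
    by rewrite wt_sw //; [rewrite /swap_nat; do 2!(case: eqP; first by lia)|lia].
  have lN' : (l.+1 < N)%N by lia.
  rewrite wt_sw ?w1 ?w2 // wt_sw //; last exact: swap_nat_lt.
  rewrite [RHS]wt_sw ?w3 ?w4 // wt_sw //; last exact: swap_nat_lt.
  congr (wt i _); rewrite /swap_nat.
  by clear -ll'; do !case: eqP => //=; lia.
transitivity (A c d * (A c' d' * f i + B c' d' * f (sw l' i)) +
   B c d * (A c' d' * f (sw l i)) + B c d * (B c' d' * f (sw l' (sw l i)))); first by ring.
rewrite E2; ring.
Qed.

Lemma mix_op_braid l f i : (l.+2 < N)%N ->
  let c := wt i l in let d := wt i l.+1 in let e := wt i l.+2 in
  A c d ^+ 2 * A d e + B c d * B d c * A c e =
    A d e ^+ 2 * A c d + B d e * B e d * A c e ->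
  B c d * (A c d * A d e + A d c * A c e - A d e * A c e) = 0 ->
  B d e * (A c d * A c e - A d e * A c d - A c e * A e d) = 0 ->
  mix_op l (mix_op l.+1 (mix_op l f)) i = mix_op l.+1 (mix_op l (mix_op l.+1 f)) i.
Proof.
move=> lN c d e id1 id2 id3.
have lN1 : (l.+1 < N)%N by lia.
have s0 : swap_nat l l = l.+1 by rewrite /swap_nat eqxx.
have s1 : swap_nat l l.+1 = l by rewrite /swap_nat eqxx; case: eqP => //; lia.
have s2 : swap_nat l l.+2 = l.+2 by rewrite /swap_nat; do 2!(case: eqP; first by lia).
have t0 : swap_nat l.+1 l = l by rewrite /swap_nat; do 2!(case: eqP; first by lia).
have t1 : swap_nat l.+1 l.+1 = l.+2 by rewrite /swap_nat eqxx.
have t2 : swap_nat l.+1 l.+2 = l.+1 by rewrite /swap_nat eqxx; case: eqP => //; lia.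
have W1 j : B (wt j l) (wt j l.+1) != 0 ->
    [/\ wt (sw l j) l = wt j l.+1, wt (sw l j) l.+1 = wt j l & wt (sw l j) l.+2 = wt j l.+2].
  by move=> nz; rewrite !wt_sw ?s0 ?s1 ?s2 //; lia.
have W2 j : B (wt j l.+1) (wt j l.+2) != 0 ->
    [/\ wt (sw l.+1 j) l = wt j l, wt (sw l.+1 j) l.+1 = wt j l.+2
      & wt (sw l.+1 j) l.+2 = wt j l.+1].
  by move=> nz; rewrite !wt_sw ?t0 ?t1 ?t2 //; lia.
have E1 : B c d * mix_op l.+1 (mix_op l f) (sw l i) =
   B c d * (A c e * (A d c * f (sw l i) + B d c * f i) +
            B c e * (A d e * f (sw l.+1 (sw l i)) + B d e * f (sw l (sw l.+1 (sw l i))))).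
  apply: cancel_nz => nz; have [w0 w1 w2] := W1 _ nz.
  rewrite !mix_opE w0 w1 w2 -/c -/d -/e; congr (_ * _ + _).
    by congr (_ + _); apply: cancel_nz => nz'; rewrite sw_twice.
  apply: cancel_nz => nz'; have [|v0 v1 v2] := W2 (sw l i); first by rewrite w1 w2.
  by rewrite v0 v1 w0 w2.
have E2 : B d e * mix_op l (mix_op l.+1 f) (sw l.+1 i) =
   B d e * (A c e * (A e d * f (sw l.+1 i) + B e d * f i) +
            B c e * (A c d * f (sw l (sw l.+1 i)) + B c d * f (sw l.+1 (sw l (sw l.+1 i))))).
  apply: cancel_nz => nz; have [w0 w1 w2] := W2 _ nz.
  rewrite !mix_opE w0 w1 w2 -/c -/d -/e; congr (_ * _ + _).
    by congr (_ + _); apply: cancel_nz => nz'; rewrite sw_twice.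
  apply: cancel_nz => nz'; have [|v0 v1 v2] := W1 (sw l.+1 i); first by rewrite w0 w1.
  by rewrite v1 v2 w0 w2.
have F1 : B d e * mix_op l f (sw l.+1 i) =
    B d e * (A c e * f (sw l.+1 i) + B c e * f (sw l (sw l.+1 i))).
  by apply: cancel_nz => nz; have [w0 w1 w2] := W2 _ nz; rewrite mix_opE w0 w1.
have F2 : B c d * mix_op l.+1 f (sw l i) =
    B c d * (A c e * f (sw l i) + B c e * f (sw l.+1 (sw l i))).
  by apply: cancel_nz => nz; have [w0 w1 w2] := W1 _ nz; rewrite mix_opE w1 w2.
have T : B c d * (B c e * (B d e * f (sw l (sw l.+1 (sw l i))))) =
         B c d * (B c e * (B d e * f (sw l.+1 (sw l (sw l.+1 i))))).
  apply: cancel_nz => n1; apply: cancel_nz => n2; apply: cancel_nz => n3.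
  congr (f _); apply: wt_inj => k kN.
  have [a0 a1 a2] := W1 _ n1; have [b0 b1 b2] := W2 _ n3.
  have [|c0 c1 c2] := W2 (sw l i); first by rewrite a1 a2.
  have [|d0 d1 d2] := W1 (sw l.+1 i); first by rewrite b0 b1.
  have k1 := swap_nat_lt lN1 kN; have k2 := swap_nat_lt lN kN.
  rewrite wt_sw // ?c0 ?c1 ?a0 ?a2 // wt_sw // ?a1 ?a2 // wt_sw //; last exact: swap_nat_lt.
  rewrite [RHS]wt_sw // ?d1 ?d2 ?b0 ?b2 // wt_sw // ?b0 ?b1 // wt_sw //; last exact: swap_nat_lt.
  congr (wt i _); rewrite /swap_nat; clear.
  by do !case: eqP => //=; lia.
rewrite [LHS]mix_opE [mix_op l.+1 _ i]mix_opE [mix_op l f i]mix_opE -/c -/d -/e F1 E1.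
rewrite [RHS]mix_opE [mix_op l _ i]mix_opE [mix_op l.+1 f i]mix_opE -/c -/d -/e F2 E2.
set f0 := f i; set f1 := f (sw l i); set f2 := f (sw l.+1 i).
set f12 := f (sw l (sw l.+1 i)); set f21 := f (sw l.+1 (sw l i)).
move: T; set f121 := f (sw l (sw _ _)); set f212 := f _ => T.
apply/eqP; rewrite -subr_eq0; apply/eqP.
transitivity ((A c d ^+ 2 * A d e + B c d * B d c * A c e
    - (A d e ^+ 2 * A c d + B d e * B e d * A c e)) * f0
  + B c d * (A c d * A d e + A d c * A c e - A d e * A c e) * f1
  + B d e * (A c d * A c e - A d e * A c d - A c e * A e d) * f2
  + (B c d * (B c e * (B d e * f121)) - B c d * (B c e * (B d e * f212)))).
  ring.
rewrite id1 id2 id3 T; ring.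
Qed.

Lemma diag_mix_op (t : X -> S) l j f i : (l.+1 < N)%N -> (j < N)%N ->
  let c := wt i l in let d := wt i l.+1 in
  A c d * t c = A c d * t d ->
  diag_op (fun i => t (wt i j)) (mix_op l f) i =
  mix_op l (diag_op (fun i => t (wt i (swap_nat l j))) f) i.
Proof.
move=> lN jN c d e; rewrite mix_opE !diag_opE mix_opE -/c -/d.
have -> : B c d * (t (wt (sw l i) (swap_nat l j)) * f (sw l i)) =
    B c d * (t (wt i j) * f (sw l i)).
  by apply: cancel_nz => nz; rewrite wt_sw // ?swap_natK // swap_nat_lt.
have e' : A c d * t (wt i (swap_nat l j)) = A c d * t (wt i j).
  rewrite /swap_nat; case: eqP => [->|_]; first by rewrite -/c -/d e.
  by case: eqP => [->|] //; rewrite -/c -/d e.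
rewrite mulrA e'; ring.
Qed.

End WeightModule.

(** Coefficients of the seminormal form. Between different components the
    generators exchange entries up to a factor; inside component j they act by
    Hoefsmit's formulas, multiplied by eps^(j+1), with [a] and [b] the
    coefficients as functions of the axial distance. *)
Section SeminormalCoefficients.
Variables (S : comNzRingType) (a b : int -> S) (eps q v : S) (G : int -> Prop).

Definition Acoef (c d : nat * int) : S :=
  if c.1 == d.1 then eps ^+ c.1.+1 * a (c.2 - d.2) else 0.

Definition Bcoef (c d : nat * int) : S :=
  if c.1 == d.1 then
    if adjacent c d then 0 else eps ^+ c.1.+1 * b (d.2 - c.2)
  else if (c.1 < d.1)%N then 1 else q.

Record hoefsmit_coefficients : Prop := {
  hc_eps : eps * eps = 1;
  hc_a : forall k, G k -> a k + a (- k) = v;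
  hc_b : forall k, G k -> b k * b (- k) = q + v * a k - a k ^+ 2;
  hc_b1 : b 1 = 0;
  hc_1 : forall k l, G k -> G l -> G (k + l) ->
    a k ^+ 2 * a l + (q + v * a k - a k ^+ 2) * a (k + l) =
    a l ^+ 2 * a k + (q + v * a l - a l ^+ 2) * a (k + l);
  hc_2 : forall k l, G k -> G l -> G (k + l) ->
    a k * a l + a (- k) * a (k + l) = a l * a (k + l);
  hc_3 : forall k l, G k -> G l -> G (k + l) ->
    a k * a (k + l) = a l * a k + a (k + l) * a (- l) }.

Hypothesis hc : hoefsmit_coefficients.

Definition same_good (c d : nat * int) := c.1 = d.1 -> G (c.2 - d.2).

Let eps2 m : eps ^+ m * eps ^+ m = 1.
Proof. by rewrite -exprMn (hc_eps hc) expr1n. Qed.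

Let opp_sub (k l : int) : k - l = - (l - k). Proof. by rewrite opprB. Qed.

Lemma adjacent_sym c d : adjacent c d = adjacent d c.
Proof. by rewrite /adjacent eq_sym distnC. Qed.

Lemma Bcoef_mul c d : same_good c d ->
  Bcoef c d * Bcoef d c = q + (if c.1 == d.1 then v * a (c.2 - d.2) - a (c.2 - d.2) ^+ 2 else 0).
Proof.
move=> g; rewrite /Bcoef [d.1 == c.1]eq_sym [adjacent d c]adjacent_sym.
case: (eqVneq c.1 d.1) => [e|ne]; last first.
  by case: ltngtP ne => //; rewrite ?mulr1 ?mul1r addr0.
have gk := g e; rewrite addrA -(hc_b hc gk) -e.
case: ifP => [/andP[_ /eqP k1]|_].
  have : (c.2 - d.2 = 1) \/ (c.2 - d.2 = -1) by lia.
  by case=> ->; rewrite ?opprK (hc_b1 hc) ?mul0r ?mulr0.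
rewrite opprB; transitivity (eps ^+ c.1.+1 * eps ^+ c.1.+1 * (b (c.2 - d.2) * b (d.2 - c.2))).
  ring.
by rewrite eps2 mul1r.
Qed.

Lemma AB_square c d : same_good c d ->
  Acoef c d ^+ 2 + Bcoef c d * Bcoef d c =
  q + (if c.1 == d.1 then v * eps ^+ c.1.+1 else 0) * Acoef c d.
Proof.
move=> g; rewrite Bcoef_mul // /Acoef; case: ifP => _; last by rewrite !(expr2, mul0r, mulr0) add0r.
rewrite exprMn expr2 eps2.
transitivity (q + v * (eps ^+ c.1.+1 * eps ^+ c.1.+1) * a (c.2 - d.2)); last by ring.
rewrite eps2; ring.
Qed.

Lemma AB_offdiag c d : same_good c d ->
  Bcoef c d * (Acoef c d + Acoef d c) =
  Bcoef c d * (if c.1 == d.1 then v * eps ^+ c.1.+1 else 0).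
Proof.
move=> g; rewrite /Acoef [d.1 == c.1]eq_sym; case: eqP => [e|_]; last by rewrite addr0.
by rewrite -e -mulrDr [d.2 - _]opp_sub (hc_a hc (g e)) [v * _]mulrC.
Qed.

Section Braid.
Variables c d e : nat * int.
Hypotheses (gcd : same_good c d) (gde : same_good d e) (gce : same_good c e).

Let sum_kl : c.2 - e.2 = (c.2 - d.2) + (d.2 - e.2).
Proof. by rewrite addrA subrK. Qed.

Lemma AB_braid1 : Acoef c d ^+ 2 * Acoef d e + Bcoef c d * Bcoef d c * Acoef c e =
    Acoef d e ^+ 2 * Acoef c d + Bcoef d e * Bcoef e d * Acoef c e.
Proof.
rewrite !Bcoef_mul // /Acoef; have [cd|ncd] := eqVneq c.1 d.1.
  rewrite -cd; have [ce|nce] := eqVneq c.1 e.1; last by rewrite !(mulr0, expr2, mul0r).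
  have := hc_1 hc (gcd cd) (gde (etrans (esym cd) ce)); rewrite -sum_kl => /(_ (gce ce)).
  set k := a _; set l := a _; set m := a _; set z := _ ^+ c.1.+1 => h.
  transitivity (z * z * z * (k ^+ 2 * l) + z * ((q + v * k - k ^+ 2) * m)); first by ring.
  transitivity (z * z * z * (l ^+ 2 * k) + z * ((q + v * l - l ^+ 2) * m)); last by ring.
  by rewrite eps2 mul1r -!mulrDr h.
have [ce|nce] := eqVneq c.1 e.1.
  by rewrite -ce [d.1 == _]eq_sym (negbTE ncd) !(mulr0, expr2, mul0r).
by rewrite !(mulr0, expr2, mul0r).
Qed.

Lemma AB_braid2 : Bcoef c d *
  (Acoef c d * Acoef d e + Acoef d c * Acoef c e - Acoef d e * Acoef c e) = 0.
Proof.
suff -> : Acoef c d * Acoef d e + Acoef d c * Acoef c e - Acoef d e * Acoef c e = 0.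
  by rewrite mulr0.
rewrite /Acoef [d.1 == c.1]eq_sym; have [cd|ncd] := eqVneq c.1 d.1.
  rewrite -cd; have [ce|nce] := eqVneq c.1 e.1; last by rewrite !mulr0 !addr0 subr0.
  have := hc_2 hc (gcd cd) (gde (etrans (esym cd) ce)); rewrite -sum_kl => /(_ (gce ce)).
  rewrite [d.2 - c.2]opp_sub.
  set k := a _; set l := a _; set m := a (c.2 - e.2); set k' := a _; set z := _ ^+ c.1.+1 => h.
  transitivity (z * z * (k * l + k' * m - l * m)); first by ring.
  by rewrite h subrr mulr0.
have [ce|nce] := eqVneq c.1 e.1; last by rewrite !(mul0r, mulr0) addr0 subr0.
by rewrite -ce [d.1 == _]eq_sym (negbTE ncd) !(mulr0, mul0r) addr0 subr0.
Qed.

Lemma AB_braid3 : Bcoef d e *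
  (Acoef c d * Acoef c e - Acoef d e * Acoef c d - Acoef c e * Acoef e d) = 0.
Proof.
suff -> : Acoef c d * Acoef c e - Acoef d e * Acoef c d - Acoef c e * Acoef e d = 0.
  by rewrite mulr0.
rewrite /Acoef [e.1 == d.1]eq_sym; have [cd|ncd] := eqVneq c.1 d.1.
  rewrite -cd; have [ce|nce] := eqVneq c.1 e.1; last by rewrite !(mul0r, mulr0) !subr0.
  have := hc_3 hc (gcd cd) (gde (etrans (esym cd) ce)); rewrite -sum_kl => /(_ (gce ce)).
  rewrite -ce [e.2 - d.2]opp_sub.
  set k := a _; set m := a (c.2 - e.2); set l := a _; set l' := a _; set z := _ ^+ c.1.+1 => h.
  transitivity (z * z * (k * m - l * k - m * l')); first by ring.
  rewrite h; ring.
have [ce|nce] := eqVneq c.1 e.1; last by rewrite !(mul0r, mulr0) !subr0.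
by rewrite -ce [d.1 == _]eq_sym (negbTE ncd) !(mulr0, mul0r) !subr0.
Qed.

End Braid.
End SeminormalCoefficients.

(** Hoefsmit's coefficients satisfy these identities because, with X = x^k,
    they are identities between rational functions. *)
Section HoefsmitField.
Variables (F : fieldType) (x y : F).
Hypotheses (x0 : x != 0) (y0 : y != 0).

Definition hoef_a (k : int) : F := (x - 1) / (y * (1 - x ^ k)).
Definition hoef_b (k : int) : F := (x - x ^ k) / (y * (1 - x ^ k)).

Let sub0 (X : F) : X != 1 -> 1 - X != 0.
Proof. by rewrite subr_eq0 eq_sym. Qed.

Lemma hoef_coefficients (eps : F) : eps * eps = 1 ->
  hoefsmit_coefficients hoef_a hoef_b eps (x / y ^+ 2) ((x - 1) / y) (fun k => x ^ k != 1).
Proof.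
move=> e2; split=> //; rewrite /hoef_a /hoef_b.
- move=> k k1; rewrite -invr_expz; have X0 : x ^ k != 0 by rewrite expfz_neq0.
  move: (x ^ k) k1 X0 => X X1 X0; field.
  have h : X - 1 != 0 by rewrite subr_eq0.
  by rewrite ?y0 ?X0 ?h ?sub0.
- move=> k k1; rewrite -invr_expz; have X0 : x ^ k != 0 by rewrite expfz_neq0.
  move: (x ^ k) k1 X0 => X X1 X0; field.
  have h : X - 1 != 0 by rewrite subr_eq0.
  by rewrite ?y0 ?X0 ?h ?sub0.
- by rewrite expr1z subrr mul0r.
- move=> k l + +; rewrite expfzDr //.
  move: (x ^ k) (x ^ l) => X Y X1 Y1 XY1; field.
  by rewrite y0 !sub0.
- move=> k l + +; rewrite -invr_expz expfzDr //.
  have: x ^ k != 0 by rewrite expfz_neq0.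
  move: (x ^ k) (x ^ l) => X Y X0 X1 Y1 XY1; field.
  have h : X - 1 != 0 by rewrite subr_eq0.
  by rewrite ?y0 ?X0 ?h ?sub0.
- move=> k l + +; rewrite -invr_expz expfzDr //.
  have: x ^ l != 0 by rewrite expfz_neq0.
  move: (x ^ k) (x ^ l) => X Y Y0 X1 Y1 XY1; field.
  have h : Y - 1 != 0 by rewrite subr_eq0.
  by rewrite ?y0 ?Y0 ?h ?sub0.
Qed.

End HoefsmitField.

(** * Algebras of Yokonuma type *)

Section GeometricSums.
Variables (S : idomainType) (b : nat) (zeta : S).
Hypotheses (b_gt0 : (0 < b)%N) (zeta_prim : b.-primitive_root zeta).

Lemma geometric_sum0 (z : S) : z ^+ b = 1 -> z != 1 -> \sum_(k < b) z ^+ k = 0.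
Proof.
move=> zb z1; have := subrX1 z b; rewrite zb subrr => /esym/eqP.
by rewrite mulf_eq0 subr_eq0 (negbTE z1) => /eqP.
Qed.

Lemma zetaXb c : zeta ^+ (c * b) = 1.
Proof. by rewrite mulnC exprM (prim_expr_order zeta_prim) expr1n. Qed.

Lemma zetaX_neq0 c : zeta ^+ c != 0.
Proof.
apply: expf_neq0; apply/eqP => z0; have := prim_expr_order zeta_prim.
by rewrite z0 expr0n gtn_eqF // => /esym/eqP; rewrite oner_eq0.
Qed.

Lemma zeta_sum c m : \sum_(k < b) zeta ^+ (m * k) * zeta ^+ (c * (b - k)) =
  if (m == c %[mod b])%N then b%:R else 0.
Proof.
pose z := zeta ^+ (m + c * (b - 1)).
have zE (k : 'I_b) : zeta ^+ (m * k) * zeta ^+ (c * (b - k)) = z ^+ k.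
  apply: (mulIf (zetaX_neq0 (c * k))); rewrite -mulrA -exprD -mulnDr subnK ?(ltnW (ltn_ord k)) //.
  rewrite zetaXb mulr1 /z -exprM -exprD.
  have -> : ((m + c * (b - 1)) * k + c * k = m * k + c * k * b)%N.
    rewrite mulnDl -addnA; congr addn; rewrite -mulnA -mulnDr -mulnA; congr muln.
    by rewrite mulnBl mul1n subnK ?leq_pmull // mulnC.
  by rewrite exprD zetaXb mulr1.
rewrite (eq_bigr _ (fun k _ => zE k)); case: ifP => mc.
  have -> : z = 1.
    rewrite /z exprD; have /eqP -> : zeta ^+ m == zeta ^+ c by rewrite (eq_prim_root_expr zeta_prim).
    by rewrite -exprD -{1}[c]muln1 -mulnDr addnC subnK // zetaXb.
  by under eq_bigr do rewrite expr1n; rewrite sumr_const card_ord.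
apply: geometric_sum0; first by rewrite /z -exprM zetaXb.
apply: contraFN mc => /eqP z1; rewrite -(eq_prim_root_expr zeta_prim); apply/eqP.
apply: (mulIf (zetaX_neq0 (c * (b - 1)))); rewrite -exprD -/z z1 -exprD.
by rewrite -{1}[c]muln1 -mulnDr addnC subnK // zetaXb.
Qed.

End GeometricSums.

Section EigenIdempotents.
Variables (S : idomainType) (b : nat) (zeta binv : S).
Hypotheses (b_gt0 : (0 < b)%N) (zeta_prim : b.-primitive_root zeta).
Hypothesis b_inv : binv * b%:R = 1.
Variable B : pzAlgType S.

(** The projection onto the eigenspace of eigenvalue zeta^c of an element of
    order dividing b. *)
Definition eig_proj (t : B) (c : nat) : B :=
  binv%:AC * \sum_(k < b) (zeta ^+ (c * (b - k)))%:AC * t ^+ k.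

Lemma eig_proj_eigen t c : t ^+ b = 1 ->
  t * eig_proj t c = (zeta ^+ c)%:AC * eig_proj t c.
Proof.
move=> tb; rewrite /eig_proj mulrA -alg_const_central -mulrA.
rewrite [RHS]mulrA [(zeta ^+ c)%:AC * _]alg_const_central -mulrA; congr (_ * _).
pose F k : B := (zeta ^+ (c * (b - k)))%:AC * t ^+ k.
transitivity ((zeta ^+ c)%:AC * \sum_(0 <= k < b) F k.+1).
  rewrite !mulr_sumr big_mkord; apply: eq_bigr => k _.
  rewrite /F mulrA -alg_const_central -mulrA -exprS mulrA -rmorphM -exprD.
  by rewrite -{2}[c]muln1 -mulnDr subnS addnC addn1 prednK // subn_gt0.
congr (_ * _); rewrite -(big_mkord xpredT F); case: b b_gt0 @F tb zeta_prim => // b' _ F tb zp.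
rewrite big_nat_recr //= [RHS]big_nat_recl // addrC; congr (_ + _).
by rewrite /F subnn muln0 expr0 tb subn0 (zetaXb zp) rmorph1.
Qed.

Lemma eig_proj_sum t : t ^+ b = 1 -> \sum_(c < b) eig_proj t c.+1 = 1.
Proof.
move=> tb; rewrite -mulr_sumr exchange_big /= (bigD1 (Ordinal b_gt0)) //= [X in _ + X]big1 => [|k k0].
  under eq_bigr => c _ do rewrite subn0 (zetaXb zeta_prim) rmorph1 mul1r expr0.
  rewrite sumr_const card_ord addr0 -[1 in X in _ * X](rmorph1 (@alg_const S B)).
  by rewrite -rmorphMn -rmorphM b_inv rmorph1.
rewrite -mulr_suml -rmorph_sum /=.
suff -> : \sum_(c < b) zeta ^+ (c.+1 * (b - k)) = 0 by rewrite rmorph0 mul0r.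
under eq_bigr do rewrite mulSn exprD mulnC exprM.
rewrite -mulr_sumr geometric_sum0 ?mulr0 //; first by rewrite -exprM (zetaXb zeta_prim).
rewrite -[1](expr0 zeta) (eq_prim_root_expr zeta_prim).
have k0' : (0 < k)%N by rewrite lt0n; apply: contraNneq k0 => e; apply/eqP/val_inj.
by rewrite modn_small ?mod0n ?subn_eq0 -?ltnNge // ltn_subrL k0' b_gt0.
Qed.

(** On an eigenvector the projection is 1 or 0. *)
Lemma eig_proj_on t c m u : t * u = (zeta ^+ m)%:AC * u ->
  eig_proj t c * u = if (m == c %[mod b])%N then u else 0.
Proof.
move=> tu; have tku k : t ^+ k * u = (zeta ^+ (m * k))%:AC * u.
  elim: k => [|k IH]; first by rewrite muln0 !expr0 rmorph1.
  by rewrite exprS -mulrA IH mulrA -alg_const_central -mulrA tu mulrA -rmorphM -exprD mulnS addnC.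
rewrite /eig_proj -mulrA mulr_suml.
have -> : \sum_(k < b) (zeta ^+ (c * (b - k)))%:AC * t ^+ k * u =
    (\sum_(k < b) zeta ^+ (m * k) * zeta ^+ (c * (b - k)))%:AC * u.
  rewrite rmorph_sum mulr_suml; apply: eq_bigr => k _ /=.
  by rewrite -mulrA tku mulrA -rmorphM [_ * zeta ^+ (m * k)]mulrC.
rewrite (zeta_sum b_gt0 zeta_prim) mulrA -rmorphM; case: ifP => _.
  by rewrite b_inv rmorph1 mul1r.
by rewrite mulr0 rmorph0 mul0r.
Qed.

Lemma eig_proj_intertwine t t' c u : t * u = u * t' -> eig_proj t c * u = u * eig_proj t' c.
Proof.
move=> tu; rewrite /eig_proj -mulrA [RHS]mulrA -alg_const_central -[RHS]mulrA; congr (_ * _).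
rewrite mulr_suml mulr_sumr; apply: eq_bigr => k _.
rewrite -mulrA [RHS]mulrA -alg_const_central -[RHS]mulrA; congr (_ * _).
elim: (k : nat) => [|m IH]; first by rewrite !expr0 mulr1 mul1r.
by rewrite exprSr -mulrA tu mulrA IH -mulrA -exprSr.
Qed.

End EigenIdempotents.

Record yokonuma (S : comNzRingType) (b n : nat) (q a : S) (B : pzAlgType S)
    (T : 'I_n -> B) (R : nat -> B) : Prop := {
  yk_Tb : forall j, T j ^+ b = 1;
  yk_TT : forall j j', T j * T j' = T j' * T j;
  yk_TR : forall j (i : 'I_n.-1), T j * R i = R i * T (tperm (ord_lo i) (ord_hi i) j);
  yk_far : forall i j, (j < n.-1)%N -> (i.+1 < j)%N -> R i * R j = R j * R i;
  yk_braid : forall i, (i.+1 < n.-1)%N -> R i * R i.+1 * R i = R i.+1 * R i * R i.+1;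
  yk_quad : forall i : 'I_n.-1, R i * R i = q%:AC +
    a%:AC * T (ord_lo i) ^+ ((b ^ 2 - b) %/ 2) *
      (\sum_(k < b) T (ord_lo i) ^+ k * T (ord_hi i) ^+ (b - k)) * R i }.

Lemma alg_const_mulACA (S : comPzRingType) (B : pzAlgType S) (c d : S) (u v : B) :
  c%:AC * u * (d%:AC * v) = (c * d)%:AC * (u * v).
Proof. by rewrite rmorphM -!mulrA; congr (_ * _); rewrite !mulrA -alg_const_central. Qed.

Section YokonumaSpan.
Variables (S : idomainType) (b n : nat) (zeta binv q a : S).
Hypotheses (b_gt0 : (0 < b)%N) (n_gt0 : (0 < n)%N).
Hypothesis zeta_prim : b.-primitive_root zeta.
Hypothesis b_inv : binv * b%:R = 1.
Variables (B : pzAlgType S) (T : 'I_n -> B) (R : nat -> B).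
Hypothesis yk : yokonuma b q a T R.

Local Notation proj := (eig_proj b zeta binv).

Definition char_proj (chi : 'I_n -> nat) : B := \prod_(j < n) proj (T j) (chi j).

Local Notation e := char_proj.

Lemma proj_commute j j' c c' : proj (T j) c * proj (T j') c' = proj (T j') c' * proj (T j) c.
Proof.
apply: eig_proj_intertwine; apply/esym; apply: eig_proj_intertwine.
exact: (yk_TT yk).
Qed.

Lemma T_proj_commute j j' c : T j * proj (T j') c = proj (T j') c * T j.
Proof. by apply/esym/eig_proj_intertwine/(yk_TT yk). Qed.

Lemma T_char_proj j chi : T j * e chi = (zeta ^+ chi j)%:AC * e chi.
Proof.
rewrite /e; have : j \in index_enum 'I_n by rewrite mem_index_enum.
elim: (index_enum _) => // k s IH; rewrite in_cons big_cons mulrA.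
case: (eqVneq j k) => [<- _|ne /= js].
  by rewrite (eig_proj_eigen binv b_gt0 zeta_prim) ?(yk_Tb yk) // -mulrA.
by rewrite T_proj_commute -mulrA IH // mulrA -alg_const_central mulrA.
Qed.

Lemma char_proj_T j chi : e chi * T j = T j * e chi.
Proof. by apply/esym/commr_prod => k _; exact: T_proj_commute. Qed.

Lemma proj_char_proj j c chi :
  proj (T j) c * e chi = if (chi j == c %[mod b])%N then e chi else 0.
Proof. by rewrite (eig_proj_on b_gt0 zeta_prim b_inv _ (T_char_proj j chi)). Qed.

Lemma char_proj_proj j c chi :
  e chi * proj (T j) c = if (chi j == c %[mod b])%N then e chi else 0.
Proof.
rewrite -proj_char_proj; apply/esym; apply: eig_proj_intertwine.
exact/esym/char_proj_T.
Qed.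

Lemma char_proj_idem chi chi' : (forall j, chi j = chi' j %[mod b])%N -> e chi * e chi' = e chi'.
Proof.
move=> h; rewrite /e -/(e chi'); elim: (index_enum _) => [|k s IH].
  by rewrite big_nil mul1r.
by rewrite big_cons -mulrA IH proj_char_proj (h k) eqxx.
Qed.

Lemma char_proj_orth chi chi' j : (chi j != chi' j %[mod b])%N -> e chi * e chi' = 0.
Proof.
move=> h; have := proj_char_proj j (chi' j) chi'; rewrite eqxx => <-.
by rewrite mulrA char_proj_proj (negbTE h) mul0r.
Qed.

Local Notation ech := (fun chi : {ffun 'I_n -> 'I_b} => e (fun j => (chi j).+1)).

Lemma char_proj_sum : \sum_(chi : {ffun 'I_n -> 'I_b}) ech chi = 1.
Proof.
rewrite /e -(bigA_distr_bigA (fun j (c : 'I_b) => proj (T j) c.+1)) /=.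
rewrite big1 // => j _; apply: eig_proj_sum => //; exact: (yk_Tb yk).
Qed.

Lemma ordS_mod (c c' : 'I_b) : (c.+1 == c'.+1 %[mod b])%N = (c == c').
Proof.
apply/idP/eqP => [|-> //]; rewrite -[c.+1]addn1 -[c'.+1]addn1 eqn_modDr !modn_small //.
by move/eqP/val_inj.
Qed.

Lemma ech_mul (chi chi' : {ffun 'I_n -> 'I_b}) : ech chi * ech chi' = if chi == chi' then ech chi else 0.
Proof.
case: eqVneq => [->|ne]; first exact: char_proj_idem.
have [j nj] : exists j, chi j != chi' j.
  by apply/existsP; apply: contraR ne; rewrite negb_exists => /forallP h;
     apply/eqP/ffunP => j; apply/eqP; have := h j; rewrite negbK.
by apply: (char_proj_orth (j := j)); rewrite ordS_mod.
Qed.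

Lemma R_proj (i : 'I_n.-1) j c :
  proj (T j) c * R i = R i * proj (T (tperm (ord_lo i) (ord_hi i) j)) c.
Proof. by apply: eig_proj_intertwine; exact: (yk_TR yk). Qed.

Lemma R_ech (i : 'I_n.-1) (chi : {ffun 'I_n -> 'I_b}) :
  R i * ech chi = ech [ffun j => chi (tperm (ord_lo i) (ord_hi i) j)] * R i.
Proof.
set s := tperm _ _; set chi' := finfun _.
have off (psi phi : {ffun 'I_n -> 'I_b}) : psi != [ffun j => phi (s j)] ->
    ech psi * R i * ech phi = 0.
  move=> ne; have [j nj] : exists j, psi j != phi (s j).
    apply/existsP; apply: contraR ne; rewrite negb_exists => /forallP h.
    by apply/eqP/ffunP => j; apply/eqP; have := h j; rewrite negbK ffunE.
  have := char_proj_proj j (psi j).+1 (fun j => (psi j).+1); rewrite eqxx => <-.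
  rewrite -mulrA -mulrA [_ * (R i * _)]mulrA R_proj -mulrA proj_char_proj.
  by rewrite ordS_mod eq_sym (negbTE nj) !mulr0.
transitivity (ech chi' * R i * ech chi).
  rewrite -[R i in LHS]mul1r -{1}char_proj_sum !mulr_suml (bigD1 chi') //= big1 ?addr0 //.
  by move=> psi; apply: off.
rewrite -[RHS]mulr1 -char_proj_sum mulr_sumr (bigD1 chi) //= big1 ?addr0 //.
move=> phi ne; apply: off; apply: contra ne => /eqP /ffunP h; apply/eqP/ffunP => j.
by have := h (s j); rewrite !ffunE tpermK.
Qed.

(** The span of the idempotents, which contains the T_j. *)
Definition torus (x : B) : Prop :=
  exists c : {ffun 'I_n -> 'I_b} -> S, x = \sum_chi (c chi)%:AC * ech chi.

Lemma torus0 : torus 0.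
Proof. by exists (fun=> 0); rewrite big1 // => chi _; rewrite rmorph0 mul0r. Qed.

Lemma torusD x y : torus x -> torus y -> torus (x + y).
Proof.
move=> [c ->] [d ->]; exists (fun chi : {ffun 'I_n -> 'I_b} => c chi + d chi).
by rewrite -big_split; apply: eq_bigr => chi _; rewrite rmorphD mulrDl.
Qed.

Lemma torusM x y : torus x -> torus y -> torus (x * y).
Proof.
move=> [c ->] [d ->]; exists (fun chi : {ffun 'I_n -> 'I_b} => c chi * d chi).
rewrite mulr_suml; apply: eq_bigr => chi _; rewrite mulr_sumr (bigD1 chi) //=.
rewrite alg_const_mulACA ech_mul eqxx big1 ?addr0 // => psi ne.
by rewrite alg_const_mulACA ech_mul eq_sym (negbTE ne) mulr0.
Qed.

Lemma torus_cst c : torus c%:AC.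
Proof. by exists (fun=> c); rewrite -mulr_sumr char_proj_sum mulr1. Qed.

Lemma torus1 : torus 1.
Proof. by rewrite -(rmorph1 (@alg_const S B)); apply: torus_cst. Qed.

Lemma torusT j : torus (T j).
Proof.
exists (fun chi : {ffun 'I_n -> 'I_b} => zeta ^+ (chi j).+1).
rewrite -[LHS]mulr1 -char_proj_sum mulr_sumr; apply: eq_bigr => chi _.
exact: T_char_proj.
Qed.

Lemma torusX x k : torus x -> torus (x ^+ k).
Proof.
by move=> tx; elim: k => [|k IH]; rewrite ?expr0 ?exprS; [exact: torus1|apply: torusM].
Qed.

Lemma torus_norm (i : 'I_n.-1) c : torus c -> exists2 c', torus c' & R i * c = c' * R i.
Proof.
move=> [c_ ->]; set s := tperm (ord_lo i) (ord_hi i).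
pose st (chi : {ffun 'I_n -> 'I_b}) := [ffun j => chi (s j)].
have stK : involutive st by move=> chi; apply/ffunP => j; rewrite !ffunE tpermK.
exists (\sum_chi (c_ (st chi))%:AC * ech chi); first by exists (fun chi => c_ (st chi)).
rewrite mulr_sumr mulr_suml (reindex_inj (inv_inj stK)) /=; apply: eq_bigr => chi _.
have := R_ech i (st chi); rewrite -/(st (st chi)) stK => h.
by rewrite mulrA -alg_const_central -!mulrA; congr (_ * _).
Qed.

Lemma yokonuma_span (gen : forall P : B -> Prop,
    (forall c : S, P c%:AC) -> (forall j, P (T j)) -> (forall i, (i < n.-1)%N -> P (R i)) ->
    (forall u v, P u -> P v -> P (u + v)) ->
    (forall u v, P u -> P v -> P (u * v)) -> forall u, P u) x :
  exists c : seq nat -> {ffun 'I_n -> 'I_b} -> S,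
    x = \sum_(p <- idx n) \sum_chi (c p chi)%:AC * ech chi * word_of R p.
Proof.
have [c tc ->] : exists2 c : seq nat -> B, forall p, torus (c p) &
    x = \sum_(p <- idx n.-1.+1) c p * word_of R p.
  apply: (normal_form torus0 torusD torusM); last exact: torus1.
  - by move=> i j; apply: (yk_far yk).
  - by move=> i; apply: (yk_braid yk).
  - move=> i iN; have /= -> := yk_quad yk (Ordinal iN).
    eexists; eexists; split; last by [].
      exact: torus_cst.
    apply: torusM; first by apply: torusM; [exact: torus_cst|apply/torusX/torusT].
    elim/big_ind: _ => [||k _]; [exact: torus0|exact: torusD|].
    by apply: torusM; apply/torusX/torusT.
  - by move=> i d iN; apply: (torus_norm (Ordinal iN)).
  - move=> P Pc PR Pa Pm; apply: gen => // [d|j]; apply: Pc; [exact: torus_cst|exact: torusT].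
have /choice[d hd] p := tc p.
exists d; rewrite prednK //; apply: eq_bigr => p _; rewrite hd mulr_suml.
by apply: eq_bigr.
Qed.

End YokonumaSpan.

(** * The seminormal representation on all standard tableaux *)

Lemma val_tperm_swap n (i : 'I_n.-1) (j : 'I_n) :
  tperm (ord_lo i) (ord_hi i) j = swap_nat i j :> nat.
Proof.
rewrite /swap_nat; case: tpermP => [->|->|/eqP n1 /eqP n2] /=; rewrite ?eqxx //.
  by case: eqP => //; lia.
by move: n1 n2; rewrite -!val_eqE /= => /negbTE -> /negbTE ->.
Qed.

Section DiagonalOperators.
Variables (S : comNzRingType) (I : finType).

Lemma diag_opM (d d' : I -> S) : diag_op d * diag_op d' = diag_op (fun i => d i * d' i).
Proof. by apply: endoP => f; apply/ffunP => i; rewrite endo_mulE !diag_opE mulrA. Qed.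

Lemma diag_op1 : diag_op (fun _ : I => 1 : S) = 1.
Proof. by apply: endoP => f; apply/ffunP => i; rewrite diag_opE mul1r. Qed.

Lemma diag_opX (d : I -> S) k : diag_op d ^+ k = diag_op (fun i => d i ^+ k).
Proof.
elim: k => [|k IH].
  by rewrite expr0 -diag_op1; apply: endoP => f; apply/ffunP => i; rewrite !diag_opE ?expr0.
rewrite exprS IH diag_opM.
by apply: endoP => f; apply/ffunP => i; rewrite !diag_opE exprS.
Qed.

Lemma diag_op_sum (J : Type) (r : seq J) (d : J -> I -> S) :
  \sum_(k <- r) diag_op (d k) = diag_op (fun i => \sum_(k <- r) d k i).
Proof.
apply: endoP => f; apply/ffunP => i; rewrite endo_sumE sum_ffunE diag_opE mulr_suml.
by apply: eq_bigr => k _; rewrite diag_opE.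
Qed.

Lemma diag_op_cst (c : S) : (c%:AC : endo {ffun I -> S^o}) = diag_op (fun=> c).
Proof.
by apply: endoP => f; apply/ffunP => i; rewrite diag_opE.
Qed.

End DiagonalOperators.

Notation lword b n := (seq_sub (lattice_words b n n)).

Section WordModule.
Variables (K : fieldType) (b n : nat) (zeta x y a : K).
Hypotheses (b_gt0 : (0 < b)%N) (n_gt0 : (0 < n)%N).
Hypothesis zeta_prim : b.-primitive_root zeta.
Hypotheses (x0 : x != 0) (y0 : y != 0).
Hypothesis x_inf : forall k : int, k != 0 -> x ^ k != 1.
Hypothesis ba : b%:R * a = (x - 1) / y.

Local Notation q := (x / y ^+ 2).
Local Notation I := (lword b n).
Local Notation W := {ffun I -> K^o}.

Definition eps_exp : nat := (b ^ 2 - b) %/ 2.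
Local Notation eps := (zeta ^+ eps_exp).

Lemma eps_sq : eps * eps = 1.
Proof.
rewrite -exprD addnn -muln2 /eps_exp divnK; last first.
  rewrite dvdn2 oddB ?oddX ?addbb // -[b]expn1 -expnM mul1n.
  by rewrite leq_pexp2l.
by rewrite -mulnn -[X in (_ - X)%N]mul1n -mulnBl (zetaXb zeta_prim).
Qed.

Lemma word_hc : hoefsmit_coefficients (hoef_a x y) (hoef_b x y) eps q ((x - 1) / y) (fun k => x ^ k != 1).
Proof. exact: (hoef_coefficients x0 y0 eps_sq). Qed.

Lemma lword_lattice (w : I) : lattice (ssval w).
Proof. by have := ssvalP w; rewrite mem_lattice_words => /and3P[]. Qed.

Lemma lword_size (w : I) : size (ssval w) = n.
Proof. by have := ssvalP w; rewrite mem_lattice_words => /and3P[_ /eqP]. Qed.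

Lemma lword_perm (w : I) s : lattice s -> perm_eq s (ssval w) -> s \in lattice_words b n n.
Proof.
move=> ls p; rewrite mem_lattice_words ls (perm_size p) lword_size eqxx /=.
by have := ssvalP w; rewrite mem_lattice_words (perm_all _ p) => /and3P[].
Qed.

Definition wt (w : I) (k : nat) : nat * int := weight (ssval w) k.

Definition sw (l : nat) (w : I) : I := insubd w (swap_word l (ssval w)).

Lemma wt_inj (w w' : I) : (forall k, (k < n)%N -> wt w k = wt w' k) -> w = w'.
Proof.
move=> h; apply: val_inj; apply: weight_inj; rewrite ?lword_lattice ?lword_size //.
Qed.

Lemma wt_comp (w : I) k : (k < n)%N -> ((wt w k).1 < b)%N.
Proof.
move=> kn; have := ssvalP w; rewrite mem_lattice_words => /and3P[_ _ /allP h].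
have := h (nth (0%N, 0%N) (ssval w) k); rewrite mem_nth ?lword_size // => /(_ isT).
by rewrite mem_letters => /andP[].
Qed.

Lemma sw_val l (w : I) : (l.+1 < n)%N -> ~~ adjacent (wt w l) (wt w l.+1) ->
  ssval (sw l w) = swap_word l (ssval w).
Proof.
move=> ln na; rewrite /sw -[ssval _]/(val _) insubdK //.
apply: (@lword_perm w); last by apply: perm_swap_word; rewrite lword_size.
by apply: swap_word_lattice; rewrite ?lword_lattice ?lword_size.
Qed.

Local Notation A := (Acoef (hoef_a x y) eps).
Local Notation Bc := (Bcoef (hoef_b x y) eps q).

Lemma Bcoef_nonadj c d : Bc c d != 0 -> ~~ adjacent c d.
Proof.
by apply: contraNN => h; rewrite /Bcoef h; case/andP: h => ->.
Qed.

Lemma wt_sw l (w : I) : (l.+1 < n)%N -> Bc (wt w l) (wt w l.+1) != 0 ->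
  forall k, (k < n)%N -> wt (sw l w) k = wt w (swap_nat l k).
Proof.
move=> ln /Bcoef_nonadj na k kn; rewrite /wt sw_val //.
by apply: weight_swap; rewrite ?lword_size.
Qed.

Lemma good_neq c d : c != d -> same_good (fun k => x ^ k != 1) c d.
Proof.
move=> ne e; apply: x_inf; rewrite subr_eq0; apply: contraNneq ne => e'.
by rewrite [c]surjective_pairing [d]surjective_pairing e e'.
Qed.

Lemma good1 l (w : I) : (l.+1 < n)%N -> same_good (fun k => x ^ k != 1) (wt w l) (wt w l.+1).
Proof.
by move=> ln; apply/good_neq/weight_neq1; rewrite ?lword_lattice ?lword_size.
Qed.

Lemma good2 l (w : I) : (l.+2 < n)%N -> same_good (fun k => x ^ k != 1) (wt w l) (wt w l.+2).
Proof.
by move=> ln; apply/good_neq/weight_neq2; rewrite ?lword_lattice ?lword_size.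
Qed.

Definition Tw (j : 'I_n) : endo W := diag_op (fun w : I => zeta ^+ (wt w j).1.+1 : K).
Definition Rw (l : nat) : endo W := mix_op wt sw A Bc l.

Lemma word_yokonuma : yokonuma b q a Tw Rw.
Proof.
split.
- move=> j; rewrite diag_opX -diag_op1; apply: endoP => f; apply/ffunP => w.
  by rewrite !diag_opE -exprM (zetaXb zeta_prim).
- move=> j j'; rewrite /Tw !diag_opM; apply: endoP => f; apply/ffunP => w.
  by rewrite !diag_opE; congr (_ * _); exact: mulrC.
- move=> j i; have i1 := ord_hi_subproof i.
  apply: endoP => f; apply/ffunP => w; rewrite !endo_mulE.
  have := @diag_mix_op _ _ _ _ wt sw A Bc wt_sw (fun c => zeta ^+ c.1.+1) i j f w i1 (ltn_ord j).
  rewrite /Tw val_tperm_swap; apply.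
  by rewrite /Acoef; case: eqP => [->|_]; rewrite ?mul0r.
- move=> i j jn ij; apply: endoP => f; apply/ffunP => w; rewrite !endo_mulE.
  rewrite /Rw; have := @mix_op_far K I n _ wt sw A Bc wt_inj wt_sw i j f w; apply; lia.
- move=> i hi; have i1 : (i.+1 < n)%N by lia.
  have i2 : (i.+2 < n)%N by lia.
  apply: endoP => f; apply/ffunP => w; rewrite !endo_mulE.
  apply: (mix_op_braid wt_inj wt_sw) => //.
  + exact: (AB_braid1 word_hc (@good1 _ w i1) (@good1 _ w i2) (@good2 _ w i2)).
  + exact: (AB_braid2 word_hc (@good1 _ w i1) (@good1 _ w i2) (@good2 _ w i2)).
  + exact: (AB_braid3 word_hc (@good1 _ w i1) (@good1 _ w i2) (@good2 _ w i2)).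
- move=> i; have i1 := ord_hi_subproof i.
  apply: endoP => f; apply/ffunP => w; rewrite endo_mulE.
  rewrite (@mix_op_sq _ _ _ _ wt sw A Bc wt_inj wt_sw (fun _ _ => q)
    (fun c d => if c.1 == d.1 then (x - 1) / y * eps ^+ c.1.+1 else 0)) //; last first.
  + exact: (AB_offdiag word_hc (@good1 _ w i1)).
  + exact: (AB_square word_hc (@good1 _ w i1)).
  rewrite endo_addE [RHS]ffunE; congr (_ + _); first by rewrite [RHS]ffunE.
  rewrite /Tw diag_op_cst diag_opX diag_opM.
  under eq_bigr do rewrite !diag_opX diag_opM.
  rewrite diag_op_sum diag_opM endo_mulE diag_opE; congr (_ * _).
  set c := wt w i; set d := wt w i.+1.
  under eq_bigr do rewrite -!exprM.
  rewrite (zeta_sum b_gt0 zeta_prim).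
  have [cb db] : (c.1 < b)%N /\ (d.1 < b)%N by split; apply: wt_comp; lia.
  have -> : (c.1.+1 == d.1.+1 %[mod b])%N = (c.1 == d.1).
    exact: (ordS_mod (Ordinal cb) (Ordinal db)).
  case: ifP => _; last by rewrite mulr0.
  rewrite -ba -exprM -/eps_exp [(eps_exp * _)%N]mulnC exprM.
  by rewrite -mulrA mulrC.
Qed.

End WordModule.

(** * Matrix units *)

Lemma square_family_free (K : fieldType) (J P : finType) (G : J -> P -> K) :
  #|J| = #|P| ->
  (forall p0, exists c : J -> K, forall p, \sum_j c j * G j p = (p == p0)%:R) ->
  forall c : J -> K, (forall p, \sum_j c j * G j p = 0) -> forall j, c j = 0.
Proof.
move=> JP /choice[C hC] c hc j.
pose M := \matrix_(i < #|J|, k < #|P|) G (enum_val i) (enum_val k).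
pose L := \matrix_(i < #|P|, k < #|J|) C (enum_val i) (enum_val k).
have LM : L *m M = 1%:M.
  apply/matrixP => i k; rewrite !mxE.
  under eq_bigr do rewrite !mxE.
  rewrite -(big_enum_val (A := J) (fun j => C (enum_val i) j * G j (enum_val k))) /=.
  by rewrite hC (inj_eq enum_val_inj) eq_sym.
have rM : row_free M.
  have : row_full M by apply/row_fullP; exists L.
  by move/eqP => r; apply/eqP; rewrite r JP.
pose v := \row_(i < #|J|) c (enum_val i).
have : v *m M = 0.
  apply/rowP => k; rewrite !mxE; under eq_bigr do rewrite !mxE.
  by rewrite -(big_enum_val (A := J) (fun j => c j * G j (enum_val k))) /= hc.
move/eqP; rewrite mulmx_free_eq0 // => /eqP /rowP /(_ (enum_rank j)).
by rewrite !mxE enum_rankK.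
Qed.

Section Units.
Variables (K : fieldType) (b n : nat) (zeta binv x y a : K).
Hypotheses (b_gt0 : (0 < b)%N) (n_gt0 : (0 < n)%N).
Hypothesis zeta_prim : b.-primitive_root zeta.
Hypothesis b_inv : binv * b%:R = 1.
Hypotheses (x0 : x != 0) (y0 : y != 0).
Hypothesis x_inf : forall k : int, k != 0 -> x ^ k != 1.
Hypothesis ba : b%:R * a = (x - 1) / y.

Local Notation q := (x / y ^+ 2).
Local Notation I := (lword b n).
Local Notation W := {ffun I -> K^o}.
Local Notation eps := (zeta ^+ eps_exp b).
Local Notation A := (Acoef (hoef_a x y) eps).
Local Notation Bc := (Bcoef (hoef_b x y) eps q).

Variables (B : pzAlgType K) (T : 'I_n -> B) (R : nat -> B).
Hypothesis yk : yokonuma b q a T R.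
Hypothesis gen : forall P : B -> Prop,
    (forall c : K, P c%:AC) -> (forall j, P (T j)) -> (forall i, (i < n.-1)%N -> P (R i)) ->
    (forall u v, P u -> P v -> P (u + v)) ->
    (forall u v, P u -> P v -> P (u * v)) -> forall u, P u.
Variable rho : {rmorphism B -> endo W}.
Hypothesis rho_cst : forall c : K, rho c%:AC = c%:AC.
Hypothesis rho_T : forall j, rho (T j) = @Tw K b n zeta j.
Hypothesis rho_R : forall i, (i < n.-1)%N -> rho (R i) = @Rw K b n zeta x y i.

Let q0 : q != 0. Proof. by rewrite mulf_neq0 // invr_eq0 expf_neq0. Qed.

Let rhoM u v f : rho (u * v) f = rho u (rho v f). Proof. by rewrite rmorphM. Qed.
Let rhoD u v f w : rho (u + v) f w = rho u f w + rho v f w.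
Proof. by rewrite rmorphD endo_addE [LHS]ffunE. Qed.
Let rhoZ (c : K) u f w : rho (c%:AC * u) f w = c * rho u f w.
Proof. by rewrite rmorphM rho_cst endo_mulE [LHS]ffunE. Qed.
Let rho1 f : rho 1 f = f. Proof. by rewrite rmorph1. Qed.

Let hc := word_hc b_gt0 zeta_prim x0 y0.

Let hoef_a_mul (k : int) : x ^ k != 1 -> hoef_a x y k * (x ^ k - 1) = - ((x - 1) / y).
Proof.
rewrite /hoef_a => k1; have h : 1 - x ^ k != 0 by rewrite subr_eq0 eq_sym.
by field; rewrite y0.
Qed.

Let AB_content1 c d : same_good (fun k => x ^ k != 1) c d ->
  A c d ^+ 2 * x ^ c.2 + Bc c d * Bc d c * x ^ d.2 = q * x ^ d.2.
Proof.
move=> g; rewrite (Bcoef_mul hc g) /Acoef.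
case: (eqVneq c.1 d.1) => [e|_]; last by rewrite expr2 !mul0r add0r addr0.
have -> : x ^ c.2 = x ^ (c.2 - d.2) * x ^ d.2 by rewrite -expfzDr // subrK.
have ax := hoef_a_mul (g e); move: ax; set al := hoef_a _ _ _; set X := x ^ _.
set z := _ ^+ c.1.+1 => ax; have z2 : z * z = 1.
  by rewrite -exprMn (eps_sq b_gt0 zeta_prim) expr1n.
transitivity (q * x ^ d.2 + x ^ d.2 * al * ((z * z) * (al * (X - 1)) + (z * z - 1) * al + (x - 1) / y)).
  by ring.
by rewrite z2 ax subrr; ring.
Qed.

Let AB_content2 c d : same_good (fun k => x ^ k != 1) c d ->
  A c d * x ^ c.2 + A d c * x ^ d.2 = 0.
Proof.
move=> g; rewrite /Acoef [d.1 == _]eq_sym.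
case: (eqVneq c.1 d.1) => [e|_]; last by rewrite !mul0r addr0.
have -> : x ^ c.2 = x ^ (c.2 - d.2) * x ^ d.2 by rewrite -expfzDr // subrK.
have ax := hoef_a_mul (g e); have := hc_a hc (g e); rewrite opprB => av.
rewrite -e; set z := _ ^+ _.
have -> : hoef_a x y (d.2 - c.2) = (x - 1) / y - hoef_a x y (c.2 - d.2) by rewrite -av; ring.
move: ax; set al := hoef_a _ _ _; set X := x ^ _ => ax.
transitivity (z * x ^ d.2 * (al * (X - 1) + (x - 1) / y)); first by ring.
by rewrite ax addNr mulr0.
Qed.

(** The Jucys-Murphy elements act on a word through the contents of its
    boxes. *)
Fixpoint jucys_murphy (k : nat) : B :=
  if k is k'.+1 then (q^-1)%:AC * (R k' * jucys_murphy k' * R k') else 1.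

Let weight0 (w : I) : (wt w 0).2 = 0.
Proof.
rewrite /wt /weight take0 /=.
have := lword_lattice w; have := lword_size w.
case: (ssval w) => [|[j [|r]] s] _ /latticeP // /(_ 1%N); rewrite /= take0.
move=> /shape_okP /(_ j r); rewrite !boxes_cons !eqxx /=; case: eqP => //; lia.
Qed.

Lemma jucys_murphyE k f w : (k < n)%N -> rho (jucys_murphy k) f w = x ^ (wt w k).2 * f w.
Proof.
elim: k f w => [|k IH] f w kn; first by rewrite rho1 weight0 expr0z mul1r.
have kn' : (k < n.-1)%N by lia.
rewrite [jucys_murphy _]/= rhoZ !rhoM rho_R // /Rw mix_opE.
rewrite !IH ?(ltnW kn) // !mix_opE.
set c := wt w k; set d := wt w k.+1.
have E : Bc c d * (x ^ (wt (sw k w) k).2 * (A (wt (sw k w) k) (wt (sw k w) k.+1) * f (sw k w)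
    + Bc (wt (sw k w) k) (wt (sw k w) k.+1) * f (sw k (sw k w)))) =
   Bc c d * (x ^ d.2 * (A d c * f (sw k w) + Bc d c * f w)).
  case: (eqVneq (Bc c d) 0) => [->|nz]; first by rewrite !mul0r.
  have w1 : wt (sw k w) k = d by rewrite (wt_sw kn nz) ?(ltnW kn) // /swap_nat eqxx.
  have w2 : wt (sw k w) k.+1 = c.
    by rewrite (wt_sw kn nz) // /swap_nat eqxx; case: eqP => //; lia.
  rewrite w1 w2; congr (_ * (_ * (_ + _))).
  case: (eqVneq (Bc d c) 0) => [->|nz']; first by rewrite !mul0r.
  by rewrite (sw_twice (@wt_inj b n) (wt_sw (zeta := zeta) (x := x) (y := y))).
rewrite E.
have g := @good1 _ _ _ _ x_inf _ w kn.
set F := f w; set F' := f _.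
transitivity (q^-1 * ((A c d ^+ 2 * x ^ c.2 + Bc c d * Bc d c * x ^ d.2) * F +
   Bc c d * (A c d * x ^ c.2 + A d c * x ^ d.2) * F')); first by ring.
by rewrite AB_content1 // AB_content2 // mulr0 mul0r addr0 -[RHS](mulKf q0); congr (_ * _); rewrite [RHS]mulrA.
Qed.

Definition acts_diag (u : B) (d : I -> K) := forall f w, rho u f w = d w * f w.

Let wordsep (w w' : I) : w != w' -> exists u d, acts_diag u d /\ d w != d w'.
Proof.
move=> ne; have [k kn nk] : exists2 k, (k < n)%N & wt w k != wt w' k.
  apply: contrapT => h; move/eqP: ne; apply; apply: wt_inj => k kn.
  by apply: contrapT => nk; apply: h; exists k => //; apply/eqP.
case: (eqVneq (wt w k).1 (wt w' k).1) => [e1|ne1].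
  exists (jucys_murphy k), (fun w => x ^ (wt w k).2).
  split=> [f v|]; first exact: jucys_murphyE.
  have ne2 : (wt w k).2 != (wt w' k).2.
    apply: contraNneq nk => e2.
    by rewrite [wt w k]surjective_pairing [wt w' k]surjective_pairing e1 e2.
  apply: contraNneq (x_inf (k := (wt w k).2 - (wt w' k).2) _) => [e|].
    by rewrite expfzDr // -invr_expz e divff ?expfz_neq0.
  by rewrite subr_eq0.
exists (T (Ordinal kn)), (fun w => zeta ^+ (wt w k).1.+1).
split=> [f v|]; first by rewrite rho_T /Tw diag_opE.
rewrite (eq_prim_root_expr zeta_prim).
have h := @ordS_mod b (Ordinal (wt_comp w kn)) (Ordinal (wt_comp w' kn)).
by rewrite h -val_eqE.
Qed.

Let diagM u d u' d' : acts_diag u d -> acts_diag u' d' -> acts_diag (u * u') (fun w => d w * d' w).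
Proof. by move=> h h' f w; rewrite rhoM h h' mulrA. Qed.

Let ex_proj (w : I) : exists u, acts_diag u (fun v => (v == w)%:R).
Proof.
suff [u [d [du dw d0]]] : exists u d,
    [/\ acts_diag u d, d w = 1 & forall v, v \in enum {: I} -> v != w -> d v = 0].
  exists u => f v; rewrite du; case: eqVneq => [->|ne]; first by rewrite dw.
  by rewrite d0 ?mem_enum.
elim: (enum {: I}) => [|v s [u [d [du dw d0]]]].
  by exists 1, (fun=> 1); split=> // f v; rewrite rho1 mul1r.
case: (eqVneq v w) => [e|ne].
  exists u, d; split=> // v'; rewrite in_cons => /orP[/eqP -> |/d0 //].
  by rewrite e eqxx.
have [u' [d' [du' ne']]] := wordsep ne; rewrite eq_sym in ne'.
have nz : d' w - d' v != 0 by rewrite subr_eq0.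
exists (((d' w - d' v)^-1)%:AC * (u' + (- d' v)%:AC) * u).
exists (fun z => (d' w - d' v)^-1 * (d' z - d' v) * d z); split.
- apply: diagM du => f z; rewrite rhoZ rhoD du' -[_%:AC]mulr1 rhoZ rho1.
  by rewrite -mulrDl mulrA.
- by rewrite dw mulr1 mulVf.
- move=> z; rewrite in_cons => /orP[/eqP -> _|zs zw]; first by rewrite subrr mulr0 mul0r.
  by rewrite d0 // mulr0.
Qed.

Definition acts_unit (u : B) (w w' : I) := forall f v, rho u f v = (v == w)%:R * f w'.

Let unit_rel (s s' : seq letter) := [/\ lattice s', perm_eq s s' &
  forall w w' : I, ssval w = s -> ssval w' = s' -> exists u, acts_unit u w w'].

Let nonadj u (l1 l2 : letter) v : l1 <> l2 -> lattice (u ++ l1 :: l2 :: v) ->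
  lattice (u ++ l2 :: l1 :: v) ->
  ~~ adjacent (weight (u ++ l1 :: l2 :: v) (size u)) (weight (u ++ l1 :: l2 :: v) (size u).+1).
Proof.
move=> ne l l'; have [hu h1 _] := lattice2 l; have [_ h2 _] := lattice2 l'.
rewrite weight_cat weight2 boxes_rcons.
case: l1 l2 ne h1 h2 {l l'} => [j r] [j' r'] ne h1 h2; rewrite /adjacent /=.
case: (eqVneq j j') => [e|//]; subst j'; rewrite andTb.
have [h|h|h] := ltngtP r r'; last by case: ne; rewrite h.
  have := shape_ok_le j hu (ltnW h); have := shape_ok_le j hu (_ : r <= r'.-1)%N.
  case: r' h {ne} h2 => // r' h /shape_okP/(_ j r'); rewrite !boxes_rcons !eqxx /= => h2.
  by move=> /(_ h); lia.
have := shape_ok_le j hu (ltnW h); have := shape_ok_le j hu (_ : r' <= r.-1)%N.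
case: r h {ne} h1 => // r h /shape_okP/(_ j r); rewrite !boxes_rcons !eqxx /= => h1.
by move=> /(_ h); lia.
Qed.

Let Bc_neq0 c d : same_good (fun k => x ^ k != 1) c d -> ~~ adjacent c d -> Bc c d != 0.
Proof.
move=> g na; rewrite /Bcoef; case: (eqVneq c.1 d.1) => [e|_]; last by case: ifP; rewrite ?oner_eq0.
rewrite (negbTE na); apply: mulf_neq0.
  by rewrite -exprM (zetaX_neq0 b_gt0 zeta_prim).
have g' : x ^ (d.2 - c.2) != 1.
  rewrite -opprB -invr_expz; apply: contraNneq (g e) => e1.
  by rewrite -[x ^ _]invrK e1 invr1.
apply: mulf_neq0; last first.
  by rewrite invr_eq0 mulf_neq0 // subr_eq0 eq_sym.
rewrite subr_eq0; have : x ^ (d.2 - c.2 - 1) != 1.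
  by apply: x_inf; move: na; rewrite /adjacent e eqxx /=; lia.
by apply: contraNneq => e1; rewrite expfzDr // -e1 -invr_expz expr1z divff.
Qed.

Lemma ex_unit (w w' : I) : perm_eq (ssval w) (ssval w') -> exists u, acts_unit u w w'.
Proof.
move=> p; suff [_ _] : unit_rel (ssval w) (ssval w') by apply.
apply: lattice_connected p; rewrite ?lword_lattice //.
- move=> s ls; split=> // v v' ev ev'.
  have -> : v' = v by apply: val_inj; rewrite /= ev ev'.
  have [u hu] := ex_proj v; exists u => f z; rewrite hu.
  by case: eqVneq => [->|_]; rewrite ?mul0r.
- move=> v u s [lv puv hu] [ls pvs hv]; split=> //; first exact: perm_trans puv pvs.
  move=> z z' ez ez'; have vI : v \in lattice_words b n n.
    by apply: (lword_perm (w := z)) => //; rewrite ez perm_sym.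
  have [u1 h1] := hu z (SeqSub vI) ez erefl.
  have [u2 h2] := hv (SeqSub vI) z' erefl ez'.
  by exists (u1 * u2) => f t; rewrite rhoM h1 h2 eqxx mul1r.
- move=> u l1 l2 v ne l l'; split=> //.
    by rewrite perm_cat2l (perm_catCA [:: l1] [:: l2]).
  move=> z z' ez ez'; have [u1 h1] := ex_proj z; have [u2 h2] := ex_proj z'.
  have nadj_uv := nonadj ne l l'.
  have kn : ((size u).+1 < n)%N by rewrite -(lword_size z) ez size_cat /=; lia.
  have na : ~~ adjacent (wt z (size u)) (wt z (size u).+1) by rewrite /wt ez.
  have szz' : sw (size u) z = z'.
    by apply: val_inj; rewrite /= sw_val // ez ez' swap_word_cat.
  have nz := Bc_neq0 (@good1 _ _ _ _ x_inf _ z kn) na.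
  have zz' : z != z'.
    apply: contra_not_neq ne => e; move: ez ez'; rewrite e => -> /eqP.
    by rewrite eqseq_cat // eqxx /= => /eqP[].
  exists (((Bc (wt z (size u)) (wt z (size u).+1))^-1)%:AC * (u1 * (R (size u) * u2))).
  move=> f t; rewrite rhoZ rhoM h1 rhoM rho_R; last by lia.
  rewrite /Rw; case: (eqVneq t z) => [->|_]; last by rewrite !mul0r mulr0.
  rewrite !mul1r mix_opE !h2 szz' eqxx (negbTE zz') mul0r mulr0 add0r mul1r.
  by rewrite mulKf.
Qed.

End Units.

(** * Split semisimplicity from matrix units *)

(** Matrix units of a product of matrix algebras, one for each class of the
    relation [r] on the index set. *)
Record matrix_units (K : fieldType) (B : pzAlgType K) (I : finType) (r : rel I)
    (mu : I -> I -> B) : Prop := {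
  mu_refl : reflexive r;
  mu_sym : symmetric r;
  mu_trans : transitive r;
  mu_sum : \sum_i mu i i = 1;
  mu_mul : forall i j k l, r i j -> r k l ->
    mu i j * mu k l = if j == k then mu i l else 0;
  mu_corner : forall i j h, r i j -> exists c : K, mu i i * h * mu j j = c%:AC * mu i j;
  mu_corner0 : forall i j h, ~~ r i j -> mu i i * h * mu j j = 0 }.

Lemma big_seq_sub (V : nmodType) (X : choiceType) (s : seq X) (F : X -> V) : uniq s ->
  \sum_(x <- s) F x = \sum_(i : seq_sub s) F (ssval i).
Proof.
move=> us; rewrite -(big_map (@ssval _ s) predT F); apply: perm_big.
apply: uniq_perm => //; first by rewrite map_inj_uniq ?index_enum_uniq //; exact: val_inj.
move=> x; apply/idP/mapP => [xs|[i _ ->]]; last exact: ssvalP.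
by exists (SeqSub xs); rewrite ?mem_index_enum.
Qed.

Section FaithfulAction.
Variables (K : fieldType) (b n : nat) (zeta binv q a : K).
Hypotheses (b_gt0 : (0 < b)%N) (n_gt0 : (0 < n)%N).
Hypothesis zeta_prim : b.-primitive_root zeta.
Hypothesis b_inv : binv * b%:R = 1.

Local Notation I := (lword b n).
Local Notation W := {ffun I -> K^o}.

Variables (B : pzAlgType K) (T : 'I_n -> B) (R : nat -> B).
Hypothesis yk : yokonuma b q a T R.
Hypothesis gen : forall P : B -> Prop,
    (forall c : K, P c%:AC) -> (forall j, P (T j)) -> (forall i, (i < n.-1)%N -> P (R i)) ->
    (forall u v, P u -> P v -> P (u + v)) ->
    (forall u v, P u -> P v -> P (u * v)) -> forall u, P u.
Variable rho : {rmorphism B -> endo W}.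
Hypothesis rho_cst : forall c : K, rho c%:AC = c%:AC.
Hypothesis rho_unit : forall w w' : I, perm_eq (ssval w) (ssval w') ->
  exists u, acts_unit rho u w w'.

Local Notation same w w' := (perm_eq (ssval w) (ssval w')).
Local Notation J := (seq_sub (idx n) * {ffun 'I_n -> 'I_b})%type.
Local Notation P := {p : I * I | same p.1 p.2}.

Let g (j : J) : B := char_proj b zeta binv T (fun k => (j.2 k).+1) * word_of R (ssval j.1).

Let delta (w : I) : W := [ffun v => (v == w)%:R].

Definition entry (u : B) (w w' : I) : K := rho u (delta w') w.

Let entryD u v w w' : entry (u + v) w w' = entry u w w' + entry v w w'.
Proof. by rewrite /entry rmorphD endo_addE [LHS]ffunE. Qed.

Let entryZ (c : K) u w w' : entry (c%:AC * u) w w' = c * entry u w w'.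
Proof. by rewrite /entry rmorphM rho_cst endo_mulE [LHS]ffunE. Qed.

Let entry_sum (A : Type) (s : seq A) (Q : pred A) (F : A -> B) w w' :
  entry (\sum_(k <- s | Q k) F k) w w' = \sum_(k <- s | Q k) entry (F k) w w'.
Proof.
rewrite (big_morph (fun u => entry u w w') (id1 := 0) (op1 := +%R)) //.
by rewrite /entry rmorph0 endo_zeroE [LHS]ffunE.
Qed.

Let entry_unit u w w' v v' : acts_unit rho u w w' -> entry u v v' = ((v == w) && (v' == w'))%:R.
Proof.
by rewrite /entry => ->; rewrite ffunE eq_sym [v' == _]eq_sym -natrM mulnb [w == _]eq_sym.
Qed.

Let spanning u : exists c : J -> K, u = \sum_j (c j)%:AC * g j.
Proof.
have [c ->] := yokonuma_span b_gt0 n_gt0 zeta_prim b_inv yk gen u.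
exists (fun j => c (ssval j.1) j.2).
rewrite (big_seq_sub _ (idx_uniq n)) pair_big /=; apply: eq_bigr => j _.
by rewrite mulrA.
Qed.

Let card_JP : #|{: J}| = #|{: P}|.
Proof.
rewrite card_prod card_seq_sub ?idx_uniq // size_idx card_ffun !card_ord.
rewrite mulnC -(sum_nwords b (leqnn n)) card_sig.
have us := lattice_words_uniq b n n.
rewrite -sum1_card (eq_bigl (fun p : I * I => same p.1 p.2)); last by move=> p; rewrite inE.
rewrite -(pair_big_dep predT (fun w w' : I => same w w') (fun _ _ => 1%N)) /=.
rewrite (big_seq_sub (V := nat) _ us); apply: eq_bigr => w _.
by rewrite /nwords -sum1_count big_mkcond (big_seq_sub (V := nat) _ us) [RHS]big_mkcond.
Qed.

Let g_free (c : J -> K) :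
  (forall w w', same w w' -> entry (\sum_j (c j)%:AC * g j) w w' = 0) -> forall j, c j = 0.
Proof.
move=> hc; apply: (@square_family_free _ _ _ (fun j (p : P) => entry (g j) (val p).1 (val p).2) card_JP).
  move=> p0; have [u hu] := rho_unit (valP p0); have [d ud] := spanning u.
  exists d => p; rewrite -[RHS]/((p == p0)%:R).
  transitivity (entry u (val p).1 (val p).2).
    by rewrite ud entry_sum; apply: eq_bigr => j _; rewrite entryZ.
  rewrite (entry_unit _ _ hu) -(inj_eq val_inj p p0).
  by case: (val p) => v v'; case: (val p0).
move=> p; rewrite -[RHS](hc _ _ (valP p)) entry_sum.
by apply: eq_bigr => j _; rewrite entryZ.
Qed.

(** The action is faithful: it is already injective on a spanning set of the
    same size as the sum of the squares of the dimensions. *)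
Lemma entry_inj u : (forall w w', same w w' -> entry u w w' = 0) -> u = 0.
Proof.
have [c ->] := spanning u => /g_free h.
by rewrite big1 // => j _; rewrite h rmorph0 mul0r.
Qed.

Lemma words_free (c : seq nat -> {ffun 'I_n -> 'I_b} -> K) :
  \sum_(p <- idx n) \sum_chi (c p chi)%:AC *
    char_proj b zeta binv T (fun k => (chi k).+1) * word_of R p = 0 ->
  forall p chi, p \in idx n -> c p chi = 0.
Proof.
move=> h p chi pn; have := @g_free (fun j => c (ssval j.1) j.2).
move/(_ _ (SeqSub pn, chi)); apply=> w w' _; rewrite [X in entry X](_ : _ = 0); last first.
  rewrite -[RHS]h (big_seq_sub _ (idx_uniq n)) pair_big /=; apply: eq_bigr => j _.
  by rewrite mulrA.
by rewrite /entry rmorph0 endo_zeroE ffunE.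
Qed.

Lemma ex_matrix_units : exists mu : I -> I -> B,
  matrix_units (fun w w' => same w w') mu /\
  forall w w', same w w' -> acts_unit rho (mu w w') w w'.
Proof.
have /choice[mu1 hmu1] : forall p : I * I, exists u, same p.1 p.2 -> acts_unit rho u p.1 p.2.
  move=> [w w'] /=; case: (boolP (same w w')) => [/rho_unit[u hu]|_]; last by exists 0.
  by exists u.
pose mu w w' := mu1 (w, w').
have hmu w w' : same w w' -> acts_unit rho (mu w w') w w' by exact: (hmu1 (w, w')).
have corner i j h v v' :
    entry (mu i i * h * mu j j) v v' = ((v == i) && (v' == j))%:R * entry h i j.
  rewrite /entry -mulrA rmorphM endo_mulE (hmu i i (perm_refl _)) rmorphM endo_mulE.
  have -> : rho (mu j j) (delta v') = (v' == j)%:R *: delta j.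
    apply/ffunP => z; rewrite (hmu j j (perm_refl _)) !ffunE /GRing.scale /=.
    by rewrite mulrC eq_sym.
  by rewrite endoZ [X in _ * X]ffunE mulrA -natrM mulnb.
exists mu; split=> //; split.
- by move=> w; apply: perm_refl.
- by move=> w w'; rewrite perm_sym.
- by move=> w w' w''; apply: perm_trans.
- apply/eqP; rewrite -subr_eq0; apply/eqP/entry_inj => v v' _.
  rewrite entryD -mulN1r -(rmorphN1 (@alg_const K B)) entryZ entry_sum.
  under eq_bigr do rewrite (entry_unit _ _ (hmu _ _ (perm_refl _))).
  rewrite /entry rmorph1 endo_oneE ffunE mulN1r; apply/eqP; rewrite subr_eq0; apply/eqP.
  rewrite (bigD1 v) //= eqxx big1 ?addr0 ?andTb ?[v' == v]eq_sym // => z ne.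
  by rewrite eq_sym (negbTE ne).
- move=> i j k l ij kl; apply/eqP; rewrite -subr_eq0; apply/eqP/entry_inj => v v' _.
  rewrite entryD -mulN1r -(rmorphN1 (@alg_const K B)) entryZ mulN1r.
  apply/eqP; rewrite subr_eq0; apply/eqP.
  rewrite {1}/entry rmorphM endo_mulE (hmu i j ij) (hmu k l kl).
  case: (eqVneq j k) => [e|ne]; last first.
    by rewrite mul0r mulr0 /entry rmorph0 endo_zeroE ffunE.
  subst k; rewrite mul1r (entry_unit _ _ (hmu i l _)); last exact: perm_trans ij kl.
  by rewrite ffunE -natrM mulnb [l == _]eq_sym.
- move=> i j h ij; exists (entry h i j).
  apply/eqP; rewrite -subr_eq0; apply/eqP/entry_inj => v v' _.
  rewrite entryD corner -mulN1r -(rmorphN1 (@alg_const K B)) !entryZ (entry_unit _ _ (hmu i j ij)).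
  by rewrite mulN1r mulrC subrr.
- move=> i j h ij; apply: entry_inj => v v' vv'; rewrite corner.
  case: andP => [[/eqP e /eqP e']|_]; last by rewrite mul0r.
  by move: vv' ij; rewrite e e' => ->.
Qed.

End FaithfulAction.

Local Open Scope classical_set_scope.

Section Submodules.
Variables (B : pzRingType) (M : lmodType B).

Lemma submodN (N : set M) u : is_submodule N -> N u -> N (- u).
Proof. by case=> _ _ NZ Nu; rewrite -scaleN1r; apply: NZ. Qed.

Lemma submodB (N : set M) u v : is_submodule N -> N u -> N v -> N (u - v).
Proof. by move=> hN Nu Nv; have [_ ND _] := hN; apply: ND => //; apply: submodN. Qed.

Lemma submod_sum (N : set M) (A : Type) (s : seq A) (P : pred A) (F : A -> M) :
  is_submodule N -> (forall i, P i -> N (F i)) -> N (\sum_(i <- s | P i) F i).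
Proof. by case=> N0 ND _ NF; elim/big_ind: _. Qed.

Lemma submod_cyclic (v : M) : is_submodule [set u | exists h : B, u = h *: v].
Proof.
split=> [|_ _ [h ->] [h' ->]|c _ [h ->]] /=; first by exists 0; rewrite scale0r.
- by exists (h + h'); rewrite scalerDl.
- by exists (c * h); rewrite scalerA.
Qed.

(** A complement of N is built by adding those of the given generators that
    are not yet reached. *)
Lemma semisimple_of_generators (A : finType) (v : A -> M) :
  (forall u, exists h : A -> B, u = \sum_i h i *: v i) ->
  (forall i (N : set M), is_submodule N -> N (v i) \/ forall h, N (h *: v i) -> h *: v i = 0) ->
  semisimple_module M.
Proof.
move=> vgen vdich N hN; have [N0 ND NZ] := hN.
suff [N' [hN' disj cover]] : exists N' : set M, [/\ is_submodule N',
    forall u, N u -> N' u -> u = 0 &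
    forall i, i \in enum A -> exists u w, [/\ N u, N' w & v i = u + w]].
  exists N'; split=> // u; have [h ->] := vgen u.
  have S : is_submodule [set u | exists x y, [/\ N x, N' y & u = x + y]].
    have [N'0 N'D N'Z] := hN'; split=> [|_ _ [x [y [Nx Ny ->]]] [x' [y' [Nx' Ny' ->]]]|c _ [x [y [Nx Ny ->]]]].
    - by exists 0, 0; rewrite addr0.
    - by exists (x + x'), (y + y'); rewrite addrACA; split=> //; [apply: ND|apply: N'D].
    - by exists (c *: x), (c *: y); rewrite scalerDr; split=> //; [apply: NZ|apply: N'Z].
  apply: (submod_sum _ S) => i _; have [_ _ SZ] := S; apply: SZ.
  by apply: cover; rewrite mem_enum.
elim: (enum A) => [|i s [N' [hN' disj cover]]].
  exists [set 0]; split; [|by move=> u _ ->|by []].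
  by split=> [|_ _ -> ->|c _ ->]; rewrite /= ?addr0 ?scaler0.
have [N'0 N'D N'Z] := hN'.
pose S := [set u | exists x y, [/\ N x, N' y & u = x + y]].
have hS : is_submodule S.
  split=> [|_ _ [x [y [Nx Ny ->]]] [x' [y' [Nx' Ny' ->]]]|c _ [x [y [Nx Ny ->]]]].
  - by exists 0, 0; rewrite addr0.
  - by exists (x + x'), (y + y'); rewrite addrACA; split=> //; [apply: ND|apply: N'D].
  - by exists (c *: x), (c *: y); rewrite scalerDr; split=> //; [apply: NZ|apply: N'Z].
have [Si|Si] := vdich i S hS.
  exists N'; split=> // j; rewrite in_cons => /orP[/eqP ->|/cover //].
  by have [x [y [Nx Ny ->]]] := Si; exists x, y.
exists [set u | exists y h, N' y /\ u = y + h *: v i]; split.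
- split=> [|_ _ [y [h [Ny ->]]] [y' [h' [Ny' ->]]]|c _ [y [h [Ny ->]]]] /=.
  + by exists 0, 0; rewrite scale0r addr0.
  + by exists (y + y'), (h + h'); rewrite scalerDl addrACA; split=> //; apply: N'D.
  + by exists (c *: y), (c * h); rewrite scalerDr scalerA; split=> //; apply: N'Z.
- move=> u Nu [y [h [Ny eu]]]; subst u.
  have e : h *: v i = 0.
    apply: Si; exists (y + h *: v i), (- y); split=> //; first exact: submodN.
    by rewrite addrAC subrr add0r.
  by move: Nu; rewrite e addr0 => Nu; apply: disj.
- move=> j; rewrite in_cons => /orP[/eqP ->|/cover[x [y [Nx Ny ->]]]].
    by exists 0, (v i); split=> //; [exists 0, 1; rewrite scale1r add0r|rewrite add0r].
  by exists x, y; split=> //; exists y, 0; rewrite scale0r addr0.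
Qed.

End Submodules.

Section MatrixUnitModules.
Variables (K : fieldType) (B : pzAlgType K) (I : finType) (r : rel I) (mu : I -> I -> B).
Hypothesis hmu : matrix_units r mu.

Let refl i : r i i := mu_refl hmu i.

Definition of_type (M : lmodType B) (w : I) := exists v : M,
  [/\ v != 0, mu w w *: v = v,
      forall u, exists c : K, mu w w *: u = c%:AC *: v & forall u, exists h, u = h *: v].

Let cst_scale (M : lmodType B) (c : K) (v : M) : c != 0 -> (c^-1)%:AC *: (c%:AC *: v) = v.
Proof. by move=> nc; rewrite scalerA -rmorphM mulVf // rmorph1 scale1r. Qed.

Let scale_cst (M : lmodType B) (c : K) h (v : M) : h *: (c%:AC *: v) = c%:AC *: (h *: v).
Proof. by rewrite !scalerA alg_const_central. Qed.

Let decomp (M : lmodType B) (u : M) : u = \sum_i mu i i *: u.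
Proof. by rewrite -scaler_suml (mu_sum hmu) scale1r. Qed.

Let nonzero_part (M : lmodType B) (u : M) : u != 0 -> exists i, mu i i *: u != 0.
Proof.
move=> nu; apply: contrapT => h; move/eqP: nu; apply; rewrite [u]decomp big1 // => i _.
by apply: contrapT => /eqP ni; apply: h; exists i.
Qed.

Let part (M : lmodType B) (v : M) w i h : mu w w *: v = v ->
  exists c : K, mu i i *: (h *: v) = c%:AC *: (mu i w *: v) /\ (c != 0 -> r i w).
Proof.
move=> vw; rewrite -{1}vw !scalerA; case riw : (r i w).
  by have [c e] := mu_corner hmu h riw; exists c; rewrite e scalerA.
by exists 0; rewrite (mu_corner0 hmu) ?riw // rmorph0 !scale0r eqxx; split.
Qed.

Let unit_scale (M : lmodType B) (v : M) i w : mu w w *: v = v -> r i w -> mu w i *: (mu i w *: v) = v.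
Proof.
by move=> vw riw; rewrite scalerA (mu_mul hmu) ?eqxx // (mu_sym hmu).
Qed.

Let unit_part (M : lmodType B) (N : set M) (v : M) w h : is_submodule N -> mu w w *: v = v ->
  N (h *: v) -> h *: v != 0 -> N v.
Proof.
move=> hN vw Nh nz; have [_ _ NZ] := hN; have [i ni] := nonzero_part nz.
have [c [e rc]] := part i h vw.
have nc : c != 0 by apply: contraNneq ni => c0; rewrite e c0 rmorph0 scale0r.
have -> : v = ((c^-1)%:AC * mu w i) *: (mu i i *: (h *: v)).
  by rewrite e -scalerA scale_cst cst_scale // unit_scale // rc.
by apply: (NZ); apply: (NZ).
Qed.

Lemma of_type_simple M w : of_type M w -> simple_module M.
Proof.
move=> [v [v0 vw _ vgen]]; split; first by exists v.
move=> N hN; have [N0 _ NZ] := hN.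
have [[u [Nu nu]]|h] := pselect (exists u, N u /\ u != 0); [right|left].
  have Nv : N v by have [h eu] := vgen u; apply: (unit_part (h := h)) vw _ _; rewrite -?eu.
  by apply/seteqP; split=> // z _; have [h ->] := vgen z; apply: NZ.
apply/seteqP; split=> [z Nz|_ -> //] /=; apply: contrapT => /eqP nz.
by apply: h; exists z.
Qed.

Lemma of_type_rel M w w' : of_type M w -> r w w' -> of_type M w'.
Proof.
move=> [v [v0 vw vc vgen]] rww'; have rw'w : r w' w by rewrite (mu_sym hmu).
exists (mu w' w *: v); split.
- by apply: contraNneq v0 => e; rewrite -(unit_scale vw rw'w) e scaler0.
- by rewrite scalerA (mu_mul hmu) ?eqxx.
- by move=> u; have [h ->] := vgen u; have [c [e _]] := part w' h vw; exists c.
- move=> u; have [h ->] := vgen u; exists (h * mu w w').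
  by rewrite -scalerA unit_scale.
Qed.

Lemma simple_of_type M : simple_module M -> exists w, of_type M w.
Proof.
move=> [[u u0] simp]; have [w v0] := nonzero_part u0; exists w, (mu w w *: u).
have vw : mu w w *: (mu w w *: u) = mu w w *: u by rewrite scalerA (mu_mul hmu) ?eqxx.
have vgen z : exists h, z = h *: (mu w w *: u).
  have [e|e] := simp _ (submod_cyclic (mu w w *: u)).
    have : [set z | exists h, z = h *: (mu w w *: u)] (mu w w *: u) by exists 1; rewrite scale1r.
    by rewrite e /= => e0; rewrite e0 eqxx in v0.
  by have : [set: M] z by []; rewrite -e.
split=> // z; have [h ->] := vgen z; have [c [e _]] := part w h vw.
by exists c; rewrite e vw.
Qed.

Let transfer (M M' : lmodType B) (v : M) (v' : M') w h :
  v != 0 -> mu w w *: v = v -> mu w w *: v' = v' -> h *: v = 0 -> h *: v' = 0.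
Proof.
move=> v0 vw vw' hv; rewrite [LHS]decomp big1 // => i _.
rewrite -vw' !scalerA; case riw : (r i w); last by rewrite (mu_corner0 hmu) ?riw ?scale0r.
have [c e] := mu_corner hmu h riw; rewrite e.
suff -> : c = 0 by rewrite rmorph0 mul0r scale0r.
apply/eqP/negPn/negP => nc; move/eqP: v0; apply.
have e2 : c%:AC *: (mu i w *: v) = 0 by rewrite scalerA -e -!scalerA vw hv scaler0.
by rewrite -(unit_scale vw riw) -[mu i w *: v](cst_scale _ nc) e2 !scaler0.
Qed.

Lemma of_type_iso M M' w : of_type M w -> of_type M' w -> isomorphic_modules M M'.
Proof.
move=> [v [v0 vw _ vgen]] [v' [v0' vw' _ vgen']].
have /choice[h hh] := vgen; have /choice[h' hh'] := vgen'.
pose f u := h u *: v'; pose f' u := h' u *: v.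
have fE k : f (k *: v) = k *: v'.
  apply/eqP; rewrite -subr_eq0 -scalerBl; apply/eqP/(transfer v0 vw vw').
  by rewrite scalerBl -hh subrr.
have fE' k : f' (k *: v') = k *: v.
  apply/eqP; rewrite -subr_eq0 -scalerBl; apply/eqP/(transfer v0' vw' vw).
  by rewrite scalerBl -hh' subrr.
have f_lin : linear f.
  move=> k u z; rewrite {1}(hh u) {1}(hh z) scalerA -scalerDl fE scalerDl -scalerA.
  by rewrite /f.
pose m := GRing.isLinear.Build _ _ _ _ f f_lin.
pose F : {linear M -> M'} := HB.pack f m.
exists F; exists f' => u /=.
- by rewrite {1}(hh u) fE fE' -hh.
- by rewrite {1}(hh' u) fE' fE -hh'.
Qed.

Lemma of_type_uniq M M' w w' : isomorphic_modules M M' -> of_type M w -> of_type M' w' -> r w w'.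
Proof.
move=> [f [g fg gf]] [v [v0 vw _ _]] [v' [v0' vw' _ vgen']].
apply: contraNT v0 => nr; rewrite -(inj_eq (can_inj fg)) linear0.
rewrite -{1}vw linearZ /=; have [h ->] := vgen' (f v).
by rewrite -vw' !scalerA (mu_corner0 hmu) // scale0r.
Qed.

Lemma of_type_scalar (M : lmodType B) w (f : {linear M -> M}) : of_type M w ->
  exists c : K, forall u, f u = c%:AC *: u.
Proof.
move=> [v [v0 vw vc vgen]]; have [c e] := vc (f v).
exists c => u; have [h ->] := vgen u.
by rewrite linearZ /= -{1}vw linearZ /= e scale_cst.
Qed.

Lemma matrix_units_split_semisimple : split_semisimple B.
Proof.
split; last first.
  by move=> M /simple_of_type[w hw] f; exact: of_type_scalar hw.
pose v (i : I) : B^o := mu i i.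
apply: (@semisimple_of_generators _ (B^o : lmodType B) I v) => [u|i N hN].
  exists (fun=> u : B); rewrite -scaler_sumr.
  by rewrite -[u in LHS]mulr1 -(mu_sum hmu).
have vi : mu i i *: v i = v i by rewrite /v /GRing.scale /= (mu_mul hmu) ?eqxx.
have [Ni|nNi] := pselect (N (v i)); [by left|right=> h Nh].
by apply: contrapT => /eqP nz; apply: nNi; apply: unit_part hN vi Nh nz.
Qed.

End MatrixUnitModules.

(** * The algebras over the ground ring and its quotient field *)

(** Restriction of scalars. *)
Definition restrict_scalars (R S : comPzRingType) (phi : {rmorphism R -> S})
  (E : pzAlgType S) : Type := E.

Section Restrict.
Variables (R S : comPzRingType) (phi : {rmorphism R -> S}) (E : pzAlgType S).

HB.instance Definition _ := GRing.PzRing.on (restrict_scalars phi E).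

Let restrict_cst (c : R) : restrict_scalars phi E := (phi c)%:AC.

Let restrict_nmod : nmod_morphism restrict_cst.
Proof. by split=> [|c d]; rewrite /restrict_cst ?rmorph0 ?rmorphD. Qed.
Let restrict_monoid : monoid_morphism restrict_cst.
Proof. by split=> [|c d]; rewrite /restrict_cst ?rmorph1 ?rmorphM. Qed.
Let restrict_central (c : R) (x : restrict_scalars phi E) : restrict_cst c * x = x * restrict_cst c.
Proof. exact: alg_const_central. Qed.
HB.instance Definition _ := PzRing_isAlgebraOver.Build R (restrict_scalars phi E)
  restrict_nmod restrict_monoid restrict_central.

Lemma restrict_cstE (c : R) : (c%:AC : restrict_scalars phi E) = (phi c)%:AC.
Proof. by []. Qed.

End Restrict.

Definition nat_index (V : Type) (d : V) (n : nat) (f : 'I_n -> V) (i : nat) : V :=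
  if insub i is Some o then f o else d.

Lemma nat_indexE (V : Type) (d : V) n (f : 'I_n -> V) (i : 'I_n) : nat_index d f i = f i.
Proof. by rewrite /nat_index valK. Qed.

Lemma Zqa_eval_q (S : comNzRingType) (u v : S) : Zqa_eval u v qZ = u.
Proof.
by rewrite /Zqa_eval /= /qZ map_polyC /= /horner_eval hornerC /= map_polyX hornerX.
Qed.

Lemma Zqa_eval_a (S : comNzRingType) (u v : S) : Zqa_eval u v aZ = v.
Proof. by rewrite /Zqa_eval /= /aZ map_polyX /horner_eval hornerX. Qed.

Section YAlgebra.
Variables (b n : nat).

Local Notation Y := (yalg b n).

Let yT_b j : yT b j ^+ b = 1 :> Y.
Proof. by have := pres_rel (yrel_Tb b j); rewrite rmorphXn rmorph1. Qed.
Let yT_comm j j' : yT b j * yT b j' = yT b j' * yT b j :> Y.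
Proof. by have := pres_rel (yrel_TT b j j'); rewrite !rmorphM. Qed.
Let yTR j i : yT b j * yR b i = yR b i * yT b (tperm (ord_lo i) (ord_hi i) j) :> Y.
Proof. by have := pres_rel (yrel_TR b j i); rewrite !rmorphM. Qed.
Let yR_far (i i' : 'I_n.-1) : far i i' -> yR b i * yR b i' = yR b i' * yR b i :> Y.
Proof. by move=> h; have := pres_rel (yrel_RR b h); rewrite !rmorphM. Qed.
Let yR_braid (i i' : 'I_n.-1) : i' = i.+1 :> nat ->
  yR b i * yR b i' * yR b i = yR b i' * yR b i * yR b i' :> Y.
Proof. by move=> h; have := pres_rel (yrel_braid b h); rewrite !rmorphM. Qed.
Let yR_quad (i : 'I_n.-1) : yR b i * yR b i = qZ%:AC +
    aZ%:AC * yT b (ord_lo i) ^+ ((b ^ 2 - b) %/ 2) *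
      (\sum_(k < b) yT b (ord_lo i) ^+ k * yT b (ord_hi i) ^+ (b - k)) * yR b i :> Y.
Proof.
have := pres_rel (yrel_quad b i).
rewrite rmorphXn rmorphD !rmorphM rmorphXn /yE rmorph_sum expr2 => ->.
congr (_ + _ * _ * _ * _); apply: eq_bigr => k _.
by rewrite rmorphM !rmorphXn.
Qed.

(** The defining relations, in any algebra over S to which the generic algebra
    is mapped. *)
Lemma yalg_yokonuma (S : comNzRingType) (phi : {rmorphism Zqa -> S}) (E : pzAlgType S)
    (f : {rmorphism Y -> E}) :
  (forall c : Zqa, f c%:AC = (phi c)%:AC) ->
  yokonuma b (phi qZ) (phi aZ) (fun j => f (yT b j)) (nat_index 0 (fun i => f (yR b i))).
Proof.
move=> fc; split.
- by move=> j; rewrite -(rmorphXn f) yT_b rmorph1.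
- by move=> j j'; rewrite -!(rmorphM f) yT_comm.
- by move=> j i; rewrite nat_indexE -!(rmorphM f) yTR.
- move=> i j jn ij; have inn : (i < n.-1)%N by lia.
  rewrite -[ i ]/(val (Ordinal inn)) -[j]/(val (Ordinal jn)) !nat_indexE.
  by rewrite -!(rmorphM f) yR_far // /far ij.
- move=> i jn; have inn : (i < n.-1)%N by lia.
  rewrite -[i.+1]/(val (Ordinal jn)) -[ i ]/(val (Ordinal inn)) !nat_indexE.
  by rewrite -!(rmorphM f) (yR_braid (i := Ordinal inn) (i' := Ordinal jn)).
- move=> i; rewrite nat_indexE -(rmorphM f) yR_quad (rmorphD f) !(rmorphM f) (rmorphXn f) (rmorph_sum f).
  rewrite -!fc; congr (_ + _ * _ * _ * _).
  by apply: eq_bigr => k _; rewrite (rmorphM f) !(rmorphXn f).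
Qed.

Lemma yalg_lift (S : comNzRingType) (phi : {rmorphism Zqa -> S}) (E : pzAlgType S) (T : 'I_n -> E) (R : nat -> E) :
  yokonuma b (phi qZ) (phi aZ) T R ->
  exists f : {rmorphism Y -> E},
    [/\ forall c : Zqa, f c%:AC = (phi c)%:AC, forall j, f (yT b j) = T j
      & forall i : 'I_n.-1, f (yR b i) = R i].
Proof.
move=> yk; pose E' : pzAlgType Zqa := restrict_scalars phi E.
pose g (x : ygen n) : E' := match x with GenT j => T j | GenR i => R i end.
have [u v|f [fc fg]] := @pres_lift _ _ (yrel b (n := n)) E' g.
  case=> [j|j j'|j i|i i' ii'|i i' ii'|i].
  - by rewrite rmorphXn rmorph1 /= free_lift_gen (yk_Tb yk).
  - by rewrite !rmorphM /= !free_lift_gen (yk_TT yk).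
  - by rewrite !rmorphM /= !free_lift_gen (yk_TR yk).
  - rewrite !rmorphM /= !free_lift_gen /=; case/orP: ii' => h.
      exact: (yk_far yk).
    by apply/esym; exact: (yk_far yk).
  - rewrite !rmorphM /= !free_lift_gen /= ii'; apply: (yk_braid yk).
    by rewrite -ii'.
  - rewrite rmorphXn rmorphD !rmorphM rmorphXn /= /yE rmorph_sum /=.
    rewrite !free_lift_gen !free_lift_cst expr2 /= (yk_quad yk i).
    congr (_ + _ * _ * _ * _); apply: eq_bigr => k _.
    by rewrite rmorphM !rmorphXn /= !free_lift_gen.
exists f; split=> [c|j|i]; first exact: fc.
- exact: (fg (GenT j)).
- exact: (fg (GenR i)).
Qed.

End YAlgebra.

Lemma inj_primitive_root (R S : idomainType) (f : {rmorphism R -> S}) m z :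
  injective f -> m.-primitive_root z -> m.-primitive_root (f z).
Proof.
move=> fI /andP[m0 /forallP h]; rewrite /primitive_root_of_unity m0 /=.
apply/forallP => i; have := h i; rewrite !unity_rootE.
by rewrite -(rmorphXn f) -(rmorph1 f) (inj_eq fI).
Qed.

Lemma inj_primitive_root_inv (R S : idomainType) (f : {rmorphism R -> S}) m z :
  injective f -> m.-primitive_root (f z) -> m.-primitive_root z.
Proof.
move=> fI /andP[m0 /forallP h]; rewrite /primitive_root_of_unity m0 /=.
apply/forallP => i; have := h i; rewrite !unity_rootE.
by rewrite -(rmorphXn f) -[in X in X -> _](rmorph1 f) (inj_eq fI).
Qed.

Lemma hoef_b_a (F : fieldType) (x y : F) (k : int) : y != 0 -> x ^ k != 1 ->
  hoef_b x y k = hoef_a x y k + y^-1.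
Proof.
rewrite /hoef_a /hoef_b => y0; move: (x ^ k) => X X1.
have h : 1 - X != 0 by rewrite subr_eq0 eq_sym.
by field; rewrite y0.
Qed.

Lemma eq_divr_of_mul (F : fieldType) (t u v : F) : v != 0 -> t * v = u -> t = u / v.
Proof. by move=> nv <-; rewrite mulfK. Qed.

Lemma frac_inv_flip (F : fieldType) (t y X : F) :
  y != 0 -> X != 0 -> X - 1 != 0 -> 1 - X^-1 != 0 ->
  t * X = t / (y * (1 - X^-1)) * (y * (X - 1)).
Proof. by move=> y0 X0 X1 X2; field; rewrite ?y0 ?X0 ?X1. Qed.

Section GroundFacts.
Variables (L : fieldType) (n b : nat) (q a zeta s : L).
Hypothesis n_gt0 : (0 < n)%N.
Hypothesis b_gt0 : (0 < b)%N.
Hypothesis q0 : q != 0.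
Hypothesis two0 : (2%:R : L) != 0.
Hypothesis b0 : (b%:R : L) != 0.
Hypothesis s_sqr : s ^+ 2 = b%:R ^+ 2 * a ^+ 2 + 4%:R * q.
Hypothesis x_ninf : forall k, (0 < k)%N -> (xL b q a s) ^+ k != 1.
Hypothesis zeta_primL : b.-primitive_root zeta.

Local Notation A := (ground n b q a zeta s).
Local Notation K := (fracA n b q a zeta s).
Local Notation x := (xL b q a s).
Local Notation y := (yL b q a s).
Local Notation qA := (qA n b q a zeta s).
Local Notation aA := (aA n b q a zeta s).
Local Notation zetaA := (zetaA n b q a zeta s).
Local Notation inA := (in_ground n b q a zeta s).
Local Notation gval := (@Defs.gval L n b q a zeta s).

Let four0 : (4%:R : L) != 0.
Proof. by rewrite (natrM L 2 2) mulf_neq0. Qed.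

Lemma yL_inv : y * ((s - b%:R * a) / 2%:R) = 1.
Proof.
rewrite /yL; transitivity ((s ^+ 2 - b%:R ^+ 2 * a ^+ 2) / (4%:R * q)).
  by field; rewrite q0 four0 two0.
rewrite s_sqr addrAC subrr add0r divff // mulf_neq0 //; exact: four0.
Qed.

Lemma yL_neq0 : y != 0.
Proof. by apply: contra_eq_neq yL_inv => ->; rewrite mul0r eq_sym oner_eq0. Qed.

Lemma xLE : x = q * y ^+ 2.
Proof.
rewrite /xL /yL.
transitivity ((b%:R ^+ 2 * a ^+ 2 + 2%:R * (b%:R * a * s) + s ^+ 2) / (4%:R * q)); last first.
  by field; rewrite ?q0 ?four0 ?two0.
by rewrite s_sqr; field; rewrite ?q0 ?four0 ?two0.
Qed.

Lemma xL_neq0 : x != 0.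
Proof. by rewrite xLE mulf_neq0 // expf_neq0 // yL_neq0. Qed.

Lemma qLE : q = x / y ^+ 2.
Proof. by rewrite xLE mulfK // expf_neq0 // yL_neq0. Qed.

Lemma baLE : b%:R * a = (x - 1) / y.
Proof.
apply: (mulIf yL_neq0); rewrite divfK ?yL_neq0 // xLE.
apply: (mulIf (x := (s - b%:R * a) / 2%:R)).
  by apply: contra_eq_neq yL_inv => ->; rewrite mulr0 eq_sym oner_eq0.
have -> : (q * y ^+ 2 - 1) * ((s - b%:R * a) / 2%:R) =
    q * y * (y * ((s - b%:R * a) / 2%:R)) - (s - b%:R * a) / 2%:R by ring.
rewrite -mulrA yL_inv !mulr1.
by rewrite /yL; field; rewrite ?q0 ?four0 ?two0.
Qed.

Lemma xL_inf (k : int) : k != 0 -> x ^ k != 1.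
Proof.
case: k => k k0; first by apply: x_ninf; rewrite lt0n.
rewrite NegzE -invr_expz; apply: contraNneq (x_ninf (ltn0Sn k)) => e.
by rewrite exprnP -[_ ^ _]invrK e invr1.
Qed.

Lemma geom_neq0 k : \sum_(i < k.+1) x ^+ i != 0.
Proof.
have := subrX1 x k.+1; apply: contra_eq_neq => ->.
by rewrite mulr0 subr_eq0 x_ninf.
Qed.

Lemma ground_closedT : ground_closed n b q a zeta s [set: L].
Proof.
split=> // [|k _]; last by split=> //; exists (\sum_(i < k.+1) x ^+ i)^-1; rewrite // divff // geom_neq0.
by split; split=> //; [exists 2%:R^-1|exists b%:R^-1|exists q^-1]; rewrite // divff.
Qed.

Lemma inA_inv2 : inA 2%:R^-1.
Proof.
apply/in_groundP => B [_ _ [[_ [v Bv e]] _ _] _].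
by have -> : 2%:R^-1 = v by apply: (mulfI two0); rewrite divff.
Qed.

Lemma inA_invb : inA b%:R^-1.
Proof.
apply/in_groundP => B [_ _ [_ [_ [v Bv e]] _] _].
by have -> : b%:R^-1 = v by apply: (mulfI b0); rewrite divff.
Qed.

Lemma inA_invq : inA q^-1.
Proof.
apply/in_groundP => B [_ _ [_ _ [_ [v Bv e]]] _].
by have -> : q^-1 = v by apply: (mulfI q0); rewrite divff.
Qed.

Lemma inA_geom k : (k <= n - 2)%N -> inA (\sum_(i < k.+1) x ^+ i)^-1.
Proof.
move=> kn; apply/in_groundP => B hB; case: (hB) => -[B1 _ _] _ _ hk.
case: k kn => [|k] kn; first by rewrite big_ord1 expr0 invr1.
have [|_ [v Bv e]] := hk k.+1; first by rewrite kn.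
have -> // : (\sum_(i < k.+2) x ^+ i)^-1 = v.
by apply: (mulfI (geom_neq0 k.+1)); rewrite divff ?geom_neq0.
Qed.

Lemma inA_s : inA s. Proof. by apply/in_groundP => B [_ [? ? ? ?]]. Qed.

Lemma gvalM (u v : A) : gval (u * v) = gval u * gval v. Proof. exact: (rmorphM val). Qed.
Lemma gvalD (u v : A) : gval (u + v) = gval u + gval v. Proof. exact: (rmorphD val). Qed.
Lemma gvalB (u v : A) : gval (u - v) = gval u - gval v. Proof. exact: (rmorphB val). Qed.
Lemma gvalN (u : A) : gval (- u) = - gval u. Proof. exact: (rmorphN val). Qed.
Lemma gval1 : gval (1 : A) = 1. Proof. exact: (rmorph1 val). Qed.
Lemma gval0 : gval (0 : A) = 0. Proof. exact: (rmorph0 val). Qed.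
Lemma gvalX (u : A) k : gval (u ^+ k) = gval u ^+ k. Proof. exact: (rmorphXn val). Qed.
Lemma gval_nat k : gval (k%:R : A) = k%:R. Proof. exact: (rmorph_nat val). Qed.
Lemma gval_inj : injective gval. Proof. exact: val_inj. Qed.
Lemma gval_toA z : inA z -> gval (toA n b q a zeta s z) = z.
Proof. by move=> hz; apply: insubdK. Qed.

Definition gvalE := (gvalM, gvalD, gvalB, gvalN, gval1, gval0, gvalX, gval_nat).

Lemma inA_M u v : inA u -> inA v -> inA (u * v).
Proof. by move=> hu hv; have := valP (Ground hu * Ground hv : A); rewrite -[val _]/(gval _) gvalM. Qed.
Lemma inA_D u v : inA u -> inA v -> inA (u + v).
Proof. by move=> hu hv; have := valP (Ground hu + Ground hv : A); rewrite -[val _]/(gval _) gvalD. Qed.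
Lemma inA_N u : inA u -> inA (- u).
Proof. by move=> hu; have := valP (- Ground hu : A); rewrite -[val _]/(gval _) gvalN. Qed.
Lemma inA_X u k : inA u -> inA (u ^+ k).
Proof. by move=> hu; have := valP (Ground hu ^+ k : A); rewrite -[val _]/(gval _) gvalX. Qed.
Lemma inA_nat k : inA k%:R.
Proof. by have := valP (k%:R : A); rewrite -[val _]/(gval _) gval_nat. Qed.

Lemma inA_y : inA y.
Proof.
rewrite /yL invfM; apply: inA_M; last by apply: inA_M; [exact: inA_inv2|exact: inA_invq].
by apply: inA_D inA_s; apply: inA_M; [exact: inA_nat|exact: in_ground_a].
Qed.

Lemma inA_yV : inA y^-1.
Proof.
have -> : y^-1 = (s - b%:R * a) / 2%:R by apply: (mulfI yL_neq0); rewrite yL_inv divff ?yL_neq0.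
apply: inA_M; last exact: inA_inv2.
by apply: inA_D inA_s _; apply/inA_N/inA_M; [exact: inA_nat|exact: in_ground_a].
Qed.

Lemma inA_x : inA x.
Proof. by rewrite xLE; apply: inA_M; [exact: in_ground_q|apply/inA_X/inA_y]. Qed.

Lemma inA_xV : inA x^-1.
Proof.
by rewrite xLE invfM; apply: inA_M; [exact: inA_invq|rewrite -exprVn; apply/inA_X/inA_yV].
Qed.

Definition xA : A := Ground inA_x.
Definition yA : A := Ground inA_y.
Definition bV : A := Ground inA_invb.
Definition root_plus : A := qA * yA.

Lemma bV_inv : bV * b%:R = 1.
Proof. by apply: gval_inj; rewrite !gvalE /= mulVf. Qed.

Lemma root_plus_quad : root_plus * root_plus = qA + b%:R * aA * root_plus.
Proof.
apply: gval_inj; rewrite /root_plus !gvalE /=.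
have := qLE; have := baLE; have := yL_neq0; move: (x) (y) => X Y Y0 -> ->.
by field; rewrite Y0.
Qed.

Lemma qA_E : qA * yA ^+ 2 = xA.
Proof. by apply: gval_inj; rewrite !gvalE /= xLE. Qed.

Lemma baA_E : b%:R * aA * yA = xA - 1.
Proof. by apply: gval_inj; rewrite !gvalE /= baLE divfK // yL_neq0. Qed.

Lemma zetaA_prim : b.-primitive_root zetaA.
Proof. exact: (@inj_primitive_root_inv A L val _ _ gval_inj). Qed.

Let tofrac_inj : injective (@tofrac A). Proof. by move=> u v /eqP; rewrite tofrac_eq => /eqP. Qed.
Local Notation toK := (@tofrac A).

Definition xK : K := toK xA.
Definition yK : K := toK yA.

Lemma yK_neq0 : yK != 0.
Proof.
rewrite /yK -(rmorph0 toK) (inj_eq tofrac_inj) -(inj_eq gval_inj) gval0.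
exact: yL_neq0.
Qed.

Lemma xK_neq0 : xK != 0.
Proof.
rewrite /xK -(rmorph0 toK) (inj_eq tofrac_inj) -(inj_eq gval_inj) gval0.
exact: xL_neq0.
Qed.

Lemma qK_E : toK qA = xK / yK ^+ 2.
Proof.
apply: (mulIf (expf_neq0 2 yK_neq0)); rewrite divfK ?expf_neq0 ?yK_neq0 //.
by rewrite -rmorphXn -rmorphM qA_E.
Qed.

Lemma baK_E : b%:R * toK aA = (xK - 1) / yK.
Proof.
apply: (mulIf yK_neq0); rewrite divfK ?yK_neq0 //.
by rewrite -(rmorph_nat toK) -!rmorphM baA_E rmorphB rmorph1.
Qed.

Lemma xK_inf (k : int) : k != 0 -> xK ^ k != 1.
Proof.
have nz m : xK ^+ m.+1 != 1.
  rewrite -rmorphXn -(rmorph1 toK) (inj_eq tofrac_inj) -(inj_eq gval_inj) gvalX gval1.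
  exact: x_ninf.
case: k => [[|k]|k] // _; first exact: nz.
rewrite NegzE -invr_expz; apply: contraNneq (nz k) => e.
by rewrite exprnP -[_ ^ _]invrK e invr1.
Qed.

Lemma zetaK_prim : b.-primitive_root (toK zetaA).
Proof. exact: (inj_primitive_root tofrac_inj zetaA_prim). Qed.

Lemma bVK_inv : toK bV * b%:R = 1.
Proof. by rewrite -(rmorph_nat toK) -rmorphM bV_inv rmorph1. Qed.

(** The coefficients of Hoefsmit's modules lie in the ground ring for all axial
    distances that occur. *)
Definition distance_ok (k : int) := (k != 0) && (`|k| < n)%N.

Lemma inA_hoef_a k : distance_ok k -> inA (hoef_a x y k).
Proof.
have pos m : (m.+1 < n)%N -> inA ((x - 1) / (1 - x ^+ m.+1)).
  move=> mn; have -> : (x - 1) / (1 - x ^+ m.+1) = - (\sum_(i < m.+1) x ^+ i)^-1.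
    have g0 := geom_neq0 m; have d0 : 1 - x ^+ m.+1 != 0 by rewrite subr_eq0 eq_sym x_ninf.
    apply: (mulIf g0); rewrite mulNr mulVf // mulrAC -subrX1.
    by apply: (mulIf d0); rewrite divfK //; ring.
  by apply/inA_N/inA_geom; lia.
case: k => [[|k]|k] /andP[// k0 kn]; rewrite /hoef_a invfM mulrCA.
  by apply: inA_M; [exact: inA_yV|exact: pos].
apply: inA_M; first exact: inA_yV.
rewrite NegzE -invr_expz -exprnP.
have -> : (x - 1) / (1 - (x ^+ k.+1)^-1) = - (x ^+ k.+1 * ((x - 1) / (1 - x ^+ k.+1))).
  have X0 : x ^+ k.+1 != 0 by rewrite expf_neq0 // xL_neq0.
  have X1 : 1 - x ^+ k.+1 != 0 by rewrite subr_eq0 eq_sym x_ninf.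
  have X2 : x ^+ k.+1 - 1 != 0 by rewrite subr_eq0 x_ninf.
  move: (x ^+ k.+1) X0 X1 X2 => X X0 X1 X2; field.
  by rewrite ?X0 ?X1 ?X2.
by apply/inA_N/inA_M; [apply/inA_X/inA_x|apply: pos].
Qed.

Lemma inA_hoef_b k : distance_ok k -> inA (hoef_b x y k).
Proof.
move=> h; rewrite hoef_b_a ?yL_neq0 //; last by apply: xL_inf; case/andP: h.
by apply: inA_D; [exact: inA_hoef_a|exact: inA_yV].
Qed.

Definition hoefA_a (k : int) : A := toA n b q a zeta s (hoef_a x y k).
Definition hoefA_b (k : int) : A := toA n b q a zeta s (hoef_b x y k).

Lemma distance_okN k : distance_ok k -> distance_ok (- k).
Proof. by rewrite /distance_ok oppr_eq0 abszN. Qed.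

Lemma hoefA_coefficients :
  hoefsmit_coefficients hoefA_a hoefA_b 1 qA (b%:R * aA) distance_ok.
Proof.
have h := hoef_coefficients xL_neq0 yL_neq0 (mulr1 1).
rewrite -qLE -baLE in h.
have ga k : distance_ok k -> gval (hoefA_a k) = hoef_a x y k.
  by move=> /inA_hoef_a/gval_toA.
have gb k : distance_ok k -> gval (hoefA_b k) = hoef_b x y k.
  by move=> /inA_hoef_b/gval_toA.
have inf k : distance_ok k -> x ^ k != 1 by case/andP => k0 _; exact: xL_inf.
split.
- by rewrite mulr1.
- move=> k hk; apply: gval_inj; rewrite !gvalE /= !ga ?distance_okN //.
  by rewrite (hc_a h) // inf.
- move=> k hk; apply: gval_inj; rewrite !gvalE /= ga ?gb ?distance_okN //.
  by rewrite (hc_b h) // inf.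
- apply: gval_inj; rewrite /hoefA_b (_ : hoef_b x y 1 = 0) ?gval_toA ?gval0 //.
    by rewrite -gval0; exact: valP.
  exact: (hc_b1 h).
- move=> k l hk hl hkl; apply: gval_inj; rewrite !gvalE /= !ga //.
  by rewrite (hc_1 h) // inf.
- move=> k l hk hl hkl; apply: gval_inj; rewrite !gvalE /= !ga ?distance_okN //.
  by rewrite (hc_2 h) // inf.
- move=> k l hk hl hkl; apply: gval_inj; rewrite !gvalE /= !ga ?distance_okN //.
  by rewrite (hc_3 h) // inf.
Qed.

Lemma toK_hoef_a k : distance_ok k -> toK (hoefA_a k) = hoef_a xK yK k.
Proof.
move=> hk; have [k0 _] := andP hk; have y0 := yK_neq0; have yl0 := yL_neq0.
have := xK_inf k0; have := xL_inf k0.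
have := gval_toA (inA_hoef_a hk); rewrite -/(hoefA_a k).
case: k {k0 hk} => m.
  rewrite -!exprnP /hoef_a -exprnP => e X1 XK1.
  have : hoefA_a m * (yA * (1 - xA ^+ m)) = xA - 1.
    apply: gval_inj; rewrite !gvalE e /= divfK //.
    by rewrite mulf_neq0 // subr_eq0 eq_sym.
  move/(congr1 toK); rewrite !(rmorphM toK) !(rmorphB toK) !(rmorph1 toK) (rmorphXn toK) => E.
  apply: eq_divr_of_mul E; apply: mulf_neq0 y0 _.
  by rewrite subr_eq0 eq_sym.
rewrite NegzE -!invr_expz -!exprnP /hoef_a -!invr_expz -!exprnP => e X1 XK1.
have x0 := xL_neq0; have xk0 := xK_neq0.
have n1 (F : fieldType) (u : F) : u^-1 != 1 -> u - 1 != 0.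
  by rewrite subr_eq0; apply: contraNneq => ->; rewrite invr1.
have n2 (F : fieldType) (u : F) : u != 0 -> u - 1 != 0 -> 1 - u^-1 != 0.
  by move=> u0; rewrite !subr_eq0 [1 == _]eq_sym invr_eq1.
have : hoefA_a (- m.+1%:Z) * (yA * (xA ^+ m.+1 - 1)) = (xA - 1) * xA ^+ m.+1.
  apply: gval_inj; rewrite !gvalE e /=.
  have := n1 _ _ X1; have := n2 _ _ (expf_neq0 m.+1 x0) (n1 _ _ X1); move: (expf_neq0 m.+1 x0).
  by move: (x ^+ m.+1) => X X0 X2 X3; field; rewrite ?yl0 ?X0 ?X3.
move/(congr1 toK); rewrite !(rmorphM toK) !(rmorphB toK) !(rmorph1 toK) !(rmorphXn toK).
move=> E0; have {E0} E : toK (hoefA_a (- m.+1%:Z)) * (yK * (xK ^+ m.+1 - 1)) = (xK - 1) * xK ^+ m.+1 := E0.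
have := n1 _ _ XK1; have := n2 _ _ (expf_neq0 m.+1 xk0) (n1 _ _ XK1).
move: (expf_neq0 m.+1 xk0) E; move: (xK ^+ m.+1) => X X0 E X2 X3.
apply: (mulIf (mulf_neq0 y0 X3)); apply: (etrans E).
exact: (frac_inv_flip _ y0 X0 X3 X2).
Qed.

Lemma toK_hoef_b k : distance_ok k -> toK (hoefA_b k) = hoef_b xK yK k.
Proof.
move=> hk; have [k0 _] := andP hk; have y0 := yK_neq0.
rewrite hoef_b_a ?xK_inf // -(toK_hoef_a hk).
have : hoefA_b k * yA = hoefA_a k * yA + 1.
  apply: gval_inj; rewrite !gvalE (gval_toA (inA_hoef_a hk)) (gval_toA (inA_hoef_b hk)) /=.
  rewrite hoef_b_a ?xL_inf ?yL_neq0 // mulrDl mulVf //; exact: yL_neq0.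
move/(congr1 toK); rewrite (rmorphD toK) !(rmorphM toK) (rmorph1 toK) => e.
by apply: (mulIf y0); rewrite mulrDl mulVf // -e.
Qed.

End GroundFacts.

(** What is used of the ground ring and its quotient field. *)
Record ground_facts (L : fieldType) (n b : nat) (q a zeta s : L)
    (xK yK : fracA n b q a zeta s) (bV rp : ground n b q a zeta s) : Prop := {
  gf_zeta : b.-primitive_root (zetaA n b q a zeta s);
  gf_zetaK : b.-primitive_root (tofrac (zetaA n b q a zeta s));
  gf_b : bV * b%:R = 1;
  gf_bK : tofrac bV * b%:R = 1;
  gf_rp : rp * rp = qA n b q a zeta s + b%:R * aA n b q a zeta s * rp;
  gf_q : tofrac (qA n b q a zeta s) = xK / yK ^+ 2;
  gf_ba : b%:R * tofrac (aA n b q a zeta s) = (xK - 1) / yK;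
  gf_x0 : xK != 0;
  gf_y0 : yK != 0;
  gf_inf : forall k : int, k != 0 -> xK ^ k != 1;
  gf_hoef : hoefsmit_coefficients (hoefA_a n b q a zeta s) (hoefA_b n b q a zeta s)
    1 (qA n b q a zeta s) (b%:R * aA n b q a zeta s) (distance_ok n);
  gf_toK_a : forall k, distance_ok n k ->
    tofrac (hoefA_a n b q a zeta s k) = hoef_a xK yK k;
  gf_toK_b : forall k, distance_ok n k ->
    tofrac (hoefA_b n b q a zeta s k) = hoef_b xK yK k }.

Lemma ex_ground_facts (L : fieldType) (n b : nat) (q a zeta s : L) :
  (0 < n)%N -> (0 < b)%N -> q != 0 -> (2%:R : L) != 0 -> (b%:R : L) != 0 ->
  s ^+ 2 = b%:R ^+ 2 * a ^+ 2 + 4%:R * q ->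
  (forall k, (0 < k)%N -> (xL b q a s) ^+ k != 1) -> b.-primitive_root zeta ->
  exists xK yK bV rp, @ground_facts L n b q a zeta s xK yK bV rp.
Proof.
move=> n_gt0 b_gt0 q0 two0 b0 s_sqr x_ninf zeta_primL.
exists (xK n zeta q0 two0 s_sqr), (yK n b a zeta s q0 two0), (bV n q a zeta s b0).
exists (root_plus n b a zeta s q0 two0); split.
- exact: zetaA_prim.
- exact: zetaK_prim.
- exact: bV_inv.
- exact: bVK_inv.
- exact: root_plus_quad.
- exact: qK_E.
- exact: baK_E.
- exact: xK_neq0.
- exact: yK_neq0.
- exact: xK_inf.
- exact: hoefA_coefficients.
- by move=> k; apply: toK_hoef_a.
- by move=> k; apply: toK_hoef_b.
Qed.

Lemma invr_of_mul (R : comUnitRingType) (u v : R) : u * v = 1 -> u^-1 = v.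
Proof.
move=> uv; have uu : u \is a GRing.unit by apply/unitrP; exists v; rewrite mulrC.
by apply: (mulrI uu); rewrite divrr.
Qed.

Lemma alg_const_prod (S : comPzRingType) (B : pzAlgType S) (J : Type) (s : seq J) (c : J -> S) (u : J -> B) :
  \prod_(j <- s) ((c j)%:AC * u j) = (\prod_(j <- s) c j)%:AC * \prod_(j <- s) u j.
Proof.
elim: s => [|j s IH]; first by rewrite !big_nil rmorph1 mul1r.
by rewrite !big_cons IH alg_const_mulACA.
Qed.

Section HeckeAlgebras.
Variables (L : fieldType) (n b : nat) (q a zeta s : L).
Hypothesis n_gt0 : (0 < n)%N.
Hypothesis b_gt0 : (0 < b)%N.
Local Notation A := (ground n b q a zeta s).
Local Notation K := (fracA n b q a zeta s).
Local Notation qA := (qA n b q a zeta s).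
Local Notation aA := (aA n b q a zeta s).
Local Notation zetaA := (zetaA n b q a zeta s).
Local Notation toK := (@tofrac A).
Local Notation H := (halg n b q a zeta s).
Local Notation KH := (khalg n b q a zeta s).
Local Notation phi := (Zqa_eval qA aA).
Variables (xK yK : K) (bV rp : A).
Hypothesis gf : ground_facts xK yK bV rp.

Definition hT' (j : 'I_n) : H := hT b q a zeta s j.
Definition hRn (i : nat) : H := nat_index 0 (@hR L n b q a zeta s) i.
Local Notation toKH := (@bc_in A K toK H).
Definition kT (j : 'I_n) : KH := toKH (hT' j).
Definition kR (i : nat) : KH := toKH (hRn i).

Lemma toKH_cst c : toKH c%:AC = (toK c)%:AC.
Proof. exact: bc_in_cst. Qed.

Lemma halg_yokonuma : yokonuma b qA aA hT' hRn.
Proof.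
have := @yalg_yokonuma b n A phi H (@bc_in Zqa A phi (yalg b n)).
move=> /(_ (@bc_in_cst Zqa A phi (yalg b n))).
by rewrite Zqa_eval_q Zqa_eval_a.
Qed.

Lemma yokonuma_morph (S S' : comNzRingType) (f : {rmorphism S -> S'}) (B : pzAlgType S) (B' : pzAlgType S')
    (g : {rmorphism B -> B'}) (q1 a1 : S) (T : 'I_n -> B) (R : nat -> B) :
  (forall c, g c%:AC = (f c)%:AC) -> yokonuma b q1 a1 T R ->
  yokonuma b (f q1) (f a1) (fun j => g (T j)) (fun i => g (R i)).
Proof.
move=> gc yk; split.
- by move=> j; rewrite -rmorphXn (yk_Tb yk) rmorph1.
- by move=> j j'; rewrite -!rmorphM (yk_TT yk).
- by move=> j i; rewrite -!rmorphM (yk_TR yk).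
- by move=> i j jn ij; rewrite -!rmorphM (yk_far yk).
- by move=> i jn; rewrite -!rmorphM (yk_braid yk).
- move=> i; rewrite -rmorphM (yk_quad yk) rmorphD !rmorphM rmorphXn rmorph_sum !gc.
  congr (_ + _ * _ * _ * _); apply: eq_bigr => k _.
  by rewrite rmorphM !rmorphXn.
Qed.

Lemma khalg_yokonuma : yokonuma b (xK / yK ^+ 2) (toK aA) kT kR.
Proof.
rewrite -(gf_q gf); exact: (yokonuma_morph toKH_cst halg_yokonuma).
Qed.

Lemma halg_gen (P : H -> Prop) : (forall c : A, P c%:AC) -> (forall j, P (hT' j)) ->
  (forall i, (i < n.-1)%N -> P (hRn i)) -> (forall u v, P u -> P v -> P (u + v)) ->
  (forall u v, P u -> P v -> P (u * v)) -> forall u, P u.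
Proof.
move=> Pc PT PR Pa Pm; apply: bc_span => // c y; rewrite bc_genE; apply: (Pm) => //.
move: y; apply: pres_ind => [[j|i]|c'|u v Pu Pv|u v Pu Pv].
- exact: PT.
- by have := PR i (ltn_ord i); rewrite /hRn nat_indexE.
- by rewrite bc_in_cst.
- by rewrite rmorphD; apply: Pa.
- by rewrite rmorphM; apply: Pm.
Qed.

Lemma khalg_gen (P : KH -> Prop) : (forall c : K, P c%:AC) -> (forall j, P (kT j)) ->
  (forall i, (i < n.-1)%N -> P (kR i)) -> (forall u v, P u -> P v -> P (u + v)) ->
  (forall u v, P u -> P v -> P (u * v)) -> forall u, P u.
Proof.
move=> Pc PT PR Pa Pm; apply: bc_span => // c h; rewrite bc_genE; apply: (Pm) => //.
move: h; apply: halg_gen => [c'|//|//|u v Pu Pv|u v Pu Pv].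
- by rewrite bc_in_cst.
- by rewrite rmorphD; apply: Pa.
- by rewrite rmorphM; apply: Pm.
Qed.

Lemma khalg_lift (E : pzAlgType K) (T : 'I_n -> E) (R : nat -> E) :
  yokonuma b (xK / yK ^+ 2) (toK aA) T R ->
  exists rho : {rmorphism KH -> E}, [/\ forall c : K, rho c%:AC = c%:AC,
    forall j, rho (kT j) = T j & forall i, (i < n.-1)%N -> rho (kR i) = R i].
Proof.
rewrite -(gf_q gf) => yk; pose psi : {rmorphism Zqa -> K} := toK \o phi.
have [|f1 [f1c f1T f1R]] := @yalg_lift b n K psi E T R.
  by rewrite -[psi qZ]/(toK (phi qZ)) -[psi aZ]/(toK (phi aZ)) Zqa_eval_q Zqa_eval_a.
have [f2 [f2c f2y]] := @bc_lift Zqa A phi (yalg b n) (restrict_scalars toK E) f1 f1c.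
have [rho [rc rh]] := @bc_lift A K toK H E f2 f2c.
exists rho; split=> // [j|i iN].
- by rewrite [LHS]rh [LHS]f2y f1T.
- rewrite /kR rh /hRn -[ i ]/(val (Ordinal iN)) nat_indexE.
  by rewrite [LHS]f2y f1R.
Qed.

Lemma e_al_E (al : 'I_b -> nat) :
  e_al n q a zeta s al = char_proj b zetaA bV hT' (fun j : 'I_n => nth 0%N (char_seq al) j).
Proof.
rewrite /e_al /e_char /char_proj; set i_ := nth 0%N (char_seq al).
pose F (j : 'I_n) (k : 'I_b) : H := (bV * zetaA ^+ (i_ j * (b - k)))%:AC * hT' j ^+ k.
have -> : \prod_(j < n) eig_proj b zetaA bV (hT' j) (i_ j) = \prod_j \sum_k F j k.
  apply: eq_bigr => j _; rewrite /eig_proj mulr_sumr; apply: eq_bigr => k _.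
  by rewrite /F mulrA -rmorphM.
rewrite (bigA_distr_bigA F) /= mulr_sumr; apply: eq_bigr => d _.
rewrite /F alg_const_prod mulrA -rmorphM; congr (_%:AC * _).
rewrite big_split /= prodr_const card_ord; congr (_ * _).
  by apply: invr_of_mul; rewrite -exprMn mulrC (gf_b gf) expr1n.
apply: invr_of_mul; rewrite /char_of prodrXr -exprD -big_split /=.
under eq_bigr do rewrite -mulnDr addnC subnK ?(ltnW (ltn_ord _)) //.
rewrite -big_distrl /=; exact: (zetaXb (gf_zeta gf)).
Qed.

End HeckeAlgebras.

(** * The isomorphism of the corner algebra with a product of Hecke algebras *)

Section Blocks.
Variables (b : nat) (al : 'I_b -> nat).
Local Notation mb := (mbar al).

Lemma mbar0 : mb 0 = 0%N.
Proof. by rewrite /mbar big_pred0. Qed.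

Lemma mbarS (j : 'I_b) : mb j.+1 = (mb j + al j)%N.
Proof.
rewrite /mbar (bigD1 j) //= addnC; congr addn; apply: eq_bigl => i.
by rewrite ltnS ltn_neqAle andbC.
Qed.

Lemma mbar_full : mb b = (\sum_j al j)%N.
Proof. by rewrite /mbar; apply: eq_bigl => i; rewrite ltn_ord. Qed.

Lemma mbar_le j j' : (j <= j')%N -> (mb j <= mb j')%N.
Proof.
move=> jj; rewrite /mbar big_mkcond [X in (_ <= X)%N]big_mkcond; apply: leq_sum => i _.
by case: ifP => // ij; rewrite (leq_trans ij jj).
Qed.

Lemma mbar_block i : (i < mb b)%N -> exists (j : 'I_b) l, i = (mb j + l)%N /\ (l < al j)%N.
Proof.
suff h m : (m <= b)%N -> (i < mb m)%N -> exists (j : 'I_b) l, i = (mb j + l)%N /\ (l < al j)%N.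
  exact: h.
elim: m => [|m IH] mb_; first by rewrite mbar0.
have := mbarS (Ordinal mb_) => /= ->; have [/IH h _|h] := ltnP i (mb m); first by apply: h; lia.
by move=> i_lt; exists (Ordinal mb_), (i - mb m)%N => /=; lia.
Qed.

Lemma mbar_lt (j : 'I_b) l : (l < al j)%N -> (mb j + l < mb b)%N.
Proof. by move=> lj; have := mbar_le (ltn_ord j); rewrite mbarS; lia. Qed.

Lemma size_char_seq : size (char_seq al) = mb b.
Proof.
rewrite size_flatten /shape -map_comp mbar_full sumnE big_map big_enum /=.
by apply: eq_bigr => j _; rewrite size_nseq.
Qed.

Lemma nth_char_seq (j : 'I_b) l : (l < al j)%N -> nth 0%N (char_seq al) (mb j + l) = j.+1.
Proof.
move=> lj; rewrite /char_seq; set s := enum 'I_b.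
have es : s = take j s ++ j :: drop j.+1 s.
  rewrite -[LHS](cat_take_drop j) (drop_nth j) ?size_enum_ord //.
  by rewrite nth_ord_enum.
rewrite es map_cat flatten_cat /= nth_cat.
have -> : size (flatten [seq nseq (al j0) j0.+1 | j0 : 'I_b <- take j s]) = mb j.
  rewrite size_flatten /shape -map_comp sumnE big_map /mbar.
  rewrite (eq_bigr al) => [|i _]; last by rewrite /= size_nseq.
  rewrite -[RHS]big_filter; apply: perm_big.
  apply: uniq_perm; rewrite ?take_uniq ?filter_uniq ?enum_uniq ?index_enum_uniq //.
  move=> i; rewrite mem_filter mem_index_enum andbT.
  rewrite -(mem_map val_inj) map_take val_enum_ord take_iota mem_iota add0n.
  by rewrite (minn_idPl (ltnW (ltn_ord j))).
by rewrite ltnNge leq_addr addKn nth_cat size_nseq lj nth_nseq lj.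
Qed.

Definition same_block (i : nat) : bool :=
  (i.+1 < mb b)%N && (nth 0%N (char_seq al) i == nth 0%N (char_seq al) i.+1).

Lemma same_blockP (j : 'I_b) l : (l < al j)%N -> same_block (mb j + l) = (l.+1 < al j)%N.
Proof.
move=> lj; rewrite /same_block nth_char_seq //; have [h|h] := ltnP l.+1 (al j).
  by rewrite -addnS nth_char_seq // mbar_lt // eqxx.
apply/negP => /andP[i1]; have [j' [l' [e l'j]]] := mbar_block i1.
rewrite e nth_char_seq // eqSS => /eqP /val_inj jj; subst j'; lia.
Qed.

Lemma char_seq_mono i i' : (i <= i')%N -> (i' < mb b)%N ->
  (nth 0%N (char_seq al) i <= nth 0%N (char_seq al) i')%N.
Proof.
move=> ii i'b; have [j [l [ei lj]]] : exists (j : 'I_b) l, i = (mb j + l)%N /\ (l < al j)%N.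
  by apply: mbar_block; lia.
subst i.
have := i'b => /mbar_block[j' [l' [e l'j]]]; subst i'; rewrite !nth_char_seq // ltnS leqNgt.
by apply/negP => jj; have := mbar_le jj; rewrite mbarS; lia.
Qed.

(** Along an interval that leaves a block the colours of the end points
    differ. *)
Lemma char_seq_interval i i' : (i <= i')%N -> (i' < mb b)%N ->
  nth 0%N (char_seq al) i = nth 0%N (char_seq al) i' ->
  forall k, (i <= k < i')%N -> same_block k.
Proof.
move=> ii i'b e k /andP[ik ki]; rewrite /same_block; have -> : (k.+1 < mb b)%N by lia.
have h1 := char_seq_mono ik (_ : k < mb b)%N; have h2 := char_seq_mono (leqnSn k) (_ : k.+1 < mb b)%N.
have h3 := char_seq_mono ki i'b.
rewrite eqn_leq h2 ?andTb; last by lia.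
by apply: leq_trans h3 _; rewrite -e; apply: h1; lia.
Qed.

Lemma char_seq_range i : (i < mb b)%N -> (0 < nth 0%N (char_seq al) i <= b)%N.
Proof. by move=> /mbar_block[j [l [-> lj]]]; rewrite nth_char_seq //= ltn_ord. Qed.

End Blocks.

Record hecke_relations (S : comPzRingType) (u v : S) (m : nat) (B : pzAlgType S) (g : nat -> B) : Prop := {
  hk_far : forall i j, (j < m.-1)%N -> (i.+1 < j)%N -> g i * g j = g j * g i;
  hk_braid : forall i, (i.+1 < m.-1)%N -> g i * g i.+1 * g i = g i.+1 * g i * g i.+1;
  hk_quad : forall i, (i < m.-1)%N -> g i * g i = u%:AC + v%:AC * g i }.

Section TypeA.
Variables (S : comPzRingType) (u v : S) (m : nat).

Lemma ialg_hecke : hecke_relations u v m (nat_index 0 (@iS S u v m)).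
Proof.
split=> [i j jm ij|i im|i im].
- have inn : (i < m.-1)%N by lia.
  rewrite -[ i ]/(val (Ordinal inn)) -[j]/(val (Ordinal jm)) !nat_indexE.
  have h : far (Ordinal inn) (Ordinal jm) by rewrite /far /= ij.
  by have := pres_rel (irel_comm u v h); rewrite !rmorphM.
- have inn : (i < m.-1)%N by lia.
  rewrite -[i.+1]/(val (Ordinal im)) -[ i ]/(val (Ordinal inn)) !nat_indexE.
  by have := pres_rel (@irel_braid S u v m (Ordinal inn) (Ordinal im) erefl); rewrite !rmorphM.
- rewrite -[ i ]/(val (Ordinal im)) nat_indexE.
  by have := pres_rel (irel_quad u v (Ordinal im)); rewrite rmorphXn rmorphD rmorphM expr2.
Qed.

Lemma ialg_lift (E : pzAlgType S) (g : nat -> E) : hecke_relations u v m g ->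
  exists f : {rmorphism ialg u v m -> E},
    (forall c : S, f c%:AC = c%:AC) /\ (forall i : 'I_m.-1, f (iS u v i) = g i).
Proof.
move=> hk; apply: (@pres_lift _ _ _ _ (fun i : 'I_m.-1 => g i)) => _ _ [i j h|i j h|i].
- rewrite !rmorphM /= !free_lift_gen; case/orP: h => h; first exact: (hk_far hk).
  by apply/esym; exact: (hk_far hk).
- rewrite !rmorphM /= !free_lift_gen h; apply: (hk_braid hk).
  by rewrite -h.
- by rewrite rmorphXn rmorphD rmorphM /= !free_lift_gen !free_lift_cst expr2 (hk_quad hk).
Qed.

End TypeA.

(** Relations in a corner e B e are completed to relations in B by letting the
    generators act by a root of the quadratic equation on the complement. *)
Lemma corner_hecke (S : comPzRingType) (u v rp : S) (m : nat) (B : pzAlgType S) (e : B) (r : nat -> B) :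
  rp * rp = u + v * rp -> e * e = e ->
  (forall i, (i < m.-1)%N -> r i * e = r i /\ e * r i = r i) ->
  (forall i j, (j < m.-1)%N -> (i.+1 < j)%N -> r i * r j = r j * r i) ->
  (forall i, (i.+1 < m.-1)%N -> r i * r i.+1 * r i = r i.+1 * r i * r i.+1) ->
  (forall i, (i < m.-1)%N -> r i * r i = u%:AC * e + v%:AC * r i) ->
  hecke_relations u v m (fun i => r i + rp%:AC * (1 - e)).
Proof.
move=> hrp ee re rfar rbraid rquad; set z := 1 - e.
have zz : z * z = z by rewrite /z mulrBr mulr1 mulrBl mul1r ee subrr subr0.
have rz i : (i < m.-1)%N -> r i * z = 0 /\ z * r i = 0.
  by move=> /re[h1 h2]; rewrite /z mulrBr mulrBl mulr1 mul1r h1 h2 subrr.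
have ez : e + z = 1 by rewrite /z addrC subrK.
clearbody z.
have prod (c d : S) (s t : B) : s * z = 0 -> z * t = 0 ->
   (s + c%:AC * z) * (t + d%:AC * z) = s * t + (c * d)%:AC * z.
  move=> sz zt; rewrite mulrDl !mulrDr alg_const_mulACA zz.
  by rewrite [s * (_ * z)]mulrA -alg_const_central -[d%:AC * s * z]mulrA sz mulr0 addr0 -[c%:AC * z * t]mulrA zt mulr0 add0r.
split=> [i j jm ij|i im|i im].
- have im : (i < m.-1)%N by lia.
  have [ri zi] := rz _ im; have [rj zj] := rz _ jm.
  by rewrite !prod // rfar.
- have im' : (i < m.-1)%N by lia.
  have [ri zi] := rz _ im'; have [rj zj] := rz _ im.
  rewrite !prod // ?rbraid //.
    by rewrite -mulrA ri mulr0.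
  by rewrite -mulrA rj mulr0.
- have [ri zi] := rz _ im; rewrite prod // rquad // hrp.
  rewrite rmorphD rmorphM mulrDl mulrDr mulrA.
  rewrite addrACA -mulrDr; congr (_ + _).
  by rewrite ez mulr1.
Qed.

Section HeckeStructure.
Variables (L : fieldType) (n b : nat) (q a zeta s : L).
Hypothesis n_gt0 : (0 < n)%N.
Hypothesis b_gt0 : (0 < b)%N.

Local Notation A := (ground n b q a zeta s).
Local Notation K := (fracA n b q a zeta s).
Local Notation zetaA := (zetaA n b q a zeta s).
Local Notation toK := (@tofrac A).
Local Notation KH := (khalg n b q a zeta s).
Local Notation I := (lword b n).
Local Notation kT := (@kT L n b q a zeta s).
Local Notation kR := (@kR L n b q a zeta s).

Variables (xK yK : K) (bV rp : A).
Hypothesis gf : ground_facts xK yK bV rp.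

(** The action on words, with its matrix units. *)
Record word_action (rho : {rmorphism KH -> endo {ffun I -> K^o}}) (mu : I -> I -> KH) : Prop := {
  wa_cst : forall c : K, rho c%:AC = c%:AC;
  wa_T : forall j, rho (kT j) = @Tw K b n (toK zetaA) j;
  wa_R : forall i, (i < n.-1)%N -> rho (kR i) = @Rw K b n (toK zetaA) xK yK i;
  wa_units : matrix_units (fun w w' => perm_eq (ssval w) (ssval w')) mu;
  wa_acts : forall w w' : I, perm_eq (ssval w) (ssval w') -> acts_unit rho (mu w w') w w' }.

Let yk := khalg_yokonuma gf.
Let gen := @khalg_gen L n b q a zeta s.

Let ex_rho : exists rho : {rmorphism KH -> endo {ffun I -> K^o}},
  [/\ forall c : K, rho c%:AC = c%:AC, forall j, rho (kT j) = @Tw K b n (toK zetaA) j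
    & forall i, (i < n.-1)%N -> rho (kR i) = @Rw K b n (toK zetaA) xK yK i].
Proof.
apply: (khalg_lift gf); apply: (word_yokonuma b_gt0 n_gt0 (gf_zetaK gf) (gf_x0 gf) (gf_y0 gf) (gf_inf gf)).
exact: (gf_ba gf).
Qed.

Let ex_units (rho : {rmorphism KH -> endo {ffun I -> K^o}}) :
  (forall c : K, rho c%:AC = c%:AC) -> (forall j, rho (kT j) = @Tw K b n (toK zetaA) j) ->
  (forall i, (i < n.-1)%N -> rho (kR i) = @Rw K b n (toK zetaA) xK yK i) ->
  forall w w' : I, perm_eq (ssval w) (ssval w') -> exists u, acts_unit rho u w w'.
Proof.
move=> rc rT rR w w'.
exact: (ex_unit b_gt0 n_gt0 (gf_zetaK gf) (gf_x0 gf) (gf_y0 gf) (gf_inf gf) rc rT rR).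
Qed.

Lemma ex_word_action : exists rho mu, word_action rho mu.
Proof.
have [rho [rc rT rR]] := ex_rho.
have [mu [mu1 mu2]] := ex_matrix_units b_gt0 n_gt0 (gf_zetaK gf) (gf_bK gf) yk gen rc (ex_units rc rT rR).
by exists rho, mu.
Qed.

Lemma kwords_free (c : seq nat -> {ffun 'I_n -> 'I_b} -> K) :
  \sum_(p <- idx n) \sum_chi (c p chi)%:AC *
    char_proj b (toK zetaA) (toK bV) kT (fun k => (chi k).+1) * word_of kR p = 0 ->
  forall p chi, p \in idx n -> c p chi = 0.
Proof.
have [rho [rc rT rR]] := ex_rho.
exact: (words_free b_gt0 n_gt0 (gf_zetaK gf) (gf_bK gf) yk gen rc (ex_units rc rT rR)).
Qed.

End HeckeStructure.

(** The corner [e B e] of an algebra with braid-like generators, for an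
    idempotent [e] that commutes with the generators inside the blocks, is the
    tensor product of the Hecke algebras of the blocks.  Words that leave a
    block vanish in the corner, and correspond to zero on the other side. *)
Section Corner.
Variables (S : comPzRingType) (u0 v0 rp eps : S) (b n : nat) (al : 'I_b -> nat).
Hypothesis al_sum : (\sum_j al j = n)%N.
Variables (B : pzAlgType S) (e : B) (R : nat -> B).
Local Notation mb := (mbar al).
Local Notation col := (fun i => nth 0%N (char_seq al) i).
Local Notation HI := (fun j => ialg u0 v0 (al j)).
Local Notation HT := (tensor_alg HI).

Hypothesis rp_root : rp * rp = u0 + v0 * rp.
Hypothesis eps_sq : eps * eps = 1.
Hypothesis e_idem : e * e = e.
Hypothesis R_e : forall i, same_block al i -> R i * e = e * R i.
Hypothesis R_sq : forall i, same_block al i ->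
  R i * R i * e = u0%:AC * e + (v0 * eps ^+ col i)%:AC * (R i * e).
Hypothesis R_far : forall i j, (j < n.-1)%N -> (i.+1 < j)%N -> R i * R j = R j * R i.
Hypothesis R_braid : forall i, (i.+1 < n.-1)%N -> R i * R i.+1 * R i = R i.+1 * R i * R i.+1.
Hypothesis R_off : forall k d p, p \in idx k -> (d <= k)%N -> (k < n)%N ->
  col (k - d)%N <> col k -> e * word_of R p * cosw R k d * e = 0.
Hypothesis words_span : forall h, exists c : seq nat -> S,
  e * h = \sum_(p <- idx n) (c p)%:AC * (e * word_of R p).
Hypothesis corner_words_free : forall c : seq nat -> S,
  \sum_(p <- idx n) (c p)%:AC * (e * word_of R p) = 0 -> forall p, p \in idx n -> c p = 0.

Let mb_n : mb b = n. Proof. by rewrite mbar_full. Qed.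

Let block_lt i : same_block al i -> (i < n.-1)%N.
Proof. by rewrite /same_block mb_n => /andP[]; lia. Qed.

Let epsX m : eps ^+ m * eps ^+ m = 1.
Proof. by rewrite -exprMn eps_sq expr1n. Qed.

Definition corner_gen (i : nat) : B := (eps ^+ col i)%:AC * R i * e.
Local Notation rr := corner_gen.

Let rr_e i : rr i * e = rr i.
Proof. by rewrite /rr -!mulrA e_idem. Qed.

Let e_rr i : same_block al i -> e * rr i = rr i.
Proof.
by move=> hi; rewrite /rr !mulrA -alg_const_central -!mulrA R_e // [e * (e * _)]mulrA e_idem.
Qed.

Let rr_mul (c : S) u k : same_block al k ->
  c%:AC * u * e * rr k = (c * eps ^+ col k)%:AC * (u * R k) * e.
Proof.
move=> hk; rewrite /rr -[_ * u * e]mulrA -[_ * R k * e]mulrA alg_const_mulACA -!mulrA.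
by rewrite [e * (R k * e)]mulrA -R_e // -mulrA e_idem.
Qed.

Let rrM i k : same_block al k ->
  rr i * rr k = (eps ^+ col i * eps ^+ col k)%:AC * (R i * R k) * e.
Proof. exact: rr_mul. Qed.

Let rrM3 i k m : same_block al k -> same_block al m ->
  rr i * rr k * rr m = (eps ^+ col i * eps ^+ col k * eps ^+ col m)%:AC * (R i * R k * R m) * e.
Proof. by move=> hk hm; rewrite rrM // rr_mul. Qed.

Let rr_far i k : same_block al i -> same_block al k -> (i.+1 < k)%N -> rr i * rr k = rr k * rr i.
Proof.
move=> hi hk ik; rewrite !rrM // mulrC R_far //; exact: block_lt.
Qed.

Let block_col (j : 'I_b) l : (l < (al j).-1)%N -> col (mb j + l)%N = j.+1.
Proof. by move=> lj; apply: nth_char_seq; lia. Qed.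

Let block_same (j : 'I_b) l : (l < (al j).-1)%N -> same_block al (mb j + l)%N.
Proof. by move=> lj; rewrite same_blockP; lia. Qed.

Let gg j l := rr (mbar al j + l)%N + rp%:AC * (1 - e).

Let gg_hecke (j : 'I_b) : hecke_relations u0 v0 (al j) (gg j).
Proof.
apply: (corner_hecke (r := fun l => rr (mb j + l)%N)) => // [l lj|l l' lj ll|l lj|l lj].
- by rewrite rr_e e_rr // block_same.
- by apply: rr_far; rewrite ?block_same //; lia.
- have lj' : (l < (al j).-1)%N by lia.
  have b2 := block_lt (block_same lj); rewrite addnS in b2.
  have c1 := block_col lj; rewrite addnS in c1.
  have hs : same_block al (mb j + l).+1 by rewrite -addnS block_same.
  by rewrite addnS !rrM3 ?block_same // (block_col lj') c1 R_braid.
- by rewrite rrM ?block_same // epsX rmorph1 mul1r R_sq ?block_same // /rr rmorphM -!mulrA.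
Qed.

Let gg_e j l : gg j l * e = rr (mb j + l)%N.
Proof. by rewrite /gg mulrDl rr_e -mulrA mulrBl mul1r e_idem subrr mulr0 addr0. Qed.

Let e_gg (j : 'I_b) l : (l < (al j).-1)%N -> e * gg j l = rr (mb j + l)%N.
Proof.
move=> lj; rewrite /gg mulrDr e_rr ?block_same // mulrA -alg_const_central -mulrA.
by rewrite mulrBr mulr1 e_idem subrr mulr0 addr0.
Qed.

Let gg_comm (i j : 'I_b) l m : (l < (al i).-1)%N -> (m < (al j).-1)%N -> i != j ->
  gg i l * gg j m = gg j m * gg i l.
Proof.
have h : forall (i j : 'I_b) l m, (l < (al i).-1)%N -> (m < (al j).-1)%N -> (i < j)%N ->
    rr (mb i + l)%N * rr (mb j + m)%N = rr (mb j + m)%N * rr (mb i + l)%N.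
  move=> i' j' l' m' li mj ij; apply: rr_far; rewrite ?block_same //.
  by have := mbar_le al ij; rewrite mbarS; lia.
move=> li mj ne; have split x y : x * y = x * e * y + x * (1 - e) * y.
  by rewrite -mulrDl -mulrDr [e + _]addrC subrK mulr1.
rewrite [LHS]split [RHS]split !gg_e.
have zz j' l' : (l' < (al j').-1)%N -> gg j' l' * (1 - e) = rp%:AC * (1 - e).
  move=> lj; rewrite mulrBr mulr1 gg_e /gg addrAC subrr add0r //.
have rz i' : rr i' * (1 - e) = 0 by rewrite mulrBr mulr1 rr_e subrr.
have zg j' l' : (l' < (al j').-1)%N -> (1 - e) * gg j' l' = rp%:AC * (1 - e).
  by move=> lj; rewrite mulrBl mul1r e_gg // /gg addrAC subrr add0r.
rewrite !zz // -[rp%:AC * (1 - e) * _]mulrA -[rp%:AC * (1 - e) * gg i l]mulrA !zg //; congr (_ + _).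
have rg i' j' l' : (l' < (al j').-1)%N -> rr i' * gg j' l' = rr i' * rr (mb j' + l')%N.
  by move=> lj; rewrite -[rr i' in LHS]rr_e -mulrA e_gg.
rewrite !rg //; have [ij|ji|eq] := ltngtP i j; first exact: h.
- by apply/esym/h.
- by case/eqP: ne; apply: val_inj.
Qed.

Let corner_morphism : exists F : {rmorphism HT -> B},
  [/\ forall c : S, F c%:AC = c%:AC,
      forall (j : 'I_b) (l : 'I_(al j).-1), F (ta_in (B := HI) (iS u0 v0 l)) = gg j l
    & forall u, F u * e = e * F u].
Proof.
pose g j := projT1 (cid (ialg_lift (gg_hecke j))).
have hg j : (forall c : S, g j c%:AC = c%:AC) /\ (forall i : 'I_(al j).-1, g j (iS u0 v0 i) = gg j i).
  exact: (projT2 (cid (ialg_lift (gg_hecke j)))).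
have g_e j x : g j x * e = e * g j x.
  move: x; apply: pres_ind => [l|c|x y hx hy|x y hx hy].
  - by rewrite (hg j).2 gg_e e_gg.
  - by rewrite (hg j).1 alg_const_central.
  - by rewrite rmorphD mulrDl mulrDr hx hy.
  - by rewrite rmorphM -mulrA hy !mulrA hx.
have g_comm i j x y : i != j -> g i x * g j y = g j y * g i x.
  move=> ne; move: x; apply: pres_ind => [l|c|x x' hx hx'|x x' hx hx'].
  - rewrite (hg i).2; move: y; apply: pres_ind => [m|c|y y' hy hy'|y y' hy hy'].
    + by rewrite (hg j).2 gg_comm.
    + by rewrite (hg j).1 alg_const_central.
    + by rewrite rmorphD mulrDr hy hy' -mulrDl.
    + by rewrite rmorphM mulrA hy -!mulrA hy'.
  - by rewrite (hg i).1 alg_const_central.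
  - by rewrite rmorphD mulrDl mulrDr hx hx'.
  - by rewrite rmorphM -mulrA hx' !mulrA hx.
have [F [Fc Fg]] := ta_lift (fun i => (hg i).1) g_comm.
exists F; split=> // [j l|]; first by rewrite Fg (hg j).2.
apply: ta_ind => [j x|c|x y hx hy|x y hx hy].
- by rewrite Fg g_e.
- by rewrite Fc alg_const_central.
- by rewrite rmorphD mulrDl mulrDr hx hy.
- by rewrite rmorphM -mulrA hy !mulrA hx.
Qed.

(** The generators of the tensor product in the order of those of B; at the
    end of a block there is none. *)
Definition block_gen (i : nat) : HT :=
  if [pick j : 'I_b | (mb j <= i < mb j.+1)%N] is Some j
  then ta_in (B := HI) (nat_index 0 (@iS S u0 v0 (al j)) (i - mb j)%N) else 0.
Local Notation X := block_gen.

Let X_in (j : 'I_b) l : (l < al j)%N ->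
  X (mb j + l)%N = ta_in (B := HI) (nat_index 0 (@iS S u0 v0 (al j)) l).
Proof.
move=> lj; rewrite /X; case: pickP => [j' /andP[h1 h2]|/(_ j)]; last by rewrite mbarS; lia.
suff jj : j' = j by subst j'; rewrite addKn.
have hle (i i' : 'I_b) : (mb i <= mb j + l)%N -> (mb j + l < mb i'.+1)%N -> (i <= i')%N.
  by move=> g1 g2; rewrite leqNgt; apply/negP => lt_; have := mbar_le al lt_; lia.
apply/val_inj/eqP; rewrite eqn_leq !hle //; first by rewrite leq_addr.
by rewrite mbarS; lia.
Qed.

Let block_of i : same_block al i -> exists (j : 'I_b) l, i = (mb j + l)%N /\ (l < (al j).-1)%N.
Proof.
move=> hi; have /andP[ib _] := hi; have [j [l [e' lj]]] := mbar_block (ltnW ib).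
exists j, l; split=> //; move: hi; rewrite e' same_blockP //; lia.
Qed.

Let X_out i : (i < n)%N -> ~~ same_block al i -> X i = 0.
Proof.
rewrite -mb_n => /mbar_block[j [l [-> lj]]]; rewrite same_blockP // => h.
rewrite X_in // /nat_index insubF ?rmorph0 //; apply/negP; lia.
Qed.

Let X_far i j : (j < n.-1)%N -> (i.+1 < j)%N -> X i * X j = X j * X i.
Proof.
move=> jn ij; have [si|/X_out ->] := boolP (same_block al i); [|by rewrite mulr0 mul0r|lia].
have [sj|/X_out ->] := boolP (same_block al j); [|by rewrite mulr0 mul0r|lia].
have [c [l [ei lc]]] := block_of si; have [d [m [ej md]]] := block_of sj.
subst i j; rewrite !X_in; [|lia|lia].
have [cd|ne] := eqVneq c d; last exact: ta_in_comm.
subst d; rewrite -!rmorphM; congr ta_in; apply: (hk_far (ialg_hecke _ _ _)) => //; lia.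
Qed.

Let X_braid i : (i.+1 < n.-1)%N -> X i * X i.+1 * X i = X i.+1 * X i * X i.+1.
Proof.
move=> jn; have [si|/X_out ->] := boolP (same_block al i); [|by rewrite !mulr0 !mul0r|lia].
have [sj|/X_out ->] := boolP (same_block al i.+1); [|by rewrite !mulr0 !mul0r|lia].
have [c [l [ei lc]]] := block_of si; subst i.
have lc' : (l.+1 < (al c).-1)%N by move: sj; rewrite -addnS same_blockP; lia.
rewrite -addnS !X_in; [|lia|lia].
by rewrite -!(rmorphM (@ta_in S _ HI c)) (hk_braid (ialg_hecke _ _ _)).
Qed.

Let X_quad i : (i < n.-1)%N ->
  exists c0 c1, [/\ exists c : S, c0 = c%:AC, exists c : S, c1 = c%:AC & X i * X i = c0 + c1 * X i].
Proof.
move=> jn; have [si|/X_out ->] := boolP (same_block al i); last 2 first.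
- exists 0, 0; split; rewrite ?mulr0 ?addr0 //; exists 0; by rewrite rmorph0.
- lia.
have [c [l [ei lc]]] := block_of si; subst i; rewrite !X_in; [|lia].
exists u0%:AC, v0%:AC; split; [by exists u0|by exists v0|].
pose tin := @ta_in S _ HI c; rewrite -(rmorphM tin) (hk_quad (ialg_hecke _ _ _)) //.
rewrite (rmorphD tin) (rmorphM tin); congr (_ + _ * _); exact: ta_in_cst.
Qed.

Hypothesis n_gt0 : (0 < n)%N.

Let X_words u : exists c : seq nat -> S, u = \sum_(p <- idx n) (c p)%:AC * word_of X p.
Proof.
have [c hc ->] : exists2 c : seq nat -> HT, forall p, exists d : S, c p = d%:AC &
    u = \sum_(p <- idx n.-1.+1) c p * word_of X p.
  apply: (normal_form (C := fun x : HT => exists d : S, x = d%:AC)) => //.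
  - by exists 0; rewrite rmorph0.
  - by move=> _ _ [c ->] [d ->]; exists (c + d); rewrite rmorphD.
  - by move=> _ _ [c ->] [d ->]; exists (c * d); rewrite rmorphM.
  - by move=> i _ iN [c ->]; exists c%:AC; [exists c|rewrite alg_const_central].
  - move=> P Pc PX Pa Pm; apply: ta_ind => // [j x|c]; last by apply: Pc; exists c.
    move: x; apply: pres_ind => [l|c|x y hx hy|x y hx hy].
    + have <- : X (mb j + l)%N = ta_in (B := HI) (iS u0 v0 l).
        by rewrite X_in ?nat_indexE //; have := ltn_ord l; lia.
      by apply/PX/block_lt/block_same.
    + by apply: Pc; exists c; exact: ta_in_cst.
    + by rewrite rmorphD; apply: Pa.
    + by rewrite rmorphM; apply: Pm.
  - by exists 1; rewrite rmorph1.
have /choice[d hd] := hc; exists d.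
by rewrite prednK //; apply: eq_bigr => p _; rewrite hd.
Qed.

Section Words.
Variable F : {rmorphism HT -> B}.
Hypothesis F_cst : forall c : S, F c%:AC = c%:AC.
Hypothesis F_gen : forall (j : 'I_b) (l : 'I_(al j).-1), F (ta_in (B := HI) (iS u0 v0 l)) = gg j l.
Hypothesis F_e : forall u, F u * e = e * F u.

Let F_X i : same_block al i -> F (X i) * e = (eps ^+ col i)%:AC * R i * e.
Proof.
move=> /block_of[j [l [-> lj]]]; rewrite X_in; last by lia.
by rewrite -[l]/(val (Ordinal lj)) nat_indexE F_gen gg_e.
Qed.

Let F_mul u v c d x y : F u * e = c%:AC * x * e -> F v * e = d%:AC * y * e -> e * y = y * e ->
  F (u * v) * e = (c * d)%:AC * (x * y) * e.
Proof.
move=> hu hv ey; rewrite rmorphM -mulrA hv -[_ * y * e]mulrA -ey mulrA -alg_const_central.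
rewrite -[LHS]mulrA [F u * _]mulrA hu -[RHS]mulrA -[x * y * e]mulrA -ey [c * d]mulrC rmorphM.
by rewrite -!mulrA.
Qed.

Let cos_case k d : (d <= k)%N -> (k < n)%N ->
  (exists2 m, F (cosw X k d) * e = (eps ^+ m)%:AC * cosw R k d * e & e * cosw R k d = cosw R k d * e) \/
  (cosw X k d = 0 /\ col (k - d)%N <> col k).
Proof.
move=> dk kn; have [ce|/eqP ne] := eqVneq (col (k - d)%N) (col k); [left|right; split=> //].
  have hb : forall i, (k - d <= i < k)%N -> same_block al i.
    by apply: char_seq_interval => //; [lia|rewrite mb_n].
  clear ce; elim: d dk hb => [|d IH] dk hb.
    by exists 0%N; rewrite ?mulr1 ?mul1r // rmorph1 expr0 rmorph1 !mul1r.
  have [||m hm em] := IH; [lia|by move=> i hi; apply: hb; lia|].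
  have hs : same_block al (k - d.+1) by apply: hb; lia.
  exists (m + col (k - d.+1)%N)%N => /=.
    by rewrite exprD; apply: F_mul => //; rewrite ?R_e ?F_X.
  by rewrite mulrA em -!mulrA R_e.
have [i /andP[ik hi]] : exists i, (k - d <= i < k)%N && ~~ same_block al i.
  apply: contrapT => hn; apply: ne.
  have hb i : (k - d <= i < k)%N -> same_block al i.
    by move=> hi; apply/negPn/negP => hs; apply: hn; exists i; rewrite hi.
  suff h t : (t <= d)%N -> col (k - t)%N = col k by apply: h.
  elim: t => [|t IH] td; first by rewrite subn0.
  have /andP[_ /eqP /= h] : same_block al (k - t.+1)%N by apply: hb; lia.
  by rewrite h -IH 1?ltnW //; congr nth; lia.
clear ne; elim: d dk ik => [|d IH] dk ik; first by lia.
rewrite /=; have [e1|ne] := eqVneq i (k - d.+1)%N; first by rewrite -e1 X_out ?mulr0 //; lia.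
by rewrite IH ?mul0r //; lia.
Qed.

Let word_case m p : p \in idx m -> (m <= n)%N ->
  (exists2 k, F (word_of X p) * e = (eps ^+ k)%:AC * word_of R p * e & e * word_of R p = word_of R p * e) \/
  (word_of X p = 0 /\ e * word_of R p * e = 0).
Proof.
elim: m p => [|m IH] p.
  rewrite inE => /eqP -> _; left; exists 0%N; rewrite !word_of_nil ?mulr1 ?mul1r //.
  by rewrite rmorph1 expr0 rmorph1 mul1r.
case/lastP: p => [|p d]; first by move=> /idx_size.
rewrite mem_idxS => /andP[pm dm] mn; rewrite !word_of_rcons (idx_size pm).
have [[k hk ek]|[-> h]] := cos_case dm mn; last first.
  by right; rewrite mulr0 mulrA R_off.
have [||[k' hk' ek']|[-> h]] := IH p _ _ => //; first by lia.
  left; exists (k' + k)%N; first by rewrite exprD; apply: F_mul.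
  by rewrite mulrA ek' -!mulrA ek.
by right; rewrite mul0r -!mulrA -ek !mulrA h mul0r.
Qed.

Let F_inj u : F u * e = 0 -> u = 0.
Proof.
have [c ->] := X_words u; rewrite rmorph_sum mulr_suml => h.
have /choice[k hk] : forall p, exists k, p \in idx n ->
    F (word_of X p) * e = (eps ^+ k)%:AC * (e * word_of R p) \/ word_of X p = 0.
  move=> p; have [pn|] := boolP (p \in idx n); last by exists 0%N.
  have [[k hk ek]|[h0 _]] := word_case pn (leqnn n); last by exists 0%N; right.
  by exists k; left; rewrite hk -mulrA -ek.
pose c' p := if `[< word_of X p = 0 >] then 0 else c p * eps ^+ k p.
have h' : \sum_(p <- idx n) (c' p)%:AC * (e * word_of R p) = 0.
  rewrite -[RHS]h big_seq [RHS]big_seq; apply: eq_bigr => p pn; rewrite /c'.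
  case: asboolP => [->|w0]; first by rewrite rmorph0 mulr0 rmorph0 !mul0r.
  by rewrite rmorphM F_cst -[RHS]mulrA; case: (hk _ pn) => // ->; rewrite rmorphM -mulrA.
rewrite big1_seq // => p /andP[_ pn]; have := corner_words_free h' pn; rewrite /c'.
case: asboolP => [->|w0 /(congr1 (fun z => z * eps ^+ k p))]; first by rewrite mulr0.
by rewrite -mulrA epsX mulr1 mul0r => ->; rewrite rmorph0 mul0r.
Qed.

Let F_onto h : exists u, F u * e = e * h * e.
Proof.
have [c ->] := words_span h; rewrite mulr_suml big_seq; elim/big_ind: _ => [|x y [u hu] [v hv]|p pn].
- by exists 0; rewrite rmorph0 mul0r.
- by exists (u + v); rewrite rmorphD mulrDl hu hv.
- have [[k hk ek]|[_ h0]] := word_case pn (leqnn n); last first.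
    by exists 0; rewrite rmorph0 mul0r -mulrA h0 mulr0.
  exists ((c p * eps ^+ k)%:AC * word_of X p); rewrite rmorphM F_cst -mulrA hk ek.
  rewrite !mulrA -(rmorphM (@alg_const _ _)) -[c p * _ * _]mulrA epsX mulr1.
  by rewrite -[RHS]mulrA e_idem.
Qed.

Lemma corner_spec : exists f : HT -> B,
  [/\ [/\ (forall u v, f (u + v) = f u + f v), (forall u v, f (u * v) = f u * f v),
          (forall c : S, f c%:AC = c%:AC * e) & f 1 = e],
      injective f, (forall h, (exists u, f u = h) <-> exists g, h = e * g * e)
    & forall (j : 'I_b) (l : 'I_(al j).-1), f (ta_in (B := HI) (iS u0 v0 l)) =
        (eps ^+ j.+1)%:AC * R (mb j + l)%N * e].
Proof.
exists (fun u => F u * e); split; first split.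
- by move=> u v; rewrite rmorphD mulrDl.
- by move=> u v; rewrite -mulrA [e * _]mulrA -F_e -!mulrA e_idem rmorphM -mulrA.
- by move=> c; rewrite F_cst.
- by rewrite rmorph1 mul1r.
- move=> u v /eqP; rewrite -subr_eq0 -mulrBl -rmorphB => /eqP/F_inj/eqP.
  by rewrite subr_eq0 => /eqP.
- move=> h; split=> [[u <-]|[g ->]]; last exact: F_onto.
  by exists (F u); rewrite -F_e -mulrA e_idem.
- by move=> j l; rewrite F_gen gg_e /rr block_col.
Qed.

End Words.

(** The isomorphism of the tensor product with the corner. *)
Lemma corner_iso : exists f : HT -> B,
  [/\ [/\ (forall u v, f (u + v) = f u + f v), (forall u v, f (u * v) = f u * f v),
          (forall c : S, f c%:AC = c%:AC * e) & f 1 = e],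
      injective f, (forall h, (exists u, f u = h) <-> exists g, h = e * g * e)
    & forall (j : 'I_b) (l : 'I_(al j).-1), f (ta_in (B := HI) (iS u0 v0 l)) =
        (eps ^+ j.+1)%:AC * R (mb j + l)%N * e].
Proof. by have [F [Fc Fg Fe]] := corner_morphism; apply: (corner_spec Fc Fg Fe). Qed.

End Corner.

Lemma half_power_sq (S : nzRingType) (b : nat) (zeta : S) : b.-primitive_root zeta ->
  zeta ^+ ((b ^ 2 - b) %/ 2) * zeta ^+ ((b ^ 2 - b) %/ 2) = 1.
Proof.
move=> zp; rewrite -exprD addnn -muln2 divnK; last first.
  rewrite dvdn2 oddB ?oddX ?addbb // -[X in (X <= _)%N]expn1.
  by rewrite leq_pexp2l // (prim_order_gt0 zp).
by rewrite -mulnn -[X in (_ - X)%N]mul1n -mulnBl mulnC exprM (prim_expr_order zp) expr1n.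
Qed.

Lemma char_proj_ext (S : idomainType) (b n : nat) (zeta binv : S) (B : pzAlgType S) (T : 'I_n -> B)
    (chi chi' : 'I_n -> nat) : chi =1 chi' ->
  char_proj b zeta binv T chi = char_proj b zeta binv T chi'.
Proof. by move=> h; apply: eq_bigr => j _; rewrite h. Qed.

Lemma word_of_comm (B : pzRingType) (R : nat -> B) z k p : p \in idx k ->
  (forall i, (i.+1 < k)%N -> z * R i = R i * z) -> z * word_of R p = word_of R p * z.
Proof.
elim: k p => [|k IH] p; first by rewrite inE => /eqP -> _; rewrite word_of_nil mulr1 mul1r.
case/lastP: p => [|p d]; first by move=> /idx_size.
rewrite mem_idxS => /andP[pk dk] h; rewrite word_of_rcons (idx_size pk) mulrA IH //; last first.
  by move=> i ik; apply: h; lia.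
rewrite -!mulrA; congr (_ * _); elim: d dk => [|d IHd] dk /=; first by rewrite mulr1 mul1r.
rewrite mulrA IHd; last by lia.
by rewrite -!mulrA h //; lia.
Qed.

Lemma word_of_morph (B B' : pzRingType) (f : {rmorphism B -> B'}) (R : nat -> B) p :
  f (word_of R p) = word_of (f \o R) p.
Proof.
rewrite /word_of rmorph_prod; apply: eq_bigr => k _; elim: (nth _ _ _) => [|d IH] /=.
  by rewrite rmorph1.
by rewrite rmorphM IH.
Qed.

Lemma char_proj_morph (S S' : idomainType) (phi : {rmorphism S -> S'}) (b n : nat) (zeta binv : S)
    (B : pzAlgType S) (B' : pzAlgType S') (f : {rmorphism B -> B'}) (T : 'I_n -> B) chi :
  (forall c, f c%:AC = (phi c)%:AC) ->
  f (char_proj b zeta binv T chi) = char_proj b (phi zeta) (phi binv) (f \o T) chi.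
Proof.
move=> fc; rewrite /char_proj rmorph_prod; apply: eq_bigr => j _; rewrite /eig_proj rmorphM fc.
congr (_ * _); rewrite rmorph_sum; apply: eq_bigr => k _.
by rewrite rmorphM fc !rmorphXn.
Qed.

(** The idempotent of a character that is constant on blocks, in an algebra
    with the Yokonuma relations. *)
Section BlockIdempotent.
Variables (S : idomainType) (b n : nat) (zeta binv q a : S).
Hypotheses (b_gt0 : (0 < b)%N) (n_gt0 : (0 < n)%N).
Hypothesis zeta_prim : b.-primitive_root zeta.
Hypothesis b_inv : binv * b%:R = 1.
Variables (B : pzAlgType S) (T : 'I_n -> B) (R : nat -> B).
Hypothesis yk : yokonuma b q a T R.
Variable al : 'I_b -> nat.
Hypothesis al_sum : (\sum_j al j = n)%N.
Local Notation mb := (mbar al).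
Local Notation col := (fun i => nth 0%N (char_seq al) i).
Local Notation eps := (zeta ^+ ((b ^ 2 - b) %/ 2)).
Local Notation proj := (eig_proj b zeta binv).

Definition block_char : {ffun 'I_n -> 'I_b} :=
  [ffun k : 'I_n => insubd (Ordinal b_gt0) (col k).-1].

Let mb_n : mb b = n. Proof. by rewrite mbar_full. Qed.

Lemma block_charE (k : 'I_n) : (block_char k).+1 = col k.
Proof.
have /andP[c0 cb] : (0 < col k <= b)%N by apply: char_seq_range; rewrite mb_n.
by rewrite ffunE val_insubd; case: ltnP => h; lia.
Qed.

Definition block_idem : B := char_proj b zeta binv T (fun k : 'I_n => col k).
Local Notation e := block_idem.

Lemma block_idemE : e = char_proj b zeta binv T (fun k => (block_char k).+1).
Proof. by apply: char_proj_ext => k; rewrite block_charE. Qed.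

Lemma block_idem_idem : e * e = e.
Proof. exact: (char_proj_idem b_gt0 zeta_prim b_inv yk). Qed.

Let block_lt i : same_block al i -> (i < n.-1)%N.
Proof. by rewrite /same_block mb_n => /andP[]; lia. Qed.

Lemma R_block_idem i : same_block al i -> R i * e = e * R i.
Proof.
move=> hi; have iN := block_lt hi; have /andP[i1 /eqP ce] := hi.
rewrite block_idemE; have /= -> := R_ech b_gt0 zeta_prim b_inv yk (Ordinal iN) block_char.
apply: (congr1 (fun z => z * R i)); apply: char_proj_ext => k; rewrite ffunE !block_charE.
rewrite val_tperm_swap /swap_nat /=; case: eqP => [-> //|_].
by case: eqP => [-> |].
Qed.

Lemma R_sq_block_idem i : same_block al i ->
  R i * R i * e = q%:AC * e + (b%:R * a * eps ^+ col i)%:AC * (R i * e).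
Proof.
move=> hi; have iN := block_lt hi; have /andP[i1 /eqP ce] := hi.
have /= -> := yk_quad yk (Ordinal iN); rewrite mulrDl; congr (_ + _).
have Te j : T j * e = (zeta ^+ col j)%:AC * e by exact: (T_char_proj binv b_gt0 zeta_prim yk).
rewrite -!mulrA R_block_idem //; move: (e) Te => e' Te.
have TX (j : 'I_n) m u : T j ^+ m * (e' * u) = (zeta ^+ (col j * m))%:AC * (e' * u).
  elim: m => [|m IH]; first by rewrite muln0 !expr0 rmorph1 mul1r.
  rewrite exprS -mulrA IH mulrA -alg_const_central -mulrA [T j * _]mulrA Te.
  by rewrite -[_ * e' * u]mulrA mulrA -rmorphM -exprD mulnS addnC.
rewrite mulr_suml.
have -> : \sum_(k < b) T (ord_lo (Ordinal iN)) ^+ k * T (ord_hi (Ordinal iN)) ^+ (b - k) * (e' * R i)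
   = (b%:R)%:AC * (e' * R i).
  rewrite (eq_bigr (fun=> e' * R i)) => [|k _].
    by rewrite sumr_const card_ord rmorph_nat mulr_natl.
  rewrite -mulrA TX /= mulrA -alg_const_central -mulrA TX /= mulrA -rmorphM -exprD.
  by rewrite -ce -mulnDr addnC subnKC ?(ltnW (ltn_ord k)) // (zetaXb zeta_prim) rmorph1 mul1r.
rewrite [T _ ^+ _ * _]mulrA -alg_const_central -mulrA TX /= !mulrA -!rmorphM.
congr (_%:AC * _ * _); rewrite -exprM [(col i * _)%N]mulnC.
by rewrite [b%:R * a]mulrC.
Qed.

Let proj_cosw k d (j j' : 'I_n) c : (d <= k)%N -> j = k :> nat -> j' = (k - d)%N :> nat ->
  proj (T j) c * cosw R k d = cosw R k d * proj (T j') c.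
Proof.
elim: d j' => [|d IH] j' dk jk j'k /=.
  rewrite mul1r mulr1; congr eig_proj; congr T; apply: val_inj => /=; lia.
have kn : (k - d < n)%N by have := ltn_ord j; lia.
rewrite mulrA (IH (Ordinal kn)) //; last by lia.
have iN : (k - d.+1 < n.-1)%N by lia.
have /= := R_proj zeta binv yk (Ordinal iN) (Ordinal kn) c; rewrite -!mulrA => ->.
congr (_ * (_ * eig_proj _ _ _ (T _) _)); apply: val_inj.
rewrite [LHS](val_tperm_swap (Ordinal iN)) /swap_nat /=; case: eqP => [|_]; first by lia.
by case: eqP => [|]; lia.
Qed.

Lemma R_off_block k d p : p \in idx k -> (d <= k)%N -> (k < n)%N ->
  col (k - d)%N <> col k -> e * word_of R p * cosw R k d * e = 0.
Proof.
move=> pk dk kn ne; have kdn : (k - d < n)%N by lia.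
have e1 : e = e * proj (T (Ordinal kn)) (col k).
  by rewrite (char_proj_proj b_gt0 zeta_prim b_inv yk) /= eqxx.
have Pw : proj (T (Ordinal kn)) (col k) * word_of R p = word_of R p * proj (T (Ordinal kn)) (col k).
  apply: (word_of_comm pk) => i ik; have iN : (i < n.-1)%N by lia.
  have /= -> := R_proj zeta binv yk (Ordinal iN) (Ordinal kn) (col k).
  congr (_ * eig_proj _ _ _ (T _) _); apply: val_inj.
  rewrite [LHS](val_tperm_swap (Ordinal iN)) /swap_nat /=; case: eqP => [|_]; first by lia.
  by case: eqP => [|]; lia.
rewrite {1}e1 -[e * _ * word_of R p]mulrA Pw [e * (_ * _)]mulrA.
rewrite -[_ * proj _ _ * _]mulrA (@proj_cosw _ _ _ (Ordinal kdn)) //.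
rewrite -[LHS]mulrA -[cosw _ _ _ * _ * _]mulrA (proj_char_proj b_gt0 zeta_prim b_inv yk) /=.
have cc : (col (k - d)%N == col k %[mod b])%N = false.
  have h1 := block_charE (Ordinal kdn); have h2 := block_charE (Ordinal kn).
  rewrite -[col (k - d)%N]h1 -[col k]h2.
  rewrite ordS_mod; apply/negP => /eqP h; apply: ne.
  by rewrite -[LHS]h1 -[RHS]h2 h.
by rewrite cc !mulr0.
Qed.

Lemma block_words_span (gen : forall P : B -> Prop,
    (forall c : S, P c%:AC) -> (forall j, P (T j)) -> (forall i, (i < n.-1)%N -> P (R i)) ->
    (forall u v, P u -> P v -> P (u + v)) ->
    (forall u v, P u -> P v -> P (u * v)) -> forall u, P u) h :
  exists c : seq nat -> S, e * h = \sum_(p <- idx n) (c p)%:AC * (e * word_of R p).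
Proof.
have [c ->] := yokonuma_span b_gt0 n_gt0 zeta_prim b_inv yk gen h.
exists (fun p => c p block_char); rewrite mulr_sumr; apply: eq_bigr => p _.
rewrite mulr_sumr (bigD1 block_char) //= big1 ?addr0 => [|chi ne].
  by rewrite -block_idemE -!mulrA mulrA -alg_const_central -mulrA [e * (e * _)]mulrA block_idem_idem.
rewrite -!mulrA mulrA -alg_const_central -mulrA [e * (_ * _)]mulrA block_idemE.
by rewrite (ech_mul b_gt0 zeta_prim b_inv yk) eq_sym (negbTE ne) mul0r mulr0.
Qed.

End BlockIdempotent.

Section EtaExists.
Variables (L : fieldType) (n b : nat) (q a zeta s : L).
Hypothesis n_gt0 : (0 < n)%N.
Hypothesis b_gt0 : (0 < b)%N.

Local Notation A := (ground n b q a zeta s).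
Local Notation K := (fracA n b q a zeta s).
Local Notation qA := (qA n b q a zeta s).
Local Notation aA := (aA n b q a zeta s).
Local Notation zetaA := (zetaA n b q a zeta s).
Local Notation epsA := (epsA n b q a zeta s).
Local Notation H := (halg n b q a zeta s).
Local Notation T := (@hT' L n b q a zeta s).
Local Notation R := (@hRn L n b q a zeta s).
Local Notation toK := (@tofrac A).
Local Notation toKH := (@bc_in A K toK H).
Local Notation e := (block_idem zetaA).

Variables (xK yK : K) (bV rp : A).
Hypothesis gf : ground_facts xK yK bV rp.
Variable al : 'I_b -> nat.
Hypothesis al_sum : (\sum_j al j = n)%N.

Let yk := halg_yokonuma n b q a zeta s.

Lemma corner_free (c : seq nat -> A) :
  \sum_(p <- idx n) (c p)%:AC * (block_idem zetaA bV T al * word_of R p) = 0 ->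
  forall p, p \in idx n -> c p = 0.
Proof.
move=> h p pn; apply/eqP; rewrite -tofrac_eq0; apply/eqP.
pose chi0 := block_char n b_gt0 al.
pose c' p (chi : {ffun 'I_n -> 'I_b}) : K := if chi == chi0 then toK (c p) else 0.
suff /(_ p chi0 pn) : forall p chi, p \in idx n -> c' p chi = 0 by rewrite /c' eqxx.
apply: (kwords_free n_gt0 b_gt0 gf).
rewrite -[RHS](rmorph0 toKH) -h rmorph_sum; apply: eq_bigr => p' _.
rewrite (bigD1 chi0) //= big1 ?addr0 => [|chi ne]; last first.
  by rewrite /c' (negbTE ne) rmorph0 !mul0r.
rewrite /c' eqxx (rmorphM toKH) [X in _ = X * _]bc_in_cst -mulrA; congr (_ * _).
rewrite (rmorphM toKH) [X in _ = _ * X](word_of_morph toKH); congr (_ * _).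
rewrite (block_idemE bV b_gt0 n_gt0 (gf_zeta gf) T al_sum).
apply/esym; apply: (@char_proj_morph A K toK b n zetaA bV H (khalg n b q a zeta s) toKH T) => d.
exact: bc_in_cst.
Qed.

Lemma ex_eta : exists f : iten n q a zeta s al -> H, is_eta f.
Proof.
have fr := @corner_free.
have e_al_def : e_al n q a zeta s al = block_idem zetaA bV T al by exact: (e_al_E gf).
have zp := gf_zeta gf; have bi := gf_b gf.
have [//|||||||||||f [[f1 f2 f3 f4] f5 f6 f7]] := @corner_iso A qA (b%:R * aA) rp epsA b n al al_sum H
  (block_idem zetaA bV T al) R.
- exact: (gf_rp gf).
- exact: half_power_sq zp.
- exact: (block_idem_idem b_gt0 zp bi yk al).
- exact: (R_block_idem b_gt0 n_gt0 zp bi yk al_sum).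
- exact: (R_sq_block_idem b_gt0 n_gt0 zp bi yk al_sum).
- exact: (yk_far yk).
- exact: (yk_braid yk).
- exact: (R_off_block b_gt0 n_gt0 zp bi yk al_sum).
- exact: (block_words_span b_gt0 n_gt0 zp bi yk al_sum (@halg_gen _ _ _ _ _ _ _)).
- exact: corner_free.
- exact: n_gt0.
exists f; rewrite /is_eta e_al_def; split.
- by split.
- exact: f5.
- apply/seteqP; split=> h; rewrite /h_al /= e_al_def.
    by move=> [u _ uh]; apply/f6; exists u.
  by move=> /f6[u uh]; exists u.
- by move=> j l i ei; rewrite f7 -ei /hRn nat_indexE.
Qed.

Lemma eta_spec : is_eta (@Defs.eta L n b q a zeta s al).
Proof. by have [f hf] := ex_eta; apply: (xgetPex _ (ex_intro _ f hf)). Qed.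

Lemma eta_invK h : h_al (n := n) (q := q) (a := a) (zeta := zeta) (s := s) al h ->
  Defs.eta (eta_inv al h) = h.
Proof.
have [_ _ <- _] := eta_spec => -[u _ uh].
exact: (xgetPex 0 (ex_intro (fun v => Defs.eta v = h) u uh)).
Qed.

End EtaExists.

(** * Standard tableaux as lattice words *)

Lemma partition_nth l r r' : is_partition l -> (r <= r')%N -> (nth 0%N l r' <= nth 0%N l r)%N.
Proof.
move=> /andP[hs _] rr; have [h|h] := ltnP r' (size l); last by rewrite nth_default.
have gt : transitive geq by move=> u v w; rewrite /geq /= => h1 h2; apply: leq_trans h2 h1.
have rf : reflexive geq by move=> u; rewrite /geq /= leqnn.
by apply: (sorted_leq_nth gt rf 0%N hs); rewrite ?inE //=; apply: leq_ltn_trans h.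
Qed.

Lemma size_partition l : is_partition l -> (size l <= sumn l)%N.
Proof.
case/andP=> _; elim: l => //= x l IH; rewrite in_cons negb_or => /andP[x0 /IH]; lia.
Qed.

Section Tableau.
Variable l : seq nat.
Hypothesis l_part : is_partition l.
Local Notation m := (sumn l).

Definition diagram : seq (nat * nat) := [seq (r, c) | r <- iota 0 (size l), c <- iota 0 (nth 0%N l r)].

Lemma size_diagram : size diagram = m.
Proof.
rewrite size_allpairs_dep -[in RHS](mkseq_nth 0%N l) /mkseq; congr sumn.
by apply: eq_map => r; rewrite size_iota.
Qed.

Lemma mem_diagram r c : ((r, c) \in diagram) = (c < nth 0%N l r)%N.
Proof.
apply/allpairsPdep/idP => [[r' [c' [+ + [-> ->]]]]|cr]; first by rewrite !mem_iota.
exists r, c; split=> //; rewrite mem_iota //= add0n.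
by rewrite ltnNge; apply/negP => h; rewrite nth_default in cr.
Qed.

Section Standard.
Variable t : tableau m.
Hypothesis ht : is_standard t.
Local Notation row i := (nat_of_ord (t i).1).
Local Notation col i := (nat_of_ord (t i).2).

Lemma standard_inj i j : row i = row j -> col i = col j -> i = j.
Proof.
case/and4P: ht => /injectiveP tI _ _ _ r c; apply: tI.
by rewrite [t i]surjective_pairing [t j]surjective_pairing; congr pair; apply: val_inj.
Qed.

Lemma standard_box i : (col i < nth 0%N l (row i))%N.
Proof. by case/and4P: ht => _ /forallP. Qed.

Lemma standard_row i j : row i = row j -> (col i < col j)%N -> (i < j)%N.
Proof.
case/and4P: ht => _ _ /forallP/(_ i)/forallP/(_ j) /implyP h _ r c; apply: h.
by rewrite c andbT; apply/eqP/val_inj.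
Qed.

Lemma standard_col i j : col i = col j -> (row i < row j)%N -> (i < j)%N.
Proof.
case/and4P: ht => _ _ _ /forallP/(_ i)/forallP/(_ j) /implyP h r c; apply: h.
by rewrite c andbT; apply/eqP/val_inj.
Qed.

Lemma standard_surj r c : (c < nth 0%N l r)%N -> exists i, row i = r /\ col i = c.
Proof.
rewrite -mem_diagram => h.
pose s := [seq (row i, col i) | i <- enum 'I_m].
have us : uniq s.
  by rewrite map_inj_uniq ?enum_uniq // => i j [h1 h2]; apply: standard_inj.
have [||_ e] := @uniq_min_size _ s diagram us.
- by move=> _ /mapP[i _ ->]; rewrite mem_diagram standard_box.
- by rewrite size_diagram size_map size_enum_ord.
- by move: h; rewrite -e => /mapP[i _ [-> ->]]; exists i.
Qed.

(** Entries increase along the rows and columns, hence towards the south-east. *)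
Lemma standard_mono i j : (row i <= row j)%N -> (col i <= col j)%N -> (i <= j)%N.
Proof.
move=> hr hc; have [k [kr kc]] : exists k, row k = row i /\ col k = col j.
  by apply: standard_surj; apply: leq_trans (standard_box j) (partition_nth l_part hr).
have ik : (i <= k)%N.
  move: hc; rewrite leq_eqVlt => /orP[/eqP e|lt]; last by apply/ltnW/standard_row; rewrite ?kr ?kc.
  by rewrite (@standard_inj i k) ?kr ?kc.
apply: leq_trans ik _; move: hr; rewrite leq_eqVlt => /orP[/eqP e|lt].
  by rewrite (@standard_inj k j) ?kr ?kc.
by apply/ltnW/standard_col; rewrite ?kr ?kc.
Qed.

Variable comp : nat.

Definition tab_word : seq (nat * nat) := [seq (comp, row i) | i <- enum 'I_m].

Definition content (i : 'I_m) : int := (col i)%:Z - (row i)%:Z.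

Lemma size_tab_word : size tab_word = m. Proof. by rewrite size_map size_enum_ord. Qed.

Let cols k r := [seq col i | i <- [seq i <- take k (enum 'I_m) | row i == r]].

Let uniq_cols k r : uniq (cols k r).
Proof.
rewrite map_inj_in_uniq ?filter_uniq ?take_uniq ?enum_uniq // => i j.
rewrite !mem_filter => /andP[/eqP hi _] /andP[/eqP hj _] h.
by apply: standard_inj; rewrite // hi hj.
Qed.

Let mem_take_enum (i : 'I_m) k : (i \in take k (enum 'I_m)) = (i < k)%N.
Proof.
rewrite -(mem_map val_inj) map_take val_enum_ord take_iota mem_iota add0n /=.
by rewrite ltn_min ltn_ord andbT.
Qed.

Let mem_cols k r c : reflect (exists i : 'I_m, [/\ (i < k)%N, row i = r & col i = c]) (c \in cols k r).
Proof.
apply: (iffP mapP) => [[i + ->]|[i [ik ri ci]]].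
  by rewrite mem_filter mem_take_enum => /andP[/eqP ri ik]; exists i.
by exists i; rewrite // mem_filter mem_take_enum ik ri eqxx.
Qed.

Let boxes_cols k r : boxes (take k tab_word) comp r = size (cols k r).
Proof.
rewrite /boxes -map_take count_map size_map size_filter; apply: eq_count => i /=.
by rewrite xpair_eqE eqxx.
Qed.

Lemma boxes_tab_word r : boxes tab_word comp r = nth 0%N l r.
Proof.
rewrite -[tab_word]take_size boxes_cols size_tab_word -[RHS](size_iota 0).
apply/perm_size/uniq_perm; rewrite ?iota_uniq // => c.
 rewrite mem_iota add0n /=; apply/mem_cols/idP => [[i [_ <- <-]]|]; first exact: standard_box.
by move=> /standard_surj[i [ri ci]]; exists i; rewrite ltn_ord.
Qed.

Lemma boxes_tab_word_out j r : j != comp -> boxes tab_word j r = 0%N.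
Proof.
move=> ne; apply/count_memPn/mapP => -[i _ []] e; by rewrite e eqxx in ne.
Qed.

Lemma nth_tab_word (i : 'I_m) : nth (0%N, 0%N) tab_word i = (comp, row i).
Proof. by rewrite (nth_map i) ?size_enum_ord // nth_ord_enum. Qed.

Lemma weight_tab_word (i : 'I_m) : weight tab_word i = (comp, content i).
Proof.
rewrite /weight nth_tab_word /= boxes_cols /content; congr (_, _%:Z - _).
rewrite -[RHS](size_iota 0); apply/perm_size/uniq_perm; rewrite ?iota_uniq // => c.
rewrite mem_iota add0n /=; apply/mem_cols/idP => [[k [ki rk <-]]|ci].
  rewrite ltnNge; apply/negP => h.
  by have := @standard_mono i k; rewrite rk leqnn h => /(_ isT isT); lia.
have [|k [rk ck]] := @standard_surj (row i) c; first by apply: ltn_trans ci (standard_box i).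
by exists k; split=> //; apply: standard_row; rewrite ?ck.
Qed.

Lemma tab_word_lattice : lattice tab_word.
Proof.
apply/latticeP => k; apply/shape_okP => j r; have [-> |ne] := eqVneq j comp; last first.
  suff -> : boxes (take k tab_word) j r.+1 = 0%N by [].
  apply/count_memPn; have /count_memPn := boxes_tab_word_out r.+1 ne.
  by apply: contra; apply: mem_take.
rewrite !boxes_cols; apply: uniq_leq_size => // c /mem_cols[i [ik ri ci]].
have [|i' [ri' ci']] := @standard_surj r c.
  by apply: leq_trans (partition_nth l_part (leqnSn r)); rewrite -ri -ci standard_box.
apply/mem_cols; exists i'; split=> //; apply: ltn_trans ik.
by apply: standard_col; rewrite ?ci ?ci' // ri ri'.
Qed.

Lemma content_range i j : (`|content i - content j| < m)%N.
Proof.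
suff h (i' j' : 'I_m) : (col i' + row j' < m)%N.
  by have := h i j; have := h j i; rewrite /content; lia.
have ci := standard_box i'; have rj := standard_box j'; move: ci rj (partition_nth l_part (leq0n (row i'))).
have sj : (row j' < size l)%N.
  by rewrite ltnNge; apply/negP => h; have := standard_box j'; rewrite nth_default.
have := l_part; rewrite /is_partition; move: (row i') (row j') (col i') (col j') sj.
clear; case: l => [//|x s] r r' c c' /= rs /andP[_]; rewrite in_cons negb_or => /andP[_ s0] h1 _ h2.
have : (size s <= sumn s)%N.
  by elim: {rs h1 h2} s s0 => //= y s IH; rewrite in_cons negb_or => /andP[y0 /IH]; lia.
lia.
Qed.

Section Swap.
Variable i : 'I_m.-1.
Local Notation lo := (ord_lo i).
Local Notation hi := (ord_hi i).

(** Consecutive entries that are in the same row or column are next to each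
    other, so that exchanging the others preserves standardness. *)
Lemma swap_standard : (`|content lo - content hi| != 1)%N -> is_standard (swap_tableau i t).
Proof.
move=> nadj; have tinj : injective t by case/and4P: ht => /injectiveP.
have sE k : swap_tableau i t k = t (tperm lo hi k) by rewrite ffunE.
have sw_lt (u v : 'I_m) : (tperm lo hi u < tperm lo hi v)%N -> ~ (tperm lo hi u = lo /\ tperm lo hi v = hi) ->
    (u < v)%N.
  move=> h1 h2; have {}h2 : ~ (u = hi /\ v = lo).
    by case=> hu hv; apply: h2; rewrite hu hv tpermL tpermR.
  move: h1; rewrite !val_tperm_swap /swap_nat.
  have ne : ~ (u = i.+1 :> nat /\ v = i :> nat) by case=> hu hv; apply: h2; split; apply: val_inj.
  move: ne; clear; do !case: eqP => ?; lia.
apply/and4P; split.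
- by apply/injectiveP => u v; rewrite !sE => /tinj/perm_inj.
- by apply/forallP => u; rewrite sE standard_box.
- apply/forallP => u; apply/forallP => v; rewrite !sE; apply/implyP => /andP[/eqP r c].
  have r' := congr1 val r; apply: sw_lt; first exact: standard_row.
  case=> hu hv; move: r' c; rewrite hu hv /= => r' c.
  have [|k [rk ck]] := @standard_surj (row hi) (col lo).+1.
    by apply: leq_ltn_trans (standard_box hi); rewrite c.
  have k1 : (lo <= k)%N by apply: standard_mono; rewrite ?rk ?ck ?r'.
  have k2 : (k <= hi)%N by apply: standard_mono; rewrite ?rk ?ck.
  have [e|e] : k = lo \/ k = hi.
  + by have [h|h] := eqVneq (k : nat) i; [left|right]; apply: val_inj => /=; move: h k1 k2 => /=; lia.
  + by move: ck; rewrite e; lia.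
  + by move: nadj; rewrite /content; move: r' ck; rewrite e; lia.
- apply/forallP => u; apply/forallP => v; rewrite !sE; apply/implyP => /andP[/eqP c r].
  have c' := congr1 val c; apply: sw_lt; first exact: standard_col.
  case=> hu hv; move: c' r; rewrite hu hv /= => c' r.
  have [|k [rk ck]] := @standard_surj (row lo).+1 (col hi).
    by apply: leq_trans (standard_box hi) (partition_nth l_part r).
  have k1 : (lo <= k)%N by apply: standard_mono; rewrite ?rk ?ck ?c'.
  have k2 : (k <= hi)%N by apply: standard_mono; rewrite ?rk ?ck.
  have [e|e] : k = lo \/ k = hi.
  + by have [h|h] := eqVneq (k : nat) i; [left|right]; apply: val_inj => /=; move: h k1 k2 => /=; lia.
  + by move: rk; rewrite e; lia.
  + by move: nadj; rewrite /content; move: c' rk; rewrite e; lia.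
Qed.

End Swap.
End Standard.

Section SwapContent.
Variables (t : tableau m) (i : 'I_m.-1).
Local Notation lo := (ord_lo i).
Local Notation hi := (ord_hi i).

Lemma swap_tableauK : swap_tableau i (swap_tableau i t) = t.
Proof. by apply/ffunP => k; rewrite !ffunE tpermK. Qed.

Lemma content_swap k : content (swap_tableau i t) k = content t (tperm lo hi k).
Proof. by rewrite /content !ffunE. Qed.

Lemma tab_word_swap comp : tab_word (swap_tableau i t) comp = swap_word i (tab_word t comp).
Proof.
apply: (@eq_from_nth _ (0%N, 0%N)); first by rewrite size_swap_word !size_tab_word.
rewrite size_tab_word => k km; rewrite nth_mkseq ?size_tab_word //.
rewrite -[k]/(val (Ordinal km)) nth_tab_word ffunE /= -(val_tperm_swap i (Ordinal km)).
by rewrite nth_tab_word.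
Qed.

Lemma swap_not_adjacent : is_standard t -> is_standard (swap_tableau i t) ->
  (`|content t lo - content t hi| != 1)%N.
Proof.
move=> h1 h2; have m1 := @standard_mono _ h1 hi lo; have m2 := @standard_mono _ h2 hi lo.
move: m1 m2; rewrite !ffunE tpermL tpermR /content /=.
set r := nat_of_ord (t lo).1; set c := nat_of_ord (t lo).2.
set r' := nat_of_ord (t hi).1; set c' := nat_of_ord (t hi).2.
by clear; lia.
Qed.

End SwapContent.

Lemma tab_word_inj t t' comp : is_standard t -> is_standard t' ->
  tab_word t comp = tab_word t' comp -> t = t'.
Proof.
move=> h h' e; apply/ffunP => k.
have := congr1 (fun w => nth (0%N, 0%N) w k) e; rewrite !nth_tab_word => -[er].
have := congr1 (fun w => weight w k) e; rewrite !weight_tab_word // => -[].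
rewrite /content er => ec; rewrite [t k]surjective_pairing [t' k]surjective_pairing.
congr pair; apply: val_inj => //=; lia.
Qed.

(** The tableau filled row by row. *)
Lemma ex_standard : exists t : tableau m, is_standard t.
Proof.
pose rw i := reshape_index l i; pose cl i := reshape_offset l i.
have box (i : 'I_m) : (cl i < nth 0%N l (rw i))%N by apply: reshape_offsetP.
have rm (i : 'I_m) : (rw i < m)%N.
  apply: leq_trans (size_partition l_part).
  by rewrite ltnNge; apply/negP => h; have := box i; rewrite nth_default.
have cm (i : 'I_m) : (cl i < m)%N.
  apply: leq_trans (box i) _; apply: leq_trans (partition_nth l_part (leq0n _)) _.
  by case: (l) => //= x s; rewrite leq_addr.
exists [ffun i => (Ordinal (rm i), Ordinal (cm i))].
have lt (i j : 'I_m) : (rw i < rw j)%N || (rw i == rw j) && (cl i < cl j)%N -> (i < j)%N.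
  by rewrite [(i < j)%N]ltnNge (reshape_leq l j i) -/(rw i) -/(rw j) -/(cl i) -/(cl j); lia.
apply/and4P; split.
- apply/injectiveP => i j; rewrite !ffunE => -[e1 e2]; apply: val_inj.
  by rewrite /= -(reshape_indexK l i) -(reshape_indexK l j) -/(rw i) -/(cl i) e1 e2.
- by apply/forallP => i; rewrite ffunE /=; exact: box.
- apply/forallP => i; apply/forallP => j; rewrite !ffunE /=; apply/implyP => /andP[/eqP[e] c].
  by apply: lt; rewrite e eqxx c orbT.
- apply/forallP => i; apply/forallP => j; rewrite !ffunE /=; apply/implyP => /andP[_ c].
  by apply: lt; rewrite c.
Qed.

End Tableau.

(** * Hoefsmit's modules *)

Section HoefsmitModule.
Variables (l : seq nat).
Hypothesis l_part : is_partition l.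
Local Notation m := (sumn l).
Local Notation J := (std_tableau l).

Definition tab_weight (t : J) (k : nat) : nat * int :=
  nat_index (0%N, 0%:Z) (fun i => (0%N, content (val t) i)) k.

Definition tab_swap (k : nat) (t : J) : J :=
  nat_index t (fun i : 'I_m.-1 => insubd t (swap_tableau i (val t))) k.

Lemma tab_weightE (t : J) (i : 'I_m) : tab_weight t i = (0%N, content (val t) i).
Proof. exact: nat_indexE. Qed.

Lemma weight_tab_weight (t : J) k : (k < m)%N -> weight (tab_word (val t) 0) k = tab_weight t k.
Proof. by move=> km; rewrite -[k]/(val (Ordinal km)) tab_weightE weight_tab_word // (valP t). Qed.

Lemma tab_weight_inj t t' : (forall k, (k < m)%N -> tab_weight t k = tab_weight t' k) -> t = t'.
Proof.
move=> h; apply: val_inj; apply: (@tab_word_inj _ l_part _ _ 0%N); rewrite ?(valP t) ?(valP t') //.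
apply: weight_inj; rewrite ?tab_word_lattice ?size_tab_word ?(valP t) ?(valP t') //.
by move=> k km; rewrite !weight_tab_weight // h.
Qed.

Lemma tab_swapE (i : 'I_m.-1) (t : J) : tab_swap i t = insubd t (swap_tableau i (val t)).
Proof. exact: nat_indexE. Qed.

Lemma tab_adjacent (i : 'I_m.-1) (t : J) :
  adjacent (tab_weight t i) (tab_weight t i.+1) = ~~ is_standard (swap_tableau i (val t)).
Proof.
have -> : tab_weight t i = (0%N, content (val t) (ord_lo i)) by exact: (tab_weightE _ (ord_lo i)).
have -> : tab_weight t i.+1 = (0%N, content (val t) (ord_hi i)) by exact: (tab_weightE _ (ord_hi i)).
rewrite /adjacent eqxx /=; have [/eqP h|h] := eqVneq `|content (val t) (ord_lo i) - content (val t) (ord_hi i)|%N 1%N.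
  apply/esym/negP => h'; have := swap_not_adjacent l_part (valP t) h'; rewrite h //.
by apply/esym/negbTE; rewrite negbK; apply: (swap_standard l_part) => //; exact: (valP t).
Qed.

Lemma tab_swap_val (i : 'I_m.-1) (t : J) : ~~ adjacent (tab_weight t i) (tab_weight t i.+1) ->
  val (tab_swap i t) = swap_tableau i (val t).
Proof. by rewrite tab_adjacent negbK => h; rewrite tab_swapE insubdK. Qed.

Lemma tab_weight_swap (i : 'I_m.-1) t : ~~ adjacent (tab_weight t i) (tab_weight t i.+1) ->
  forall k, (k < m)%N -> tab_weight (tab_swap i t) k = tab_weight t (swap_nat i k).
Proof.
move=> na k km; rewrite -[k]/(val (Ordinal km)) tab_weightE tab_swap_val // content_swap /=.
by rewrite -(val_tperm_swap i (Ordinal km)) tab_weightE.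
Qed.

Variables (S : comNzRingType) (a b : int -> S) (q v : S) (G : int -> Prop).
Hypothesis hc : hoefsmit_coefficients a b 1 q v G.
Hypothesis G_ok : forall k, k != 0 -> (`|k| < m)%N -> G k.
Local Notation Ac := (Acoef a 1).
Local Notation Bc := (Bcoef b 1 q).

Definition hoef_op (i : nat) : endo {ffun J -> S^o} := mix_op tab_weight tab_swap Ac Bc i.

Let wt_sw k t : (k.+1 < m)%N -> Bc (tab_weight t k) (tab_weight t k.+1) != 0 ->
  forall i, (i < m)%N -> tab_weight (tab_swap k t) i = tab_weight t (swap_nat k i).
Proof.
move=> km nz; have k1 : (k < m.-1)%N by lia.
apply: (tab_weight_swap (i := Ordinal k1)) => /=.
by apply: contraNN nz => h; rewrite /Bcoef h; case/andP: h => ->.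
Qed.

Let good k k' t : (k < m)%N -> (k' < m)%N -> tab_weight t k != tab_weight t k' ->
  same_good G (tab_weight t k) (tab_weight t k').
Proof.
move=> km km'; rewrite -[k]/(val (Ordinal km)) -[k']/(val (Ordinal km')) !tab_weightE => ne _ /=.
apply: G_ok; last by apply: content_range => //; exact: (valP t).
by rewrite subr_eq0; apply: contra ne => /eqP ->.
Qed.

Let good1 k t : (k.+1 < m)%N -> same_good G (tab_weight t k) (tab_weight t k.+1).
Proof.
move=> km; apply: good; rewrite ?(ltnW km) // -!weight_tab_weight // 1?ltnW //.
by apply: weight_neq1; rewrite ?size_tab_word // tab_word_lattice // (valP t).
Qed.

Let good2 k t : (k.+2 < m)%N -> same_good G (tab_weight t k) (tab_weight t k.+2).
Proof.
move=> km; apply: good => //; [lia|]; rewrite -!weight_tab_weight //; [|lia].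
by apply: weight_neq2; rewrite ?size_tab_word // tab_word_lattice // (valP t).
Qed.

Lemma hoef_op_hecke : hecke_relations q v m hoef_op.
Proof.
split.
- move=> i j jm ij; apply: endoP => f; apply/ffunP => t; rewrite !endo_mulE.
  have := @mix_op_far S J m _ tab_weight tab_swap Ac Bc tab_weight_inj wt_sw i j f t; apply; lia.
- move=> i im; have i1 : (i.+1 < m)%N by lia.
  have i2 : (i.+2 < m)%N by lia.
  apply: endoP => f; apply/ffunP => t; rewrite !endo_mulE.
  apply: (mix_op_braid tab_weight_inj wt_sw) => //.
  + exact: (AB_braid1 hc (@good1 _ t i1) (@good1 _ t i2) (@good2 _ t i2)).
  + exact: (AB_braid2 hc (@good1 _ t i1) (@good1 _ t i2) (@good2 _ t i2)).
  + exact: (AB_braid3 hc (@good1 _ t i1) (@good1 _ t i2) (@good2 _ t i2)).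
- move=> i im; have i1 : (i.+1 < m)%N by lia.
  apply: endoP => f; apply/ffunP => t; rewrite endo_mulE.
  have cE (k : nat) : (k < m)%N -> (tab_weight t k).1 = 0%N.
    by move=> km; rewrite -[k]/(val (Ordinal km)) tab_weightE.
  rewrite /hoef_op (@mix_op_sq _ _ _ _ tab_weight tab_swap Ac Bc tab_weight_inj wt_sw (fun _ _ => q)
    (fun c d => if c.1 == d.1 then v * 1 ^+ c.1.+1 else 0)) //; last first.
  + exact: (AB_offdiag hc (@good1 _ t i1)).
  + exact: (AB_square hc (@good1 _ t i1)).
  rewrite !cE ?(ltnW i1) // eqxx expr1n mulr1 endo_addE endo_mulE !endo_cstE [RHS]ffunE.
  by rewrite !ffunE.
Qed.

Local Notation basis t := ([ffun t' => (val t' == t)%:R] : {ffun J -> S^o}).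

Lemma hoef_op_basis (i : 'I_m.-1) (t : J) : let k := axial (val t) (ord_hi i) (ord_lo i) in
  hoef_op i (basis (val t)) = a k *: basis (val t) + b k *: basis (swap_tableau i (val t)).
Proof.
move=> k; apply/ffunP => t'; rewrite mix_opE !ffunE.
have wlo t0 : tab_weight t0 i = (0%N, content (val t0) (ord_lo i)) by exact: (tab_weightE _ (ord_lo i)).
have whi t0 : tab_weight t0 i.+1 = (0%N, content (val t0) (ord_hi i)) by exact: (tab_weightE _ (ord_hi i)).
congr (_ + _).
  rewrite /Acoef wlo whi eqxx expr1n mul1r; have [e|ne] := eqVneq (val t') (val t).
    by rewrite e !mulr1n /GRing.scale /= !mulr1 /k /axial.
  by rewrite mulr0 scaler0.
have [e|ne] := eqVneq (val t') (swap_tableau i (val t)).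
  have na : ~~ adjacent (tab_weight t' i) (tab_weight t' i.+1).
    by rewrite tab_adjacent negbK e swap_tableauK (valP t).
  rewrite tab_swap_val // e swap_tableauK eqxx /Bcoef (negbTE na) wlo whi eqxx /= expr1n mul1r.
  by rewrite e !content_swap tpermL tpermR /GRing.scale.
rewrite scaler0; have [h|na] := boolP (adjacent (tab_weight t' i) (tab_weight t' i.+1)).
  by rewrite /Bcoef h wlo whi eqxx mul0r.
rewrite tab_swap_val //; case: eqP => [h|]; last by rewrite mulr0.
by move: ne; rewrite -h swap_tableauK eqxx.
Qed.

End HoefsmitModule.

Section HoefAction.
Variables (L : fieldType) (n b : nat) (q a zeta s : L).
Local Notation A := (ground n b q a zeta s).
Local Notation K := (fracA n b q a zeta s).
Local Notation qA := (qA n b q a zeta s).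
Local Notation aA := (aA n b q a zeta s).
Variables (xK yK : K) (bV rp : A).
Hypothesis gf : ground_facts xK yK bV rp.
Variable l : seq nat.
Hypothesis l_part : is_partition l.
Hypothesis l_size : (sumn l <= n)%N.
Local Notation ha := (hoefA_a n b q a zeta s).
Local Notation hb := (hoefA_b n b q a zeta s).

Let G_ok k : k != 0 -> (`|k| < sumn l)%N -> distance_ok n k.
Proof. by move=> k0 kl; rewrite /distance_ok k0 (leq_trans kl l_size). Qed.

Lemma ex_hoefsmit : exists act : iA n b q a zeta s (sumn l) -> hoef_mod n b q a zeta s l -> hoef_mod n b q a zeta s l,
  is_hoefsmit act.
Proof.
have [F [Fc Fg]] := ialg_lift (hoef_op_hecke l_part (gf_hoef gf) G_ok).
exists (fun u f => F u f); split; first split.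
- by move=> u f g; rewrite endoD.
- by move=> u v f; rewrite rmorphD.
- by move=> u v f; rewrite rmorphM.
- by move=> c f; rewrite Fc.
- by move=> i t k; rewrite Fg; exact: hoef_op_basis.
Qed.

Lemma hoef_act_spec : is_hoefsmit (@hoef_act L n b q a zeta s l).
Proof. by have [f hf] := ex_hoefsmit; apply: (xgetPex _ (ex_intro _ f hf)). Qed.

Lemma hoef_act_gen (i : 'I_(sumn l).-1) (f : hoef_mod n b q a zeta s l) :
  hoef_act (iS _ _ i) f = hoef_op l ha hb qA i f.
Proof.
have [[aD _ aM aC] hg] := hoef_act_spec.
have aZ u c g : hoef_act u (c *: g) = c *: hoef_act u g :> hoef_mod n b q a zeta s l.
  by rewrite -!aC -!aM alg_const_central.
have a0 u : hoef_act u 0 = 0 :> hoef_mod n b q a zeta s l.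
  by have := aZ u 0 0; rewrite !scale0r.
have -> : f = \sum_(t : std_tableau l) f t *: hoef_basis n b q a zeta s (val t).
  apply/ffunP => t; rewrite sum_ffunE (bigD1 t) //= big1 ?addr0 => [|t' ne].
    by rewrite !ffunE eqxx /GRing.scale /= mulr1.
  by rewrite !ffunE (inj_eq val_inj) eq_sym (negbTE ne) scaler0.
rewrite (big_morph (hoef_act (iS _ _ i)) (aD _) (a0 _)) endo_sum.
by apply: eq_bigr => t _; rewrite aZ endoZ hg (hoef_op_basis l_part).
Qed.

End HoefAction.

(** * Tuples of standard tableaux as lattice words *)

Lemma boxes_cat u v j r : boxes (u ++ v) j r = (boxes u j r + boxes v j r)%N.
Proof. exact: count_cat. Qed.

Lemma lattice_cat u v : lattice u -> lattice v -> lattice (u ++ v).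
Proof.
move=> /latticeP hu /latticeP hv; apply/latticeP => k; rewrite take_cat.
case: ltnP => // _; apply/shape_okP => j r; rewrite !boxes_cat.
have /latticeP/lattice_shape/shape_okP h1 := hu; have /shape_okP h2 := hv (k - size u)%N.
by rewrite leq_add.
Qed.

Lemma swap_nat_shift i l k : swap_nat (i + l) (i + k) = (i + swap_nat l k)%N.
Proof. by rewrite /swap_nat eqn_add2l -addnS eqn_add2l; do !case: ifP. Qed.

Section TupleWords.
Variables (b n : nat) (lam : 'I_b -> seq nat).
Hypothesis lam_part : forall j, is_partition (lam j).
Hypothesis lam_size : (\sum_j sumn (lam j) = n)%N.
Local Notation al := (fun j => sumn (lam j)).
Local Notation mb := (mbar al).
Local Notation tuple := {dffun forall j : 'I_b, std_tableau (lam j)}.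
Implicit Types (tau : tuple) (j : 'I_b).

Definition tup_seq tau : seq (nat * nat) := flatten [seq tab_word (val (tau j)) j | j <- enum 'I_b].

Let mb_n : mb b = n. Proof. by rewrite mbar_full. Qed.

Lemma size_tup_seq tau : size (tup_seq tau) = n.
Proof.
rewrite size_flatten /shape -map_comp -lam_size sumnE big_map big_enum /=.
by apply: eq_bigr => j _; rewrite size_tab_word.
Qed.

Let tup_split tau j : exists2 P, size P = mb j /\ forall x, x \in P -> (x.1 < j)%N &
  exists Q, tup_seq tau = P ++ tab_word (val (tau j)) j ++ Q.
Proof.
rewrite /tup_seq; set s := enum 'I_b.
have es : s = take j s ++ j :: drop j.+1 s.
  rewrite -[LHS](cat_take_drop j) (drop_nth j) ?size_enum_ord //.
  by rewrite nth_ord_enum.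
have mem_s (i : 'I_b) : (i \in take j s) = (i < j)%N.
  rewrite -(mem_map val_inj) map_take val_enum_ord take_iota mem_iota add0n /=.
  by rewrite ltn_min ltn_ord andbT.
exists (flatten [seq tab_word (val (tau i)) i | i <- take j s]); last first.
  by eexists; rewrite {1}es map_cat flatten_cat /=.
split; last first.
  by move=> x /flatten_mapP[i + /mapP[k _ ->]] /=; rewrite mem_s.
rewrite size_flatten /shape -map_comp sumnE big_map /mbar.
rewrite (eq_bigr al) => [|i _]; last by rewrite /= size_tab_word.
rewrite -[RHS]big_filter; apply: perm_big; apply: uniq_perm.
- by rewrite take_uniq ?enum_uniq.
- by rewrite filter_uniq ?index_enum_uniq.
- by move=> i; rewrite mem_filter mem_index_enum andbT mem_s.
Qed.

Lemma nth_tup_seq tau j l : (l < al j)%N ->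
  nth (0%N, 0%N) (tup_seq tau) (mb j + l) = nth (0%N, 0%N) (tab_word (val (tau j)) j) l.
Proof.
move=> lj; have [P [<- _] [Q ->]] := tup_split tau j.
by rewrite nth_cat ltnNge leq_addr addKn nth_cat size_tab_word lj.
Qed.

Lemma weight_tup_seq tau j (l : 'I_(al j)) : weight (tup_seq tau) (mb j + l) = (j : nat, content (val (tau j)) l).
Proof.
have lj := ltn_ord l; rewrite -(weight_tab_word (lam_part j) (valP (tau j)) j l).
rewrite /weight nth_tup_seq //; have [P [sP hP] [Q ->]] := tup_split tau j.
rewrite nth_tab_word /= -sP take_cat ltnNge leq_addr addKn takel_cat ?size_tab_word ?(ltnW lj) //.
rewrite boxes_cat (_ : boxes P _ _ = 0%N) //.
by apply/count_memPn/negP => /hP /=; rewrite ltnn.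
Qed.

Lemma boxes_tup_seq tau j r : boxes (tup_seq tau) j r = nth 0%N (lam j) r.
Proof.
rewrite /boxes count_flatten -map_comp sumnE big_map big_enum /= (bigD1 j) //=.
rewrite -[count_mem _ _]/(boxes _ j r) (boxes_tab_word (valP (tau j))).
rewrite big1 ?addn0 // => i ne; apply: boxes_tab_word_out.
by rewrite eq_sym.
Qed.

Lemma tup_seq_lattice tau : lattice (tup_seq tau).
Proof.
rewrite /tup_seq; elim: (enum _) => //= j s IH; apply: lattice_cat => //.
exact: (tab_word_lattice (lam_part j) (valP _)).
Qed.

Lemma tup_seq_word tau : tup_seq tau \in lattice_words b n n.
Proof.
rewrite mem_lattice_words tup_seq_lattice size_tup_seq eqxx /=; apply/allP => x.
move=> /flatten_mapP[j _ /mapP[k _ ->]]; rewrite mem_letters /= ltn_ord /=.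
apply: (leq_trans (ltn_ord _)); rewrite -mb_n.
apply: leq_trans (mbar_le al (ltn_ord j)); by rewrite mbarS leq_addl.
Qed.

Definition tup_word tau : lword b n := SeqSub (tup_seq_word tau).

Lemma tup_word_inj : injective tup_word.
Proof.
move=> tau tau' /(congr1 (@ssval _ _)) /= e; apply/ffunP => j; apply: val_inj.
apply: (tab_word_inj (lam_part j) (valP _) (valP _) (comp := j)).
apply: (@eq_from_nth _ (0%N, 0%N)); rewrite ?size_tab_word // => l lj.
by rewrite -!nth_tup_seq // e.
Qed.

Lemma tup_word_perm tau tau' : perm_eq (tup_seq tau) (tup_seq tau').
Proof.
apply: boxes_perm; apply: functional_extensionality_dep => j; apply: functional_extensionality_dep => r.
have [jb|jb] := ltnP j b; first by have /= := boxes_tup_seq _ (Ordinal jb) r => ->; rewrite (boxes_tup_seq tau' (Ordinal jb)).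
have out t : boxes (tup_seq t) j r = 0%N.
  apply/count_memPn/negP; have := tup_seq_word t; rewrite mem_lattice_words => /and3P[_ _ /allP h] /h.
  by rewrite mem_letters /= ltnNge jb.
by rewrite !out.
Qed.

Lemma tup_word_comp tau k : (k < n)%N -> (weight (tup_seq tau) k).1.+1 = nth 0%N (char_seq al) k.
Proof.
rewrite -mb_n => /mbar_block[j [l [-> lj]]].
by rewrite nth_char_seq // -[l]/(val (Ordinal lj)) weight_tup_seq.
Qed.

Definition tup_swap j (l : 'I_(al j).-1) tau : tuple :=
  finfun (dfwith tau (tab_swap l (tau j))).

Lemma tup_seq_swap j (l : 'I_(al j).-1) tau :
  ~~ adjacent (weight (tup_seq tau) (mb j + l)%N) (weight (tup_seq tau) (mb j + l).+1) ->
  tup_seq (tup_swap l tau) = swap_word (mb j + l) (tup_seq tau).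
Proof.
have -> : weight (tup_seq tau) (mb j + l) = (j : nat, content (val (tau j)) (ord_lo l)).
  exact: (weight_tup_seq tau (ord_lo l)).
have -> : weight (tup_seq tau) (mb j + l).+1 = (j : nat, content (val (tau j)) (ord_hi l)).
  by rewrite -addnS; exact: (weight_tup_seq tau (ord_hi l)).
move=> na; have l1 := ord_hi_subproof l.
apply: (@eq_from_nth _ (0%N, 0%N)); first by rewrite size_swap_word !size_tup_seq.
move=> k; rewrite size_tup_seq => kn; rewrite nth_mkseq ?size_tup_seq //.
have [|i [l' [ek li]]] := @mbar_block b al k; first by rewrite mb_n.
rewrite ek nth_tup_seq //; have [e|ne] := eqVneq j i.
  subst i; rewrite swap_nat_shift nth_tup_seq; last exact: swap_nat_lt.
  rewrite ffunE dfwith_in (tab_swap_val (lam_part j)); last first.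
    by move: na; rewrite /adjacent eqxx !(tab_weightE _ (ord_lo l)) !(tab_weightE _ (ord_hi l)).
  by rewrite tab_word_swap nth_mkseq // size_tab_word.
rewrite ffunE dfwith_out // -nth_tup_seq //; congr nth.
have kj l'' : (l'' < al j)%N -> (mb i + l' == mb j + l'')%N = false.
  move=> lj; apply/negP => /eqP e; have := @nth_char_seq b al i l' li; rewrite e nth_char_seq // => -[] e'.
  by move/eqP: ne; apply; apply: val_inj.
by rewrite /swap_nat kj ?(ltnW l1) // -addnS kj.
Qed.

End TupleWords.

Section CharacterIdempotents.
Variables (K : fieldType) (b n : nat) (zeta binv q a : K).
Hypotheses (b_gt0 : (0 < b)%N) (n_gt0 : (0 < n)%N).
Hypothesis zeta_prim : b.-primitive_root zeta.
Hypothesis b_inv : binv * b%:R = 1.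
Local Notation I := (lword b n).
Local Notation W := {ffun I -> K^o}.
Variables (B : pzAlgType K) (T : 'I_n -> B) (R : nat -> B).
Hypothesis yk : yokonuma b q a T R.
Variables (rho : {rmorphism B -> endo W}) (mu : I -> I -> B).
Hypothesis rho_cst : forall c : K, rho c%:AC = c%:AC.
Hypothesis rho_T : forall j, rho (T j) = @Tw K b n zeta j.
Hypothesis hmu : matrix_units (fun w w' => perm_eq (ssval w) (ssval w')) mu.
Hypothesis acts : forall w w' : I, perm_eq (ssval w) (ssval w') -> acts_unit rho (mu w w') w w'.

Lemma rho_faithful h : rho h = 0 -> h = 0.
Proof.
move=> h0; rewrite -[h]mulr1 -[h]mul1r -(mu_sum hmu) mulr_suml mulr_suml big1 // => i _.
rewrite mulr_sumr big1 // => j _; case ij : (perm_eq (ssval i) (ssval j)); last first.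
  by rewrite (mu_corner0 hmu) // ij.
have [c e] := mu_corner hmu h ij; rewrite e.
have := congr1 (fun x => rho x [ffun v => (v == j)%:R] i) e.
rewrite !rmorphM h0 mulr0 mul0r endo_zeroE ffunE rho_cst endo_mulE endo_cstE !ffunE acts //.
by rewrite eqxx ffunE eqxx mul1r /GRing.scale /= mulr1 => <-; rewrite rmorph0 mul0r.
Qed.

Lemma T_unit (j : 'I_n) (w w' : I) : perm_eq (ssval w) (ssval w') ->
  T j * mu w w' = (zeta ^+ (wt w j).1.+1)%:AC * mu w w'.
Proof.
move=> p; apply/eqP; rewrite -subr_eq0; apply/eqP/rho_faithful.
rewrite rmorphB !rmorphM rho_T rho_cst; apply/eqP; rewrite subr_eq0; apply/eqP.
apply: endoP => f; apply/ffunP => v; rewrite !endo_mulE diag_opE endo_cstE ffunE acts //.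
by have [->|ne] := eqVneq v w; rewrite // mul0r mulr0 scaler0.
Qed.

Definition has_char (chi : nat -> nat) (w : I) : bool :=
  [forall k : 'I_n, (wt w k).1.+1 == chi k].

Variable chi : nat -> nat.
Hypothesis chi_range : forall k : 'I_n, (0 < chi k <= b)%N.
Local Notation e := (char_proj b zeta binv T (fun k : 'I_n => chi k)).

Lemma idem_unit w : e * mu w w = if has_char chi w then mu w w else 0.
Proof.
case: ifP => [/forallP h|/negbT].
  rewrite /char_proj; elim: (index_enum _) => [|j s IH]; first by rewrite big_nil mul1r.
  rewrite big_cons -mulrA IH (eig_proj_on b_gt0 zeta_prim b_inv _ (T_unit j (perm_refl _))).
  by rewrite (eqP (h j)) eqxx.
rewrite negb_forall => /existsP[j nj].
have := char_proj_proj b_gt0 zeta_prim b_inv yk j (chi j) (fun k : 'I_n => chi k).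
rewrite eqxx => <-; rewrite -mulrA (eig_proj_on b_gt0 zeta_prim b_inv _ (T_unit j (perm_refl _))).
have wb : ((wt w j).1 < b)%N by apply: wt_comp.
have /andP[c0 cb] := chi_range j; have cb' : ((chi j).-1 < b)%N by lia.
have := ordS_mod (Ordinal wb) (Ordinal cb'); rewrite /= prednK // => ->.
rewrite -(inj_eq val_inj) /= ifF ?mulr0 //; apply/negP => /eqP h.
by case/eqP: nj; rewrite [(wt w j).1]h prednK.
Qed.

Lemma rho_idem (f : W) v : rho e f v = if has_char chi v then f v else 0.
Proof.
rewrite -[e]mulr1 -(mu_sum hmu) mulr_sumr rmorph_sum endo_sumE sum_ffunE (bigD1 v) //=.
rewrite big1 ?addr0 => [|w ne].
  rewrite idem_unit; case: ifP => _; last by rewrite rmorph0 endo_zeroE ffunE.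
  by rewrite acts // eqxx mul1r.
rewrite idem_unit; case: ifP => _; last by rewrite rmorph0 endo_zeroE ffunE.
by rewrite acts // eq_sym (negbTE ne) mul0r.
Qed.

End CharacterIdempotents.

(** * The modules of the multipartitions as functions on words *)

Lemma swap_wordK i w : (i.+1 < size w)%N -> swap_word i (swap_word i w) = w.
Proof.
move=> iw; apply: (@eq_from_nth _ (0%N, 0%N)); rewrite !size_swap_word // => k kw.
rewrite nth_mkseq ?size_swap_word // nth_mkseq ?swap_natK //; exact: swap_nat_lt.
Qed.

Lemma square_one_cancel (S : comNzRingType) (u x y z : S) : u * u = 1 ->
  u * (u * x * (y * z)) = x * y * z.
Proof. by move=> h; rewrite -mulrA mulrA h mul1r mulrA. Qed.

Section SpechtMap.
Variables (L : fieldType) (n b : nat) (q a zeta s : L).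
Hypothesis n_gt0 : (0 < n)%N.
Hypothesis b_gt0 : (0 < b)%N.

Local Notation A := (ground n b q a zeta s).
Local Notation K := (fracA n b q a zeta s).
Local Notation zetaA := (zetaA n b q a zeta s).
Local Notation epsA := (epsA n b q a zeta s).
Local Notation H := (halg n b q a zeta s).
Local Notation KH := (khalg n b q a zeta s).
Local Notation toK := (@tofrac A).
Local Notation toKH := (@bc_in A K toK H).
Local Notation I := (lword b n).
Local Notation W := {ffun I -> K^o}.

Variables (xK yK : K) (bV rp : A).
Hypothesis gf : ground_facts xK yK bV rp.
Variables (rho : {rmorphism KH -> endo W}) (mu : I -> I -> KH).
Hypothesis wa : word_action xK yK rho mu.

Variable lam : {ffun 'I_b -> seq nat}.
Hypothesis lam_part : forall j, is_partition (lam j).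
Hypothesis lam_size : (\sum_j sumn (lam j) = n)%N.
Local Notation al := (al_of lam).
Local Notation mb := (mbar al).
Local Notation tuple := {dffun forall j : 'I_b, std_tableau (lam j)}.
Local Notation col := (fun i => nth 0%N (char_seq al) i).
Local Notation HM j := (hoef_mod n b q a zeta s (lam j)).
Local Notation HT := (iten n q a zeta s al).
Local Notation tw := (tup_word lam_part lam_size).
Local Notation e := (e_al n q a zeta s al).
Local Notation eta := (@Defs.eta L n b q a zeta s al).
Local Notation tin := (fun j => @ta_in A _ (fun j => iA n b q a zeta s (al j)) j).

Let eta_ok : is_eta eta. Proof. exact: (eta_spec n_gt0 b_gt0 gf lam_size). Qed.

Let etaD u v : eta (u + v) = eta u + eta v. Proof. by have [[h _ _ _] _ _ _] := eta_ok; apply: h. Qed.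
Let etaM u v : eta (u * v) = eta u * eta v. Proof. by have [[_ h _ _] _ _ _] := eta_ok; apply: h. Qed.
Let etaC c : eta c%:AC = c%:AC * e. Proof. by have [[_ _ h _] _ _ _] := eta_ok; apply: h. Qed.
Let eta1 : eta 1 = e. Proof. by have [[_ _ _ h] _ _ _] := eta_ok. Qed.

Definition eK : KH := toKH e.

Lemma eK_E : eK = char_proj b (toK zetaA) (toK bV) (@kT L n b q a zeta s) (fun k : 'I_n => col k).
Proof.
rewrite /eK (e_al_E gf).
apply: (@char_proj_morph A K toK b n zetaA bV H KH toKH (@hT' L n b q a zeta s)) => d.
exact: bc_in_cst.
Qed.

Lemma rho_eK f v : rho eK f v = if has_char col v then f v else 0.
Proof.
rewrite eK_E; apply: (rho_idem b_gt0 n_gt0 (gf_zetaK gf) (gf_bK gf) (khalg_yokonuma gf)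
  (wa_cst wa) (wa_T wa) (wa_units wa) (wa_acts wa)).
by move=> k; apply: char_seq_range; rewrite mbar_full lam_size.
Qed.

Lemma eK_unit w : eK * mu w w = if has_char col w then mu w w else 0.
Proof.
rewrite eK_E; apply: (idem_unit b_gt0 n_gt0 (gf_zetaK gf) (gf_bK gf) (khalg_yokonuma gf)
  (wa_cst wa) (wa_T wa) (wa_units wa) (wa_acts wa)).
by move=> k; apply: char_seq_range; rewrite mbar_full lam_size.
Qed.

Lemma has_char_tup tau : has_char col (tw tau).
Proof. by apply/forallP => k; rewrite (tup_word_comp lam_part lam_size) // eqxx. Qed.

(** The product of functions on tableaux as a function on words. *)
Definition tensor_fun (f : forall j, HM j) : W :=
  [ffun w => if [pick tau | tw tau == w] is Some tau then \prod_j toK (f j (tau j)) else 0].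

Lemma tensor_funE f tau : tensor_fun f (tw tau) = \prod_j toK (f j (tau j)).
Proof.
rewrite ffunE; case: pickP => [tau' /eqP/tup_word_inj -> //|/(_ tau)].
by rewrite eqxx.
Qed.

Lemma tensor_fun_out f w : (forall tau, tw tau != w) -> tensor_fun f w = 0.
Proof. by move=> h; rewrite ffunE; case: pickP => [tau|//]; rewrite (negbTE (h tau)). Qed.

Lemma rho_eK_tensor f : rho eK (tensor_fun f) = tensor_fun f.
Proof.
apply/ffunP => w; rewrite rho_eK; case: ifP => // nw; rewrite tensor_fun_out // => tau.
by apply: contraFneq nw => <-; exact: has_char_tup.
Qed.

Let dist_ok (j : 'I_b) (tau : tuple) (l : 'I_(al j).-1) :
  distance_ok n (content (val (tau j)) (ord_lo l) - content (val (tau j)) (ord_hi l)).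
Proof.
have ln : (sumn (lam j) <= n)%N by rewrite -lam_size (bigD1 j) //= leq_addr.
rewrite /distance_ok (leq_trans _ ln) ?(content_range (lam_part j) (valP _)) // andbT subr_eq0.
apply/eqP => h.
have := @weight_neq1 (tab_word (val (tau j)) j) l (tab_word_lattice (lam_part j) (valP _) _).
rewrite size_tab_word => /(_ (ord_hi_subproof l)).
have -> := weight_tab_word (lam_part j) (valP (tau j)) j (ord_lo l).
have -> := weight_tab_word (lam_part j) (valP (tau j)) j (ord_hi l).
by rewrite h eqxx.
Qed.

Let gen_index (j : 'I_b) (l : 'I_(al j).-1) : (mb j + l < n.-1)%N.
Proof.
have := ord_hi_subproof l; have := mbar_le al (ltn_ord j); rewrite mbarS mbar_full lam_size.
by clear; rewrite /al_of; lia.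
Qed.

Let eta_gen (j : 'I_b) (l : 'I_(al j).-1) f :
  rho (toKH (eta (tin j (iS _ _ l)))) f =
  toK epsA ^+ j.+1 *: @Rw K b n (toK zetaA) xK yK (mb j + l) (rho eK f).
Proof.
have [_ _ _ h] := eta_ok; rewrite (h j l (Ordinal (gen_index l)) erefl).
rewrite /eK; generalize e => ee; rewrite !(rmorphM toKH) [X in rho (X * _ * _)]bc_in_cst !(rmorphM rho) !endo_mulE.
rewrite (wa_cst wa) endo_cstE rmorphXn; congr (_ *: _).
rewrite -(wa_R wa (gen_index l)) /kR /hRn.
by rewrite (nat_indexE 0 (@hR L n b q a zeta s) (Ordinal (gen_index l))).
Qed.

Lemma tensor_fun_gen (j : 'I_b) (l : 'I_(al j).-1) (f : forall j, HM j) :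
  rho (toKH (eta (tin j (iS _ _ l)))) (tensor_fun f) =
  tensor_fun (dfwith f (hoef_act (iS _ _ l) (f j))).
Proof.
rewrite eta_gen rho_eK_tensor; apply/ffunP => w; rewrite ffunE mix_opE.
have eps2 : toK epsA ^+ j.+1 * toK epsA ^+ j.+1 = 1.
  by rewrite -exprMn -rmorphM (half_power_sq (gf_zeta gf)) rmorph1 expr1n.
have i1 : ((mb j + l).+1 < n)%N by have := gen_index l; lia.
have ln : (sumn (lam j) <= n)%N by rewrite -lam_size (bigD1 j) //= leq_addr.
have [[tau ew]|now] := pselect (exists tau, tw tau = w).
  subst w; rewrite !tensor_funE.
  have wlo : wt (tw tau) (mb j + l) = (j : nat, content (val (tau j)) (ord_lo l)).
    exact: (weight_tup_seq lam_part tau (ord_lo l)).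
  have whi : wt (tw tau) (mb j + l).+1 = (j : nat, content (val (tau j)) (ord_hi l)).
    by rewrite -addnS; exact: (weight_tup_seq lam_part tau (ord_hi l)).
  have dk := dist_ok tau l; have dk' := distance_okN dk; rewrite opprB in dk'.
  rewrite (bigD1 j) //= [RHS](bigD1 j) //= dfwith_in.
  rewrite [X in _ = _ * X](eq_bigr (fun i => toK (f i (tau i)))) => [|i ne]; last first.
    by rewrite dfwith_out // eq_sym.
  rewrite (hoef_act_gen gf (lam_part j) ln) mix_opE.
  rewrite !(tab_weightE _ (ord_lo l)) !(tab_weightE _ (ord_hi l)) wlo whi.
  set P := (\prod_(i | i != j) _); set c := content _ (ord_lo l); set d := content _ (ord_hi l).
  have eA : toK (Acoef (hoefA_a n b q a zeta s) 1 (0%N, c) (0%N, d)) = hoef_a xK yK (c - d).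
    by rewrite /Acoef /= mul1r (gf_toK_a gf).
  have eA' : Acoef (hoef_a xK yK) (toK zetaA ^+ eps_exp b) (j : nat, c) (j : nat, d) =
      toK epsA ^+ j.+1 * hoef_a xK yK (c - d).
    by rewrite /Acoef eqxx -rmorphXn.
  have adj : adjacent (j : nat, c) (j : nat, d) = adjacent (0%N, c) (0%N, d) by rewrite /adjacent eqxx.
  have toK2 (u v u' v' : A) : toK (u * v + u' * v') = toK u * toK v + toK u' * toK v'.
    by rewrite rmorphD !rmorphM.
  rewrite toK2 eA eA' mulrDl.
  rewrite [X in X = _]/GRing.scale /= mulrDr; congr (_ + _).
    exact: (square_one_cancel _ _ _ eps2).
  have [ad|na] := boolP (adjacent (0%N, c) (0%N, d)).
    by rewrite /Bcoef eqxx adj ad /= rmorph0 !mul0r mulr0.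
  have -> : sw (mb j + l) (tw tau) = tw (tup_swap l tau).
    apply: val_inj; rewrite [LHS]sw_val // ?wlo ?whi ?adj // [RHS](tup_seq_swap lam_part lam_size) //.
    by move: wlo whi; rewrite /wt /= => -> ->; rewrite adj.
  rewrite tensor_funE (bigD1 j) //= [X in _ * (_ * (_ * X))](eq_bigr (fun i => toK (f i (tau i)))) => [|i ne]; last first.
    by rewrite ffunE dfwith_out // eq_sym.
  rewrite ffunE dfwith_in -/P /Bcoef eqxx adj (negbTE na) /= mul1r (gf_toK_b gf) //.
  have -> : toK zetaA ^+ eps_exp b = toK epsA by rewrite -rmorphXn.
  exact: (square_one_cancel _ _ _ eps2).
have out tau : tw tau != w by apply/eqP => h; apply: now; exists tau.
rewrite [tensor_fun f w]tensor_fun_out // [RHS]tensor_fun_out // mulr0 add0r.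
set B0 := Bcoef _ _ _ _ _; have [->|nz] := eqVneq B0 0; first by rewrite mul0r scaler0.
have na := Bcoef_nonadj nz; rewrite tensor_fun_out ?mulr0 ?scaler0 // => tau.
apply/eqP => h; apply: now; exists (tup_swap l tau); apply: val_inj.
have iw : ((mb j + l).+1 < size (ssval w))%N by rewrite lword_size.
have hs : tup_seq tau = swap_word (mb j + l) (ssval w) by rewrite -(sw_val i1 na) -h.
rewrite [LHS](tup_seq_swap lam_part lam_size) hs ?swap_wordK //.
rewrite !weight_swap //; last exact: ltnW.
have s0 i : swap_nat i i = i.+1 by rewrite /swap_nat eqxx.
have s1 i : swap_nat i i.+1 = i by rewrite -[RHS](swap_natK i) s0.
by rewrite s0 s1 adjacent_sym.
Qed.
End SpechtMap.

Section SpechtModule.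
Variables (L : fieldType) (n b : nat) (q a zeta s : L).
Hypothesis n_gt0 : (0 < n)%N.
Hypothesis b_gt0 : (0 < b)%N.

Local Notation A := (ground n b q a zeta s).
Local Notation K := (fracA n b q a zeta s).
Local Notation zetaA := (zetaA n b q a zeta s).
Local Notation epsA := (epsA n b q a zeta s).
Local Notation H := (halg n b q a zeta s).
Local Notation KH := (khalg n b q a zeta s).
Local Notation toK := (@tofrac A).
Local Notation toKH := (@bc_in A K toK H).
Local Notation I := (lword b n).
Local Notation W := {ffun I -> K^o}.

Variables (xK yK : K) (bV rp : A).
Hypothesis gf : ground_facts xK yK bV rp.
Variables (rho : {rmorphism KH -> endo W}) (mu : I -> I -> KH).
Hypothesis wa : word_action xK yK rho mu.

Variable lam : {ffun 'I_b -> seq nat}.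
Hypothesis lam_part : forall j, is_partition (lam j).
Hypothesis lam_size : (\sum_j sumn (lam j) = n)%N.
Local Notation al := (al_of lam).
Local Notation mb := (mbar al).
Local Notation tuple := {dffun forall j : 'I_b, std_tableau (lam j)}.
Local Notation col := (fun i => nth 0%N (char_seq al) i).
Local Notation HM j := (hoef_mod n b q a zeta s (lam j)).
Local Notation HT := (iten n q a zeta s al).
Local Notation tw := (tup_word lam_part lam_size).
Local Notation e := (e_al n q a zeta s al).
Local Notation eta := (@Defs.eta L n b q a zeta s al).
Local Notation tin := (fun j => @ta_in A _ (fun j => iA n b q a zeta s (al j)) j).

Let eta_ok : is_eta eta. Proof. exact: (eta_spec n_gt0 b_gt0 gf lam_size). Qed.

Let etaD u v : eta (u + v) = eta u + eta v. Proof. by have [[h _ _ _] _ _ _] := eta_ok; apply: h. Qed.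
Let etaM u v : eta (u * v) = eta u * eta v. Proof. by have [[_ h _ _] _ _ _] := eta_ok; apply: h. Qed.
Let etaC c : eta c%:AC = c%:AC * e. Proof. by have [[_ _ h _] _ _ _] := eta_ok; apply: h. Qed.
Let eta1 : eta 1 = e. Proof. by have [[_ _ _ h] _ _ _] := eta_ok. Qed.

Local Notation eK := (@eK L n b q a zeta s lam).
Local Notation tfun := (tensor_fun lam_part lam_size).
Local Notation ract u := (rho (toKH (eta u))).
Local Notation tin_ j x := (@ta_in A _ (fun j => iA n b q a zeta s (al j)) j x).

Let rho_eK_t f : rho eK (tfun f) = tfun f.
Proof. exact: (rho_eK_tensor n_gt0 b_gt0 gf wa). Qed.

Let prod_split (F F1 : 'I_b -> K) j : (forall i, i != j -> F i = F1 i) ->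
  \prod_i F i = F j * \prod_(i | i != j) F1 i.
Proof. by move=> h; rewrite (bigD1 j) //=; congr (_ * _); apply: eq_bigr. Qed.

Lemma tensor_funD (f : forall j, HM j) j (u v : HM j) :
  tfun (dfwith f (u + v)) = tfun (dfwith f u) + tfun (dfwith f v).
Proof.
apply/ffunP => w; rewrite !ffunE; case: pickP => [tau _|_]; last by rewrite addr0.
have out (x : HM j) i : i != j -> toK (dfwith f x i (tau i)) = toK (f i (tau i)).
  by move=> ne; rewrite dfwith_out // eq_sym.
by rewrite !(prod_split (out _)) !dfwith_in ffunE rmorphD mulrDl.
Qed.

Lemma tensor_funZ (f : forall j, HM j) j c (u : HM j) :
  tfun (dfwith f (c *: u)) = toK c *: tfun (dfwith f u).
Proof.
apply/ffunP => w; rewrite !ffunE; case: pickP => [tau _|_]; last by rewrite scaler0.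
have out (x : HM j) i : i != j -> toK (dfwith f x i (tau i)) = toK (f i (tau i)).
  by move=> ne; rewrite dfwith_out // eq_sym.
by rewrite !(prod_split (out _)) !dfwith_in ffunE /GRing.scale /= rmorphM mulrA.
Qed.

Let lam_le j : (sumn (lam j) <= n)%N.
Proof. by rewrite -lam_size (bigD1 j) //= leq_addr. Qed.

Let hspec j := hoef_act_spec gf (lam_part j) (lam_le j).

Let tinM j x y : tin_ j (x * y) = tin_ j x * tin_ j y.
Proof. exact: (rmorphM (tin j)). Qed.
Let tinD j x y : tin_ j (x + y) = tin_ j x + tin_ j y.
Proof. exact: (rmorphD (tin j)). Qed.

Let ractM u v f : ract (u * v) f = ract u (ract v f).
Proof. by rewrite etaM (rmorphM toKH) (rmorphM rho). Qed.
Let ractD u v f : ract (u + v) f = ract u f + ract v f.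
Proof. by rewrite etaD (rmorphD toKH) (rmorphD rho). Qed.
Let ractC c f : rho eK f = f -> ract c%:AC f = toK c *: f.
Proof.
move=> hf; rewrite etaC (rmorphM toKH) (rmorphM rho) endo_mulE [rho (toKH e) f]hf.
have -> : rho (toKH c%:AC) = (toK c)%:AC; last exact: endo_cstE.
by rewrite -(wa_cst wa); congr (rho _); exact: bc_in_cst.
Qed.
Let ract1 f : rho eK f = f -> ract 1 f = f.
Proof. by rewrite eta1. Qed.

Let dfwith_twice (f : forall j, HM j) j (u v : HM j) : dfwith (dfwith f u) v = dfwith f v.
Proof.
apply: functional_extensionality_dep => i; have [e'|ne] := eqVneq j i.
  by subst i; rewrite !dfwith_in.
by rewrite !dfwith_out.
Qed.

Let dfwith_self (f : forall j, HM j) j : dfwith f (f j) = f.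
Proof.
apply: functional_extensionality_dep => i; have [e'|ne] := eqVneq j i.
  by subst i; rewrite dfwith_in.
by rewrite dfwith_out.
Qed.

Lemma tensor_fun_act j (x : iA n b q a zeta s (al j)) (f : forall j, HM j) :
  ract (tin_ j x) (tfun f) = tfun (dfwith f (hoef_act x (f j))).
Proof.
have [[aD aD' aM aC] _] := hspec j.
move: x f; apply: pres_ind => [l|c|x y hx hy|x y hx hy] f.
- exact: (tensor_fun_gen n_gt0 b_gt0 gf wa lam_part lam_size l f).
- rewrite (aC c) tensor_funZ dfwith_self [X in ract X]ta_in_cst ractC //.
- by rewrite tinD ractD hx hy aD' tensor_funD.
- by rewrite tinM ractM hy hx dfwith_in dfwith_twice aM.
Qed.

Lemma tensor_fun_ta (g : forall j, iA n b q a zeta s (al j)) (f : forall j, HM j) :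
  ract (ta_gen g) (tfun f) = tfun (fun j => hoef_act (g j) (f j)).
Proof.
rewrite ta_gen_prodT.
have h (r : seq 'I_b) : uniq r -> ract (\prod_(i <- r) tin_ i (g i)) (tfun f) =
    tfun (fun j => if j \in r then hoef_act (g j) (f j) else f j).
  elim: r => [|i r IH] /=; first by rewrite big_nil ract1.
  case/andP=> nir ur; rewrite big_cons ractM IH // tensor_fun_act (negbTE nir).
  congr tfun; apply: functional_extensionality_dep => k; rewrite in_cons.
  have [e'|ne] := eqVneq k i; first by subst k; rewrite dfwith_in.
  by rewrite dfwith_out // eq_sym.
rewrite h ?enum_uniq //; congr tfun; apply: functional_extensionality_dep => k.
by rewrite mem_enum.
Qed.

Lemma ex_P0_map : exists g : P0 n q a zeta s lam -> W,
  [/\ forall u v, g (u + v) = g u + g v,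
      forall c u, g (c *: u) = ract c (g u),
      forall f, g (pmgen _ f) = tfun f & forall u, rho eK (g u) = g u].
Proof.
pose act (u : HT) (f : W) := ract u f; pose P (f : W) := rho eK f = f.
have a1 c u v : act c (u + v) = act c u + act c v by rewrite /act endoD.
have a2 c d u : act (c + d) u = act c u + act d u by rewrite /act ractD.
have a3 c d u : act (c * d) u = act c (act d u) by rewrite /act ractM.
have a4 u : P u -> act 1 u = u by exact: ract1.
have a5 : P 0 by rewrite /P endo0.
have a6 u v : P u -> P v -> P (u + v) by rewrite /P endoD => -> ->.
have a7 c u : P u -> P (act c u) by move=> _; rewrite /P /act -{2}[c]mul1r ractM eta1.
have a8 f : P (tfun f) by exact: rho_eK_t.
apply: (presmod_lift a1 a2 a3 a4 a5 a6 a7 a8) => u v [f j x y|f j c x|g f].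
- by rewrite (freem_liftD a1 a2 a3 a4 a5 a6 a7 a8) !(freem_lift_gen a1 a2 a3 a4 a5 a6 a7 a8) tensor_funD.
- rewrite (freem_liftZ a1 a2 a3 a4 a5 a6 a7 a8) !(freem_lift_gen a1 a2 a3 a4 a5 a6 a7 a8) tensor_funZ.
  by rewrite /act ractC.
- rewrite (freem_liftZ a1 a2 a3 a4 a5 a6 a7 a8) !(freem_lift_gen a1 a2 a3 a4 a5 a6 a7 a8).
  exact: tensor_fun_ta.
Qed.

End SpechtModule.

Section SpechtModule.
Variables (L : fieldType) (n b : nat) (q a zeta s : L).
Hypothesis n_gt0 : (0 < n)%N.
Hypothesis b_gt0 : (0 < b)%N.

Local Notation A := (ground n b q a zeta s).
Local Notation K := (fracA n b q a zeta s).
Local Notation zetaA := (zetaA n b q a zeta s).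
Local Notation epsA := (epsA n b q a zeta s).
Local Notation H := (halg n b q a zeta s).
Local Notation KH := (khalg n b q a zeta s).
Local Notation toK := (@tofrac A).
Local Notation toKH := (@bc_in A K toK H).
Local Notation I := (lword b n).
Local Notation W := {ffun I -> K^o}.

Variables (xK yK : K) (bV rp : A).
Hypothesis gf : ground_facts xK yK bV rp.
Variables (rho : {rmorphism KH -> endo W}) (mu : I -> I -> KH).
Hypothesis wa : word_action xK yK rho mu.

Variable lam : {ffun 'I_b -> seq nat}.
Hypothesis lam_part : forall j, is_partition (lam j).
Hypothesis lam_size : (\sum_j sumn (lam j) = n)%N.
Local Notation al := (al_of lam).
Local Notation mb := (mbar al).
Local Notation tuple := {dffun forall j : 'I_b, std_tableau (lam j)}.
Local Notation col := (fun i => nth 0%N (char_seq al) i).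
Local Notation HM j := (hoef_mod n b q a zeta s (lam j)).
Local Notation HT := (iten n q a zeta s al).
Local Notation tw := (tup_word lam_part lam_size).
Local Notation e := (e_al n q a zeta s al).
Local Notation eta := (@Defs.eta L n b q a zeta s al).
Local Notation tin := (fun j => @ta_in A _ (fun j => iA n b q a zeta s (al j)) j).

Let eta_ok : is_eta eta. Proof. exact: (eta_spec n_gt0 b_gt0 gf lam_size). Qed.

Let etaD u v : eta (u + v) = eta u + eta v. Proof. by have [[h _ _ _] _ _ _] := eta_ok; apply: h. Qed.
Let etaM u v : eta (u * v) = eta u * eta v. Proof. by have [[_ h _ _] _ _ _] := eta_ok; apply: h. Qed.
Let etaC c : eta c%:AC = c%:AC * e. Proof. by have [[_ _ h _] _ _ _] := eta_ok; apply: h. Qed.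
Let eta1 : eta 1 = e. Proof. by have [[_ _ _ h] _ _ _] := eta_ok. Qed.

Local Notation ract u := (rho (toKH (eta u))).
Local Notation eK := (@eK L n b q a zeta s lam).
Local Notation tfun := (tensor_fun lam_part lam_size).
Local Notation P0 := (P0 n q a zeta s lam).
Local Notation VL := (Vlam n q a zeta s lam).
Local Notation KV := (KVlam n q a zeta s lam).

Let e_idem : e * e = e. Proof. by rewrite -eta1 -etaM mulr1. Qed.

Section Maps.
Variable g0 : P0 -> W.
Hypothesis g0D : forall u v, g0 (u + v) = g0 u + g0 v.
Hypothesis g0Z : forall c u, g0 (c *: u) = ract c (g0 u).
Hypothesis g0e : forall u, rho eK (g0 u) = g0 u.

Let rhoM x y f : rho (toKH (x * y)) f = rho (toKH x) (rho (toKH y) f).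
Proof. by rewrite (rmorphM toKH) (rmorphM rho). Qed.

Let rhoD x y f : rho (toKH (x + y)) f = rho (toKH x) f + rho (toKH y) f.
Proof. by rewrite (rmorphD toKH) (rmorphD rho). Qed.

Let rhoC c f : rho (toKH c%:AC) f = toK c *: f.
Proof.
have -> : rho (toKH c%:AC) = (toK c)%:AC; last exact: endo_cstE.
by rewrite -(wa_cst wa); congr (rho _); exact: bc_in_cst.
Qed.

Let g0_act c p : h_al (n := n) (q := q) (a := a) (zeta := zeta) (s := s) al c ->
  g0 (h_al_act c p) = rho (toKH c) (g0 p).
Proof.
by move=> hc; rewrite /h_al_act g0Z (eta_invK n_gt0 b_gt0 gf lam_size hc).
Qed.

Lemma ex_V_map : exists g1 : VL -> W,
  [/\ forall u v, g1 (u + v) = g1 u + g1 v,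
      forall h u, g1 (h *: u) = rho (toKH h) (g1 u)
    & forall u p, g1 (pmgen _ (u, p)) = rho (toKH (sval u)) (g0 p)].
Proof.
pose act (h : H) (f : W) := rho (toKH h) f; pose P (f : W) := True.
pose g (x : he_sub n q a zeta s lam * P0) := rho (toKH (sval x.1)) (g0 x.2).
have a1 c u v : act c (u + v) = act c u + act c v by rewrite /act endoD.
have a2 c d u : act (c + d) u = act c u + act d u by rewrite /act rhoD.
have a3 c d u : act (c * d) u = act c (act d u) by rewrite /act rhoM.
have a4 u : P u -> act 1 u = u by move=> _; rewrite /act !rmorph1.
have a5 : P 0 by [].
have a6 u v : P u -> P v -> P (u + v) by [].
have a7 c u : P u -> P (act c u) by [].
have a8 x : P (g x) by [].
have lG := freem_lift_gen a1 a2 a3 a4 a5 a6 a7 a8.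
have lD := freem_liftD a1 a2 a3 a4 a5 a6 a7 a8.
have lZ := freem_liftZ a1 a2 a3 a4 a5 a6 a7 a8.
have [|f [f1 f2 f3 _]] := presmod_lift (rel := @v_rel L n b q a zeta s lam) a1 a2 a3 a4 a5 a6 a7 a8.
  move=> u v [x x1 x2 p ex|x p1 p2|x x' c p hc ex|h x x' p ex].
  - by rewrite lD !lG /g /= ex rhoD.
  - by rewrite lD !lG /g /= g0D endoD.
  - by rewrite !lG /g /= ex rhoM g0_act.
  - by rewrite lZ !lG /g /= ex /act rhoM.
by exists f; split=> // u p; rewrite f3.
Qed.

Lemma ex_KV_map : exists g2 : KV -> W,
  [/\ forall u v, g2 (u + v) = g2 u + g2 v,
      forall h u, g2 (h *: u) = rho h (g2 u)
    & forall (u : he_sub n q a zeta s lam) p, g2 (pmgen _ (1, pmgen _ (u, p))) = rho (toKH (sval u)) (g0 p)].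
Proof.
have [g1 [g1D g1Z g1G]] := ex_V_map.
pose act (h : KH) (f : W) := rho h f; pose P (f : W) := True.
pose g (x : K * VL) := x.1 *: (g1 x.2).
have a1 c u v : act c (u + v) = act c u + act c v by rewrite /act endoD.
have a2 c d u : act (c + d) u = act c u + act d u by rewrite /act (rmorphD rho).
have a3 c d u : act (c * d) u = act c (act d u) by rewrite /act (rmorphM rho).
have a4 u : P u -> act 1 u = u by move=> _; rewrite /act !rmorph1.
have a5 : P 0 by [].
have a6 u v : P u -> P v -> P (u + v) by [].
have a7 c u : P u -> P (act c u) by [].
have a8 x : P (g x) by [].
have lG := freem_lift_gen a1 a2 a3 a4 a5 a6 a7 a8.
have lD := freem_liftD a1 a2 a3 a4 a5 a6 a7 a8.
have lZ := freem_liftZ a1 a2 a3 a4 a5 a6 a7 a8.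
have [|f [f1 f2 f3 _]] := presmod_lift (rel := @kv_rel L n b q a zeta s lam) a1 a2 a3 a4 a5 a6 a7 a8.
  move=> u v [k k' x|k x x'|k c x|k h k' x].
  - by rewrite lD !lG /g /= scalerDl.
  - by rewrite lD !lG /g /= g1D scalerDr.
  - by rewrite !lG /g /= g1Z rhoC scalerA.
  - rewrite lZ !lG /g /= /act bc_genE (rmorphM rho) endo_mulE (wa_cst wa) endo_cstE endoZ.
    by rewrite g1Z scalerA.
by exists f; split=> // u p; rewrite f3 /g /= scale1r g1G.
Qed.

End Maps.
End SpechtModule.

Section SpechtModule.
Variables (L : fieldType) (n b : nat) (q a zeta s : L).
Hypothesis n_gt0 : (0 < n)%N.
Hypothesis b_gt0 : (0 < b)%N.

Local Notation A := (ground n b q a zeta s).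
Local Notation K := (fracA n b q a zeta s).
Local Notation zetaA := (zetaA n b q a zeta s).
Local Notation epsA := (epsA n b q a zeta s).
Local Notation H := (halg n b q a zeta s).
Local Notation KH := (khalg n b q a zeta s).
Local Notation toK := (@tofrac A).
Local Notation toKH := (@bc_in A K toK H).
Local Notation I := (lword b n).
Local Notation W := {ffun I -> K^o}.

Variables (xK yK : K) (bV rp : A).
Hypothesis gf : ground_facts xK yK bV rp.
Variables (rho : {rmorphism KH -> endo W}) (mu : I -> I -> KH).
Hypothesis wa : word_action xK yK rho mu.

Variable lam : {ffun 'I_b -> seq nat}.
Hypothesis lam_part : forall j, is_partition (lam j).
Hypothesis lam_size : (\sum_j sumn (lam j) = n)%N.
Local Notation al := (al_of lam).
Local Notation mb := (mbar al).
Local Notation tuple := {dffun forall j : 'I_b, std_tableau (lam j)}.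
Local Notation col := (fun i => nth 0%N (char_seq al) i).
Local Notation HM j := (hoef_mod n b q a zeta s (lam j)).
Local Notation HT := (iten n q a zeta s al).
Local Notation tw := (tup_word lam_part lam_size).
Local Notation e := (e_al n q a zeta s al).
Local Notation eta := (@Defs.eta L n b q a zeta s al).
Local Notation tin := (fun j => @ta_in A _ (fun j => iA n b q a zeta s (al j)) j).

Let eta_ok : is_eta eta. Proof. exact: (eta_spec n_gt0 b_gt0 gf lam_size). Qed.

Let etaD u v : eta (u + v) = eta u + eta v. Proof. by have [[h _ _ _] _ _ _] := eta_ok; apply: h. Qed.
Let etaM u v : eta (u * v) = eta u * eta v. Proof. by have [[_ h _ _] _ _ _] := eta_ok; apply: h. Qed.
Let etaC c : eta c%:AC = c%:AC * e. Proof. by have [[_ _ h _] _ _ _] := eta_ok; apply: h. Qed.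
Let eta1 : eta 1 = e. Proof. by have [[_ _ _ h] _ _ _] := eta_ok. Qed.

Local Notation ract u := (rho (toKH (eta u))).
Local Notation eK := (@eK L n b q a zeta s lam).
Local Notation tfun := (tensor_fun lam_part lam_size).
Local Notation P0 := (P0 n q a zeta s lam).
Local Notation VL := (Vlam n q a zeta s lam).
Local Notation KV := (KVlam n q a zeta s lam).
Local Notation basis t := (@hoef_basis L n b q a zeta s _ (val t)).

Definition basis_tensor (tau : tuple) : P0 := pmgen _ (fun j => basis (tau j)).

Definition spanned (p : P0) := exists c : tuple -> A, p = \sum_tau (c tau)%:AC *: basis_tensor tau.

Let spanned0 : spanned 0.
Proof. by exists (fun=> 0); rewrite big1 // => tau _; rewrite rmorph0 scale0r. Qed.

Let spannedD p p' : spanned p -> spanned p' -> spanned (p + p').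
Proof.
move=> [c ->] [d ->]; exists (fun tau : tuple => c tau + d tau); rewrite -big_split.
by apply: eq_bigr => tau _; rewrite rmorphD scalerDl.
Qed.

Let spannedZ (c : A) p : spanned p -> spanned (c%:AC *: p).
Proof.
move=> [d ->]; exists (fun tau : tuple => c * d tau); rewrite scaler_sumr.
by apply: eq_bigr => tau _; rewrite scalerA -rmorphM.
Qed.

Let spanned_sum (J : Type) (r : seq J) (F : J -> P0) : (forall i, spanned (F i)) ->
  spanned (\sum_(i <- r) F i).
Proof. by move=> h; elim/big_ind: _. Qed.

Let pgenD f j (u v : HM j) : pmgen (@p0_rel L n b q a zeta s lam) (dfwith f (u + v)) =
  pmgen _ (dfwith f u) + pmgen _ (dfwith f v).
Proof. by rewrite -mprojD; apply: presmod_rel; apply: p0_add. Qed.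

Let pgenZ f j c (u : HM j) : pmgen (@p0_rel L n b q a zeta s lam) (dfwith f (c *: u)) =
  c%:AC *: pmgen _ (dfwith f u).
Proof. by rewrite -mprojZ; apply: presmod_rel; apply: p0_scale. Qed.

Let pgen0 f j : pmgen (@p0_rel L n b q a zeta s lam) (dfwith f (0 : HM j)) = 0.
Proof. by have := pgenZ f 0 (0 : HM j); rewrite scale0r rmorph0 scale0r. Qed.

Let hoef_expand j (f : HM j) : f = \sum_t f t *: basis t.
Proof.
apply/ffunP => t; rewrite sum_ffunE (bigD1 t) //= big1 ?addr0 => [|t' ne].
  by rewrite !ffunE eqxx /GRing.scale /= mulr1.
by rewrite !ffunE (inj_eq val_inj) eq_sym (negbTE ne) scaler0.
Qed.

Let dfwith_self (f : forall j, HM j) j : dfwith f (f j) = f.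
Proof.
apply: functional_extensionality_dep => i; have [e'|ne] := eqVneq j i.
  by subst i; rewrite dfwith_in.
by rewrite dfwith_out.
Qed.

Lemma spanned_gen f : spanned (pmgen _ f).
Proof.
have h (r : seq 'I_b) : forall f : (forall j, HM j),
    (forall j, j \notin r -> exists t : std_tableau (lam j), f j = basis t) -> spanned (pmgen _ f).
  elim: r => [|j r IH] g hg.
    have hg' j := cid (hg j isT).
    pose tau : tuple := finfun (fun j => projT1 (hg' j)).
    have -> : pmgen _ g = basis_tensor tau.
      congr pmgen; apply: functional_extensionality_dep => j.
      by rewrite ffunE; exact: (projT2 (hg' j)).
    exists (fun tau' => (tau' == tau)%:R); rewrite (bigD1 tau) //= eqxx rmorph1 scale1r.
    by rewrite big1 ?addr0 // => tau' /negbTE ->; rewrite rmorph0 scale0r.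
  rewrite -(dfwith_self g j) (hoef_expand (g j)).
  rewrite (big_morph (fun x => pmgen _ (dfwith g x)) (pgenD g (j := j)) (pgen0 g j)).
  apply: spanned_sum => t; rewrite pgenZ; apply: spannedZ; apply: IH => i ir.
  have [e'|ne] := eqVneq j i; first by subst i; exists t; rewrite dfwith_in.
  by rewrite dfwith_out //; apply: hg; rewrite in_cons negb_or eq_sym ne.
by apply: (h (enum 'I_b)) => j; rewrite mem_enum.
Qed.

Let spanned_act (u : HT) p : spanned p -> spanned (u *: p).
Proof.
move: u p; apply: pres_ind => [g|c|u v hu hv|u v hu hv] p.
- move=> [c ->]; rewrite scaler_sumr; apply: spanned_sum => tau.
  rewrite scalerA -alg_const_central -scalerA; apply: spannedZ.
  have -> : pgen (@ta_rel A _ (fun j => iA n b q a zeta s (al j))) g *: basis_tensor tau =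
      pmgen _ (fun j => hoef_act (g j) (basis (tau j))).
    by rewrite -mprojZ; apply: presmod_rel; apply: p0_act.
  exact: spanned_gen.
- exact: spannedZ.
- by move=> hp; rewrite scalerDl; apply: spannedD; [apply: hu|apply: hv].
- by move=> hp; rewrite -scalerA; apply: hu; apply: hv.
Qed.

Lemma P0_spanned p : spanned p.
Proof.
by move: p; apply: presmod_ind => [f||u v|u p]; [exact: spanned_gen|exact: spanned0|exact: spannedD|exact: spanned_act].
Qed.

Let e_idem : e * e = e. Proof. by rewrite -eta1 -etaM mulr1. Qed.

Let he_e : he_al al e. Proof. by exists 1; rewrite mul1r. Qed.
Definition corner_one : he_sub n q a zeta s lam := exist _ e he_e.

Definition corner_gen_KV (p : P0) : KV := pmgen _ (1, pmgen _ (corner_one, p)).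
Local Notation X := corner_gen_KV.

Let kv_gen_addr (u v : VL) : pmgen (@kv_rel L n b q a zeta s lam) (1, u + v) =
  pmgen _ (1, u) + pmgen _ (1, v).
Proof. by rewrite -mprojD; apply: presmod_rel; apply: kv_addr. Qed.

Lemma X_D p p' : X (p + p') = X p + X p'.
Proof.
rewrite /X; have -> : pmgen (@v_rel L n b q a zeta s lam) (corner_one, p + p') =
    pmgen _ (corner_one, p) + pmgen _ (corner_one, p').
  by rewrite -mprojD; apply: presmod_rel; apply: v_addr.
exact: kv_gen_addr.
Qed.

Let h_al_eta u : h_al al (eta u).
Proof. by have [_ _ <- _] := eta_ok; exists u. Qed.

Let eta_invE u : eta_inv al (eta u) = u.
Proof.
have [_ inj _ _] := eta_ok; apply: inj.
exact: (eta_invK n_gt0 b_gt0 gf lam_size (h_al_eta u)).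
Qed.

Let toKH_gen1 (h : H) (v : VL) : toKH h *: (pmgen (@kv_rel L n b q a zeta s lam) (1, v)) = pmgen _ (1, h *: v).
Proof. by rewrite -mprojZ -[in RHS](mulr1 1); apply: presmod_rel; apply: kv_act. Qed.

Lemma X_act u p : toKH (eta u) *: X p = X (u *: p).
Proof.
rewrite /X toKH_gen1; congr (pmgen _ (1, _)).
have hu : he_al al (eta u * e) by exists (eta u).
have -> : eta u *: pmgen (@v_rel L n b q a zeta s lam) (corner_one, p) = pmgen _ (exist _ _ hu, p).
  by rewrite -mprojZ; apply: presmod_rel; apply: v_act.
have -> : u *: p = h_al_act (eta u) p by rewrite /h_al_act eta_invE.
apply: presmod_rel; apply: v_bal; first exact: h_al_eta.
by rewrite /= -eta1 -!etaM mulr1 mul1r.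
Qed.

Lemma X_e p : eK *: X p = X p.
Proof. by have := X_act 1 p; rewrite eta1 scale1r. Qed.

Lemma X_C c p : X (c%:AC *: p) = (toK c)%:AC *: X p.
Proof.
rewrite -X_act etaC (rmorphM toKH) -scalerA X_e; congr (_ *: _).
exact: bc_in_cst.
Qed.

Let X0 : X 0 = 0.
Proof. by apply: (addrI (X 0)); rewrite -X_D !addr0. Qed.

Lemma X_expand p : exists c : tuple -> K, X p = \sum_tau (c tau)%:AC *: X (basis_tensor tau).
Proof.
have [c ->] := P0_spanned p; exists (fun tau => toK (c tau)).
by rewrite (big_morph X X_D X0); apply: eq_bigr => tau _; rewrite X_C.
Qed.

Lemma KV_spanned z : exists h : tuple -> KH, z = \sum_tau h tau *: X (basis_tensor tau).
Proof.
pose Q (z : KV) := exists h : tuple -> KH, z = \sum_tau h tau *: X (basis_tensor tau).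
have Q0 : Q 0 by exists (fun=> 0); rewrite big1 // => tau _; rewrite scale0r.
have QD u v : Q u -> Q v -> Q (u + v).
  move=> [c ->] [d ->]; exists (fun tau : tuple => c tau + d tau); rewrite -big_split.
  by apply: eq_bigr => tau _; rewrite scalerDl.
have QZ c u : Q u -> Q (c *: u).
  move=> [d ->]; exists (fun tau : tuple => c * d tau); rewrite scaler_sumr.
  by apply: eq_bigr => tau _; rewrite scalerA.
have QX p : Q (X p) by have [c ->] := X_expand p; exists (fun tau : tuple => (c tau)%:AC).
move: z; apply: presmod_ind => // -[k v].
have -> : pmgen (@kv_rel L n b q a zeta s lam) (k, v) = bc_gen toK k 1 *: pmgen _ (1, v).
  rewrite -mprojZ -[v in LHS]scale1r -[k in LHS]mulr1; apply/esym; apply: presmod_rel; exact: kv_act.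
apply: (QZ); move: v; apply: presmod_ind => [[u p]||u v hu hv|h u hu].
- case: u => u [g eu].
  have -> : pmgen (@v_rel L n b q a zeta s lam) (exist _ u (ex_intro _ g eu), p) = g *: pmgen _ (corner_one, p).
    by rewrite -mprojZ; apply/esym; apply: presmod_rel; apply: v_act.
  by rewrite -toKH_gen1; apply: (QZ); apply: (QX).
- have -> : pmgen (@kv_rel L n b q a zeta s lam) (1, 0) = 0; last exact: Q0.
  by have := toKH_gen1 0 0; rewrite rmorph0 !scale0r.
- by rewrite kv_gen_addr; apply: (QD).
- by rewrite -toKH_gen1; apply: (QZ).
Qed.

(** The corner of the module is the span over K of the basis tensors. *)
Lemma corner_KV z : eK *: z = z -> exists c : tuple -> K, z = \sum_tau (c tau)%:AC *: X (basis_tensor tau).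
Proof.
pose Q (z : KV) := exists c : tuple -> K, z = \sum_tau (c tau)%:AC *: X (basis_tensor tau).
have Q0 : Q 0 by exists (fun=> 0); rewrite big1 // => tau _; rewrite rmorph0 scale0r.
have QD u v : Q u -> Q v -> Q (u + v).
  move=> [c ->] [d ->]; exists (fun tau : tuple => c tau + d tau); rewrite -big_split.
  by apply: eq_bigr => tau _; rewrite rmorphD scalerDl.
have QZ (c : K) u : Q u -> Q (c%:AC *: u).
  move=> [d ->]; exists (fun tau : tuple => c * d tau); rewrite scaler_sumr.
  by apply: eq_bigr => tau _; rewrite scalerA -rmorphM.
move=> <-; have [h ->] := KV_spanned z; rewrite scaler_sumr; elim/big_ind: _ => // tau _.
rewrite -X_e; move: (h tau) => k; rewrite scalerA.
move: k; apply: bc_span => [k h0|u v hu hv]; last by rewrite mulrDr scalerDl; apply: (QD).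
rewrite bc_genE mulrA -alg_const_central -!scalerA.
apply: (QZ).
have : h_al al (e * h0 * e) by exists h0.
have [_ _ <- _] := eta_ok => -[u _ hu].
have -> : eK *: (toKH h0 *: (eK *: X (basis_tensor tau))) = X (u *: basis_tensor tau).
  by rewrite !scalerA -X_act -(rmorphM toKH) -(rmorphM toKH) hu.
exact: X_expand.
Qed.
End SpechtModule.

(** A module generated by vectors X_tau of a corner of B, with a map to
    functions that sends them to distinct coordinate vectors, is a simple
    module: a nonzero vector of the kernel would have a nonzero multiple in
    the corner, where the map is injective. *)
Section CornerModule.
Variables (K : fieldType) (B : pzAlgType K) (I J : finType) (r : rel I) (mu : I -> I -> B).
Hypothesis hmu : matrix_units r mu.
Local Notation W := {ffun I -> K^o}.
Variable rho : {rmorphism B -> endo W}.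
Hypothesis rho_cst : forall c : K, rho c%:AC = c%:AC.
Hypothesis acts : forall i j f v, r i j -> rho (mu i j) f v = (v == i)%:R * f j.
Variables (M : lmodType B) (X : J -> M) (t : J -> I) (e : B).
Hypothesis t_inj : injective t.
Hypothesis t_rel : forall x y, r (t x) (t y).
Hypothesis X_gen : forall z, exists h : J -> B, z = \sum_x h x *: X x.
Hypothesis X_e : forall x, e *: X x = X x.
Hypothesis corner : forall z, e *: z = z -> exists c : J -> K, z = \sum_x (c x)%:AC *: X x.
Hypothesis e_unit : forall i, e * mu i i = mu i i \/ e * mu i i = 0.
Variable g : M -> W.
Hypothesis gD : forall u v, g (u + v) = g u + g v.
Hypothesis gZ : forall h u, g (h *: u) = rho h (g u).
Hypothesis gX : forall x i, g (X x) i = (i == t x)%:R.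

Let g0 : g 0 = 0. Proof. by apply: (addrI (g 0)); rewrite -gD !addr0. Qed.

Let g_comb (c : J -> K) x : g (\sum_x (c x)%:AC *: X x) (t x) = c x.
Proof.
rewrite (big_morph g gD g0) sum_ffunE (bigD1 x) //= big1 => [|y ne].
  by rewrite gZ rho_cst endo_cstE ffunE gX eqxx addr0 /GRing.scale /= mulr1.
rewrite gZ rho_cst endo_cstE ffunE gX (inj_eq t_inj) eq_sym (negbTE ne).
by rewrite /GRing.scale /= mulr0.
Qed.

Let g_inj z : g z = 0 -> z = 0.
Proof.
move=> gz; apply: contrapT => /eqP nz.
have [i ni] : exists i, mu i i *: z != 0.
  apply: contrapT => h; move/eqP: nz; apply; rewrite -[z]scale1r -(mu_sum hmu) scaler_suml.
  by rewrite big1 // => i _; apply: contrapT => /eqP ni; apply: h; exists i.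
have [j [rij ej]] : exists j, r i j /\ e * mu j j = mu j j.
  apply: contrapT => hj; move/eqP: ni; apply; have [h ->] := X_gen z.
  rewrite scaler_sumr big1 // => x _; rewrite -X_e.
  have -> : e = \sum_j e * mu j j by rewrite -mulr_sumr (mu_sum hmu) mulr1.
  rewrite scaler_suml !scaler_sumr big1 // => j _; have [ej|->] := e_unit j; last first.
    by rewrite scale0r !scaler0.
  rewrite ej !scalerA; case rij : (r i j); first by case: hj; exists j.
  by rewrite (mu_corner0 hmu) ?rij // scale0r.
have rji : r j i by rewrite (mu_sym hmu).
have [|c ec] := corner (z := mu j i *: z).
  by rewrite scalerA -[mu j i](_ : mu j j * mu j i = _) ?mulrA ?ej // (mu_mul hmu) ?eqxx // (mu_refl hmu).
have c0 x : c x = 0 by rewrite -g_comb -ec gZ gz endo0 ffunE.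
move/eqP: ni; apply; have -> : mu i i = mu i j * mu j i by rewrite (mu_mul hmu) ?eqxx.
by rewrite -scalerA ec big1 ?scaler0 // => x _; rewrite c0 rmorph0 scale0r.
Qed.

Lemma corner_module_of_type x : of_type mu M (t x).
Proof.
have gB u v : g u = g v -> u = v.
  move=> h; apply/eqP; rewrite -subr_eq0; apply/eqP/g_inj.
  by rewrite gD -scaleN1r gZ rmorphN1 -h; apply/ffunP => i; rewrite !ffunE addrN.
have rr i : r i i by exact: (mu_refl hmu).
exists (X x); split.
- apply/eqP => X0; have := gX x (t x); rewrite X0 g0 ffunE eqxx => /eqP.
  by rewrite eq_sym oner_eq0.
- apply: gB; apply/ffunP => i; rewrite gZ acts // !gX eqxx mulr1.
  by [].
- move=> u; exists (g u (t x)); apply: gB; apply/ffunP => i.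
  by rewrite !gZ acts // rho_cst endo_cstE ffunE gX /GRing.scale /= mulrC.
- move=> u; have [h ->] := X_gen u; exists (\sum_y h y * mu (t y) (t x)).
  rewrite scaler_suml; apply: eq_bigr => y _; rewrite -scalerA; congr (_ *: _).
  by apply: gB; apply/ffunP => i; rewrite gZ acts // !gX eqxx mulr1.
Qed.

End CornerModule.

Section SpechtModule.
Variables (L : fieldType) (n b : nat) (q a zeta s : L).
Hypothesis n_gt0 : (0 < n)%N.
Hypothesis b_gt0 : (0 < b)%N.

Local Notation A := (ground n b q a zeta s).
Local Notation K := (fracA n b q a zeta s).
Local Notation zetaA := (zetaA n b q a zeta s).
Local Notation epsA := (epsA n b q a zeta s).
Local Notation H := (halg n b q a zeta s).
Local Notation KH := (khalg n b q a zeta s).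
Local Notation toK := (@tofrac A).
Local Notation toKH := (@bc_in A K toK H).
Local Notation I := (lword b n).
Local Notation W := {ffun I -> K^o}.

Variables (xK yK : K) (bV rp : A).
Hypothesis gf : ground_facts xK yK bV rp.
Variables (rho : {rmorphism KH -> endo W}) (mu : I -> I -> KH).
Hypothesis wa : word_action xK yK rho mu.

Variable lam : {ffun 'I_b -> seq nat}.
Hypothesis lam_part : forall j, is_partition (lam j).
Hypothesis lam_size : (\sum_j sumn (lam j) = n)%N.
Local Notation al := (al_of lam).
Local Notation mb := (mbar al).
Local Notation tuple := {dffun forall j : 'I_b, std_tableau (lam j)}.
Local Notation col := (fun i => nth 0%N (char_seq al) i).
Local Notation HM j := (hoef_mod n b q a zeta s (lam j)).
Local Notation HT := (iten n q a zeta s al).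
Local Notation tw := (tup_word lam_part lam_size).
Local Notation e := (e_al n q a zeta s al).
Local Notation eta := (@Defs.eta L n b q a zeta s al).
Local Notation tin := (fun j => @ta_in A _ (fun j => iA n b q a zeta s (al j)) j).

Let eta_ok : is_eta eta. Proof. exact: (eta_spec n_gt0 b_gt0 gf lam_size). Qed.

Let etaD u v : eta (u + v) = eta u + eta v. Proof. by have [[h _ _ _] _ _ _] := eta_ok; apply: h. Qed.
Let etaM u v : eta (u * v) = eta u * eta v. Proof. by have [[_ h _ _] _ _ _] := eta_ok; apply: h. Qed.
Let etaC c : eta c%:AC = c%:AC * e. Proof. by have [[_ _ h _] _ _ _] := eta_ok; apply: h. Qed.
Let eta1 : eta 1 = e. Proof. by have [[_ _ _ h] _ _ _] := eta_ok. Qed.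

Local Notation eK := (@eK L n b q a zeta s lam).
Local Notation KV := (KVlam n q a zeta s lam).
Local Notation X tau := (corner_gen_KV (@basis_tensor L n b q a zeta s lam tau)).

Lemma KVlam_of_type tau : of_type mu KV (tw tau).
Proof.
have [g0 [g0D g0Z g0G g0e]] := ex_P0_map n_gt0 b_gt0 gf wa lam_part lam_size.
have [g2 [g2D g2Z g2G]] := ex_KV_map n_gt0 b_gt0 gf wa lam_size g0D g0Z.
apply: (@corner_module_of_type K KH I _ _ mu (wa_units wa) rho (wa_cst wa) _ KV
  (fun tau => X tau) tw eK _ _ _ _ _ _ g2) => //.
- by move=> i j f v rij; apply: (wa_acts wa).
- exact: tup_word_inj.
- by move=> x y; apply: (tup_word_perm lam_part lam_size).
- exact: (KV_spanned n_gt0 b_gt0 gf lam_size).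
- by move=> x; exact: (X_e n_gt0 b_gt0 gf lam_size).
- by move=> z; exact: (corner_KV n_gt0 b_gt0 gf lam_size).
- move=> i; have := eK_unit n_gt0 b_gt0 gf wa lam_size i.
  by case: ifP => _ ->; [left|right].
- move=> x i; rewrite [g2 _]g2G /= [rho _ _]g0e g0G; have [->|ne] := eqVneq i (tw x).
    by rewrite tensor_funE big1 // => j _; rewrite ffunE eqxx rmorph1.
  have [[y ey]|no] := pselect (exists y, tw y = i); last first.
    by rewrite tensor_fun_out // => y; apply/eqP => ey; apply: no; exists y.
  subst i; rewrite tensor_funE.
  have [j nj] : exists j, y j != x j.
    apply: contrapT => h; move/eqP: ne; apply; congr tw; apply/ffunP => j.
    by apply: contrapT => nj; apply: h; exists j; apply/eqP.
  by rewrite (bigD1 j) //= ffunE (inj_eq val_inj) (negbTE nj) rmorph0 mul0r.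
Qed.

End SpechtModule.

(** * Multipartitions and classes of words *)

Lemma partition_inj l l' : is_partition l -> is_partition l' ->
  (forall r, nth 0%N l r = nth 0%N l' r) -> l = l'.
Proof.
have le (l1 l2 : seq nat) : is_partition l1 -> (forall r, nth 0%N l1 r = nth 0%N l2 r) -> (size l1 <= size l2)%N.
  move=> /andP[_ z1] h; rewrite leqNgt; apply/negP => lt.
  by have := h (size l2); rewrite [RHS]nth_default // => e; rewrite -e mem_nth in z1.
move=> h h' e; apply: (@eq_from_nth _ 0%N) => //.
by apply/eqP; rewrite eqn_leq !le.
Qed.

Lemma ex_bpartition b n (w : lword b n) : exists lam : bpartition b n,
  forall j r, nth 0%N (val lam j) r = boxes (ssval w) j r.
Proof.
set s := ssval w; have hs : shape_ok s := lattice_shape (lword_lattice w).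
have ex (j : 'I_b) : exists r, boxes s j r == 0%N.
  exists (size s); rewrite eqn0Ngt boxes_gt0; apply/negP => /(shape_ok_row hs).
  by rewrite ltnn.
pose h j := ex_minn (ex j).
have hP j r : (r < h j)%N = (0 < boxes s j r)%N.
  rewrite /h; case: ex_minnP => m /eqP m0 hm; apply/idP/idP => [rm|].
    by rewrite lt0n; apply/negP => /hm; rewrite leqNgt rm.
  by rewrite !ltnNge; apply: contra => mr; have := shape_ok_le j hs mr; rewrite m0.
pose lam : {ffun 'I_b -> seq nat} := [ffun j : 'I_b => mkseq (boxes s j) (h j)].
have lamE j r : nth 0%N (lam j) r = boxes s j r.
  rewrite ffunE; have [rh|rh] := ltnP r (h j); first by rewrite nth_mkseq.
  by rewrite nth_default ?size_mkseq //; move: rh; rewrite leqNgt hP -eqn0Ngt => /eqP.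
suff hlam : is_bpartition n lam by exists (exist _ lam hlam).
apply/andP; split.
  apply/forallP => j; apply/andP; split.
    apply/(sortedP 0%N) => r; rewrite !lamE => _; exact: shape_ok_le.
  rewrite ffunE; apply/mapP => -[r]; rewrite mem_iota add0n /= hP => + e.
  by rewrite -e.
apply/eqP; transitivity (\sum_(x <- s) \sum_(j < b) \sum_(0 <= r < h j) (x == (j : nat, r)))%N; last first.
  transitivity (\sum_(x <- s) 1)%N; last by rewrite sum1_size lword_size.
  rewrite big_seq [RHS]big_seq; apply: eq_bigr => -[j r] xs.
  have jb : (j < b)%N.
    have := ssvalP w; rewrite mem_lattice_words => /and3P[_ _ /allP /(_ _ xs)].
    by rewrite mem_letters => /andP[].
  have rh : (r < h (Ordinal jb))%N by rewrite hP boxes_gt0.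
  rewrite (bigD1 (Ordinal jb)) //= (bigD1_seq r) ?iota_uniq ?mem_index_iota //= eqxx.
  rewrite big1 => [|i ne]; last by rewrite xpair_eqE eqxx eq_sym (negbTE ne).
  rewrite big1 // => i ne; rewrite big1 // => r' _; rewrite xpair_eqE.
  by rewrite -[j]/(val (Ordinal jb)) (inj_eq val_inj) eq_sym (negbTE ne).
rewrite exchange_big; apply: eq_bigr => j _; rewrite exchange_big ffunE sumnE big_map.
by rewrite /index_iota subn0; apply: eq_bigr => r _;
  rewrite /boxes -sum1_count big_mkcond; apply: eq_bigr => x _; rewrite /=; case: eqP.
Qed.
(** * The theorem *)

Section GenericParameters.
Variables (C : closedFieldType) (L : fieldType) (iota : {rmorphism Cqa C -> L}) (b n : nat) (s : L).
Hypothesis C_char : forall k, (0 < k)%N -> (k%:R : C) != 0.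
Hypothesis b_gt0 : (0 < b)%N.
Local Notation q := (iota (qF C)).
Local Notation a := (iota (aF C)).
Hypothesis s_sqr : s ^+ 2 = b%:R ^+ 2 * a ^+ 2 + 4%:R * q.

Lemma iota_inj : injective iota. Proof. exact: fmorph_inj. Qed.

Lemma cF_inj : injective (@cF C).
Proof. by move=> u v /eqP; rewrite tofrac_eq => /eqP /polyC_inj /polyC_inj. Qed.

Lemma nat_neq0 k : (0 < k)%N -> (k%:R : L) != 0.
Proof.
move=> k0; have -> : k%:R = iota (cF k%:R).
  by rewrite /cF !rmorph_nat.
rewrite -(rmorph0 iota) (inj_eq iota_inj) -[0](rmorph0 (@tofrac _)) tofrac_eq.
by rewrite !polyC_eq0 C_char.
Qed.

Lemma qL_neq0 : q != 0.
Proof.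
by rewrite -(rmorph0 iota) (inj_eq iota_inj) tofrac_eq0 polyC_eq0 polyX_eq0.
Qed.

(** A root of unity would be algebraic over C, hence a constant c, and
    b^2 a^2 c = (c - 1)^2 q is impossible for indeterminates q and a. *)
Lemma xL_not_unity k : (0 < k)%N -> xL b q a s ^+ k != 1.
Proof.
move=> k0; apply/eqP => xk; pose phi : {rmorphism C -> L} := iota \o (@tofrac _ \o (polyC \o polyC)).
have two0 := @nat_neq0 2 isT; have b0 := nat_neq0 b_gt0.
have q0 := qL_neq0; set x := xL b q a s in xk *.
have [c ec] : exists c, x = phi c.
  have [r er] := closed_field_poly_normal ('X^k - 1%:P : {poly C}).
  have : (map_poly phi ('X^k - 1%:P)).[x] = 0.
    by rewrite rmorphB /= map_polyXn map_polyC /= !hornerE xk rmorph1 subrr.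
  rewrite er (monicP (monicXnsubC _ k0)) scale1r rmorph_prod horner_prod => /eqP.
  rewrite prodf_seq_eq0 => /hasP[c _]; rewrite /= rmorphB /= map_polyX map_polyC /= !hornerE.
  by rewrite subr_eq0 => /eqP ->; exists c.
have rel : b%:R ^+ 2 * a ^+ 2 * x = (x - 1) ^+ 2 * q.
  have y0 := yL_neq0 q0 two0 s_sqr; rewrite -exprMn (baLE q0 two0 s_sqr) -/x.
  by rewrite {2}/x (xLE q0 two0 s_sqr); field.
pose P : {poly {poly C}} := (b%:R ^+ 2 * c)%:P%:P * 'X^2.
pose Q : {poly {poly C}} := (((c - 1) ^+ 2)%:P * 'X)%:P.
have PQ : P = Q.
  apply/eqP; rewrite -tofrac_eq; apply/eqP/iota_inj.
  have -> : P = b%:R ^+ 2 * 'X ^+ 2 * c%:P%:P.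
    by rewrite /P (rmorphM polyC) (rmorphM polyC) !(rmorphXn polyC) !(rmorph_nat polyC) mulrAC.
  have -> : Q = (c%:P%:P - 1) ^+ 2 * 'X%:P.
    by rewrite /Q (rmorphM polyC) !(rmorphXn polyC) !(rmorphB polyC) !(rmorph1 polyC).
  have e1 := rel; rewrite ec !expr2 in e1; rewrite !expr2.
  rewrite !(rmorphM (@tofrac _)) !(rmorphM iota) !rmorph_nat !(rmorphB (@tofrac _)) !(rmorphB iota) !rmorph1.
  exact: e1.
have : (b%:R ^+ 2 * c)%:P = 0 :> {poly C}.
  have := congr1 (fun p : {poly {poly C}} => p`_2) PQ.
  by rewrite /P /Q coefCM coefXn eqxx mulr1 coefC.
move/eqP; rewrite polyC_eq0 mulf_eq0 expf_eq0 (negbTE (C_char b_gt0)) /= => /eqP c0.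
have := xL_neq0 q0 two0 s_sqr; rewrite -/x ec c0 rmorph0 eqxx.
done.
Qed.
End GenericParameters.

Lemma bpartition_part b n (lam : bpartition b n) j : is_partition (val lam j).
Proof. by have /andP[/forallP h _] := valP lam; apply: h. Qed.

Lemma bpartition_size b n (lam : bpartition b n) : (\sum_j sumn (val lam j) = n)%N.
Proof. by have /andP[_ /eqP] := valP lam. Qed.

Lemma ex_tuple b n (lam : bpartition b n) : {dffun forall j : 'I_b, std_tableau (val lam j)}.
Proof.
have t j : std_tableau (val lam j).
  by have [t ht] := cid (ex_standard (bpartition_part lam j)); exists t.
exact: (finfun t).
Qed.

Lemma boxes_perm_word b n (w w' : lword b n) :
  (forall (j : 'I_b) r, boxes (ssval w) j r = boxes (ssval w') j r) -> perm_eq (ssval w) (ssval w').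
Proof.
move=> h; apply: boxes_perm; apply: functional_extensionality_dep => j.
apply: functional_extensionality_dep => r; have [jb|jb] := ltnP j b; first exact: (h (Ordinal jb)).
have out (v : lword b n) : boxes (ssval v) j r = 0%N.
  apply/count_memPn/negP; have := ssvalP v; rewrite mem_lattice_words => /and3P[_ _ /allP g] /g.
  by rewrite mem_letters /= ltnNge jb.
by rewrite !out.
Qed.

Local Open Scope complex_scope.

Theorem corollary3p20 (R : realType) (n b : nat) (hn : (0 < n)%N)
    (hb : (0 < b)%N) (L : closedFieldType)
    (iota : {rmorphism Cqa R[i] -> L})
    (iota_alg : forall z : L, algebraicOver iota z)
    (zeta : R[i]) (zeta_prim : b.-primitive_root zeta)
    (s : L)
    (s_sqr : s ^+ 2 = b%:R ^+ 2 * iota (aF R[i]) ^+ 2 + 4%:R * iota (qF R[i])) :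
  let q := iota (qF R[i]) in
  let a := iota (aF R[i]) in
  let z := iota (cF zeta) in
  split_semisimple (khalg n b q a z s) /\
  complete_irreducibles
    (fun lam : bpartition b n => KVlam n q a z s (val lam)).
Proof.
move=> q a z.
have C_char k : (0 < k)%N -> (k%:R : R[i]) != 0 by rewrite Num.Theory.pnatr_eq0 lt0n.
have zp : b.-primitive_root z.
  pose phi : {rmorphism R[i] -> L} := iota \o (@tofrac _ \o (polyC \o polyC)).
  exact: (inj_primitive_root (f := phi) (inj_comp (@iota_inj _ _ iota) (@cF_inj _)) zeta_prim).
have [xK [yK [bV [rp gf]]]] := ex_ground_facts hn hb (qL_neq0 iota)
  (nat_neq0 iota C_char (isT : 0 < 2)%N) (nat_neq0 iota C_char hb) s_sqr
  (xL_not_unity C_char hb s_sqr) zp.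
have [rho [mu wa]] := ex_word_action hn hb gf.
have hmu := wa_units wa.
have type_of (lam : bpartition b n) : exists w : lword b n,
    (forall (j : 'I_b) r, nth 0%N (val lam j) r = boxes (ssval w) j r) /\
    of_type mu (KVlam n q a z s (val lam)) w.
  have lp := bpartition_part lam; have ls := bpartition_size lam; pose t := ex_tuple lam.
  exists (tup_word lp ls t); split=> [j r|]; first by rewrite boxes_tup_seq.
  exact: (KVlam_of_type hn hb gf wa lp ls).
split; first exact: (matrix_units_split_semisimple hmu).
split=> [lam|lam lam' iso|N /(simple_of_type hmu)[w Nw]].
- by have [w [_ h]] := type_of lam; apply: (of_type_simple hmu h).
- have [w [e h]] := type_of lam; have [w' [e' h']] := type_of lam'.
  have /perm_boxes ww := of_type_uniq hmu iso h h'.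
  apply: val_inj; apply/ffunP => j; apply: partition_inj; try exact: bpartition_part.
  by move=> r; rewrite e e' ww.
- have [lam e] := ex_bpartition w; exists lam; have [w' [e' h]] := type_of lam.
  apply: (of_type_iso hmu Nw); apply: (of_type_rel hmu h).
  by apply: boxes_perm_word => j r; rewrite -e -e'.
Qed.
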